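(* Assume that the quasi-interpolation operator $\mathcal{I}_H:V_h\to V_H$ satisfies conditions (QI1)--(QI4) stated in the context with constants $C_{\mathrm{qip}}\approx C_{\mathrm{qip}}'\approx 1$ independent of $A$. Let $u\in V$ be the weak solution, $u_h\in V_h$ the reference finite element solution and, for $k\in\mathbb{N}$, let $u^{\mathrm{cs}}_k\in V^{\mathrm{cs}}_k$ be the localized coarse approximation. Then there exists $c\approx 1$ such that $$\|A^{1/2}\nabla(u-u^{\mathrm{cs}}_k)\|_{L^2(\Omega)}\lesssim \|A^{1/2}\nabla(u-u_h)\|_{L^2(\Omega)}+\alpha^{-1/2}\|Hg\|_{L^2(\Omega)}+\sqrt{\tfrac{\beta}{\alpha}}\,\alpha^{-1/2}H_{\min}^{-1}e^{-ck}\|g\|_{H^{-1}(\Omega)} .$$ If, moreover, $k\ge \frac{1}{2c}\log\left(\frac{\beta}{\alpha}\right)+\frac{2}{c}\log(1/H_{\min})$, then $$\|A^{1/2}\nabla(u-u^{\mathrm{cs}}_k)\|_{L^2(\Omega)}\lesssim \|A^{1/2}\nabla(u-u_h)\|_{L^2(\Omega)}+\alpha^{-1/2}H_{\max}\|g\|_{L^2(\Omega)} .$$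
   Context: Setting. $\Omega\subset\mathbb{R}^d$ is a bounded polyhedral domain, $A\in L^\infty(\Omega,\mathbb{R}^{d\times d}_{\mathrm{sym}})$ satisfies $\sigma(A(x))\subset[\alpha,\beta]$ for a.e. $x\in\Omega$, with $0<\alpha\le\beta<\infty$ ($\sigma$ denotes the spectrum), and $g\in L^2(\Omega)$. Let $V:=H^1_0(\Omega)$, $b(u,v):=\int_\Omega (A\nabla u)\cdot\nabla v\,dx$, $G(v):=\int_\Omega gv\,dx$. The weak solution $u\in V$ satisfies $b(u,v)=G(v)$ for all $v\in V$. Meshes and spaces. $\mathcal{T}_H$ is a regular triangulation of $\Omega$ into closed simplices; $H$ is the $\mathcal{T}_H$-piecewise constant function with $H|_T=H_T:=\mathrm{diam}(T)$; $H_{\min}:=\min_T H_T$, $H_{\max}:=\max_T H_T$. $\mathcal{T}_h$ is a regular triangulation refining $\mathcal{T}_H$. $V_H$ and $V_h$ are the spaces of continuous functions in $H^1_0(\Omega)$ that are affine on each element of $\mathcal{T}_H$, respectively $\mathcal{T}_h$. $\mathcal{N}_H$ is the set of interior vertices of $\mathcal{T}_H$ and $\lambda_z\in V_H$, $z\in\mathcal{N}_H$, are the nodal hat functions. The reference solution $u_h\in V_h$ satisfies $b(u_h,v_h)=G(v_h)$ for all $v_h\in V_h$. It is assumed that the contrast is small on each fine element: for every $\tau\in\mathcal{T}_h$, $\operatorname{ess\,sup}_{x\in\tau}\sup_{v\neq 0}\frac{(A(x)v)\cdot v}{v\cdot v}\lesssim\operatorname{ess\,inf}_{x\in\tau}\inf_{v\ne0}\frac{(A(x)v)\cdot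 v}{v\cdot v}$. Notation. $a\lesssim b$ means $a\le Cb$ with $C>0$ depending only on $\Omega$ and the shape regularity of the meshes (not on mesh sizes, nor on $k$, nor on $A$); $a\approx b$ means $a\lesssim b\lesssim a$. Conditions on $\mathcal{I}_H:V_h\to V_H$: (QI1) $\mathcal{I}_H$ is linear and continuous. (QI2) The restriction of $\mathcal{I}_H$ to $V_H$ is an isomorphism. (QI3) For all $v_h\in V_h$ and $T\in\mathcal{T}_H$, $H_T^{-1}\|A^{1/2}(v_h-\mathcal{I}_Hv_h)\|_{L^2(T)}+\|A^{1/2}\nabla(v_h-\mathcal{I}_Hv_h)\|_{L^2(T)}\le C_{\mathrm{qip}}\|A^{1/2}\nabla v_h\|_{L^2(\omega_T)}$, where $\omega_T:=\mathrm{int}\bigcup\{K\in\mathcal{T}_H: K\cap T\ne\emptyset\}$. (QI4) For every $v_H\in V_H$ there is $v_h\in V_h$ with $\mathcal{I}_Hv_h=v_H$, $\mathrm{supp}\,v_h\subset\mathrm{supp}\,v_H$ and $\|A^{1/2}\nabla v_h\|_{L^2(\Omega)}\le C_{\mathrm{qip}}'\|A^{1/2}\nabla v_H\|_{L^2(\Omega)}$. Localized method. $V^{\mathrm{fs}}:=\{v\in V_h:\mathcal{I}_Hv=0\}$. For $z\in\mathcal{N}_H$, $\omega_{z,1}:=\mathrm{supp}\,\lambda_z=\bigcup\{T\in\mathcal{T}_H: z\in T\}$ and $\omega_{z,k}:=\bigcup\{T\in\mathcal{T}_H:T\cap\omega_{z,k-1}\neq\emptyset\}$ for $k\ge2$.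 $V^{\mathrm{fs}}(\omega_{z,k}):=\{v\in V^{\mathrm{fs}}: v|_{\Omega\setminus\omega_{z,k}}=0\}$. The local corrector $\phi_{z,k}\in V^{\mathrm{fs}}(\omega_{z,k})$ is the unique solution of $b(\phi_{z,k},w)=b(\lambda_z,w)$ for all $w\in V^{\mathrm{fs}}(\omega_{z,k})$. $V^{\mathrm{cs}}_k:=\mathrm{span}\{\lambda_z-\phi_{z,k}: z\in\mathcal{N}_H\}$, and $u^{\mathrm{cs}}_k\in V^{\mathrm{cs}}_k$ is the Galerkin solution: $b(u^{\mathrm{cs}}_k,v)=G(v)$ for all $v\in V^{\mathrm{cs}}_k$.
   Formalization: (QI2) is made quantitative: the hidden constant (but not c) may also depend on a bound for the inverse of I_H restricted to V_H in L^2(Ω); with the merely qualitative isomorphism the estimate fails for nearly singular I_H on V_H. *)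

(* Defs.v *)
From HB Require Import structures.
From mathcomp Require Import all_boot all_order all_algebra finmap.
From mathcomp Require Import all_classical all_reals all_analysis.

Set Implicit Arguments.
Unset Strict Implicit.
Unset Printing Implicit Defensive.

Import Order.TTheory GRing.Theory Num.Theory.
Import numFieldNormedType.Exports.

Local Open Scope classical_set_scope.
Local Open Scope ring_scope.

Section measurable_rV.
Context (R : realType) (n : nat).

Definition rV_coord (i : 'I_n) (x : 'rV[R]_n) : measurableTypeR R := x ord0 i.

Let rV_set0 : g_sigma_preimage rV_coord set0.
Proof. exact: sigma_algebra0. Qed.

Let rV_setC A : g_sigma_preimage rV_coord A -> g_sigma_preimage rV_coord (~` A).
Proof. exact: sigma_algebraC. Qed.

Let rV_bigcup (F : _^nat) : (forall i, g_sigma_preimage rV_coord (F i)) ->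
  g_sigma_preimage rV_coord (\bigcup_i (F i)).
Proof. exact: sigma_algebra_bigcup. Qed.

HB.instance Definition _ := @isMeasurable.Build default_measure_display
  ('rV[R]_n) (g_sigma_preimage rV_coord) rV_set0 rV_setC rV_bigcup.

End measurable_rV.

Section Lebesgue_rV.
Context (R : realType).

Lemma measurable_rV_coord n (i : 'I_n) :
  measurable_fun [set: 'rV[R]_n] (@rV_coord R n i).
Proof.
move=> _ Y mY; apply: sub_sigma_algebra.
rewrite (bigD1 i)//=; left; exists Y => //.
Qed.

Lemma measurable_fun_rVP d (T : measurableType d) n (f : T -> 'rV[R]_n) :
  (forall i, measurable_fun [set: T] (@rV_coord R n i \o f)) ->
  measurable_fun [set: T] f.
Proof.
move=> mf; pose G :=
  \big[setU/set0]_(i < n) preimage_set_system setT (@rV_coord R n i) measurable.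
apply: (@measurability _ _ _ _ _ _ G) => // _ [A GA <-]; rewrite setTI.
have [i [B mB <-]] : exists i,
    preimage_set_system setT (@rV_coord R n i) measurable A.
  move: GA; rewrite /G; elim/big_rec: _ => //= i P _ IH [?|/IH//].
  by exists i.
by rewrite setTI -comp_preimage -[X in measurable X]setTI; exact: mf.
Qed.

Definition rV_cons n (p : measurableTypeR R * 'rV[R]_n) : 'rV[R]_n.+1 :=
  row_mx (p.1 : R)%:M p.2.

Definition rV_uncons n (x : 'rV[R]_n.+1) : measurableTypeR R * 'rV[R]_n :=
  (x ord0 ord0, \row_i x ord0 (lift ord0 i)).

Lemma rV_coord_cons0 n p : rV_coord ord0 (@rV_cons n p) = p.1.
Proof.
rewrite /rV_coord /rV_cons (_ : ord0 = lshift n (@ord0 0)); last exact: val_inj.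
by rewrite (@row_mxEl _ 1 1 n) mxE.
Qed.

Lemma rV_coord_consS n p i :
  rV_coord (lift ord0 i) (@rV_cons n p) = rV_coord i p.2.
Proof.
rewrite /rV_coord /rV_cons (_ : lift ord0 i = rshift 1 i); last exact: val_inj.
by rewrite (@row_mxEr _ 1 1 n).
Qed.

Lemma measurable_rV_cons n : measurable_fun setT (@rV_cons n).
Proof.
apply: measurable_fun_rVP => i; case: (unliftP ord0 i) => [j|] ->.
  rewrite (_ : _ \o _ = rV_coord j \o snd).
    exact: measurableT_comp (measurable_rV_coord j) measurable_snd.
  by apply/funext => p /=; rewrite rV_coord_consS.
rewrite (_ : _ \o _ = fst); first exact: measurable_fst.
by apply/funext => p /=; rewrite rV_coord_cons0.
Qed.

Lemma measurable_rV_uncons n : measurable_fun setT (@rV_uncons n).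
Proof.
apply/measurable_fun_pairP; split.
  exact: (measurable_rV_coord ord0).
apply: measurable_fun_rVP => i.
rewrite (_ : _ \o _ = rV_coord (lift ord0 i)); first exact: measurable_rV_coord.
by apply/funext => x /=; rewrite /rV_coord mxE.
Qed.

Lemma rV_consK n : cancel (@rV_cons n) (@rV_uncons n).
Proof.
move=> p; rewrite /rV_uncons [RHS]surjective_pairing; congr (_, _).
  exact: rV_coord_cons0.
by apply/rowP => i; rewrite mxE; exact: rV_coord_consS.
Qed.

Section step.
Context (n : nat) (m : {sigma_finite_measure set 'rV[R]_n -> \bar R}).

Definition lebesgue_rV_step : set 'rV[R]_n.+1 -> \bar R :=
  pushforward (@lebesgue_measure R \x m)%E (@rV_cons n).

Let step0 : lebesgue_rV_step set0 = 0%E.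
Proof. by rewrite /lebesgue_rV_step /pushforward preimage_set0 measure0. Qed.

Let step_ge0 A : (0 <= lebesgue_rV_step A)%E.
Proof. by rewrite /lebesgue_rV_step /pushforward measure_ge0. Qed.

Let step_sigma_additive : semi_sigma_additive lebesgue_rV_step.
Proof.
have mcons A : measurable A -> measurable (@rV_cons n @^-1` A).
  by move=> mA; rewrite -[X in measurable X]setTI; exact: measurable_rV_cons.
move=> F mF tF mUF; rewrite /lebesgue_rV_step /pushforward preimage_bigcup.
apply: measure_semi_sigma_additive.
- by move=> i; exact: mcons.
- apply/trivIsetP => i j _ _ ij; rewrite -preimage_setI.
  by move/trivIsetP : tF => /(_ _ _ _ _ ij) ->//; rewrite preimage_set0.
- by rewrite -preimage_bigcup; exact: mcons.
Qed.

HB.instance Definition _ := isMeasure.Build _ _ _ lebesgue_rV_step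
  step0 step_ge0 step_sigma_additive.

Let step_sigma_finite : sigma_finite setT lebesgue_rV_step.
Proof.
have /sigma_finiteP[F [TF ndF Foo]] := sigma_finiteT (@lebesgue_measure R).
have /sigma_finiteP[G [TG ndG Goo]] := sigma_finiteT m.
exists (fun k => @rV_uncons n @^-1` (F k `*` G k)) => [|k].
  apply/esym; rewrite -subTset => x _.
  have [k _ Fk] : (\bigcup_k F k) (rV_uncons x).1 by rewrite -TF.
  have [l _ Gl] : (\bigcup_k G k) (rV_uncons x).2 by rewrite -TG.
  exists (maxn k l) => //; split.
    by move: Fk; exact/subsetPset/ndF/leq_maxl.
  by move: Gl; exact/subsetPset/ndG/leq_maxr.
have [mF ltF] := Foo k; have [mG ltG] := Goo k.
have mFG : measurable (F k `*` G k) by exact: measurableX.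
split; first by rewrite -[X in measurable X]setTI; exact: measurable_rV_uncons.
rewrite /lebesgue_rV_step /pushforward -comp_preimage.
rewrite (_ : _ \o _ = id) ?preimage_id; last first.
  by apply/funext => p /=; rewrite rV_consK.
by rewrite product_measure1E// lte_mul_pinfty// ge0_fin_numE.
Qed.

HB.instance Definition _ := Measure_isSigmaFinite.Build _ _ _ lebesgue_rV_step
  step_sigma_finite.

End step.

Fixpoint lebesgue_rV n : {sigma_finite_measure set 'rV[R]_n -> \bar R} :=
  if n is k.+1 then lebesgue_rV_step (lebesgue_rV k)
  else dirac (0 : 'rV[R]_0).

Lemma measurable_rV_box n (A : 'I_n -> set (measurableTypeR R)) :
  (forall i, measurable (A i)) ->
  measurable [set x : 'rV[R]_n | forall i, A i (rV_coord i x)].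
Proof.
move=> mA.
rewrite (_ : [set x | _] = \bigcap_(i in [set: 'I_n]) (@rV_coord R n i @^-1` A i)).
  apply: fin_bigcap_measurable => [|i _]; first exact: finite_finset.
  by rewrite -[X in measurable X]setTI; exact: measurable_rV_coord.
by apply/seteqP; split => x Ax i => [_|]; exact: Ax.
Qed.

Lemma lebesgue_rV_box n (A : 'I_n -> set (measurableTypeR R)) :
  (forall i, measurable (A i)) ->
  lebesgue_rV n [set x | forall i, A i (rV_coord i x)] =
  (\prod_(i < n) lebesgue_measure (A i))%E.
Proof.
elim: n A => [|n IH] A mA.
  by rewrite big_ord0 /= diracE mem_set// => -[].
rewrite big_ord_recl -IH//= /lebesgue_rV_step /pushforward.
have mB := measurable_rV_box (fun i => mA (lift ord0 i)).
transitivity (product_measure1 lebesgue_measure (lebesgue_rV n) (A ord0 `*`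
    [set x | forall i, A (lift ord0 i) (rV_coord i x)])); last first.
  exact: product_measure1E.
congr (product_measure1 _ _ _); apply/seteqP; split => p /=.
  move=> Ap; split; first by rewrite -(rV_coord_cons0 p); exact: Ap.
  by move=> i; rewrite -(rV_coord_consS p); exact: Ap.
move=> [A0 AS] i; case: (unliftP ord0 i) => [j|] ->.
  by rewrite rV_coord_consS; exact: AS.
by rewrite rV_coord_cons0.
Qed.

End Lebesgue_rV.

Section function_spaces.
Context (R : realType) (d : nat).
Local Notation pt := 'rV[R]_d.
Local Notation mu := (lebesgue_rV R d).
Implicit Types (D Omega : set pt) (v : pt -> R) (A : pt -> 'M[R]_d).

(* Euclidean norm of a vector, Frobenius norm of a matrix; the library norm of
   a matrix is the maximum norm. *)
Definition enorm m n (M : 'M[R]_(m, n)) : R :=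
  Num.sqrt (\sum_i \sum_j M i j ^+ 2).

Definition dot (x y : 'cV[R]_d) : R := (x^T *m y) ord0 ord0.

Definition L2 D v : Prop := v \_ D \in Lfun mu 2%:E.

Definition L2norm D v : R := fine 'N[mu]_2%:E [EFin \o (v \_ D)].

Definition basis_vector (i : 'I_d) : pt := delta_mx ord0 i.

Fixpoint Ck (k : nat) v : Prop :=
  if k is k'.+1 then
    forall i, (forall x, derivable v x (basis_vector i)) /\
              Ck k' ('D_(basis_vector i) v)
  else continuous v.

Definition test_function Omega v : Prop :=
  (forall k, Ck k v) /\
  exists K, [/\ compact K, K `<=` Omega & forall x, ~ K x -> v x = 0].

Definition is_gradient Omega v (p : pt -> 'cV[R]_d) : Prop :=
  (forall i, L2 Omega (fun x => p x i ord0)) /\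
  forall w i, test_function Omega w ->
    \int[mu]_(x in Omega) (v x * 'D_(basis_vector i) w x) =
    - \int[mu]_(x in Omega) (p x i ord0 * w x).

Definition H1 Omega v : Prop := L2 Omega v /\ exists p, is_gradient Omega v p.

(* A representative of the weak gradient, which is unique up to a null set. *)
Definition grad Omega v : pt -> 'cV[R]_d :=
  xget (fun=> 0) [set p | is_gradient Omega v p].

Definition gradnorm Omega v : R := L2norm Omega (fun x => enorm (grad Omega v x)).

Definition H1norm Omega v : R :=
  Num.sqrt (L2norm Omega v ^+ 2 + gradnorm Omega v ^+ 2).

Definition H10 Omega : set (pt -> R) := [set v | H1 Omega v /\
  forall e, 0 < e -> exists w, test_function Omega w /\ H1norm Omega (v \- w) < e].

(* Dual norm of V = H10 Omega, normed by gradnorm. *)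
Definition Hm1norm Omega (g : pt -> R) : R :=
  sup [set `|\int[mu]_(x in Omega) (g x * v x)| / gradnorm Omega v |
       v in [set v | H10 Omega v /\ gradnorm Omega v != 0]].

(* The symmetric positive semidefinite square root. *)
Definition sqrtmx (M : 'M[R]_d) : 'M[R]_d :=
  xget 0 [set B : 'M[R]_d | [/\ B^T = B,
    forall x, 0 <= dot (B *m x) x & B *m B = M]].

(* || A^{1/2} grad v ||_{L^2(D)} *)
Definition energy Omega A D v : R :=
  L2norm D (fun x => enorm (sqrtmx (A x) *m grad Omega v x)).

(* || A^{1/2} v ||_{L^2(D)} for scalar v: A^{1/2} v is matrix-valued. *)
Definition weighted_L2norm A D v : R :=
  L2norm D (fun x => enorm (v x *: sqrtmx (A x))).

Definition coefficient Omega (alpha beta : R) A : Prop :=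
  [/\ forall i j, (fun x => A x i j) \_ Omega \in Lfun mu +oo%E,
      {ae mu, forall x, Omega x -> (A x)^T = A x} &
      {ae mu, forall x, Omega x ->
        forall s, eigenvalue (A x) s -> alpha <= s <= beta}].

Definition bform Omega A u v : R :=
  \int[mu]_(x in Omega) dot (A x *m grad Omega u x) (grad Omega v x).

(* u in W and b(u, w) = G(w) for all w in W *)
Definition galerkin Omega A (g : pt -> R) (W : set (pt -> R)) u : Prop :=
  W u /\ forall w, W w -> bform Omega A u w = \int[mu]_(x in Omega) (g x * w x).

(* ess_sup and ess_inf of the library, restricted to D *)
Definition ess_sup_on D (f : pt -> \bar R) : \bar R :=
  ereal_inf [set y | {ae mu, forall x, D x -> (f x <= y)%E}].

Definition ess_inf_on D (f : pt -> \bar R) : \bar R :=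
  ereal_sup [set y | {ae mu, forall x, D x -> (y <= f x)%E}].

Definition quotients (M : 'M[R]_d) : set (\bar R) :=
  [set (dot (M *m x) x / dot x x)%:E | x in [set x : 'cV[R]_d | x != 0]].

End function_spaces.

Section meshes.
Context (R : realType) (d : nat).
Local Notation pt := 'rV[R]_d.
Local Notation mesh := {fset {fset pt}}.
Implicit Types (D Omega : set pt) (v : pt -> R) (A : pt -> 'M[R]_d).

Definition hull (S : {fset pt}) : set pt :=
  [set x | exists w : pt -> R, [/\ forall p, p \in S -> 0 <= w p,
    \sum_(p <- S) w p = 1 & x = \sum_(p <- S) w p *: p]].

Definition affinely_independent (S : {fset pt}) : Prop :=
  forall w : pt -> R, \sum_(p <- S) w p = 0 -> \sum_(p <- S) w p *: p = 0 ->
  forall p, p \in S -> w p = 0.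

(* A closed simplex is given by the set of its d + 1 vertices. *)
Definition simplex (S : {fset pt}) : Prop :=
  #|` S| = d.+1 /\ affinely_independent S.

Definition covers Omega (T : mesh) : Prop :=
  (forall S, S \in T -> simplex S) /\
  \bigcup_(S in [set` T]) hull S = closure Omega.

Definition polyhedral_domain Omega : Prop :=
  [/\ Omega !=set0, open Omega, connected Omega,
      (exists T, covers Omega T) & (closure Omega)° = Omega].

(* Two elements meet in a common face, possibly empty, the face being the hull
   of the common vertices. *)
Definition triangulation Omega (T : mesh) : Prop :=
  covers Omega T /\ forall S S', S \in T -> S' \in T ->
    hull S `&` hull S' = hull (S `&` S')%fset.

Definition refines (Th TH : mesh) : Prop :=
  forall S, S \in Th -> exists2 S', S' \in TH & hull S `<=` hull S'.

Definition diam D : R := sup [set enorm (x - y) | x in D & y in D].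

Definition inball_diam D : R :=
  sup [set r | exists2 c, 0 <= r & [set x | enorm (x - c) <= r / 2] `<=` D].

Definition shape_regular (gamma : R) (T : mesh) : Prop :=
  forall S, S \in T -> diam (hull S) <= gamma * inball_diam (hull S).

(* Zero on the skeleton of the mesh, which is a null set. *)
Definition meshsize (T : mesh) (x : pt) : R :=
  \sum_(S <- T) diam (hull S) * \1_((hull S)°) x.

Definition meshsize_min (T : mesh) : R := inf [set diam (hull S) | S in [set` T]].

Definition meshsize_max (T : mesh) : R := sup [set diam (hull S) | S in [set` T]].

Definition affine_on D v : Prop :=
  exists (a : 'cV[R]_d) (b : R), forall x, D x -> v x = (x *m a) ord0 ord0 + b.

(* Finite element functions are extended by zero, so that equality in the space
   is equality of functions on R^d and v is continuous on all of R^d. *)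
Definition P1 Omega (T : mesh) : set (pt -> R) :=
  [set v | [/\ H10 Omega v, continuous v,
    forall S, S \in T -> affine_on (hull S) v &
    forall x, ~ Omega x -> v x = 0]].

Definition nodes Omega (T : mesh) : {fset pt} :=
  [fset z in \bigcup_(S <- T) S | z \in Omega]%fset.

Definition is_hat Omega (T : mesh) (z : pt) v : Prop :=
  [/\ P1 Omega T v, v z = 1 &
    forall y, y \in nodes Omega T -> y != z -> v y = 0].

Definition layer (T : mesh) D : set pt :=
  \bigcup_(S in [set S | S \in T /\ hull S `&` D !=set0]) hull S.

(* omega_{z,k} for k >= 1; the first layer around [set z] is the union of the
   elements that contain z. *)
Definition vertex_patch (T : mesh) (z : pt) (k : nat) : set pt :=
  iter k (layer T) [set z].

(* omega_T *)
Definition element_patch (T : mesh) (S : {fset pt}) : set pt :=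
  (layer T (hull S))°.

Definition support v : set pt := closure [set x | v x != 0].

Definition small_contrast (kappa : R) A (Th : mesh) : Prop :=
  forall S, S \in Th ->
  (ess_sup_on (hull S) (fun x => ereal_sup (quotients (A x))) <=
   kappa%:E * ess_inf_on (hull S) (fun x => ereal_inf (quotients (A x))))%E.

Section quasi_interpolation.
Variables (Omega : set pt) (A : pt -> 'M[R]_d) (TH Th : mesh).
Variable I : (pt -> R) -> (pt -> R).
Local Notation VH := (P1 Omega TH).
Local Notation Vh := (P1 Omega Th).

Definition QI1 : Prop :=
  [/\ forall v, Vh v -> VH (I v),
      forall (a : R) v w, Vh v -> Vh w ->
        I (fun x => a * v x + w x) = (fun x => a * I v x + I w x) &
      exists C, forall v, Vh v -> H1norm Omega (I v) <= C * H1norm Omega v].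

(* Ciso bounds the inverse of I on V_H in L^2(Omega). As V_H has finite
   dimension, every bijective I satisfies this for some Ciso. *)
Definition QI2 (Ciso : R) : Prop :=
  set_bij VH VH I /\
  forall v, VH v -> L2norm Omega v <= Ciso * L2norm Omega (I v).

Definition QI3 (Cqip : R) : Prop :=
  forall v S, Vh v -> S \in TH ->
    (diam (hull S))^-1 * weighted_L2norm A (hull S) (v \- I v) +
    energy Omega A (hull S) (v \- I v) <=
    Cqip * energy Omega A (element_patch TH S) v.

Definition QI4 (Cqip' : R) : Prop :=
  forall w, VH w -> exists v, [/\ Vh v, I v = w, support v `<=` support w &
    energy Omega A Omega v <= Cqip' * energy Omega A Omega w].

Definition Vfs : set (pt -> R) := [set v | Vh v /\ I v = (fun=> 0)].

Definition Vfs_on D : set (pt -> R) :=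
  [set v | Vfs v /\ forall x, (Omega `\` D) x -> v x = 0].

Definition is_corrector (z : pt) (k : nat) (lambda phi : pt -> R) : Prop :=
  Vfs_on (vertex_patch TH z k) phi /\
  forall w, Vfs_on (vertex_patch TH z k) w ->
    bform Omega A phi w = bform Omega A lambda w.

Definition Vcs (lambda phi : pt -> (pt -> R)) : set (pt -> R) :=
  [set v | exists c : pt -> R,
    v = fun x => \sum_(z <- nodes Omega TH) c z * (lambda z x - phi z x)].

End quasi_interpolation.
End meshes.

(* Main.v *)
Require Import Defs.
From mathcomp Require Import all_boot all_order all_algebra finmap.
From mathcomp Require Import all_classical all_reals all_analysis.
From mathcomp Require Import measurable_realfun ess_sup_inf spectral complex ring lra.

Set Implicit Arguments.
Unset Strict Implicit.
Unset Printing Implicit Defensive.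

Import Order.TTheory GRing.Theory Num.Theory.
Import numFieldNormedType.Exports.

Local Open Scope classical_set_scope.
Local Open Scope ring_scope.

(* The coarse function v_H with I v_H = I u_h splits u_h as f plus the combination
   of the lambda_z - phi_z with coefficients v_H(z), where phi_z is the corrector
   on the whole domain and f is in the fine scale space; the interpolation estimate
   bounds the energy of f by alpha^{-1/2} ||H g||. By Cea's lemma it remains to
   replace phi_z by phi_{z,k}. The energy of phi_z outside of the patch of order m
   decreases by a fixed factor theta when m grows by 5: test with phi_z cut off in
   a ring around the patch, interpolated on the fine mesh and corrected by (QI4),
   and absorb the energy in the ring by hole filling. Inverse estimates and the
   number of nodes cost a power of 1 / H_min, namely (3d + 2) / 2. If
   (beta / alpha)^{1/2} e^{-ck} / H_min is at least 1, the error is trivially bounded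
   by the stability of the method; otherwise 1 / H_min <= e^{ck}, and the surplus
   power is absorbed in the exponential decay when c is a small multiple of
   - ln theta. *)

(** * Lebesgue measure on row vectors *)

Section euclidean_measure.
Context (R : realType) (d : nat).
Local Notation pt := 'rV[R]_d.
Local Notation mu := (lebesgue_rV R d).

Lemma rV_ballP (x y : pt) (e : R) : 0 < e ->
  ball x e y <-> forall i, `|x ord0 i - y ord0 i| < e.
Proof.
move=> e0; split=> [[_ h] i|h]; first exact: (h ord0 i).
by split=> // i j; rewrite (ord1 i); exact: h.
Qed.

Lemma rV_nbhsP (x : pt) (A : set pt) : nbhs x A <->
  exists2 e : R, 0 < e & forall y : pt, (forall i, `|x ord0 i - y ord0 i| < e) -> A y.
Proof.
split=> [/nbhs_ballP[e e0 h]|[e e0 h]].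
  by exists e => // y hy; apply: h; exact/rV_ballP.
by apply/nbhs_ballP; exists e => // y /rV_ballP hy; apply: h; exact: hy.
Qed.

Definition cube (c : pt) (r : R) : set pt :=
  [set x | forall i, `|c ord0 i - x ord0 i| < r].

Definition obox (l u : pt) : set pt :=
  [set x | forall i, l ord0 i < x ord0 i < u ord0 i].

Definition cbox (l u : pt) : set pt :=
  [set x | forall i, l ord0 i <= x ord0 i <= u ord0 i].

Lemma oboxE l u : obox l u =
  [set x | forall i, `]l ord0 i, u ord0 i[%classic (rV_coord i x)].
Proof. by apply/seteqP; split => x h i; have := h i; rewrite /= in_itv. Qed.

Lemma cboxE l u : cbox l u =
  [set x | forall i, `[l ord0 i, u ord0 i]%classic (rV_coord i x)].
Proof. by apply/seteqP; split => x h i; have := h i; rewrite /= in_itv. Qed.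

Lemma cubeE c r : cube c r = obox (\row_i (c ord0 i - r)) (\row_i (c ord0 i + r)).
Proof.
apply/seteqP; split => x h i; have := h i; rewrite !mxE distrC ltr_distl.
  by [].
by [].
Qed.

Lemma measurable_obox l u : measurable (obox l u).
Proof.
rewrite oboxE; apply: (@measurable_rV_box _ _ (fun i => `]l ord0 i, u ord0 i[%classic)) => i.
exact: measurable_itv.
Qed.

Lemma mu_obox l u : mu (obox l u) =
  (\prod_(i < d) lebesgue_measure `]l ord0 i, u ord0 i[%classic)%E.
Proof.
by rewrite oboxE (@lebesgue_rV_box _ _ (fun i => `]l ord0 i, u ord0 i[%classic)).
Qed.

Lemma measurable_cube c r : measurable (cube c r).
Proof. by rewrite cubeE; exact: measurable_obox. Qed.

Lemma open_obox l u : open (obox l u).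
Proof.
rewrite openE => x /= hx; apply/rV_nbhsP.
pose e := \big[Num.min/1]_i Num.min (x ord0 i - l ord0 i) (u ord0 i - x ord0 i).
exists e.
  rewrite /e; elim/big_ind: _ => //= [a b a0 b0|i _]; first by rewrite lt_min a0.
  by rewrite lt_min !subr_gt0; exact: hx.
move=> y hy i; have := hy i; rewrite distrC ltr_distl.
have : e <= Num.min (x ord0 i - l ord0 i) (u ord0 i - x ord0 i).
  by rewrite /e; exact: bigmin_le_cond.
by rewrite le_min => /andP[]; set a := x _ _; lra.
Qed.

Lemma open_cube c r : open (cube c r).
Proof. by rewrite cubeE; exact: open_obox. Qed.

Lemma mu_cube c r : 0 <= r -> mu (cube c r) = ((2 * r) ^+ d)%:E.
Proof.
move=> r0; rewrite cubeE mu_obox.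
under eq_bigr => i _.
  rewrite lebesgue_measure_itv /= !mxE.
  have -> : (if ((c ord0 i - r)%:E < (c ord0 i + r)%:E)%E
    then (c ord0 i + r)%:E - (c ord0 i - r)%:E else 0)%E = (2 * r)%:E.
    rewrite lte_fin; case: ltP => h; first by rewrite -EFinB; congr EFin; lra.
    by congr EFin; lra.
  over.
rewrite prodEFin; congr EFin; rewrite prodr_const card_ord.
by [].
Qed.

Lemma cube_bounded_lty c r : (mu (cube c r) < +oo)%E.
Proof.
have [r0|r0] := leP 0 r; first by rewrite mu_cube// ltry.
apply: (@le_lt_trans _ _ (mu (cube c 1))); last by rewrite mu_cube ?ltry.
apply: le_measure; rewrite ?inE; try exact: measurable_cube.
by move=> x h i; apply: lt_trans (h i) _; lra.
Qed.

Lemma rat_cube (x : pt) (e : R) : 0 < e ->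
  exists q : 'rV[rat]_d, exists n : nat,
  cube (map_mx ratr q) (n.+1%:R^-1) x /\
  (forall y : pt, (forall i, `|ratr (q ord0 i) - y ord0 i| <= n.+1%:R^-1) -> cube x e y).
Proof.
move=> e0; have [n hn] : exists n : nat, n.+1%:R^-1 < e / 2.
  have e2 : 0 < e / 2 by rewrite divr_gt0.
  have := @near_infty_natSinv_lt R (PosNum e2).
  by case=> n _ /(_ n (leqnn _)) ?; exists n.
have h (i : 'I_d) : exists r : rat, `|ratr r - x ord0 i| < n.+1%:R^-1 :> R.
  have : x ord0 i - n.+1%:R^-1 < x ord0 i + n.+1%:R^-1.
    by rewrite ltrBlDr -addrA ltrDl addr_gt0.
  move=> /rat_in_itvoo[r]; rewrite in_itv/= => hr.
  by exists r; rewrite ltr_distl.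
have [f hf] := choice h.
exists (\row_i f i), n; split => [i|y hy i]; first by rewrite !mxE.
have := hy i; have := hf i; rewrite !mxE => h1 h2.
rewrite (splitr e); apply: le_lt_trans (ler_distD (ratr (f i)) _ _) _.
by apply: ltrD; [rewrite distrC; exact: lt_trans hn|exact: le_lt_trans hn].
Qed.

Lemma open_measurable_rV (U : set pt) : open U -> measurable U.
Proof.
move=> oU.
pose F (p : 'rV[rat]_d * nat) : set pt :=
  if `[< cube (map_mx ratr p.1) (p.2.+1%:R^-1) `<=` U >]
  then cube (map_mx ratr p.1) (p.2.+1%:R^-1) else set0.
have -> : U = \bigcup_p F p.
  apply/seteqP; split=> [x Ux|x [p _]]; last first.
    by rewrite /F; case: asboolP => // h; exact: h.
  have /rV_nbhsP[e e0 he] : nbhs x U by exact: open_nbhs_nbhs.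
  have [q [n [h1 h2]]] := rat_cube x e0.
  exists (q, n) => //; rewrite /F; case: asboolP => //= -[] y hy.
  by apply: he; apply: h2 => i; have := hy i; rewrite mxE => /ltW.
apply: countable_bigcupT_measurable => // p; rewrite /F.
by case: asboolP => _; [exact: measurable_cube | exact: measurable0].
Qed.

Lemma closed_measurable_rV (U : set pt) : closed U -> measurable U.
Proof.
move=> cU; rewrite -(setCK U); apply: measurableC; apply: open_measurable_rV.
exact: closed_openC.
Qed.

Lemma continuous_measurable_rV (f : pt -> R) : continuous f -> measurable_fun setT f.
Proof.
move=> cf; apply: (measurability _ (measurable_realfun.RGenOpens.measurableE R)).
move=> _ [_ [a [b ->]] <-]; rewrite setTI; apply: open_measurable_rV.
by move/continuousP : cf; apply; exact: interval_open.
Qed.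

Lemma measurable_coord (i : 'I_d) : measurable_fun setT (fun x : pt => x ord0 i).
Proof. exact: (measurable_rV_coord i). Qed.

Lemma coordinate_bound (x : pt) : exists n : nat, forall i, `|x ord0 i| < n%:R.
Proof.
have h (i : 'I_d) : exists n : nat, `|x ord0 i| < n%:R.
  by exists (Num.bound `|x ord0 i|); exact: archi_boundP.
have [f hf] := choice h; exists (\max_i f i)%N => i.
by apply: lt_le_trans (hf i) _; rewrite ler_nat leq_bigmax.
Qed.

Definition oboxes : set_system pt := [set B | exists l u, B = obox l u].

Lemma measurable_oboxes : @measurable _ pt = <<s oboxes >>.
Proof.
apply/seteqP; split=> A; last first.
  apply; split; first by split; [exact: measurable0|
    move=> ?; rewrite setTD; exact: measurableC|exact: bigcupT_measurable].
  by move=> _ [l [u ->]]; exact: measurable_obox.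
apply; split; first exact: smallest_sigma_algebra.
suff mG i : measurable_fun setT
    (fun x : g_sigma_algebraType oboxes => x ord0 i : measurableTypeR R).
  move=> B; elim/big_rec: _ => //= i C _ IH [[D mD <-]|/IH//].
  exact: (mG i measurableT D mD).
apply: (measurability _ (measurable_realfun.RGenOInfty.measurableE R)).
move=> _ [_ [a ->] <-].
have -> : [set: g_sigma_algebraType oboxes] `&`
    (fun x : g_sigma_algebraType oboxes => x ord0 i) @^-1` `]a, +oo[ =
    \bigcup_n obox (\row_j if j == i then a else - n%:R) (\row_j n%:R).
  apply/seteqP; split=> [x [_]|x [n _ h]]; last first.
    split=> //; have := h i; rewrite !mxE eqxx /= in_itv/= andbT.
    by case/andP.
  rewrite /= in_itv/= andbT => ax.
  have [n hn] := coordinate_bound x.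
  exists n => // j; rewrite !mxE; have := hn j; rewrite ltr_norml => /andP[h1 h2].
  by rewrite h2 andbT; case: eqP => // ->.
apply: bigcupT_measurable => n; apply: sub_sigma_algebra.
by eexists; eexists.
Qed.

Lemma obox_setI (l1 u1 l2 u2 : pt) : obox l1 u1 `&` obox l2 u2 =
  obox (\row_i Num.max (l1 ord0 i) (l2 ord0 i)) (\row_i Num.min (u1 ord0 i) (u2 ord0 i)).
Proof.
apply/seteqP; split=> [x [h1 h2] i|x h].
  have := h1 i; have := h2 i; rewrite !mxE gt_max lt_min.
  by move=> /andP[-> ->] /andP[-> ->].
by split=> i; have := h i; rewrite !mxE gt_max lt_min =>
  /andP[/andP[a1 a2] /andP[a3 a4]]; apply/andP.
Qed.

Lemma oboxes_setI : setI_closed oboxes.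
Proof.
by move=> _ _ [l1 [u1 ->]] [l2 [u2 ->]]; rewrite obox_setI; eexists; eexists.
Qed.

Lemma measure_eq_oboxP (m1 m2 : {measure set pt -> \bar R}) :
  (forall l u, m1 (obox l u) = m2 (obox l u)) ->
  (forall l u, (m1 (obox l u) < +oo)%E) ->
  forall E, measurable E -> m1 E = m2 E.
Proof.
move=> m12 m1oo E mE.
apply: (measure_unique oboxes (fun n : nat => cube 0 n%:R)) => //.
- exact: measurable_oboxes.
- exact: oboxes_setI.
- by move=> n; rewrite cubeE; eexists; eexists.
- rewrite -subTset => x _; have [n hn] := coordinate_bound x.
  by exists n => // i; rewrite mxE sub0r normrN.
- by move=> _ [l [u ->]].
- by move=> n; rewrite cubeE.
Qed.

Lemma shift_obox (h l u : pt) : (fun x => x + h) @^-1` obox l u = obox (l - h) (u - h).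
Proof.
apply/seteqP; split=> x hx i; have := hx i; rewrite /= !mxE => /andP[h1 h2].
  by rewrite ltrBlDr ltrBrDr h1.
by rewrite -ltrBlDr h1 -ltrBrDr.
Qed.

Lemma measurable_shift (h : pt) : measurable_fun setT (fun x : pt => x + h).
Proof.
apply: measurable_fun_rVP => i.
rewrite (_ : _ \o _ = fun x : pt => x ord0 i + h ord0 i); last first.
  by apply/funext => x /=; rewrite /rV_coord mxE.
by apply: measurable_funD => //; exact: measurable_coord.
Qed.

Lemma mu_obox_lty l u : (mu (obox l u) < +oo)%E.
Proof.
suff: mu (obox l u) \is a fin_num by rewrite ltey_eq => ->.
rewrite mu_obox; elim/big_ind: _ => [//|a b|i _]; first exact: fin_numM.
by rewrite lebesgue_measure_itv /=; case: ifP.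
Qed.

Lemma mu_shift (h : pt) E : measurable E -> mu ((fun x => x + h) @^-1` E) = mu E.
Proof.
move=> mE.
have := @measure_eq_oboxP (pushforward mu (fun x : pt => x + h)) mu.
apply => //; first exact: measurable_shift.
all: move=> ? l u.
  transitivity (mu (obox (l - h) (u - h))); first by rewrite -shift_obox.
  rewrite mu_obox; etransitivity; last by apply/esym; exact: mu_obox.
  apply: eq_bigr => i _; rewrite !lebesgue_measure_itv /= !lte_fin !mxE.
  by rewrite ltrD2r; case: ifP => // _; rewrite -!EFinB; congr EFin; lra.
by have := mu_obox_lty (l - h) (u - h); rewrite -shift_obox.
Qed.

Lemma ge0_integral_shift (h : pt) (f : pt -> \bar R) : measurable_fun setT f ->
  (forall x, 0 <= f x)%E ->
  (\int[mu]_x f ((x : pt) + h)%R = \int[mu]_x f x)%E.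
Proof.
move=> mf f0.
have := ge0_integral_pushforward (measurable_shift h) mu measurableT mf (fun x _ => f0 x).
rewrite preimage_setT => <-; apply: eq_measure_integral.
  exact: measurable_shift.
by move=> ? A mA _; exact: mu_shift.
Qed.

Definition intg (f : pt -> R) := mu.-integrable setT (EFin \o f).

Lemma intgP (f : pt -> R) : intg f <->
  measurable_fun setT f /\ (\int[mu]_x `|f x|%:E < +oo)%E.
Proof.
split=> [/integrableP[mf foo]|[mf foo]].
  by split=> //; exact/measurable_EFinP.
by apply/integrableP; split => //; exact/measurable_EFinP.
Qed.

Lemma intg_measurable (f : pt -> R) : intg f -> measurable_fun setT f.
Proof. by case/intgP. Qed.

Lemma intg_shift (h : pt) (f : pt -> R) : intg f -> intg (fun x => f (x + h)).
Proof.
move=> /intgP[mf foo]; apply/intgP; split.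
  exact: (measurableT_comp mf (measurable_shift h)).
rewrite (ge0_integral_shift h (f := fun x => `|f x|%:E)) //.
by apply/measurable_EFinP; exact: measurableT_comp.
Qed.

Lemma Int_shift (h : pt) (f : pt -> R) : intg f ->
  \int[mu]_x f (x + h) = \int[mu]_x f x.
Proof.
move=> intf; rewrite /Rintegral; congr fine.
have mf : measurable_fun setT (EFin \o f) by apply/measurable_EFinP; exact: intg_measurable.
have := @integral_pushforward _ _ _ _ _ _ (measurable_shift h) mu setT _ mf _ measurableT.
rewrite preimage_setT => <-; last exact: (intg_shift h intf).
apply: eq_measure_integral; first exact: measurable_shift.
by move=> ? A mA _; exact: mu_shift.
Qed.


Lemma intg_add (f g : pt -> R) : intg f -> intg g -> intg (fun x => f x + g x).
Proof. by move=> intf intg; exact: (integrableD measurableT intf intg). Qed.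

Lemma intg_scale (a : R) (f : pt -> R) : intg f -> intg (fun x => a * f x).
Proof. by move=> intf; exact: (integrableZl measurableT a intf). Qed.

Lemma intg_opp (f : pt -> R) : intg f -> intg (fun x => - f x).
Proof.
by move=> intf; under [X in intg X]eq_fun do rewrite -mulN1r; exact: intg_scale.
Qed.

Lemma intg_sub (f g : pt -> R) : intg f -> intg g -> intg (fun x => f x - g x).
Proof. by move=> intf intg; apply: intg_add => //; exact: intg_opp. Qed.

Lemma intg_norm (f : pt -> R) : intg f -> intg (fun x => `|f x|).
Proof. by move=> intf; exact: (integrable_norm intf). Qed.

Lemma intg0 : intg (fun=> 0).
Proof. exact: integrable0. Qed.

Lemma intg_sum (I : Type) (s : seq I) (F : I -> pt -> R) :
  (forall i, intg (F i)) -> intg (fun x => \sum_(i <- s) F i x).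
Proof.
move=> h; elim: s => [|i s IH].
  by under [X in intg X]eq_fun do rewrite big_nil; exact: intg0.
by under [X in intg X]eq_fun do rewrite big_cons; exact: intg_add.
Qed.

Lemma IntD (f g : pt -> R) : intg f -> intg g ->
  \int[mu]_x (f x + g x) = \int[mu]_x f x + \int[mu]_x g x.
Proof. by move=> ? ?; rewrite RintegralD. Qed.

Lemma IntZ (a : R) (f : pt -> R) : intg f ->
  \int[mu]_x (a * f x) = a * \int[mu]_x f x.
Proof. by move=> ?; rewrite RintegralZl. Qed.

Lemma IntN (f : pt -> R) : intg f -> \int[mu]_x (- f x) = - \int[mu]_x f x.
Proof.
move=> intf; rewrite -[RHS]mulN1r -IntZ//; apply: eq_Rintegral => x _.
by rewrite mulN1r.
Qed.

Lemma IntB (f g : pt -> R) : intg f -> intg g ->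
  \int[mu]_x (f x - g x) = \int[mu]_x f x - \int[mu]_x g x.
Proof. by move=> ? ?; rewrite RintegralB. Qed.

Lemma Int0 : \int[mu]_(x in setT) (0 : R) = 0.
Proof. by rewrite /Rintegral integral0. Qed.

Lemma Int_sum (I : Type) (s : seq I) (F : I -> pt -> R) :
  (forall i, intg (F i)) ->
  \int[mu]_x (\sum_(i <- s) F i x) = \sum_(i <- s) \int[mu]_x F i x.
Proof.
move=> h; elim: s => [|i s IH].
  rewrite big_nil -[RHS]Int0; apply: eq_Rintegral => x _; exact: big_nil.
rewrite big_cons -IH -IntD//; last exact: intg_sum.
by apply: eq_Rintegral => x _; exact: big_cons.
Qed.

Lemma intg_dom (f g : pt -> R) : measurable_fun setT f -> intg g ->
  {ae mu, forall x, `|f x| <= g x} -> intg f.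
Proof.
move=> mf intg_g fg.
have mm : measurable_fun setT (EFin \o (fun x => Num.min `|f x| `|g x|)).
  apply/measurable_EFinP; apply: measurable_minr; apply: measurableT_comp => //.
  exact: intg_measurable.
have intm : intg (fun x => Num.min `|f x| `|g x|).
  apply: (le_integrable measurableT mm _ (intg_norm intg_g)) => x _ /=.
  rewrite lee_fin normr_id ger0_norm; last by rewrite le_min !normr_ge0.
  by rewrite ge_min lexx orbT.
apply/intgP; split=> //.
have /intgP[_] := intm; apply: le_lt_trans.
rewrite le_eqVlt; apply/orP; left; apply/eqP; apply: ae_eq_integral => //.
- by apply/measurable_EFinP; exact: measurableT_comp.
- by apply/measurable_EFinP; apply: measurableT_comp => //; exact/measurable_EFinP.
- apply: filterS fg => x h _; congr (_%:E).
  rewrite [RHS]ger0_norm ?le_min ?normr_ge0//.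
  by rewrite min_l// (le_trans h)// ler_norm.
Qed.

Lemma intg_dom_all (f g : pt -> R) : measurable_fun setT f -> intg g ->
  (forall x, `|f x| <= g x) -> intg f.
Proof. by move=> mf ig fg; apply: (intg_dom mf ig); exact: aeW. Qed.

Lemma intg_ae (f g : pt -> R) : measurable_fun setT g -> intg f ->
  {ae mu, forall x, f x = g x} -> intg g.
Proof.
move=> mg intf fg; apply: (intg_dom mg (intg_norm intf)).
by apply: filterS fg => x ->.
Qed.

Lemma Int_ae (f g : pt -> R) : measurable_fun setT f -> measurable_fun setT g ->
  {ae mu, forall x, f x = g x} -> \int[mu]_x f x = \int[mu]_x g x.
Proof.
move=> mf mg fg; congr fine; apply: ae_eq_integral => //.
- exact/measurable_EFinP.
- exact/measurable_EFinP.
- by apply: filterS fg => x -> _.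
Qed.

Lemma Int_le_ae (f g : pt -> R) : intg f -> intg g ->
  {ae mu, forall x, f x <= g x} -> \int[mu]_x f x <= \int[mu]_x g x.
Proof.
move=> intf intg_g fg.
have mm : measurable_fun setT (fun x => Num.max (f x) (g x)).
  by apply: measurable_maxr; exact: intg_measurable.
have mE : {ae mu, forall x, g x = Num.max (f x) (g x)}.
  by apply: filterS fg => x h; rewrite max_r.
rewrite (Int_ae _ mm mE); last exact: intg_measurable.
apply: le_Rintegral => //; first exact: (intg_ae mm intg_g mE).
by move=> x _; rewrite le_max lexx.
Qed.

Lemma Int_le (f g : pt -> R) : intg f -> intg g ->
  (forall x, f x <= g x) -> \int[mu]_x f x <= \int[mu]_x g x.
Proof. by move=> ? ? fg; apply: Int_le_ae => //; exact: aeW. Qed.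

Lemma Int_ge0 (f : pt -> R) : (forall x, 0 <= f x) -> 0 <= \int[mu]_x f x.
Proof. by move=> f0; apply: Rintegral_ge0 => x _. Qed.

Lemma Int_ge0_ae (f : pt -> R) : intg f -> {ae mu, forall x, 0 <= f x} ->
  0 <= \int[mu]_x f x.
Proof. by move=> intf f0; rewrite -Int0; apply: Int_le_ae => //; exact: intg0. Qed.

Lemma Int_norm (f : pt -> R) : intg f -> `|\int[mu]_x f x| <= \int[mu]_x `|f x|.
Proof. by move=> intf; exact: le_normr_Rintegral. Qed.

Lemma Int_eq0_ae (f : pt -> R) : intg f -> (forall x, 0 <= f x) ->
  \int[mu]_x f x = 0 -> {ae mu, forall x, f x = 0}.
Proof.
move=> intf f0 If.
have If' : (\int[mu]_x `|f x|%:E = 0)%E.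
  have <- : (\int[mu]_x (f x)%:E = \int[mu]_x `|f x|%:E)%E.
    by apply: eq_integral => x _; rewrite ger0_norm.
  have := integrable_fin_num measurableT intf.
  by rewrite -[RHS]/(0%:E) -If /Rintegral => ?; rewrite fineK.
have mf := intg_measurable intf.
have mf' : measurable_fun setT (EFin \o f) by exact/measurable_EFinP.
have : ae_eq mu setT (EFin \o f) (cst 0).
  exact: (ae_eq_integral_abs mu measurableT mf').1.
by apply: filterS => x /(_ I)[].
Qed.

Lemma Int_dct (f_ : nat -> pt -> R) (f g : pt -> R) :
  (forall n, measurable_fun setT (f_ n)) -> measurable_fun setT f -> intg g ->
  (forall n x, `|f_ n x| <= g x) ->
  {ae mu, forall x, f_ ^~ x @ \oo --> f x} ->
  intg f /\ (fun n => \int[mu]_x f_ n x) @ \oo --> \int[mu]_x f x.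
Proof.
move=> mf_ mf ig fg cf.
have [] := @dominated_convergence _ _ _ mu setT measurableT
  (fun n => EFin \o f_ n) (EFin \o f) (EFin \o g).
- by move=> n; exact/measurable_EFinP.
- exact/measurable_EFinP.
- apply: filterS cf => x h _; apply: cvg_EFin => //.
  exact: nearW.
- exact: ig.
- by apply: aeW => x n _ /=; rewrite lee_fin.
move=> intf _ h; split=> //.
have -> : (fun n => \int[mu]_x f_ n x) = fine \o (fun n => \int[mu]_x (EFin \o f_ n) x)%E by [].
apply: fine_cvg; rewrite fineK//; last exact: integrable_fin_num.
Qed.

End euclidean_measure.

(** * Square integrable functions *)

Section square_integrable.
Context (R : realType) (d : nat).
Local Notation pt := 'rV[R]_d.
Local Notation mu := (lebesgue_rV R d).
Implicit Types (f g : pt -> R).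

Definition sqi f := measurable_fun setT f /\ intg (fun x => f x ^+ 2).

Lemma sqi_mul f g : sqi f -> sqi g -> intg (fun x => f x * g x).
Proof.
move=> [mf if2] [mg ig2]; apply: (intg_dom_all _ (intg_add if2 ig2)).
  exact: measurable_funM.
by move=> x; rewrite normrM -(real_normK (num_real (f x))) -(real_normK (num_real (g x))); nra.
Qed.

Lemma sqi_add f g : sqi f -> sqi g -> sqi (fun x => f x + g x).
Proof.
move=> hf hg; split; first by apply: measurable_funD; [case: hf|case: hg].
have -> : (fun x => (f x + g x) ^+ 2) =
    (fun x => (f x ^+ 2 + 2 * (f x * g x)) + g x ^+ 2).
  by apply/funext => x; ring.
apply: intg_add; last by case: hg.
by apply: intg_add; [case: hf|apply: intg_scale; exact: sqi_mul].
Qed.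

Lemma sqi_scale (a : R) f : sqi f -> sqi (fun x => a * f x).
Proof.
move=> [mf if2]; split; first exact: measurable_funM.
by under [X in intg X]eq_fun do rewrite exprMn; exact: intg_scale.
Qed.

Lemma sqi_opp f : sqi f -> sqi (fun x => - f x).
Proof.
by move=> h; under [X in sqi X]eq_fun do rewrite -mulN1r; exact: sqi_scale.
Qed.

Lemma sqi_sub f g : sqi f -> sqi g -> sqi (fun x => f x - g x).
Proof. by move=> hf hg; apply: sqi_add => //; exact: sqi_opp. Qed.

Lemma sqi_dom f g : measurable_fun setT f -> sqi g ->
  {ae mu, forall x, `|f x| <= `|g x|} -> sqi f.
Proof.
move=> mf [mg ig2] fg; split=> //; apply: (intg_dom _ ig2).
  exact: measurable_funX.
apply: filterS fg => x h; rewrite ger0_norm ?sqr_ge0//.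
by rewrite -(real_normK (num_real (f x))) -(real_normK (num_real (g x))) lerXn2r ?nnegrE.
Qed.

Lemma sqi_dom_all f g : measurable_fun setT f -> sqi g ->
  (forall x, `|f x| <= `|g x|) -> sqi f.
Proof. by move=> mf sg fg; apply: (sqi_dom mf sg); exact: aeW. Qed.

Definition nrm2 f : R := Num.sqrt (\int[mu]_x (f x ^+ 2)).

Lemma nrm2_ge0 f : 0 <= nrm2 f.
Proof. exact: sqrtr_ge0. Qed.

Lemma nrm2_sqr f : nrm2 f ^+ 2 = \int[mu]_x (f x ^+ 2).
Proof. by rewrite sqr_sqrtr//; apply: Int_ge0 => x; exact: sqr_ge0. Qed.

Lemma nrm2_cs f g : sqi f -> sqi g ->
  `|\int[mu]_x (f x * g x)| <= nrm2 f * nrm2 g.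
Proof.
move=> hf hg.
have key (t : R) : 0 <= nrm2 f ^+ 2 + 2 * t * \int[mu]_x (f x * g x) + t ^+ 2 * nrm2 g ^+ 2.
  have <- : \int[mu]_x ((f x + t * g x) ^+ 2) =
      nrm2 f ^+ 2 + 2 * t * \int[mu]_x (f x * g x) + t ^+ 2 * nrm2 g ^+ 2.
    have [[_ f2] [_ g2]] := (hf, hg).
    rewrite !nrm2_sqr -!IntZ//; last exact: sqi_mul.
    rewrite -!IntD//.
    - by apply: eq_Rintegral => x _; ring.
    - by apply: intg_add => //; apply: intg_scale; exact: sqi_mul.
    - exact: intg_scale.
    - by apply: intg_scale; exact: sqi_mul.
  by apply: Int_ge0 => x; exact: sqr_ge0.
have := nrm2_ge0 f; have := nrm2_ge0 g.
move: key; set F := nrm2 f; set G := nrm2 g; set I := (X in `|X|) => key G0 F0.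
suff: I ^+ 2 <= (F * G) ^+ 2.
  by rewrite -(real_normK (num_real I)) ler_sqr ?nnegrE// mulr_ge0.
have [G00|Gn0] := eqVneq G 0.
  have [->|In0] := eqVneq I 0; first by rewrite expr0n sqr_ge0.
  have := key (- (F ^+ 2 + 1) / (2 * I)); rewrite G00.
  have -> : 2 * (- (F ^+ 2 + 1) / (2 * I)) * I = - (F ^+ 2 + 1) by field.
  by nra.
have Gp : 0 < G ^+ 2 by rewrite exprn_gt0// lt_neqAle eq_sym Gn0.
have := key (- I / G ^+ 2).
have -> : F ^+ 2 + 2 * (- I / G ^+ 2) * I + (- I / G ^+ 2) ^+ 2 * G ^+ 2 =
  ((F * G) ^+ 2 - I ^+ 2) / G ^+ 2 by field.
by rewrite pmulr_lge0 ?invr_gt0// subr_ge0.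
Qed.

Lemma nrm2_triangle f g : sqi f -> sqi g ->
  nrm2 (fun x => f x + g x) <= nrm2 f + nrm2 g.
Proof.
move=> hf hg; have h := nrm2_cs hf hg.
rewrite -ler_sqr ?nnegrE ?addr_ge0 ?nrm2_ge0// nrm2_sqr.
have -> : \int[mu]_x ((f x + g x) ^+ 2) =
    nrm2 f ^+ 2 + 2 * \int[mu]_x (f x * g x) + nrm2 g ^+ 2.
  have [[_ f2] [_ g2]] := (hf, hg).
  rewrite !nrm2_sqr -!IntZ//; last exact: sqi_mul.
  rewrite -!IntD//.
  - by apply: eq_Rintegral => x _; ring.
  - by apply: intg_add => //; apply: intg_scale; exact: sqi_mul.
  - by apply: intg_scale; exact: sqi_mul.
by have := ler_norm (\int[mu]_x (f x * g x)); move: h; set I := Rintegral _ _ _; nra.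
Qed.

Lemma nrm2Z (a : R) f : sqi f -> nrm2 (fun x => a * f x) = `|a| * nrm2 f.
Proof.
move=> [mf f2]; rewrite /nrm2.
under eq_Rintegral do rewrite exprMn.
by rewrite IntZ// sqrtrM ?sqr_ge0// sqrtr_sqr.
Qed.

Lemma nrm2_le_ae f g : sqi f -> sqi g -> {ae mu, forall x, `|f x| <= `|g x|} ->
  nrm2 f <= nrm2 g.
Proof.
move=> [_ f2] [_ g2] fg; rewrite ler_wsqrtr//; apply: Int_le_ae => //.
apply: filterS fg => x h.
by rewrite -(real_normK (num_real (f x))) -(real_normK (num_real (g x))) lerXn2r ?nnegrE.
Qed.

Lemma Lfun2P f : f \in Lfun mu 2%:E <-> sqi f.
Proof.
split=> [h|[mf f2]].
  split; last exact: Lfun2_integrable_sqr.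
  by move: h; rewrite inE => /andP[]; rewrite inE.
rewrite inE; apply/andP; split; first by rewrite inE.
rewrite inE /= /finite_norm unlock.
apply: poweR_lty; have /intgP[_] := f2; apply: le_lt_trans.
rewrite le_eqVlt; apply/orP; left; apply/eqP; apply: eq_integral => x _.
rewrite /= powR_mulrn// [X in _ = X%:E]ger0_norm ?sqr_ge0//.
by rewrite real_normK ?num_real.
Qed.

Lemma L2P (D : set pt) f : L2 D f <-> sqi (f \_ D).
Proof. exact: Lfun2P. Qed.

Lemma L2normE (D : set pt) f : L2norm D f = nrm2 (f \_ D).
Proof.
rewrite /L2norm unlock /nrm2 /Rintegral.
have -> : (\int[mu]_x `|(EFin \o (f \_ D)) x| `^ 2 = \int[mu]_x ((f \_ D) x ^+ 2)%:E)%E.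
  apply: eq_integral => x _.
  by rewrite /= powR_mulrn// real_normK ?num_real.
have : (0 <= \int[mu]_x ((f \_ D) x ^+ 2)%:E)%E.
  by apply: integral_ge0 => x _; rewrite lee_fin sqr_ge0.
case: (integral _ _ _) => [r| |] //=.
  by rewrite lee_fin => r0; rewrite powR12_sqrt.
by move=> _; rewrite /poweR /= invr_eq0 pnatr_eq0 sqrtr0.
Qed.

Lemma L2norm_sqr (D : set pt) f : L2norm D f ^+ 2 = \int[mu]_x ((f \_ D) x ^+ 2).
Proof. by rewrite L2normE nrm2_sqr. Qed.

Lemma L2norm_ge0 (D : set pt) f : 0 <= L2norm D f.
Proof. by rewrite L2normE nrm2_ge0. Qed.

Lemma intg_indic (D : set pt) : measurable D -> (mu D < +oo)%E ->
  intg (\1_D : pt -> R).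
Proof.
move=> mD Doo; apply/intgP; split; first exact: measurable_indic.
apply: le_lt_trans Doo; rewrite -[X in (_ <= mu X)%E]setIT -integral_indic//.
rewrite le_eqVlt; apply/orP; left; apply/eqP; apply: eq_integral => x _.
by rewrite ger0_norm// indicE.
Qed.

Lemma intg_bounded_support f (M : R) (n : R) : measurable_fun setT f ->
  (forall x, `|f x| <= M) -> (forall x, f x != 0 -> cube 0 n x) -> intg f.
Proof.
move=> mf fM f0.
have mc := measurable_cube (0 : pt) n.
have ic : intg (\1_(cube 0 n) : pt -> R).
  exact: intg_indic mc (cube_bounded_lty _ _).
apply: (intg_dom_all mf (intg_scale M ic)) => x.
have M0 : 0 <= M by apply: le_trans (fM x).
have [->|fx] := eqVneq (f x) 0; first by rewrite normr0 mulr_ge0// indicE.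
by rewrite indicE mem_set ?mulr1//; exact: f0.
Qed.

Lemma sqi_bounded_support f (M : R) (n : R) : measurable_fun setT f ->
  (forall x, `|f x| <= M) -> (forall x, f x != 0 -> cube 0 n x) -> sqi f.
Proof.
move=> mf fM f0; split=> //.
apply: (@intg_bounded_support _ (M ^+ 2) n); first exact: measurable_funX.
  move=> x; rewrite ger0_norm ?sqr_ge0// -(real_normK (num_real (f x))).
  by rewrite lerXn2r// nnegrE// (le_trans _ (fM x)).
by move=> x; rewrite sqrf_eq0; exact: f0.
Qed.

End square_integrable.

Section hyperplane.
Context (R : realType).

Lemma dotrowE d (x : 'rV[R]_d) (a : 'cV[R]_d) :
  (x *m a) ord0 ord0 = \sum_i x ord0 i * a i ord0.
Proof. by rewrite mxE. Qed.

Lemma measurable_dotrow d (a : 'cV[R]_d) :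
  measurable_fun setT (fun x : 'rV[R]_d => (x *m a) ord0 ord0).
Proof.
under eq_fun do rewrite dotrowE.
by apply: measurable_sum => i; apply: measurable_funM => //; exact: measurable_coord.
Qed.

Lemma measurable_hyperplane d (a : 'cV[R]_d) (b : R) :
  measurable [set x : 'rV[R]_d | (x *m a) ord0 ord0 = b].
Proof.
have := @measurable_dotrow d a measurableT [set b] (measurable_set1 b).
by rewrite setTI.
Qed.

Lemma hyperplane_null d (a : 'cV[R]_d) (b : R) : a != 0 ->
  lebesgue_rV R d [set x | (x *m a) ord0 ord0 = b] = 0.
Proof.
elim: d a b => [|d IH] a b an0.
  by move: an0; rewrite (_ : a = 0) ?eqxx//; apply/matrixP => -[].
pose a' : 'cV[R]_d := \col_i a (lift ord0 i) ord0.
pose E : set (measurableTypeR R * 'rV[R]_d) :=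
  [set p | p.1 * a ord0 ord0 + (p.2 *m a') ord0 ord0 = b].
have EE : @rV_cons R d @^-1` [set x | (x *m a) ord0 ord0 = b] = E.
  apply/seteqP; split=> p; rewrite /E /= !dotrowE big_ord_recl.
    move=> <-; congr (_ * _ + _); first by rewrite -[LHS](rV_coord_cons0 p).
    by apply: eq_bigr => i _; rewrite mxE; congr (_ * _);
    rewrite -[LHS]/(rV_coord i p.2) -rV_coord_consS.
  move=> <-; congr (_ * _ + _); first by rewrite -[RHS](rV_coord_cons0 p).
  by apply: eq_bigr => i _; rewrite [X in _ = _ * X]mxE; congr (_ * _);
    rewrite -[RHS]/(rV_coord i p.2) -rV_coord_consS.
have mE : measurable E.
  rewrite -EE -[X in measurable X]setTI.
  by apply: measurable_rV_cons => //; exact: measurable_hyperplane.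
transitivity (product_measure1 (@lebesgue_measure R) (lebesgue_rV R d) E).
  by rewrite -EE.
have [a'0|a'n0] := eqVneq a' 0; last first.
  rewrite /product_measure1 /=.
  under eq_integral => x _.
    rewrite (_ : lebesgue_rV R d (xsection E x) = 0%E); first over.
    rewrite /= -(IH a' (b - x * a ord0 ord0) a'n0).
    congr (lebesgue_rV R d _); apply/seteqP; split=> y /=.
      by rewrite /xsection /= inE /E /= => <-; ring.
    by rewrite /xsection /= inE /E /= => ->; ring.
  by rewrite integral0.
have a00 : a ord0 ord0 != 0.
  apply: contra_neq an0 => a00; apply/matrixP => i j; rewrite (ord1 j) mxE.
  case: (unliftP ord0 i) => [k|] -> //.
  by have := congr1 (fun m : 'cV_d => m k ord0) a'0; rewrite !mxE.
apply/eqP; rewrite eq_le measure_ge0 andbT.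
apply: (@le_trans _ _ (product_measure1 (@lebesgue_measure R) (lebesgue_rV R d)
  ([set b / a ord0 ord0] `*` setT))).
  apply: le_measure; rewrite ?inE//; first exact: measurableX.
  move=> [x y]; rewrite /E /= a'0 mulmx0 mxE addr0 => h; split=> //=.
  by rewrite -h mulfK.
by rewrite product_measure1E//= lebesgue_measure_set1 mul0e.
Qed.
End hyperplane.

(** * Smooth functions *)

Section directional_derivatives.
Context (R : realType) (V : normedModType R).
Implicit Types (f g : V -> R).

Lemma line_is_derive f (x e : V) (t l : R) : is_derive (t *: e + x) e f l ->
  is_derive t 1 (fun h : R => f (h *: e + x)) l.
Proof.
move=> [df dl].
have E : (fun h : R => h^-1 *: ((f \o shift (t *: e + x)) (h *: e) - f (t *: e + x))) =
  (fun h : R => h^-1 *: (((fun h0 : R => f (h0 *: e + x)) \o shift t) (h *: 1) -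
     f (t *: e + x))).
  by apply/funext => h /=; rewrite addrA -scalerDl [_%:A]mulr1.
by split; [rewrite /derivable -E|rewrite /derive -E].
Qed.

Lemma is_derive_line f (x e : V) (l : R) :
  is_derive (0 : R) 1 (fun h : R => f (h *: e + x)) l -> is_derive x e f l.
Proof.
move=> [df dl].
have E : (fun h : R => h^-1 *: ((f \o shift x) (h *: e) - f x)) =
  (fun h : R => h^-1 *: (((fun h0 : R => f (h0 *: e + x)) \o shift 0) (h *: 1) -
     f (0 *: e + x))).
  by apply/funext => h /=; rewrite addr0 scale0r add0r [_%:A]mulr1.
by split; [rewrite /derivable E|rewrite /derive E].
Qed.

Lemma is_deriveD' f g x e a b : is_derive x e f a -> is_derive x e g b ->
  is_derive x e (fun y => f y + g y) (a + b).
Proof. by move=> hf hg; exact: is_deriveD. Qed.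

Lemma is_deriveM' f g x e a b : is_derive x e f a -> is_derive x e g b ->
  is_derive x e (fun y => f y * g y) (f x * b + g x * a).
Proof. by move=> hf hg; exact: is_deriveM. Qed.

Lemma is_deriveZ' (c : R) f x e a : is_derive x e f a ->
  is_derive x e (fun y => c * f y) (c * a).
Proof. by move=> hf; exact: is_deriveZ. Qed.

Lemma is_derive_near f g (x e : V) (a : R) : (\near x, f x = g x) ->
  is_derive x e f a -> is_derive x e g a.
Proof.
move=> fg [df da]; split; first exact: near_eq_derivable fg df.
by rewrite -(near_eq_derive _ fg).
Qed.

Lemma is_derive_seq f (x e : V) (a : R) (h : nat -> R) : is_derive x e f a ->
  (forall n, h n != 0) -> h @ \oo --> 0 ->
  (fun n => (h n)^-1 * (f (x + h n *: e) - f x)) @ \oo --> a.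
Proof.
move=> [df <-] hn0 h0.
have cf : (fun h : R => h^-1 *: ((f \o shift x) (h *: e) - f x)) @ 0^' --> 'D_e f x by [].
have : (fun n => h n) @ \oo --> (0 : R)^'.
  move=> A nA; have H : \forall n \near \oo, (h n != 0 -> A (h n)) := h0 _ nA.
  by apply: filterS H => n; apply; exact: hn0.
move=> /cvg_comp/(_ cf).
set A := (X in X @ _ --> _); set B := (X in _ -> X @ _ --> _).
by have -> : B = A by apply/funext => n; rewrite /A /B /= [h n *: e + x]addrC.
Qed.

Lemma dnbhs_cvg_seq (F : R -> R) (l : R) :
  (forall h : nat -> R, (forall n, h n != 0) -> h @ \oo --> 0 -> F \o h @ \oo --> l) ->
  F @ 0^' --> l.
Proof.
move=> H; apply: contrapT => /cvgrPdist_lt/= nF.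
have [e e0 he] : exists2 e : R, 0 < e & ~ (\forall t \near 0^', `|l - F t| < e).
  by move: nF => /existsNP[e /not_implyP[e0 ?]]; exists e.
have h (n : nat) : exists t : R, [/\ t != 0, `|t| < n.+1%:R^-1 & e <= `|l - F t|].
  apply: contrapT => /forallNP ht; apply: he.
  rewrite /dnbhs /within /=; apply/nbhs_ballP; exists n.+1%:R^-1 => //=.
  move=> t; rewrite /ball /= sub0r normrN => tn t0; rewrite ltNge; apply/negP => et.
  by apply: (ht t).
have [u hu] := choice h.
have u0 n : u n != 0 by have [] := hu n.
have cu : u @ \oo --> 0.
  apply/cvgrPdist_lt => r r0; near=> n.
  rewrite sub0r normrN; have [_ h1 _] := hu n; apply: lt_trans h1 _.
  by near: n; exact: (near_infty_natSinv_lt (PosNum r0)).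
have /cvgrPdist_lt/(_ _ e0)[N _ /(_ N (leqnn _))] := H u u0 cu.
by rewrite /= ltNge; have [_ _ ->] := hu N.
Unshelve. all: by end_near. Qed.

Lemma is_derive_from_seq f (x e : V) (a : R) :
  (forall h : nat -> R, (forall n, h n != 0) -> h @ \oo --> 0 ->
    (fun n => (h n)^-1 * (f (x + h n *: e) - f x)) @ \oo --> a) ->
  is_derive x e f a.
Proof.
move=> H.
have cf : (fun h : R => h^-1 *: ((f \o shift x) (h *: e) - f x)) @ 0^' --> a.
  apply: dnbhs_cvg_seq => h h0 ch; have := H h h0 ch.
  rewrite (_ : _ \o h = fun n => (h n)^-1 * (f (x + h n *: e) - f x)) //.
  by apply/funext => n /=; rewrite [h n *: e + x]addrC.
split; first by apply/cvg_ex; exists a.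
exact: cvg_lim.
Qed.

Lemma is_derive_lip f (e : V) (f1 : V -> R) (L : R) :
  (forall x, is_derive x e f (f1 x)) -> (forall x, `|f1 x| <= L) ->
  forall x h, `|f (x + h *: e) - f x| <= L * `|h|.
Proof.
move=> df fL.
have key x h : 0 < h -> `|f (x + h *: e) - f x| <= L * `|h|.
  move=> h0.
  pose p (t : R) := f (t *: e + x).
  have dp (t : R) : is_derive t 1 p (f1 (t *: e + x)) by exact: line_is_derive.
  have [|c _] := @MVT R p (fun t => f1 (t *: e + x)) 0 h h0 (fun t _ => dp t).
    apply: derivable_within_continuous => t _.
    by have [] := dp t.
  rewrite /p scale0r add0r subr0 [x + _]addrC => ->; rewrite normrM.
  by rewrite ler_wpM2r.
move=> x h; have [h0|h0|<-] := ltgtP 0 h; first exact: key.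
  have := key (x + h *: e) (- h); rewrite scaleNr addrK oppr_gt0 normrN => /(_ h0).
  by rewrite distrC.
by rewrite scale0r addr0 subrr normr0 mulr0.
Qed.

Lemma continuous_add (f g : V -> R) : continuous f -> continuous g ->
  continuous (fun x => f x + g x).
Proof. by move=> cf cg x; apply: continuousD; [exact: cf|exact: cg]. Qed.

Lemma continuous_mul (f g : V -> R) : continuous f -> continuous g ->
  continuous (fun x => f x * g x).
Proof. by move=> cf cg x; apply: continuousM; [exact: cf|exact: cg]. Qed.

End directional_derivatives.

Section smooth_functions.
Context (R : realType) (d : nat).
Local Notation pt := 'rV[R]_d.
Local Notation e_ := (@basis_vector R d).
Implicit Types (f g v : pt -> R).

Definition smooth f := forall k, Ck k f.

Lemma smooth_continuous f : smooth f -> continuous f.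
Proof. by move=> h; exact: (h 0%N). Qed.

Lemma smooth_derivable f i x : smooth f -> derivable f x (e_ i).
Proof. by move=> h; have [] := h 1%N i. Qed.

Lemma smooth_is_derive f i x : smooth f -> is_derive x (e_ i) f ('D_(e_ i) f x).
Proof. by move=> h; apply: derivableP; exact: smooth_derivable. Qed.

Lemma smooth_deriv f i : smooth f -> smooth ('D_(e_ i) f).
Proof. by move=> h k; have [] := h k.+1 i. Qed.

Lemma smooth_closed (P : (pt -> R) -> Prop) :
  (forall f, P f -> continuous f) ->
  (forall f, P f -> forall i, exists2 f1, P f1 & forall x, is_derive x (e_ i) f (f1 x)) ->
  forall f, P f -> smooth f.
Proof.
move=> Pc Pd f Pf k; elim: k f Pf => [|k IH] f Pf /=; first exact: Pc.
move=> i; have [f1 Pf1 df] := Pd f Pf i; split.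
  by move=> x; have [] := df x.
rewrite (_ : 'D_(e_ i) f = f1); first exact: IH.
by apply/funext => x; have [] := df x.
Qed.

Lemma smooth_cst (c : R) : smooth (fun=> c).
Proof.
apply: (@smooth_closed (fun f => exists c, f = fun=> c)); last by exists c.
  by move=> f [a ->]; exact: cst_continuous.
move=> f [a ->] i; exists (fun=> 0); first by exists 0.
by move=> x; exact: is_derive_cst.
Qed.

Lemma smoothD f g : smooth f -> smooth g -> smooth (fun x => f x + g x).
Proof.
move=> sf sg; apply: (@smooth_closed (fun h => exists f g, [/\ smooth f, smooth g &
  h = fun x => f x + g x])); last by exists f, g.
  move=> _ [f1 [g1 [s1 s2 ->]]] x.
  by apply: continuousD; [exact: (smooth_continuous s1)|exact: (smooth_continuous s2)].
move=> _ [f1 [g1 [s1 s2 ->]]] i.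
exists (fun x => 'D_(e_ i) f1 x + 'D_(e_ i) g1 x).
  by exists ('D_(e_ i) f1), ('D_(e_ i) g1); split=> //; exact: smooth_deriv.
by move=> x; apply: is_deriveD'; exact: smooth_is_derive.
Qed.

(* The span of the products of two smooth functions is closed under partial
   derivatives. *)
Lemma smoothM f g : smooth f -> smooth g -> smooth (fun x => f x * g x).
Proof.
move=> sf sg.
pose P (h : pt -> R) := exists s : seq ((pt -> R) * (pt -> R)),
  (forall p, p \in s -> smooth p.1 /\ smooth p.2) /\
  h = fun x => \sum_(p <- s) p.1 x * p.2 x.
have contP h : P h -> continuous h.
  move=> [s [hs ->]]; elim: s hs => [|p s IH] hs.
    under [X in continuous X]eq_fun do rewrite big_nil.
    exact: cst_continuous.
  under [X in continuous X]eq_fun do rewrite big_cons.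
  have [s1 s2] := hs p (mem_head _ _).
  apply: (@continuous_add R pt (fun x => p.1 x * p.2 x)).
    by apply: continuous_mul; exact: smooth_continuous.
  by apply: IH => q qs; apply: hs; rewrite inE qs orbT.
apply: (@smooth_closed P) => //; last first.
  exists [:: (f, g)]; split; first by move=> p; rewrite inE => /eqP ->.
  by apply/funext => x; rewrite big_seq1.
move=> h [s [hs ->]] i.
elim: s hs => [|p s IH] hs.
  exists (fun=> 0).
    by exists [::]; split=> //; apply/funext => x; rewrite big_nil.
  by move=> x; under [X in is_derive _ _ X _]eq_fun do rewrite big_nil; exact: is_derive_cst.
have [|h1 [s1 [hs1 h1E]] dh1] := IH; first by move=> q qs; apply: hs; rewrite inE qs orbT.
have [p1 p2] := hs p (mem_head _ _).
exists (fun x => (p.1 x * 'D_(e_ i) p.2 x + p.2 x * 'D_(e_ i) p.1 x) + h1 x).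
  exists [:: (p.1, 'D_(e_ i) p.2), (p.2, 'D_(e_ i) p.1) & s1]; split.
    move=> q; rewrite !inE => /or3P[/eqP->|/eqP->|/hs1//]; split=> //=;
      exact: smooth_deriv.
  by apply/funext => x; rewrite !big_cons /= h1E addrA.
move=> x; under [X in is_derive _ _ X _]eq_fun do rewrite big_cons.
by apply: is_deriveD' => //; apply: is_deriveM'; exact: smooth_is_derive.
Qed.

Lemma smoothZ (c : R) f : smooth f -> smooth (fun x => c * f x).
Proof. by move=> sf; apply: smoothM => //; exact: smooth_cst. Qed.

Lemma smooth_prod (I : Type) (s : seq I) (F : I -> pt -> R) :
  (forall i, smooth (F i)) -> smooth (fun x => \prod_(i <- s) F i x).
Proof.
move=> h; elim: s => [|i s IH].
  by under [X in smooth X]eq_fun do rewrite big_nil; exact: smooth_cst.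
by under [X in smooth X]eq_fun do rewrite big_cons; exact: smoothM.
Qed.

End smooth_functions.

(** * Bump functions *)

Section one_dimensional_bump.
Context (R : realType).
Implicit Types (t : R).

Definition bump1 (n : nat) t : R := if 0 < t then t^-1 ^+ n * expR (- t^-1) else 0.

Lemma bump1_le n t : `|bump1 n t| <= (n.+2`!)%:R * t ^+ 2.
Proof.
rewrite /bump1; case: ifPn => t0; last by rewrite normr0 mulr_ge0// sqr_ge0.
have ti0 : 0 < t^-1 by rewrite invr_gt0.
rewrite ger0_norm ?mulr_ge0 ?expR_ge0 ?exprn_ge0 ?(ltW ti0)// expRN.
rewrite ler_pdivrMr ?expR_gt0//.
have := expR_ge1Dxn n.+1 (ltW ti0) => h.
have f0 : 0 < (n.+2)`!%:R :> R by rewrite ltr0n fact_gt0.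
have h2 : t^-1 ^+ n.+2 <= n.+2`!%:R * expR t^-1.
  rewrite mulrC -ler_pdivrMr//; apply: le_trans h; by rewrite lerDr.
have -> : t^-1 ^+ n = t ^+ 2 * t^-1 ^+ n.+2.
  by rewrite (exprD _ 2 n : t^-1 ^+ n.+2 = _) mulrA -exprMn divff ?gt_eqF// expr1n mul1r.
by rewrite [leRHS]mulrAC [leRHS]mulrC; apply: ler_wpM2l => //; exact: sqr_ge0.
Qed.

Lemma bump1_is_derive n t :
  is_derive t 1 (bump1 n) (bump1 n.+2 t - n%:R * bump1 n.+1 t).
Proof.
have [t0|t0|<-] := ltgtP 0 t.
- have tn0 : t != 0 by rewrite gt_eqF.
  have d1 : is_derive t 1 (fun y : R => y^-1) (- t ^- 2 *: 1).
    exact: is_deriveV.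
  apply: (@is_derive_near R R (fun y => y^-1 ^+ n * expR (- y^-1))).
    near=> y; rewrite /bump1; have -> : 0 < y by near: y; exact: lt_nbhsr.
    by [].
  have d2 : is_derive t 1 (fun y : R => y^-1 ^+ n) (n%:R * t^-1 ^+ n.-1 *: (- t ^- 2 *: 1)).
    by have := is_deriveX n d1; rewrite exprfctE.
  have d3 : is_derive t 1 (fun y : R => expR (- y^-1)) (expR (- t^-1) * - (- t ^- 2 *: 1)).
    have d3' : is_derive t 1 (fun y : R => - y^-1) (- (- t ^- 2 *: 1)) by exact: is_deriveN.
    exact: (is_derive1_comp _ d3').
  suff -> : bump1 n.+2 t - n%:R * bump1 n.+1 t = t^-1 ^+ n *
      (expR (- t^-1) * - (- t ^- 2 *: 1)) + expR (- t^-1) *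
      (n%:R * t^-1 ^+ n.-1 *: (- t ^- 2 *: 1)) by exact: is_deriveM' d2 d3.
  rewrite /bump1 t0 /= ![_ *: _]mulrC !mul1r.
  case: n {d2} => [|n] /=.
    by rewrite !mul0r !mulr0 addr0 subr0 expr0 mul1r opprK mulrC exprVn.
  by rewrite -exprVn !exprS expr0; set s := t^-1; set E := expR _; ring.
- apply: (@is_derive_near R R (fun=> 0)).
    near=> y; rewrite /bump1 ltNge; have -> : y <= 0 by apply: ltW; near: y; exact: lt_nbhsl.
    by [].
  rewrite /bump1 ltNge (ltW t0) /= mulr0 subr0; exact: is_derive_cst.
have -> : bump1 n.+2 0 - n%:R * bump1 n.+1 0 = 0 by rewrite /bump1 ltxx mulr0 subr0.
apply: is_derive_from_seq => h h0 ch.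
have ch2 : (fun k => (n.+2`!)%:R * `|h k|) @ \oo --> 0.
  rewrite -[X in _ --> X](mulr0 (n.+2`!)%:R) -[X in _ * X](@normr0 R R).
  by apply: cvgMr; exact: cvg_norm.
apply/norm_cvg0P; apply: (squeeze_cvgr _ (cvg_cst 0) ch2).
near=> k; rewrite normr_ge0 /= add0r [_%:A]mulr1 normrM normfV.
rewrite {2}/bump1 ltxx subr0 ler_pdivrMl ?normr_gt0//.
by rewrite mulrCA -expr2 real_normK ?num_real ?bump1_le.
Unshelve. all: by end_near. Qed.

Lemma bump1_continuous n : continuous (bump1 n).
Proof.
by move=> t; apply/differentiable_continuous/derivable1_diffP; have [] := bump1_is_derive n t.
Qed.

Lemma bump1_ge0 t : 0 <= bump1 0 t.
Proof. by rewrite /bump1; case: ifP => // _; rewrite mul1r expR_ge0. Qed.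

Lemma bump1_le1 t : bump1 0 t <= 1.
Proof.
rewrite /bump1; case: ifP => // t0; rewrite mul1r -[leRHS]expR0 ler_expR.
by rewrite oppr_le0 invr_ge0 ltW.
Qed.

Lemma bump1_gt0 t : (0 < bump1 0 t) = (0 < t).
Proof. by rewrite /bump1; case: ifP => // _; rewrite ?ltxx// mul1r expR_gt0. Qed.

Lemma bump1_eq0 t : t <= 0 -> bump1 0 t = 0.
Proof. by rewrite /bump1 leNgt => /negbTE ->. Qed.

Lemma bump1_cvg t : (fun m => bump1 0 (m.+1%:R * t)) @ \oo --> ((0 < t)%R%:R : R).
Proof.
have [t0|t0] := ltP 0 t; last first.
  rewrite (_ : (fun _ => _) = fun=> 0); first exact: cvg_cst.
  by apply/funext => m; rewrite bump1_eq0// mulr_ge0_le0.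
rewrite (_ : (fun _ => _) = fun m => expR (- (m.+1%:R^-1 * t^-1))); last first.
  by apply/funext => m; rewrite /bump1 mulr_gt0// mul1r invfM.
rewrite -[X in _ --> X]expR0.
apply: continuous_cvg; first exact: continuous_expR.
rewrite -oppr0; apply: cvgN; rewrite -[X in _ --> X](mul0r t^-1).
by apply: cvgMl; exact: cvg_harmonic.
Qed.
End one_dimensional_bump.

Section bump_functions.
Context (R : realType) (d : nat).
Local Notation pt := 'rV[R]_d.
Local Notation e_ := (@basis_vector R d).

Lemma coord_continuous' (j : 'I_d) : continuous (fun x : pt => x ord0 j).
Proof. exact: coord_continuous. Qed.

(* The span of the functions bump1 n (a x_j + c), for all n, is closed under partial
   derivatives. *)
Lemma smooth_bump1 n (a c : R) (j : 'I_d) :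
  smooth (fun x : pt => bump1 n (a * x ord0 j + c)).
Proof.
pose P (h : pt -> R) := exists s : seq (R * nat),
  h = fun x => \sum_(p <- s) p.1 * bump1 p.2 (a * x ord0 j + c).
apply: (@smooth_closed R d P); last first.
- by exists [:: (1, n)]; apply/funext => x; rewrite big_seq1 mul1r.
- move=> h [s ->] i; elim: s => [|p s [h1 [s1 h1E] dh1]].
    exists (fun=> 0); first by exists [::]; apply/funext => x; rewrite big_nil.
    by move=> x; under [X in is_derive _ _ X _]eq_fun do rewrite big_nil; exact: is_derive_cst.
  exists (fun x : pt => p.1 * ((bump1 p.2.+2 (a * x ord0 j + c) -
      p.2%:R * bump1 p.2.+1 (a * x ord0 j + c)) * (a * (j == i)%:R)) + h1 x).
    exists [:: (p.1 * (a * (j == i)%:R), p.2.+2),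
      (- p.1 * p.2%:R * (a * (j == i)%:R), p.2.+1) & s1].
    by apply/funext => x; rewrite !big_cons h1E /=; ring.
  move=> x; under [X in is_derive _ _ X _]eq_fun do rewrite big_cons.
  apply: is_deriveD' => //; apply: is_deriveZ'; apply: is_derive_line.
  rewrite (_ : (fun _ => _) = bump1 p.2 \o
    (fun h : R => a * (j == i)%:R * h + (a * x ord0 j + c))); last first.
    by apply/funext => r /=; congr bump1; rewrite !mxE; ring.
  apply: is_derive1_comp.
    rewrite mulr0 add0r; exact: bump1_is_derive.
  have := is_deriveD' (is_deriveZ' (a * (j == i)%:R) (is_derive_id (0 : R) 1))
    (is_derive_cst (a * x ord0 j + c) (0 : R) 1).
  by rewrite addr0 mulr1.
- move=> h [s ->]; elim: s => [|p s IH].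
    by under [X in continuous X]eq_fun do rewrite big_nil; exact: cst_continuous.
  under [X in continuous X]eq_fun do rewrite big_cons.
  apply: (@continuous_add R pt (fun x => p.1 * _)) => //.
  apply: continuous_mul; first exact: cst_continuous.
  move=> x; apply: (@continuous_comp _ _ _ (fun x : pt => a * x ord0 j + c)).
    apply: continuous_add; last exact: cst_continuous.
    by apply: continuous_mul; [exact: cst_continuous|exact: coord_continuous'].
  exact: bump1_continuous.
Qed.

Definition bump (m : nat) (l u : pt) (x : pt) : R :=
  \prod_(i < d) (bump1 0 (m.+1%:R * x ord0 i + - (m.+1%:R * l ord0 i)) *
                 bump1 0 (- m.+1%:R * x ord0 i + m.+1%:R * u ord0 i)).

Lemma smooth_bump m l u : smooth (bump m l u).
Proof.
by apply: smooth_prod => i; apply: smoothM; exact: smooth_bump1.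
Qed.

Lemma bumpE m l u x : bump m l u x =
  \prod_(i < d) (bump1 0 (m.+1%:R * (x ord0 i - l ord0 i)) *
                 bump1 0 (m.+1%:R * (u ord0 i - x ord0 i))).
Proof.
by apply: eq_bigr => i _; congr (bump1 _ _ * bump1 _ _); ring.
Qed.

Lemma bump_ge0 m l u x : 0 <= bump m l u x.
Proof. by apply: prodr_ge0 => i _; rewrite mulr_ge0 ?bump1_ge0. Qed.

Lemma bump_le1 m l u x : bump m l u x <= 1.
Proof.
apply: prodr_ile1 => i _; rewrite mulr_ge0 ?bump1_ge0//=.
by rewrite mulr_ile1 ?bump1_ge0 ?bump1_le1.
Qed.

Lemma bump_gt0 m l u x : obox l u x -> 0 < bump m l u x.
Proof.
move=> h; rewrite bumpE; apply: prodr_gt0 => i _; have /andP[h1 h2] := h i.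
by rewrite mulr_gt0// bump1_gt0 mulr_gt0// subr_gt0.
Qed.

Lemma bump_eq0 m l u x : ~ obox l u x -> bump m l u x = 0.
Proof.
move=> h; have [i hi] : exists i, ~~ (l ord0 i < x ord0 i < u ord0 i).
  by apply: contrapT => /forallNP hn; apply: h => i; have := hn i; rewrite -[_ <> true]/(~ _) => /negP; rewrite negbK.
rewrite bumpE (bigD1 i)//=; move: hi; rewrite negb_and -!leNgt => /orP[] h1.
  by rewrite bump1_eq0 ?mul0r// mulr_ge0_le0// subr_le0.
by rewrite [X in _ * X * _]bump1_eq0 ?mulr0 ?mul0r// mulr_ge0_le0// subr_le0.
Qed.

Lemma bump_cvg l u x : (fun m => bump m l u x) @ \oo --> (\1_(obox l u) x : R).
Proof.
have -> : \1_(obox l u) x =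
    \prod_(i < d) ((0 < x ord0 i - l ord0 i)%R%:R * (0 < u ord0 i - x ord0 i)%R%:R) :> R.
  rewrite indicE; case: (boolP (x \in obox l u)).
    rewrite inE => h; rewrite big1// => i _; have /andP[h1 h2] := h i.
    by rewrite !subr_gt0 h1 h2 mul1r.
  rewrite notin_setE => h; have [i hi] : exists i, ~~ (l ord0 i < x ord0 i < u ord0 i).
    by apply: contrapT => /forallNP hn; apply: h => i; have /negP := hn i; rewrite negbK.
  rewrite (bigD1 i)//= !subr_gt0; move: hi.
  by rewrite negb_and => /orP[] /negbTE ->; rewrite ?mulr0 ?mul0r.
rewrite (_ : (fun m => bump m l u x) = fun m => \prod_(i < d) (bump1 0 (m.+1%:R * (x ord0 i - l ord0 i)) *
                 bump1 0 (m.+1%:R * (u ord0 i - x ord0 i)))); last first.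
  by apply/funext => m; rewrite bumpE.
apply: cvg_big => [|i _]; first exact: mul_continuous.
by apply: cvgM; exact: bump1_cvg.
Qed.

Lemma compact_cbox (l u : pt) : compact (cbox l u).
Proof.
have := @rV_compact R d (fun i => `[l ord0 i, u ord0 i]%classic).
move=> /(_ (fun i => @segment_compact _ _ _)).
by rewrite cboxE.
Qed.

Lemma bump_test (Omega : set pt) m l u : cbox l u `<=` Omega ->
  test_function Omega (bump m l u).
Proof.
move=> h; split; first exact: smooth_bump.
exists (cbox l u); split=> //; first exact: compact_cbox.
move=> x hx; apply: bump_eq0 => ho; apply: hx => i.
by have /andP[h1 h2] := ho i; rewrite !ltW.
Qed.

End bump_functions.

(** * Weak gradients *)

Section weak_gradients.
Context (R : realType) (d : nat).
Local Notation pt := 'rV[R]_d.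
Local Notation mu := (lebesgue_rV R d).
Local Notation e_ := (@basis_vector R d).
Implicit Types (f g v w : pt -> R).

Lemma cvg_uniqueR (u : nat -> R) (a b : R) : u @ \oo --> a -> u @ \oo --> b -> a = b.
Proof. by move=> ua ub; rewrite -(cvg_lim (@Rhausdorff R) ua); exact: cvg_lim. Qed.

Lemma ae_ord (n : nat) (P : 'I_n -> pt -> Prop) : (forall i, {ae mu, forall x, P i x}) ->
  {ae mu, forall x, forall i, P i x}.
Proof. by move=> h; exact: filter_forall. Qed.

Definition bbs f := measurable_fun setT f /\
  exists M n : R, (forall x, `|f x| <= M) /\ (forall x, f x != 0 -> cube 0 n x).

Lemma bbs_intg f : bbs f -> intg f.
Proof. by move=> [mf [M [n [h1 h2]]]]; exact: intg_bounded_support h1 h2. Qed.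

Lemma bbs_sqi f : bbs f -> sqi f.
Proof. by move=> [mf [M [n [h1 h2]]]]; exact: sqi_bounded_support h1 h2. Qed.

Lemma bbs_mul f g (M : R) : bbs f -> measurable_fun setT g ->
  (forall x, `|g x| <= M) -> bbs (fun x => f x * g x).
Proof.
move=> [mf [N [n [h1 h2]]]] mg gM; split; first exact: measurable_funM.
exists (N * M), n; split=> x; first by rewrite normrM ler_pM.
by rewrite mulf_eq0 negb_or => /andP[fx _]; exact: h2.
Qed.

Lemma bbs_shift f (h : pt) : bbs f -> bbs (fun x => f (x + h)).
Proof.
move=> [mf [N [n [h1 h2]]]]; split.
  exact: (measurableT_comp mf (measurable_shift h)).
have [m hm] := coordinate_bound h.
exists N, (n + m%:R); split=> // x /h2 hx i.
have := hx i; have := hm i; rewrite !mxE !sub0r !normrN => H1 H2.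
rewrite -[x ord0 i](addrK (h ord0 i)); apply: le_lt_trans (ler_normB _ _) _.
exact: ltrD.
Qed.

Definition lip1 (e : pt) f (L : R) := forall x h, `|f (x + h *: e) - f x| <= L * `|h|.

Lemma Int_by_parts (e : pt) f g f1 g1 (L : R) : bbs f -> bbs g ->
  measurable_fun setT f1 -> measurable_fun setT g1 ->
  lip1 e f L -> lip1 e g L ->
  {ae mu, forall x, is_derive x e f (f1 x)} ->
  {ae mu, forall x, is_derive x e g (g1 x)} ->
  \int[mu]_x (f x * g1 x) = - \int[mu]_x (f1 x * g x).
Proof.
move=> bf bg mf1 mg1 Lf Lg df dg.
have [mf _] := bf; have [mg _] := bg.
pose h (n : nat) : R := n.+1%:R^-1.
have h0 n : 0 < h n by rewrite invr_gt0.
have hn0 n : h n != 0 by rewrite gt_eqF.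
have ch : h @ \oo --> 0 by exact: cvg_harmonic.
pose A n x := f x * ((h n)^-1 * (g (x + h n *: e) - g x)).
pose B n x := (h n)^-1 * (f (x + - h n *: e) - f x) * g x.
have AB n : \int[mu]_x A n x = \int[mu]_x B n x.
  have [M [k [gM _]]] := bg.2.
  have i1 : intg (fun x => f x * g (x + h n *: e)).
    apply: bbs_intg; apply: (bbs_mul (M := M)) => //.
    exact: (measurableT_comp mg (measurable_shift _)).
  have i2 : intg (fun x => f x * g x) by apply: bbs_intg; exact: bbs_mul bf mg gM.
  have i3 : intg (fun x => f (x + - h n *: e) * g x).
    apply: bbs_intg; apply: (bbs_mul _ mg gM); exact: bbs_shift.
  transitivity ((h n)^-1 * (\int[mu]_x (f x * g (x + h n *: e)) - \int[mu]_x (f x * g x))).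
    rewrite -IntB// -IntZ; last exact: intg_sub.
    by apply: eq_Rintegral => x _; rewrite /A; ring.
  transitivity ((h n)^-1 * (\int[mu]_x (f (x + - h n *: e) * g x) - \int[mu]_x (f x * g x))).
    congr (_ * (_ - _)); rewrite -(Int_shift (- h n *: e) i1).
    by apply: eq_Rintegral => x _; rewrite -addrA -scalerDl addNr scale0r addr0.
  rewrite -IntB// -IntZ; last exact: intg_sub.
  by apply: eq_Rintegral => x _; rewrite /B; ring.
have mshift (k : pt -> R) (y : pt) : measurable_fun setT k -> measurable_fun setT (fun x : pt => k (x + y)).
  by move=> mk; exact: (measurableT_comp mk (measurable_shift _)).
have cA : (fun n => \int[mu]_x A n x) @ \oo --> \int[mu]_x (f x * g1 x).
  have := @Int_dct R d A (fun x => f x * g1 x) (fun x => L * `|f x|).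
  case=> //.
  - move=> n; apply: measurable_funM => //; apply: measurable_funM => //.
    by apply: measurable_funB => //; exact: mshift.
  - exact: measurable_funM.
  - by apply: intg_scale; apply: intg_norm; exact: bbs_intg.
  - move=> n x; rewrite /A !normrM mulrC ler_wpM2r//.
    rewrite normfV ler_pdivrMl ?normr_gt0// mulrC; exact: Lg.
  - apply: filterS dg => x dgx; apply: cvgMr.
    exact: (is_derive_seq dgx).
have [iB cB] : intg (fun x => - (f1 x * g x)) /\ (fun n => \int[mu]_x B n x) @ \oo --> \int[mu]_x (- (f1 x * g x)).
  apply: (@Int_dct R d B (fun x => - (f1 x * g x)) (fun x => L * `|g x|)).
  - move=> n; apply: measurable_funM => //; apply: measurable_funM => //.
    by apply: measurable_funB => //; exact: mshift.
  - by apply: measurableT_comp => //; exact: measurable_funM.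
  - by apply: intg_scale; apply: intg_norm; exact: bbs_intg.
  - move=> n x; rewrite /B !normrM ler_wpM2r//.
    rewrite normfV ler_pdivrMl ?normr_gt0// mulrC.
    by apply: le_trans (Lf _ _) _; rewrite normrN.
  - apply: filterS df => x dfx.
    have nh0 n : - h n != 0 by rewrite oppr_eq0.
    have nch : (fun n => - h n) @ \oo --> 0 by rewrite -oppr0; apply: cvgN.
    have := is_derive_seq dfx nh0 nch => H.
    have : (fun n => - ((- h n)^-1 * (f (x + - h n *: e) - f x)) * g x) @ \oo --> - f1 x * g x.
      by apply: cvgMl; exact: cvgN.
    rewrite mulNr (_ : (fun n : nat => - _ * g x) = B ^~ x)//.
    by apply/funext => n; rewrite /B invrN; ring.
have <- : \int[mu]_x (- (f1 x * g x)) = - \int[mu]_x (f1 x * g x).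
  by rewrite -IntN//; under [X in intg X]eq_fun do rewrite -[_ * _]opprK; exact: intg_opp.
apply: cvg_uniqueR cA _.
by have -> : (fun n => \int[mu]_x A n x) = (fun n => \int[mu]_x B n x) by apply/funext.
Qed.

Lemma le_mx_norm_coord (x : pt) i : `|x ord0 i| <= `|x|.
Proof.
rewrite /Num.norm /= mx_normrE.
by apply: (le_trans _ (le_bigmax _ _ (ord0, i))) => /=.
Qed.

Lemma compact_cube (K : set pt) : compact K -> exists n : R, K `<=` cube 0 n.
Proof.
move=> /compact_bounded[M [_ hM]]; exists (M + 2) => x Kx i.
have := hM (M + 1); rewrite ltrDl ltr01 => /(_ isT x Kx) h.
rewrite mxE sub0r normrN; apply: (@le_lt_trans _ _ `|x|); last by apply: le_lt_trans h _; lra.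
exact: le_mx_norm_coord.
Qed.

Lemma continuous_bbs f (K : set pt) : continuous f -> compact K ->
  (forall x, ~ K x -> f x = 0) -> bbs f.
Proof.
move=> cf cK f0; split; first exact: continuous_measurable_rV.
have [n hn] := compact_cube cK.
have /compact_bounded[M [_ hM]] : compact (f @` K).
  by apply: continuous_compact => //; exact: continuous_subspaceT.
exists (`|M| + 1), n; split=> x.
  have [Kx|nKx] := pselect (K x); last by rewrite f0// normr0 addr_ge0.
  by apply: hM; [rewrite ltr_pwDr// ler_norm|exists x].
by have [Kx|nKx] := pselect (K x); [move=> _; exact: hn|rewrite f0// eqxx].
Qed.

Lemma test_deriv0 f (K : set pt) i : compact K -> (forall x, ~ K x -> f x = 0) ->
  forall x, ~ K x -> 'D_(e_ i) f x = 0.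
Proof.
move=> cK f0 x nKx.
have cl : closed K by apply: compact_closed cK; exact: norm_hausdorff.
have -> : 'D_(e_ i) f x = 'D_(e_ i) (cst 0) x.
  apply: near_eq_derive; have : nbhs x (~` K).
    by apply: open_nbhs_nbhs; split=> //; exact: closed_openC.
  by apply: filterS => y; exact: f0.
exact: derive_cst.
Qed.

Lemma test_bbs (Omega : set pt) w : test_function Omega w -> bbs w.
Proof.
by move=> [sw [K [cK _ w0]]]; apply: continuous_bbs cK w0; exact: smooth_continuous.
Qed.

Lemma test_deriv (Omega : set pt) w i : test_function Omega w ->
  test_function Omega ('D_(e_ i) w).
Proof.
move=> [sw [K [cK KO w0]]]; split; first exact: smooth_deriv.
by exists K; split=> //; exact: test_deriv0.
Qed.

Lemma test_lip (Omega : set pt) w i : test_function Omega w ->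
  exists L, lip1 (e_ i) w L.
Proof.
move=> tw; have [_ [M [n [dM _]]]] := test_bbs (test_deriv i tw).
exists M; apply: is_derive_lip dM => x; apply: smooth_is_derive.
by case: tw.
Qed.

Lemma test_out (Omega : set pt) w x : test_function Omega w -> ~ Omega x -> w x = 0.
Proof. by move=> [_ [K [_ KO w0]]] nO; apply: w0 => /KO. Qed.

Lemma test_deriv_out (Omega : set pt) w i x : test_function Omega w -> ~ Omega x ->
  'D_(e_ i) w x = 0.
Proof. by move=> tw nO; exact: test_out (test_deriv i tw) nO. Qed.

Lemma test_add (Omega : set pt) v w (a : R) : test_function Omega v ->
  test_function Omega w -> test_function Omega (fun x => a * v x + w x).
Proof.
move=> [sv [K [cK KO v0]]] [sw [K' [cK' KO' w0]]]; split.
  by apply: smoothD => //; exact: smoothZ.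
exists (K `|` K'); split; first exact: compactU.
  by move=> x [/KO|/KO'].
by move=> x /not_orP[nK nK']; rewrite v0// w0// mulr0 addr0.
Qed.

Lemma test0 (Omega : set pt) : test_function Omega (fun=> 0).
Proof.
split; first exact: smooth_cst.
by exists set0; split=> //; exact: compact0.
Qed.

Lemma restrictM (D : set pt) f g : (fun x => f x * g x) \_ D = fun x => (f \_ D) x * g x.
Proof. by apply/funext => x; rewrite /patch; case: ifP => // _; rewrite mul0r. Qed.

Lemma Int_restrict_mul (D : set pt) f g :
  \int[mu]_(x in D) (f x * g x) = \int[mu]_x ((f \_ D) x * g x).
Proof. by rewrite Rintegral_mkcond restrictM. Qed.

Lemma test_gradient (Omega : set pt) w : test_function Omega w -> measurable Omega ->
  is_gradient Omega w (fun x => \col_i 'D_(e_ i) w x).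
Proof.
move=> tw mO; split=> [i|v i tv].
  apply/L2P; have bw := test_bbs (test_deriv i tw).
  apply: (sqi_dom_all _ (bbs_sqi bw)).
    apply/(measurable_restrictT _ mO); apply: measurable_funTS.
    by under eq_fun do rewrite mxE; case: bw.
  by move=> x; rewrite /patch; case: ifP; rewrite ?normr0// mxE.
have [L1 l1] := test_lip i tw; have [L2 l2] := test_lip i tv.
have wk f L L' : L <= L' -> lip1 (e_ i) f L -> lip1 (e_ i) f L'.
  by move=> LL' lf x h; apply: le_trans (lf x h) _; rewrite ler_wpM2r.
have out (f g : pt -> R) : (forall x, ~ Omega x -> g x = 0) ->
    \int[mu]_(x in Omega) (f x * g x) = \int[mu]_x (f x * g x).
  move=> g0; rewrite Rintegral_mkcond; apply: eq_Rintegral => x _.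
  by rewrite /patch; case: ifPn => //; rewrite notin_setE => /g0 ->; rewrite mulr0.
rewrite !out; last 2 first.
- by move=> x; exact: test_out.
- by move=> x; exact: test_deriv_out.
transitivity (- \int[mu]_x ('D_(e_ i) w x * v x)); last first.
  by congr (- _); apply: eq_Rintegral => x _; rewrite mxE.
apply: (Int_by_parts (e := e_ i) (L := Num.max L1 L2)).
- exact: test_bbs tw.
- exact: test_bbs tv.
- by case: (test_bbs (test_deriv i tw)).
- by case: (test_bbs (test_deriv i tv)).
- by apply: wk l1; rewrite le_max lexx.
- by apply: wk l2; rewrite le_max lexx orbT.
- by apply: aeW => x; apply: smooth_is_derive; case: tw.
- by apply: aeW => x; apply: smooth_is_derive; case: tv.
Qed.

Lemma sqi_indic (D : set pt) : measurable D -> (mu D < +oo)%E -> sqi (\1_D : pt -> R).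
Proof.
move=> mD Doo; split; first exact: measurable_indic.
apply: (intg_dom_all _ (intg_indic mD Doo)); first by apply: measurable_funX; exact: measurable_indic.
by move=> x; rewrite indicE; case: (_ \in _); rewrite ?expr1n ?expr0n ?normr1 ?normr0.
Qed.

Lemma ae_open (Omega : set pt) (P : pt -> Prop) : open Omega ->
  (forall l u, cbox l u `<=` Omega -> {ae mu, forall x, obox l u x -> P x}) ->
  {ae mu, forall x, Omega x -> P x}.
Proof.
move=> oO h.
pose l (p : 'rV[rat]_d * nat) : pt := \row_i (ratr (p.1 ord0 i) - p.2.+1%:R^-1).
pose u (p : 'rV[rat]_d * nat) : pt := \row_i (ratr (p.1 ord0 i) + p.2.+1%:R^-1).
have : {ae mu, forall x, forall n, if @choice.unpickle ('rV[rat]_d * nat)%type n is Some p then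
    cbox (l p) (u p) `<=` Omega -> obox (l p) (u p) x -> P x else True}.
  apply: ae_foralln => n; case: (choice.unpickle n) => [p|]; last exact: aeW.
  have [bO|nbO] := pselect (cbox (l p) (u p) `<=` Omega); last by apply: aeW.
  by apply: filterS (h _ _ bO) => x hx _.
apply: filterS => x hx Ox.
have /rV_nbhsP[e e0 he] : nbhs x Omega by exact: open_nbhs_nbhs.
have [q [n [h1 h2]]] := rat_cube x e0.
have := hx (choice.pickle (q, n)); rewrite choice.pickleK; apply.
  move=> y hy; apply: he; apply: h2 => i; have := hy i; rewrite !mxE /=.
  by rewrite distrC ler_distl.
by move: h1; rewrite cubeE; congr (obox _ _ x); apply/rowP => i; rewrite !mxE.
Qed.

Lemma test_ortho_ae0 (Omega : set pt) f : open Omega -> sqi (f \_ Omega) ->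
  (forall w, test_function Omega w -> \int[mu]_(x in Omega) (f x * w x) = 0) ->
  {ae mu, forall x, Omega x -> f x = 0}.
Proof.
move=> oO sf h; pose P := f \_ Omega.
have P0 w : test_function Omega w -> \int[mu]_x (P x * w x) = 0.
  by move=> tw; rewrite -Int_restrict_mul; exact: h.
have [mP _] := sf.
have iP D : measurable D -> (mu D < +oo)%E -> intg (fun x => P x * \1_D x).
  by move=> mD Doo; apply: sqi_mul => //; exact: sqi_indic.
have box0 l u : cbox l u `<=` Omega -> \int[mu]_x (P x * \1_(obox l u) x) = 0.
  move=> bO.
  have [] := @Int_dct R d (fun m x => P x * bump m l u x) (fun x => P x * \1_(obox l u) x)
    (fun x => `|P x * \1_(obox l u) x|).
  - move=> m; apply: measurable_funM => //; apply: continuous_measurable_rV.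
    by apply: smooth_continuous; exact: smooth_bump.
  - apply: measurable_funM => //; apply: measurable_indic; exact: measurable_obox.
  - by apply: intg_norm; apply: iP; [exact: measurable_obox|exact: mu_obox_lty].
  - move=> m x; rewrite !normrM indicE; case: (boolP (x \in obox l u)).
      by rewrite inE => hx; rewrite normr1 ler_wpM2l// ger0_norm ?bump_ge0 ?bump_le1.
    by rewrite notin_setE => hx; rewrite bump_eq0// normr0.
  - by apply: aeW => x; apply: cvgMr; exact: bump_cvg.
  move=> _; rewrite (_ : (fun _ => _) = fun=> 0); last first.
    by apply/funext => m; apply: P0; exact: bump_test.
  by move=> c0; apply: cvg_uniqueR c0 _; exact: cvg_cst.
have key l u : cbox l u `<=` Omega -> {ae mu, forall x, obox l u x -> P x = 0}.
  move=> bO; pose Q x := P x * \1_(obox l u) x.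
  have iQ : intg Q by apply: iP; [exact: measurable_obox|exact: mu_obox_lty].
  have mQ := intg_measurable iQ.
  have iQE E : measurable E -> intg (fun x => Q x * \1_E x).
    move=> mE; apply: (intg_dom_all _ (intg_norm iQ)).
      by apply: measurable_funM => //; exact: measurable_indic.
    by move=> x; rewrite normrM indicE; case: (_ \in _); rewrite ?normr1 ?mulr1// normr0 mulr0.
  have Q0 : forall E : set pt, measurable E -> \int[mu]_x (Q x * \1_E x) = 0.
    rewrite measurable_oboxes.
    refine (@dynkin_induction _ _ (@oboxes R d)
      (fun E : set pt => \int[mu]_x (Q x * \1_E x) = 0)
      (@measurable_oboxes R d) (@oboxes_setI R d) _ _ _ _).
    - rewrite -[RHS](box0 l u bO); apply: eq_Rintegral => x _.
      by rewrite /Q indicT mulr1.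
    - move=> _ [l' [u' ->]].
      rewrite -[RHS](box0 (\row_i Num.max (l ord0 i) (l' ord0 i))
        (\row_i Num.min (u ord0 i) (u' ord0 i))).
        apply: eq_Rintegral => x _; rewrite -obox_setI /Q -mulrA; congr (_ * _).
        by rewrite !indicE in_setI; case: (_ \in _); case: (_ \in _) => /=; ring.
      move=> x hx; apply: bO => i; have := hx i.
      by rewrite !mxE ge_max le_min => /andP[/andP[-> _] /andP[-> _]].
    - move=> S mS IS.
      transitivity (\int[mu]_x (Q x - Q x * \1_S x)).
        apply: eq_Rintegral => x _; rewrite !indicE in_setC.
        by case: (_ \in _) => /=; ring.
      rewrite IntB//; last exact: iQE.
      rewrite IS subr0 -[RHS](box0 l u bO); exact: eq_Rintegral.
    - move=> F mF tF IF.
      have mU : measurable (\bigcup_k F k) by exact: bigcupT_measurable.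
      have E (S : set pt) : measurable S ->
          \int[mu]_x (Q x * \1_S x) = fine (\int[mu]_(x in S) (Q x)%:E)%E.
        move=> mS; rewrite /Rintegral; congr fine; rewrite [RHS]integral_mkcond.
        apply: eq_integral => x _; rewrite /patch indicE.
        by case: ifP => _; rewrite ?mulr1 ?mulr0.
      have iS (S : set pt) : measurable S -> mu.-integrable S (EFin \o Q).
        by move=> mS; apply: integrableS iQ.
      rewrite E// integral_bigcup//; last exact: iS.
      rewrite eseries0// => i _ _; have := IF i; rewrite E//.
      by have := integrable_fin_num (mF i) (iS _ (mF i)); rewrite /comp; case: (integral _ _ _) => //= r _ ->.
  pose E1 := [set x : pt | 0 < Q x]; pose E2 := [set x : pt | Q x < 0].
  have mE1 : measurable E1.
    have := mQ measurableT _ (measurable_itv `]0, +oo[); rewrite setTI.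
    by congr measurable; apply/seteqP; split => x; rewrite /E1 /= in_itv/= andbT.
  have mE2 : measurable E2.
    have := mQ measurableT _ (measurable_itv `]-oo, 0[); rewrite setTI.
    by congr measurable; apply/seteqP; split => x; rewrite /E2 /= in_itv/=.
  have h1 : {ae mu, forall x, Q x * \1_E1 x = 0}.
    apply: Int_eq0_ae; [exact: iQE| |exact: Q0] => x; rewrite indicE.
    by case: (boolP (x \in E1)); rewrite ?mulr0// inE mulr1 => /ltW.
  have h2 : {ae mu, forall x, - (Q x * \1_E2 x) = 0}.
    apply: Int_eq0_ae; [by apply: intg_opp; exact: iQE| |]; last first.
      by rewrite IntN ?Q0 ?oppr0//; exact: iQE.
    move=> x; rewrite indicE.
    by case: (boolP (x \in E2)); rewrite ?mulr0 ?oppr0// inE mulr1 oppr_ge0 => /ltW.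
  apply: filterS2 h1 h2 => x; rewrite !indicE => H1 H2 hx.
  have QP : Q x = P x by rewrite /Q indicE mem_set// mulr1.
  have [p0|p0|//] := ltgtP (P x) 0.
    by move/eqP: H2; rewrite oppr_eq0 mem_set ?mulr1 ?QP//= => [/eqP//|]; rewrite /E2 /= QP.
  by move: H1; rewrite mem_set ?mulr1 ?QP//= /E1 /= QP.
apply: (ae_open oO) => l u bO; apply: filterS (key l u bO) => x hx ox.
by rewrite -(hx ox) /P patchT// inE; apply: bO => i; have /andP[a b] := ox i; rewrite !ltW.
Qed.

Lemma gradient_unique (Omega : set pt) v p q : open Omega ->
  is_gradient Omega v p -> is_gradient Omega v q ->
  {ae mu, forall x, Omega x -> p x = q x}.
Proof.
move=> oO [Lp hp] [Lq hq]; have mO := open_measurable_rV oO.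
have h i : {ae mu, forall x, Omega x -> p x i ord0 - q x i ord0 = 0}.
  have := Lp i => /L2P sp; have := Lq i => /L2P sq.
  apply: test_ortho_ae0 => //.
    have := sqi_sub sp sq; congr sqi; apply/funext => x.
    by rewrite /patch; case: ifP; rewrite ?subr0.
  move=> w tw; have bw := bbs_sqi (test_bbs tw).
  rewrite Int_restrict_mul.
  transitivity (\int[mu]_x (((fun x => p x i ord0) \_ Omega) x * w x
     - ((fun x => q x i ord0) \_ Omega) x * w x)).
    apply: eq_Rintegral => x _; rewrite -mulrBl; congr (_ * _).
    by rewrite /patch; case: ifP; rewrite ?subr0.
  rewrite IntB; [|exact: sqi_mul..].
  by rewrite -!Int_restrict_mul -[X in X - _]opprK -[X in _ - X]opprK -hp// -hq// subrr.
have : {ae mu, forall x, forall i, Omega x -> p x i ord0 - q x i ord0 = 0}.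
  exact: ae_ord.
apply: filterS => x hx Ox; apply/matrixP => i j; rewrite (ord1 j).
by apply/eqP; rewrite -subr_eq0; apply/eqP; exact: hx.
Qed.

End weak_gradients.

(** * Square roots of symmetric matrices *)

Section symmetric_matrices.
Context (R : realType).
Implicit Types (s : seq R).

Lemma poly_interpolation s (f : R -> R) : exists q : {poly R}, forall x, x \in s -> q.[x] = f x.
Proof.
elim: s => [|a s [q hq]]; first by exists 0.
have [as_|as_] := boolP (a \in s).
  by exists q => x; rewrite inE => /orP[/eqP->|]; exact: hq.
pose p : {poly R} := \prod_(b <- s) ('X - b%:P).
have pa : p.[a] != 0.
  rewrite /p horner_prod prodf_seq_neq0; apply/allP => b bs /=.
  by rewrite hornerXsubC subr_eq0; apply: contraNneq as_ => ->.
exists (q + ((f a - q.[a]) / p.[a]) *: p) => x; rewrite inE => /orP[/eqP->|xs].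
  by rewrite hornerD hornerZ divfK// addrC subrK.
have -> : (q + ((f a - q.[a]) / p.[a]) *: p).[x] = q.[x] + ((f a - q.[a]) / p.[a]) * p.[x].
  by rewrite hornerD hornerZ.
have -> : p.[x] = 0.
  rewrite /p horner_prod (big_rem x)//= hornerXsubC subrr mul0r //.
by rewrite mulr0 addr0 hq.
Qed.

Lemma horner_mx_sym n (A : 'M[R]_n.+1) (q : {poly R}) : A^T = A ->
  (horner_mx A q)^T = horner_mx A q.
Proof.
move=> sA; elim/poly_ind: q => [|q c IH]; first by rewrite rmorph0 trmx0.
rewrite !rmorphD !rmorphM /= horner_mx_X horner_mx_C linearD /= tr_scalar_mx.
congr (_ + _); rewrite -mulmxE trmx_mul sA IH.
exact: comm_mx_horner.
Qed.

Lemma sym_spectrum n (A : 'M[R]_n.+1) : A^T = A -> exists s,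
  (forall x, x \in s -> eigenvalue A x) /\
  forall p : {poly R}, (forall x, x \in s -> p.[x] = 0) -> horner_mx A p = 0.
Proof.
move=> sA; pose toC := (real_complex R).
pose A' := map_mx toC A.
have hA' : A' \is hermsymmx.
  apply/is_hermitianmxP; rewrite expr0 scale1r.
  by apply/matrixP => i j; rewrite !mxE -[in LHS]sA mxE; apply/esym; exact: conjc_real.
have /orthomx_spectralP := hermitian_normalmx hA'.
have /mxOverP := hermitian_spectral_diag_real hA'.
have Pu := spectral_unit A'.
move: Pu; set P := spectralmx A'; set D := spectral_diag A' => Pu Dreal AE.
pose s i := complex.Re (D ord0 i).
have Ds i : D ord0 i = toC (s i).
  by rewrite /s /toC; apply/esym/RRe_real; exact: Dreal.
exists [seq s i | i <- enum 'I_n.+1]; split.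
  move=> _ /mapP[i _ ->].
  have : eigenvalue A' (D ord0 i).
    apply/eigenvalueP; exists (row i P).
      rewrite {1}AE !mulmxA -row_mul mulmxV// row1.
      rewrite -[delta_mx 0 i *m _]rowE row_diag_mx -scalemxAl -rowE.
      by congr (D _ _ *: _); exact: val_inj.
    apply/eqP => r0; have := row_free_unit P; rewrite Pu => /row_freeP[Q PQ].
    have := congr1 (row i) PQ; rewrite row_mul r0 mul0mx row1 => /matrixP/(_ 0 i).
    by rewrite !mxE !eqxx /= => /eqP; rewrite eq_sym oner_eq0.
  by rewrite Ds !eigenvalue_root_char -map_char_poly fmorph_root.
move=> p hp; apply/(map_mx_inj (f := toC)); rewrite map_mx0 map_horner_mx -/A' AE.
have -> : horner_mx (invmx P *m diag_mx D *m P) (map_poly toC p) =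
    invmx P *m horner_mx (diag_mx D) (map_poly toC p) *m P.
  elim/poly_ind: (map_poly toC p) => [|q c IH].
    by rewrite !rmorph0 mulmx0 mul0mx.
  rewrite !rmorphD !rmorphM /= !horner_mx_X !horner_mx_C IH -!mulmxE.
  rewrite mulmxDr mulmxDl; congr (_ + _).
    by rewrite !mulmxA mulmxK//.
  by rewrite scalar_mxC mulmxKV.
rewrite horner_mx_diag (_ : map_mx _ D = 0) ?linear0 ?mulmx0 ?mul0mx//.
apply/matrixP => i j; rewrite !mxE (ord1 i) Ds horner_map hp ?rmorph0//.
by apply: map_f; rewrite mem_enum.
Qed.

Lemma dot_sym d (B : 'M[R]_d) x : B^T = B -> dot ((B *m B) *m x) x = dot (B *m x) (B *m x).
Proof. by move=> sB; rewrite /dot -!mulmxA !trmx_mul sB -!mulmxA. Qed.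

Lemma dotE d (x y : 'cV[R]_d) : dot x y = \sum_i x i ord0 * y i ord0.
Proof. by rewrite /dot mxE; apply: eq_bigr => i _; rewrite mxE. Qed.

Lemma dot_ge0 d (x : 'cV[R]_d) : 0 <= dot x x.
Proof. by rewrite dotE; apply: sumr_ge0 => i _; rewrite -expr2 sqr_ge0. Qed.

(* B is a polynomial of A that interpolates the square root of p on the spectrum. *)
Lemma sym_poly_sqrt n (A : 'M[R]_n.+1) (p : {poly R}) : A^T = A ->
  (forall x, eigenvalue A x -> 0 <= p.[x]) ->
  exists B : 'M[R]_n.+1, [/\ B^T = B, forall x, 0 <= dot (B *m x) x &
    B *m B = horner_mx A p].
Proof.
move=> sA pge0; have [s [sE s0]] := sym_spectrum sA.
have [q hq] := poly_interpolation s (fun x => Num.sqrt p.[x]).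
have [r hr] := poly_interpolation s (fun x => Num.sqrt (Num.sqrt p.[x])).
have q0 : horner_mx A (q ^+ 2 - p) = 0.
  apply: s0 => x xs; rewrite !hornerE hq// sqr_sqrtr ?subrr//.
  by apply: pge0; exact: sE.
have r0 : horner_mx A (r ^+ 2 - q) = 0.
  by apply: s0 => x xs; rewrite !hornerE hr// hq// sqr_sqrtr ?subrr ?sqrtr_ge0.
have rE : horner_mx A r *m horner_mx A r = horner_mx A q.
  by apply/eqP; move/eqP: r0; rewrite rmorphB rmorphXn /= expr2 subr_eq0.
exists (horner_mx A q); split; first exact: horner_mx_sym.
  by move=> x; rewrite -rE dot_sym ?horner_mx_sym// dot_ge0.
by apply/eqP; move/eqP: q0; rewrite rmorphB rmorphXn /= expr2 subr_eq0.
Qed.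

Lemma sqrtmxP d (A : 'M[R]_d) : A^T = A -> (forall x, eigenvalue A x -> 0 <= x) ->
  [/\ (sqrtmx A)^T = sqrtmx A, forall x, 0 <= dot (sqrtmx A *m x) x &
    sqrtmx A *m sqrtmx A = A].
Proof.
move=> sA A0; rewrite /sqrtmx; case: xgetP => [B -> //|].
case: d A sA A0 => [|n] A sA A0 /(_ _) H.
  exfalso; apply: (H 0); split=> [|x|]; first by apply/matrixP => -[].
    by rewrite dotE big_ord0.
  by apply/matrixP => -[].
have [|B hB] := @sym_poly_sqrt n A 'X sA; first by move=> x /A0; rewrite hornerX.
by exfalso; apply: (H B); rewrite horner_mx_X in hB.
Qed.

Lemma rayleigh_bounds d (A : 'M[R]_d) (alpha beta : R) : A^T = A ->
  (forall x, eigenvalue A x -> alpha <= x <= beta) ->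
  forall v : 'cV[R]_d, alpha * dot v v <= dot (A *m v) v <= beta * dot v v.
Proof.
case: d A => [|n] A sA hA v.
  by rewrite !dotE !big_ord0 !mulr0 lexx.
have [|B [sB _ BE]] := @sym_poly_sqrt n A ('X - alpha%:P) sA.
  by move=> x /hA /andP[h _]; rewrite hornerXsubC subr_ge0.
have [|C [sC _ CE]] := @sym_poly_sqrt n A (beta%:P - 'X) sA.
  by move=> x /hA /andP[_ h]; rewrite !hornerE subr_ge0.
have dZ (c : R) : dot (c%:M *m v) v = c * dot v v.
  by rewrite mul_scalar_mx /dot linearZ /= -scalemxAl mxE.
have dB (M N : 'M[R]_n.+1) : dot ((M - N) *m v) v = dot (M *m v) v - dot (N *m v) v.
  by rewrite /dot mulmxBl linearB /= mulmxBl !mxE.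
have := dot_ge0 (B *m v); rewrite -dot_sym// BE rmorphB /= horner_mx_X horner_mx_C dB dZ.
have := dot_ge0 (C *m v); rewrite -dot_sym// CE rmorphB /= horner_mx_X horner_mx_C dB dZ.
by rewrite !subr_ge0 => -> ->.
Qed.

End symmetric_matrices.

(** * Quadratic forms of the coefficient *)

Section psd_forms.
Context (R : realType) (T : Type).
Implicit Types (u v w : T -> R).

Lemma discriminant_le (a b c : R) : 0 <= a -> 0 <= c ->
  (forall t, 0 <= a + 2 * t * b + t ^+ 2 * c) -> b ^+ 2 <= a * c.
Proof.
move=> a0 c0 h; have [c00|cn0] := eqVneq c 0.
  have [->|bn0] := eqVneq b 0; first by rewrite expr0n mulr_ge0.
  have := h (- (a + 1) / (2 * b)); rewrite c00.
  have -> : 2 * (- (a + 1) / (2 * b)) * b = - (a + 1) by field.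
  by lra.
have cp : 0 < c by rewrite lt_neqAle eq_sym cn0.
have := h (- b / c).
have -> : a + 2 * (- b / c) * b + (- b / c) ^+ 2 * c = (a * c - b ^+ 2) / c by field.
by rewrite pmulr_lge0 ?invr_gt0// subr_ge0.
Qed.

Context (P : set (T -> R)) (b : (T -> R) -> (T -> R) -> R).
Hypothesis Plin : forall a v w, P v -> P w -> P (fun x => a * v x + w x).
Hypothesis bl : forall a u v w, P u -> P v -> P w ->
  b (fun x => a * u x + v x) w = a * b u w + b v w.
Hypothesis bsym : forall u v, P u -> P v -> b u v = b v u.
Hypothesis bge0 : forall v, P v -> 0 <= b v v.

Lemma psd_quadratic (t : R) u v : P u -> P v ->
  b (fun x => t * v x + u x) (fun x => t * v x + u x) =
  b u u + 2 * t * b u v + t ^+ 2 * b v v.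
Proof.
move=> Pu Pv; have Pw := Plin t Pv Pu.
rewrite bl// (bsym Pv Pw) (bsym Pu Pw) !bl// (bsym Pu Pv); ring.
Qed.

Lemma psd_cauchy_schwarz u v : P u -> P v -> b u v ^+ 2 <= b u u * b v v.
Proof.
move=> Pu Pv; apply: discriminant_le; [exact: bge0..|] => t.
by rewrite -psd_quadratic//; apply: bge0; exact: Plin.
Qed.

Lemma psd_cs u v : P u -> P v -> `|b u v| <= Num.sqrt (b u u) * Num.sqrt (b v v).
Proof.
move=> Pu Pv; rewrite -sqrtrM ?bge0// -(sqrtr_sqr (b u v)) ler_wsqrtr//.
exact: psd_cauchy_schwarz.
Qed.

Lemma psd_triangle u v : P u -> P v ->
  Num.sqrt (b (fun x => u x + v x) (fun x => u x + v x)) <=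
  Num.sqrt (b u u) + Num.sqrt (b v v).
Proof.
move=> Pu Pv.
have -> : (fun x => u x + v x) = (fun x => 1 * u x + v x).
  by apply/funext => x; rewrite mul1r.
rewrite psd_quadratic// -ler_sqr ?nnegrE ?addr_ge0 ?sqrtr_ge0//.
have := ler_norm (b v u); have := psd_cs Pv Pu.
have := bge0 Pu; have := bge0 Pv.
rewrite sqr_sqrtr; last first.
  by rewrite -psd_quadratic//; apply: bge0; exact: Plin.
move=> v0 u0; rewrite sqrrD !sqr_sqrtr//; set a := Num.sqrt _ * _; set c := Num.sqrt _ * _.
have ac : a = c by exact: mulrC.
by rewrite -ac; clearbody a; move=> H1 H2; nra.
Qed.

Lemma psd_null u v : P u -> P v -> b u u = 0 -> b u v = 0.
Proof.
move=> Pu Pv u0; have := psd_cauchy_schwarz Pu Pv; rewrite u0 mul0r => h.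
by apply/eqP; rewrite -sqrf_eq0 eq_le h sqr_ge0.
Qed.

Lemma psd_addr a u v w : P u -> P v -> P w ->
  b w (fun x => a * u x + v x) = a * b w u + b w v.
Proof. by move=> Pu Pv Pw; rewrite bsym ?bl ?(bsym Pw)//; exact: Plin. Qed.

End psd_forms.

Section lower_integral.
Context (R : realType) (d : nat).
Local Notation pt := 'rV[R]_d.
Local Notation mu := (lebesgue_rV R d).

Import HBNNSimple.

(* No measurability: the integral of a nonnegative function is a supremum over
   simple functions below it, and does not see null sets. *)
Lemma ge0_integral_ae_eq (f g : pt -> R) : (forall x, 0 <= f x) -> (forall x, 0 <= g x) ->
  {ae mu, forall x, f x = g x} -> (\int[mu]_x (f x)%:E = \int[mu]_x (g x)%:E)%E.
Proof.
suff key (f' g' : pt -> R) : (forall x, 0 <= f' x) -> (forall x, 0 <= g' x) ->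
    {ae mu, forall x, f' x = g' x} -> (\int[mu]_x (f' x)%:E <= \int[mu]_x (g' x)%:E)%E.
  move=> f0 g0 fg; apply/eqP; rewrite eq_le !key//.
  by apply: filterS fg => x ->.
move=> f0 g0 [N [mN N0 hN]].
rewrite ge0_integralTE; last by move=> x; rewrite lee_fin.
apply: ge_ereal_sup => _ [h hf <-].
have mNc : measurable (~` N) by exact: measurableC.
pose k := mul_nnsfun h (indic_nnsfun R mNc).
rewrite -integralT_nnsfun.
rewrite (@ae_eq_integral _ _ _ mu setT (fun x => (k x)%:E)) //.
- rewrite integralT_nnsfun [leRHS]ge0_integralTE; last by move=> x; rewrite lee_fin.
  apply: ereal_sup_ubound; exists k => // x /=.
  rewrite lee_fin /k /= mindicE.
  have [xN|xN] := pselect (N x); first by rewrite memNset ?mulr0//; apply.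
  rewrite mem_set// mulr1.
  have -> : g' x = f' x by apply/esym; apply: contrapT => nfg; apply: xN; exact: hN.
  by rewrite -lee_fin; exact: hf.
- by apply/measurable_EFinP; exact: measurable_funP.
- by apply/measurable_EFinP; exact: measurable_funP.
- exists N; split=> // x /= nx; apply: contrapT => xN; apply: nx => _.
  by rewrite /k /= mindicE mem_set// mulr1.
Qed.

Lemma Int_ge0_ae_eq (f g : pt -> R) : (forall x, 0 <= f x) -> (forall x, 0 <= g x) ->
  {ae mu, forall x, f x = g x} -> \int[mu]_x f x = \int[mu]_x g x.
Proof. by move=> f0 g0 fg; rewrite /Rintegral (ge0_integral_ae_eq f0 g0 fg). Qed.

Lemma Linfty_bound (f : pt -> R) : f \in Lfun mu +oo%E ->
  measurable_fun setT f /\ exists M : R, {ae mu, forall x, `|f x| <= M}.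
Proof.
rewrite inE => /andP[]; rewrite !inE /= => mf; rewrite /finite_norm unlock => foo.
split=> //; move: foo; case: ifPn => [_ foo|]; last first.
  rewrite -leNgt => m0 _; exists 0.
  exists setT; split=> //; apply/eqP; rewrite eq_le m0 /=; exact: measure_ge0.
have [M hM] : exists M : R, {ae mu, forall x, (fun y => `|f y|) x <= M}.
  by apply: ess_supr_bounded; move: foo; congr (_ < _)%E.
by exists M.
Qed.
End lower_integral.

Lemma dotC (R : realType) d (x y : 'cV[R]_d) : dot x y = dot y x.
Proof. by rewrite !dotE; apply: eq_bigr => i _; rewrite mulrC. Qed.

Lemma dot_mulmx (R : realType) d (A : 'M[R]_d) (x y : 'cV[R]_d) :
  dot (A *m x) y = dot x (A^T *m y).
Proof. by rewrite /dot trmx_mul mulmxA. Qed.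

Section energy_forms.
Context (R : realType) (d : nat).
Local Notation pt := 'rV[R]_d.
Local Notation mu := (lebesgue_rV R d).
Local Notation e_ := (@basis_vector R d).
Context (Omega : set pt).
Hypothesis oO : open Omega.
Implicit Types (u v w : pt -> R) (p q : pt -> 'cV[R]_d).


Lemma H1_gradient v : H1 Omega v -> is_gradient Omega v (grad Omega v).
Proof. by move=> [_ hp]; rewrite /grad; case: xgetP => [p -> //|H]; case: hp => p /H. Qed.

Lemma gradient_ae v p : is_gradient Omega v p ->
  {ae mu, forall x, Omega x -> grad Omega v x = p x}.
Proof.
move=> gp; apply: gradient_unique (gp) => //.
by rewrite /grad; case: xgetP => [q -> //|H]; case: (H p).
Qed.

Lemma restrict_lin (D : set pt) (a : R) (f g : pt -> R) :
  (fun x => a * f x + g x) \_ D = fun x => a * (f \_ D) x + (g \_ D) x.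
Proof. by apply/funext => x; rewrite /patch; case: ifP; rewrite ?mulr0 ?addr0. Qed.

Lemma L2_lin (D : set pt) (a : R) (f g : pt -> R) : L2 D f -> L2 D g ->
  L2 D (fun x => a * f x + g x).
Proof.
by move=> /L2P hf /L2P hg; apply/L2P; rewrite restrict_lin; apply: sqi_add => //; exact: sqi_scale.
Qed.

Lemma is_gradient_lin (a : R) v w p q : L2 Omega v -> L2 Omega w ->
  is_gradient Omega v p -> is_gradient Omega w q ->
  is_gradient Omega (fun x => a * v x + w x) (fun x => a *: p x + q x).
Proof.
move=> /L2P Lv /L2P Lw [Lp hp] [Lq hq]; split=> [i|t i tt].
  have -> : (fun x => (a *: p x + q x) i ord0) = (fun x => a * p x i ord0 + q x i ord0).
    by apply/funext => x; rewrite !mxE.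
  exact: L2_lin.
have bt := bbs_sqi (test_bbs tt); have bdt := bbs_sqi (test_bbs (test_deriv i tt)).
have Lpi : sqi ((fun x => p x i ord0) \_ Omega) by apply/L2P.
have Lqi : sqi ((fun x => q x i ord0) \_ Omega) by apply/L2P.
have := hp t i tt; have := hq t i tt; rewrite !(Int_restrict_mul Omega) => Hq Hp.
have -> : (fun x => (a *: p x + q x) i ord0) = (fun x => a * p x i ord0 + q x i ord0).
  by apply/funext => x; rewrite !mxE.
rewrite !restrict_lin.
under eq_Rintegral do rewrite mulrDl -mulrA.
under [in RHS]eq_Rintegral do rewrite mulrDl -mulrA.
rewrite !IntD ?IntZ ?Hp ?Hq; first by ring.
all: try exact: sqi_mul.
all: by apply: intg_scale; exact: sqi_mul.
Qed.

Lemma H1_lin (a : R) v w : H1 Omega v -> H1 Omega w -> H1 Omega (fun x => a * v x + w x).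
Proof.
move=> hv hw; have [Lv _] := hv; have [Lw _] := hw; split; first exact: L2_lin.
exists (fun x => a *: grad Omega v x + grad Omega w x).
by apply: is_gradient_lin => //; exact: H1_gradient.
Qed.

Lemma grad_lin (a : R) v w : H1 Omega v -> H1 Omega w -> {ae mu, forall x, Omega x ->
  grad Omega (fun x => a * v x + w x) x = a *: grad Omega v x + grad Omega w x}.
Proof.
move=> hv hw; have [Lv _] := hv; have [Lw _] := hw.
by apply: gradient_ae; apply: is_gradient_lin => //; exact: H1_gradient.
Qed.

Definition gradc v (i : 'I_d) : pt -> R := (fun x => grad Omega v x i ord0) \_ Omega.

Lemma sqi_gradc v i : H1 Omega v -> sqi (gradc v i).
Proof. by move=> /H1_gradient [h _]; exact/L2P. Qed.

Record coef_bounds (A : pt -> 'M[R]_d) (alpha beta : R) : Prop := CoefBounds {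
  coef_measurable : forall i j, measurable_fun setT ((fun x => A x i j) \_ Omega);
  coef_bounded : exists M : R, {ae mu, forall x, forall i j, `|((fun x => A x i j) \_ Omega) x| <= M};
  coef_sym : {ae mu, forall x, Omega x -> (A x)^T = A x};
  coef_rayleigh : {ae mu, forall x, Omega x -> forall y,
    alpha * dot y y <= dot (A x *m y) y <= beta * dot y y} }.

Lemma coefficient_bounds A (alpha beta : R) : coefficient Omega alpha beta A ->
  coef_bounds A alpha beta.
Proof.
move=> [hL hs hE]; split=> //.
- by move=> i j; have [] := Linfty_bound (hL i j).
- have /choice[M hM] (i : 'I_d) : exists M : R,
    {ae mu, forall x, forall j, `|((fun x => A x i j) \_ Omega) x| <= M}.
    have /choice[M hM] (j : 'I_d) : exists M : R,
        {ae mu, forall x, `|((fun x => A x i j) \_ Omega) x| <= M}.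
      by have [] := Linfty_bound (hL i j).
    exists (\sum_j `|M j|).
    have : {ae mu, forall x, forall j, `|((fun x => A x i j) \_ Omega) x| <= M j} by exact: ae_ord.
    apply: filterS => x hx j; apply: le_trans (hx j) _; apply: le_trans (ler_norm _) _.
    by rewrite (bigD1 j)//= lerDl sumr_ge0.
  exists (\sum_j `|M j|).
  have : {ae mu, forall x, forall i j, `|((fun x => A x i j) \_ Omega) x| <= M i} by exact: ae_ord.
  apply: filterS => x hx i j; apply: le_trans (hx i j) _; apply: le_trans (ler_norm _) _.
  by rewrite (bigD1 i)//= lerDl sumr_ge0.
- apply: filterS2 hs hE => x h1 h2 Ox y.
  by apply: rayleigh_bounds; [exact: h1|exact: h2].
Qed.

Section coefficient.
Context (A : pt -> 'M[R]_d) (alpha beta : R).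
Hypothesis hA : coef_bounds A alpha beta.

Definition edens u v (x : pt) : R :=
  \1_Omega x * dot (A x *m grad Omega u x) (grad Omega v x).

Lemma edensE u v x : edens u v x =
  \sum_i \sum_j ((fun x => A x i j) \_ Omega) x * (gradc u j x * gradc v i x).
Proof.
rewrite /edens /gradc /patch indicE; case: (x \in Omega); last first.
  by rewrite mul0r big1// => i _; rewrite big1// => j _; rewrite mul0r.
rewrite mul1r dotE; apply: eq_bigr => i _.
by rewrite mxE mulr_suml; apply: eq_bigr => j _; rewrite mulrA.
Qed.

Lemma intg_edens u v : H1 Omega u -> H1 Omega v -> intg (edens u v).
Proof.
move=> hu hv; rewrite (_ : edens u v = fun x => \sum_i \sum_j
   ((fun x => A x i j) \_ Omega) x * (gradc u j x * gradc v i x)); last first.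
  by apply/funext => x; exact: edensE.
apply: intg_sum => i; apply: intg_sum => j.
have [M hM] := coef_bounded hA.
have iuv := sqi_mul (sqi_gradc j hu) (sqi_gradc i hv).
apply: (intg_dom (g := fun x => M * `|gradc u j x * gradc v i x|)).
- apply: measurable_funM; first exact: coef_measurable hA _ _.
  exact: intg_measurable.
- by apply: intg_scale; exact: intg_norm.
- by apply: filterS hM => x hx; rewrite normrM ler_wpM2r.
Qed.

Definition eform (D : set pt) u v : R := \int[mu]_x (\1_D x * edens u v x).

Lemma intg_indicM (D : set pt) (f : pt -> R) : measurable D -> intg f ->
  intg (fun x => \1_D x * f x).
Proof.
move=> mD intf; apply: (intg_dom_all _ (intg_norm intf)).
  by apply: measurable_funM; [exact: measurable_indic|exact: intg_measurable].
move=> x; rewrite normrM indicE; case: (_ \in _); rewrite ?normr1 ?mul1r//.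
by rewrite normr0 mul0r.
Qed.

Lemma intg_eform D u v : measurable D -> H1 Omega u -> H1 Omega v ->
  intg (fun x => \1_D x * edens u v x).
Proof. by move=> mD hu hv; apply: intg_indicM => //; exact: intg_edens. Qed.

Lemma bform_eform u v : bform Omega A u v = eform setT u v.
Proof.
rewrite /bform Rintegral_mkcond; apply: eq_Rintegral => x _.
rewrite indicT mul1r /edens /patch indicE.
by case: ifP; rewrite ?mul1r ?mul0r.
Qed.

Lemma eform_lin D (a : R) u v w : measurable D -> H1 Omega u -> H1 Omega v -> H1 Omega w ->
  eform D (fun x => a * u x + v x) w = a * eform D u w + eform D v w.
Proof.
move=> mD hu hv hw; have huv := H1_lin a hu hv.
have iu := intg_eform mD hu hw; have iv := intg_eform mD hv hw.
have E : \int[mu]_x (a * (\1_D x * edens u w x) + \1_D x * edens v w x) =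
    a * eform D u w + eform D v w.
  exact: etrans (IntD (intg_scale a iu) iv) (congr1 (fun z => z + _) (IntZ a iu)).
rewrite -E; apply: Int_ae.
- by apply: intg_measurable; exact: intg_eform.
- by apply: intg_measurable; apply: intg_add iv; exact: intg_scale.
apply: filterS (grad_lin a hu hv) => x hx.
rewrite /edens; have [Ox|xO] := pselect (Omega x); last first.
  have : (\1_Omega x : R) = 0 by rewrite indicE memNset.
  move: (\1_Omega x : R) (\1_D x : R) (dot _ _) (dot _ _) (dot _ _).
  by move=> i1 i2 d1 d2 d3 ->; ring.
have -> := hx Ox; have dl (y z t : 'cV[R]_d) : dot (A x *m (a *: y + z)) t =
    a * dot (A x *m y) t + dot (A x *m z) t.
  by rewrite mulmxDr -scalemxAr !dotE mulr_sumr -big_split; apply: eq_bigr => i _; rewrite !mxE mulrDl mulrA.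
rewrite dl; move: (\1_Omega x : R) (\1_D x : R) (dot _ _) (dot _ _).
by move=> i1 i2 d1 d2; ring.
Qed.

Lemma eform_sym D u v : measurable D -> H1 Omega u -> H1 Omega v ->
  eform D u v = eform D v u.
Proof.
move=> mD hu hv; apply: Int_ae; [by apply: intg_measurable; exact: intg_eform..|].
apply: filterS (coef_sym hA) => x hx; congr (_ * _); rewrite /edens.
rewrite indicE; case: (boolP (x \in Omega)) => [|_]; last by rewrite !mul0r.
rewrite inE => Ox; congr (_ * _).
by rewrite dot_mulmx hx// dotC.
Qed.

Lemma eform_ge0 D v : 0 < alpha -> measurable D -> H1 Omega v -> 0 <= eform D v v.
Proof.
move=> a0 mD hv; apply: Int_ge0_ae; first exact: intg_eform.
apply: filterS (coef_rayleigh hA) => x hx.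
apply: mulr_ge0; first by rewrite indicE.
rewrite /edens indicE; case: (boolP (x \in Omega)) => [|_]; last by rewrite mul0r.
rewrite inE => /hx/(_ (grad Omega v x))/andP[h _]; rewrite mul1r.
by apply: le_trans h; rewrite mulr_ge0 ?dot_ge0// ltW.
Qed.

Lemma enorm_sqr m n (M : 'M[R]_(m, n)) : enorm M ^+ 2 = \sum_i \sum_j M i j ^+ 2.
Proof.
by rewrite /enorm sqr_sqrtr//; apply: sumr_ge0 => i _; apply: sumr_ge0 => j _; exact: sqr_ge0.
Qed.

Lemma enorm_dot (y : 'cV[R]_d) : enorm y ^+ 2 = dot y y.
Proof.
by rewrite enorm_sqr dotE; apply: eq_bigr => i _; rewrite big_ord_recl big_ord0 addr0 expr2.
Qed.

Lemma enorm_ge0 m n (M : 'M[R]_(m, n)) : 0 <= enorm M.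
Proof. exact: sqrtr_ge0. Qed.

End coefficient.
End energy_forms.

Section energy_norms.
Context (R : realType) (d : nat).
Local Notation pt := 'rV[R]_d.
Local Notation mu := (lebesgue_rV R d).
Local Notation e_ := (@basis_vector R d).
Context (Omega : set pt).
Hypothesis oO : open Omega.
Implicit Types (u v w : pt -> R).

Let mO : measurable Omega := open_measurable_rV oO.

Section coefficient.
Context (A : pt -> 'M[R]_d) (alpha beta : R).
Hypothesis hA : coef_bounds Omega A alpha beta.
Hypothesis a0 : 0 < alpha.

Lemma eform_triangle D u v : measurable D -> H1 Omega u -> H1 Omega v ->
  Num.sqrt (eform Omega A D (fun x => u x + v x) (fun x => u x + v x)) <=
  Num.sqrt (eform Omega A D u u) + Num.sqrt (eform Omega A D v v).
Proof.
move=> mD hu hv.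
have Hl := fun (a : R) (f g h : pt -> R) pf pg ph => @eform_lin R d Omega oO A alpha beta hA D a f g h mD pf pg ph.
have Hs := fun (f g : pt -> R) pf pg => @eform_sym R d Omega A alpha beta hA D f g mD pf pg.
have H0 := fun (f : pt -> R) pf => @eform_ge0 R d Omega A alpha beta hA D f a0 mD pf.
have Hp := fun (a : R) (f g : pt -> R) pf pg => @H1_lin R d Omega a f g pf pg.
exact: (@psd_triangle R pt (H1 Omega) (eform Omega A D) Hp Hl Hs H0 u v hu hv).
Qed.

Lemma edens_ge0 v : {ae mu, forall x, 0 <= edens Omega A v v x}.
Proof.
apply: filterS (coef_rayleigh hA) => x hx; rewrite /edens indicE.
case: (boolP (x \in Omega)) => [|_]; last by rewrite mul0r.
rewrite inE => /hx/(_ (grad Omega v x))/andP[h _]; rewrite mul1r.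
by apply: le_trans h; rewrite mulr_ge0 ?dot_ge0// ltW.
Qed.

Lemma eform_sum (I : Type) (s : seq I) (D : I -> set pt) (E : set pt) u v :
  (forall i, measurable (D i)) -> measurable E -> H1 Omega u -> H1 Omega v ->
  {ae mu, forall x, Omega x -> (\1_E x : R) = \sum_(i <- s) \1_(D i) x} ->
  eform Omega A E u v = \sum_(i <- s) eform Omega A (D i) u v.
Proof.
move=> mD mE hu hv hE.
have iD i := intg_eform hA (mD i) hu hv.
rewrite -(Int_sum s iD); apply: Int_ae.
- by apply: intg_measurable; exact: (intg_eform hA).
- by apply: intg_measurable; exact: intg_sum.
apply: filterS hE => x hx; rewrite -mulr_suml.
have [Ox|nOx] := pselect (Omega x); first by rewrite hx.
by rewrite /edens [\1_Omega x]indicE memNset// mul0r !mulr0.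
Qed.

Lemma eform_le_sum (I : Type) (s : seq I) (D : I -> set pt) (E : set pt) v :
  (forall i, measurable (D i)) -> measurable E -> H1 Omega v ->
  {ae mu, forall x, Omega x -> E x -> (1 : R) <= \sum_(i <- s) \1_(D i) x} ->
  eform Omega A E v v <= \sum_(i <- s) eform Omega A (D i) v v.
Proof.
move=> mD mE hv hE.
have iD i := intg_eform hA (mD i) hv hv.
rewrite -(Int_sum s iD); apply: Int_le_ae.
- exact: (intg_eform hA).
- exact: intg_sum.
apply: filterS2 hE (edens_ge0 v) => x hx e0; rewrite -mulr_suml.
have [Ox|nOx] := pselect (Omega x); last first.
  by rewrite /edens [\1_Omega x]indicE memNset// mul0r !mulr0.
rewrite ler_wpM2r// indicE; have [Ex|nEx] := pselect (E x).
  by rewrite mem_set//; exact: hx.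
by rewrite memNset//; apply: sumr_ge0 => i _; rewrite indicE.
Qed.

Lemma eform_ae0 D u v : measurable D -> H1 Omega u -> H1 Omega v ->
  {ae mu, forall x, Omega x -> D x -> grad Omega u x = 0} -> eform Omega A D u v = 0.
Proof.
move=> mD hu hv h0; rewrite -[RHS](@Int0 R d); apply: Int_ae => //.
  by apply: intg_measurable; exact: (intg_eform hA).
apply: filterS h0 => x hx; rewrite /edens !indicE.
have [Ox|nOx] := pselect (Omega x); last by rewrite (memNset nOx) mul0r mulr0.
have [Dx|nDx] := pselect (D x); last by rewrite (memNset nDx) mul0r.
by rewrite hx// mulmx0 dotC /dot mulmx0 mxE !mulr0.
Qed.

Lemma nonneg_eigenvalue (M : 'M[R]_d) : M^T = M -> (forall y, 0 <= dot (M *m y) y) ->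
  forall x, eigenvalue M x -> 0 <= x.
Proof.
move=> sM M0 x /eigenvalueP[y yM yn0].
have := M0 y^T; rewrite -{1}sM -trmx_mul yM linearZ /= dotE.
under eq_bigr do rewrite mxE -mulrA.
rewrite -mulr_sumr -dotE; case: (ltP x 0) => // x0 h.
have y0 : dot y^T y^T = 0.
  by apply/eqP; rewrite eq_le dot_ge0 andbT; move: h; rewrite nmulr_rge0.
case/eqP: yn0; apply/matrixP => i j; rewrite (ord1 i) mxE.
move: y0; rewrite dotE => /eqP; rewrite psumr_eq0; last by move=> k _; rewrite -expr2 sqr_ge0.
by move=> /allP/(_ j (mem_index_enum _)) /=; rewrite !mxE mulf_eq0 orbb => /eqP.
Qed.

Lemma sqrtmx_ae : {ae mu, forall x, Omega x -> forall y,
  enorm (sqrtmx (A x) *m y) ^+ 2 = dot (A x *m y) y}.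
Proof.
apply: filterS2 (coef_sym hA) (coef_rayleigh hA) => x hs hr Ox y.
have [|sB _ BB] := @sqrtmxP R d (A x) (hs Ox).
  apply: nonneg_eigenvalue; first exact: hs.
  move=> z; have /andP[h _] := hr Ox z; apply: le_trans h.
  by rewrite mulr_ge0 ?dot_ge0// ltW.
by rewrite -[in RHS]BB dot_sym// enorm_dot.
Qed.

Lemma energy_sqr D v : measurable D -> {ae mu, forall x, D x -> Omega x} -> H1 Omega v ->
  energy Omega A D v ^+ 2 = eform Omega A D v v.
Proof.
move=> mD DO hv; rewrite /energy L2norm_sqr.
have ie := intg_eform hA mD hv hv.
transitivity (\int[mu]_x `|\1_D x * edens Omega A v v x|).
  apply: Int_ge0_ae_eq => [x|x|]; [exact: sqr_ge0|exact: normr_ge0|].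
  apply: filterS3 DO sqrtmx_ae (edens_ge0 v) => x hx hs e0.
  rewrite ger0_norm; last by rewrite mulr_ge0// indicE.
  rewrite /patch indicE; case: (boolP (x \in D)) => [|_]; last by rewrite mul0r expr0n.
  rewrite inE => Dx; rewrite hs; last exact: hx.
  by rewrite mul1r /edens indicE mem_set ?mul1r//; exact: hx.
apply: Int_ae; first by apply: intg_measurable; exact: intg_norm.
  exact: intg_measurable.
apply: filterS (edens_ge0 v) => x e0.
by rewrite ger0_norm// mulr_ge0// indicE.
Qed.

Lemma energy_eform D v : measurable D -> {ae mu, forall x, D x -> Omega x} -> H1 Omega v ->
  energy Omega A D v = Num.sqrt (eform Omega A D v v).
Proof.
move=> mD DO hv; rewrite -energy_sqr// sqrtr_sqr ger0_norm//; exact: L2norm_ge0.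
Qed.

(* wform D v is the square of || A^{1/2} v ||_{L^2(D)}: the Frobenius norm of
   A^{1/2} squares to the trace of A. *)
Definition wform D v : R := \int[mu]_x (\1_D x * (\tr (A x) * (v \_ Omega) x ^+ 2)).

Lemma trace_ae : {ae mu, forall x, Omega x -> enorm (sqrtmx (A x)) ^+ 2 = \tr (A x)}.
Proof.
apply: filterS2 (coef_sym hA) (coef_rayleigh hA) => x hs hr Ox.
have [|sB _ BB] := @sqrtmxP R d (A x) (hs Ox).
  apply: nonneg_eigenvalue; first exact: hs.
  move=> z; have /andP[h _] := hr Ox z; apply: le_trans h.
  by rewrite mulr_ge0 ?dot_ge0// ltW.
rewrite enorm_sqr -[in RHS]BB /mxtrace; apply: eq_bigr => i _.
rewrite mxE; apply: eq_bigr => j _; rewrite expr2; congr (_ * _).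
by rewrite -[in RHS]sB mxE.
Qed.

Lemma dot_delta (M : 'M[R]_d) (i : 'I_d) :
  dot (M *m delta_mx i ord0) (delta_mx i ord0) = M i i.
Proof. by rewrite -colE dotE (bigD1 i)//= !mxE !eqxx mulr1 big1 ?addr0// => j ji; rewrite !mxE (negbTE ji) mulr0. Qed.

Lemma dot_delta1 (i : 'I_d) : dot (delta_mx i ord0 : 'cV[R]_d) (delta_mx i ord0) = 1.
Proof. by rewrite -[X in dot X _]mul1mx dot_delta mxE eqxx. Qed.

Lemma trace_ge (M : 'M[R]_d) (m : R) : (0 < d)%N -> 0 <= m ->
  (forall y, m * dot y y <= dot (M *m y) y) -> m <= \tr M.
Proof.
case: d M => // n M _ m0 h; rewrite /mxtrace.
have hi i : m <= M i i.
  have := h (delta_mx i ord0); rewrite -colE !dotE (bigD1 i)//= big1 ?addr0; last first.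
    by move=> j ji; rewrite !mxE (negbTE ji) mulr0.
  rewrite (bigD1 i)//= big1 ?addr0; last first.
    by move=> j ji; rewrite !mxE (negbTE ji) mulr0.
  by rewrite !mxE !eqxx !mulr1.
rewrite big_ord_recl; apply: le_trans (hi ord0) _; rewrite lerDl; apply: sumr_ge0 => i _.
exact: le_trans m0 (hi _).
Qed.

Lemma trace_ge0 : {ae mu, forall x, Omega x -> 0 <= \tr (A x)}.
Proof. by apply: filterS trace_ae => x h Ox; rewrite -h// sqr_ge0. Qed.

Lemma intg_wform D v : measurable D -> L2 Omega v ->
  intg (fun x => \1_D x * (\tr (A x) * (v \_ Omega) x ^+ 2)).
Proof.
move=> mD /L2P[mv v2].
have mt : measurable_fun setT (fun x => \sum_i ((fun x => A x i i) \_ Omega) x).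
  by apply: measurable_sum => i; exact: coef_measurable hA _ _.
rewrite (_ : (fun _ => _) = fun x => \1_D x * ((\sum_i ((fun x => A x i i) \_ Omega) x) *
    (v \_ Omega) x ^+ 2)); last first.
  apply/funext => x; congr (_ * _); rewrite /patch; case: (x \in Omega) => //.
  by rewrite !expr0n !mulr0.
apply: intg_indicM => //.
have [M hM] := coef_bounded hA.
apply: (intg_dom (g := fun x => (d%:R * M) * (v \_ Omega) x ^+ 2)).
- by apply: measurable_funM => //; exact: measurable_funX.
- exact: intg_scale.
- apply: filterS hM => x hx; rewrite normrM [X in _ * X]ger0_norm ?sqr_ge0//.
  rewrite ler_wpM2r ?sqr_ge0//; apply: le_trans (ler_norm_sum _ _ _) _.
  apply: (@le_trans _ _ (\sum_(i < d) M)); first by apply: ler_sum.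
  by rewrite sumr_const card_ord mulr_natl.
Qed.

Lemma weighted_sqr D v : measurable D -> {ae mu, forall x, D x -> Omega x} -> L2 Omega v ->
  weighted_L2norm A D v ^+ 2 = wform D v.
Proof.
move=> mD DO hv; rewrite /weighted_L2norm L2norm_sqr /wform.
have ie := intg_wform mD hv.
transitivity (\int[mu]_x `|\1_D x * (\tr (A x) * (v \_ Omega) x ^+ 2)|).
  apply: Int_ge0_ae_eq => [x|x|]; [exact: sqr_ge0|exact: normr_ge0|].
  apply: filterS2 DO trace_ae => x hx hs.
  rewrite /patch [\1_D x]indicE; case: (boolP (x \in D)) => [|_]; last first.
    by rewrite mul0r expr0n normr0.
  rewrite inE => Dx; have Ox := hx Dx; rewrite mem_set// mul1r -hs//.
  have -> : `|enorm (sqrtmx (A x)) ^+ 2 * v x ^+ 2| = enorm (sqrtmx (A x)) ^+ 2 * v x ^+ 2.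
    by apply: ger0_norm; apply: mulr_ge0; exact: sqr_ge0.
  rewrite !enorm_sqr mulr_suml; apply: eq_bigr => i _.
  by rewrite mulr_suml; apply: eq_bigr => j _; rewrite mxE exprMn mulrC.
apply: Int_ae; first by apply: intg_measurable; exact: intg_norm.
  exact: intg_measurable.
apply: filterS trace_ge0 => x e0; rewrite ger0_norm//.
apply: mulr_ge0 => //.
rewrite /patch; case: ifPn => [|_]; last by rewrite expr0n mulr0.
by rewrite inE => /e0 h; rewrite mulr_ge0// sqr_ge0.
Qed.

Lemma wform_ge0 D v : measurable D -> {ae mu, forall x, D x -> Omega x} -> L2 Omega v -> 0 <= wform D v.
Proof. by move=> *; rewrite -weighted_sqr// sqr_ge0. Qed.

End coefficient.

Lemma identity_bounds : coef_bounds Omega (fun=> 1%:M) 1 1.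
Proof.
split.
- move=> i j; apply/(measurable_restrictT _ mO); exact: measurable_cst.
- exists 1; apply: aeW => x i j; rewrite /patch; case: ifP => _; last by rewrite normr0.
  by rewrite mxE; case: (i == j); rewrite ?normr1 ?normr0.
- by apply: aeW => x _; rewrite trmx1.
- by apply: aeW => x _ y; rewrite mul1mx mul1r lexx.
Qed.

Lemma gradnorm_sqr v : gradnorm Omega v ^+ 2 = eform Omega (fun=> 1%:M) setT v v.
Proof.
rewrite /gradnorm L2norm_sqr; apply: eq_Rintegral => x _.
rewrite indicT mul1r /edens /patch indicE; case: (x \in Omega).
  by rewrite mul1mx mul1r enorm_dot.
by rewrite mul0r expr0n.
Qed.

Lemma gradnorm_ge0 v : 0 <= gradnorm Omega v.
Proof. exact: L2norm_ge0. Qed.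

Lemma gradnorm_eform v : gradnorm Omega v = Num.sqrt (eform Omega (fun=> 1%:M) setT v v).
Proof. by rewrite -gradnorm_sqr sqrtr_sqr ger0_norm// gradnorm_ge0. Qed.

Lemma gradnorm_gradc v i : H1 Omega v -> nrm2 (gradc Omega v i) <= gradnorm Omega v.
Proof.
move=> hv; rewrite gradnorm_eform; rewrite ler_wsqrtr//.
have [_ h2] := sqi_gradc i hv.
apply: Int_le => // [|x]; first exact: (intg_eform identity_bounds).
rewrite indicT mul1r /edens /gradc /patch indicE; case: (x \in Omega).
  rewrite mul1mx mul1r dotE (bigD1 i)//= -expr2 lerDl; apply: sumr_ge0 => j _.
  by rewrite -expr2 sqr_ge0.
by rewrite mul0r expr0n.
Qed.

Lemma eform_gradnorm A (alpha beta : R) v : coef_bounds Omega A alpha beta -> H1 Omega v ->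
  alpha * gradnorm Omega v ^+ 2 <= eform Omega A setT v v <= beta * gradnorm Omega v ^+ 2.
Proof.
move=> hA hv; rewrite gradnorm_sqr.
have i1 := intg_eform identity_bounds measurableT hv hv.
have iA := intg_eform hA measurableT hv hv.
rewrite /eform -!IntZ//; apply/andP; split; apply: Int_le_ae => //;
  try exact: intg_scale; apply: filterS (coef_rayleigh hA) => x hx;
  rewrite !indicT !mul1r /edens indicE; have [Ox|nOx] := pselect (Omega x);
  rewrite ?(memNset nOx) ?mul0r ?mulr0// mem_set// !mul1r mul1mx;
  by have /andP[] := hx Ox (grad Omega v x).
Qed.

Definition h1form u v : R := \int[mu]_x ((u \_ Omega) x * (v \_ Omega) x) +
  eform Omega (fun=> 1%:M) setT u v.

Lemma H1norm_h1form v : H1norm Omega v = Num.sqrt (h1form v v).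
Proof. by rewrite /H1norm gradnorm_sqr L2norm_sqr. Qed.

Lemma h1form_lin a u v w : H1 Omega u -> H1 Omega v -> H1 Omega w ->
  h1form (fun x => a * u x + v x) w = a * h1form u w + h1form v w.
Proof.
move=> hu hv hw; rewrite /h1form (eform_lin oO identity_bounds)//.
have [/L2P su _] := hu; have [/L2P sv _] := hv; have [/L2P sw _] := hw.
rewrite restrict_lin.
have E : \int[mu]_x (a * ((u \_ Omega) x * (w \_ Omega) x) + (v \_ Omega) x * (w \_ Omega) x) =
    a * \int[mu]_x ((u \_ Omega) x * (w \_ Omega) x) + \int[mu]_x ((v \_ Omega) x * (w \_ Omega) x).
  exact: etrans (IntD (intg_scale a (sqi_mul su sw)) (sqi_mul sv sw))
    (congr1 (fun z => z + _) (IntZ a (sqi_mul su sw))).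
rewrite mulrDr addrACA -E; congr (_ + _); apply: eq_Rintegral => x _.
by rewrite mulrDl mulrA.
Qed.

Lemma h1form_sym u v : H1 Omega u -> H1 Omega v -> h1form u v = h1form v u.
Proof.
move=> hu hv; rewrite /h1form (eform_sym identity_bounds)//; congr (_ + _).
by apply: eq_Rintegral => x _; rewrite mulrC.
Qed.

Lemma gradnorm_triangle u v : H1 Omega u -> H1 Omega v ->
  gradnorm Omega (fun x => u x + v x) <= gradnorm Omega u + gradnorm Omega v.
Proof.
by move=> hu hv; rewrite !gradnorm_eform; exact: (eform_triangle identity_bounds).
Qed.

Lemma test_H1 w : test_function Omega w -> H1 Omega w.
Proof.
move=> tw; split; last by eexists; exact: test_gradient.
apply/L2P; have bw := bbs_sqi (test_bbs tw).
rewrite (_ : w \_ Omega = w)//; apply/funext => x; rewrite /patch.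
by case: ifPn => //; rewrite notin_setE => nO; rewrite (test_out tw nO).
Qed.

Lemma H1_0 : H1 Omega (fun=> 0).
Proof. by apply: test_H1; exact: test0. Qed.

Lemma H1_scale a u : H1 Omega u -> H1 Omega (fun x => a * u x).
Proof.
move=> hu; have := H1_lin a hu H1_0; congr H1; apply/funext => x.
by rewrite addr0.
Qed.

Lemma H1norm_scale a u : H1 Omega u -> H1norm Omega (fun x => a * u x) = `|a| * H1norm Omega u.
Proof.
move=> hu; rewrite !H1norm_h1form -sqrtr_sqr -sqrtrM ?sqr_ge0//; congr Num.sqrt.
have l (f : pt -> R) w : H1 Omega f -> H1 Omega w -> h1form (fun x => a * f x) w = a * h1form f w.
  move=> hf hw; have -> : (fun x => a * f x) = (fun x => (a - 1) * f x + f x).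
    by apply/funext => x; ring.
  by rewrite h1form_lin//; ring.
have hau := H1_scale a hu.
rewrite (l _ _ hu hau) (h1form_sym hu hau) (l _ _ hu hu).
by move: (h1form u u) => t; ring.
Qed.

End energy_norms.

(** * Friedrichs' inequality and the dual norm *)

Section friedrichs.
Context (R : realType) (d : nat).
Local Notation pt := 'rV[R]_d.
Local Notation mu := (lebesgue_rV R d).
Local Notation e_ := (@basis_vector R d).

Lemma smooth_coord (j : 'I_d) : smooth (fun x : pt => x ord0 j).
Proof.
pose P (h : pt -> R) := exists a c, h = fun x => a * x ord0 j + c.
apply: (@smooth_closed R d P); last first.
- by exists 1, 0; apply/funext => x; rewrite mul1r addr0.
- move=> h [a [c ->]] i; exists (fun=> a * (j == i)%:R).
    by exists 0, (a * (j == i)%:R); apply/funext => x; rewrite mul0r add0r.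
  move=> x; apply: is_derive_line.
  rewrite (_ : (fun _ => _) = (fun h : R => a * (j == i)%:R * h + (a * x ord0 j + c))); last first.
    by apply/funext => r /=; rewrite !mxE; ring.
  have := is_deriveD' (is_deriveZ' (a * (j == i)%:R) (is_derive_id (0 : R) 1))
    (is_derive_cst (a * x ord0 j + c) (0 : R) (1 : R)).
  by rewrite addr0 mulr1.
- move=> h [a [c ->]]; apply: continuous_add; last by move=> x; exact: cst_continuous.
  by apply: continuous_mul; [move=> x; exact: cst_continuous|exact: coord_continuous'].
Qed.

Context (Omega : set pt) (n : R).
Hypotheses (oO : open Omega) (d0 : (0 < d)%N) (n0 : 0 <= n) (On : Omega `<=` cube 0 n).

Lemma test_friedrichs w : test_function Omega w ->
  L2norm Omega w <= 2 * n * gradnorm Omega w.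
Proof.
move=> tw; pose i := Ordinal d0.
have [sw [K [cK KO wK]]] := tw.
have tf : test_function Omega (fun x : pt => x ord0 i * w x).
  split; first exact: smoothM (smooth_coord i) sw.
  by exists K; split=> // x /wK ->; rewrite mulr0.
have [L1 l1] := test_lip i tw; have [L2 l2] := test_lip i tf.
have wk f L L' : L <= L' -> lip1 (e_ i) f L -> lip1 (e_ i) f L'.
  by move=> LL' lf x h; apply: le_trans (lf x h) _; rewrite ler_wpM2r.
have dw x := @smooth_is_derive R d w i x sw.
have df (x : pt) : is_derive x (e_ i) (fun x : pt => x ord0 i * w x)
    (x ord0 i * 'D_(e_ i) w x + w x * 1).
  apply: is_deriveM' => //.
  have := @smooth_is_derive R d _ i x (smooth_coord i).
  suff -> : 'D_(e_ i) (fun x : pt => x ord0 i) x = 1 by [].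
  apply: derive_val; apply: is_derive_line.
  rewrite (_ : (fun _ => _) = (fun h : R => h + x ord0 i)); last first.
    by apply/funext => r /=; rewrite !mxE !eqxx mulr1.
  have := is_deriveD' (is_derive_id (0 : R) 1) (is_derive_cst (x ord0 i) (0 : R) (1 : R)).
  by rewrite addr0.
have bw := test_bbs tw; have bf := test_bbs tf; have bdw := test_bbs (test_deriv i tw).
have sqw := bbs_sqi bw; have sqf := bbs_sqi bf; have sqd := bbs_sqi bdw.
have iww := sqi_mul sqw sqw; have ifd := sqi_mul sqf sqd.
have E : \int[mu]_x (w x * w x) = - 2 * \int[mu]_x ((x : pt) ord0 i * w x * 'D_(e_ i) w x).
  have mdf : measurable_fun setT (fun x : pt => x ord0 i * 'D_(e_ i) w x + w x * 1).
    apply: measurable_funD; first by apply: measurable_funM; [exact: measurable_coord|case: bdw].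
    by apply: measurable_funM; [case: bw|exact: measurable_cst].
  have := Int_by_parts (e := e_ i) (L := Num.max L1 L2) bf bw mdf (proj1 bdw) (wk _ _ _ _ l2) (wk _ _ _ _ l1)
    (aeW _ df) (aeW _ dw).
  rewrite !le_max !lexx orbT => /(_ isT isT).
  have -> : \int[mu]_x ((x ord0 i * 'D_(e_ i) w x + w x * 1) * w x) =
      \int[mu]_x ((x : pt) ord0 i * w x * 'D_(e_ i) w x) + \int[mu]_x (w x * w x).
    by rewrite -IntD//; apply: eq_Rintegral => x _; ring.
  by move: (\int[mu]_x _) (\int[mu]_x _) => p q; lra.
have Lw : L2norm Omega w = nrm2 w.
  rewrite L2normE; congr nrm2; apply/funext => x; rewrite /patch.
  by case: ifPn => //; rewrite notin_setE => nO; rewrite (test_out tw nO).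
have Dw : nrm2 ('D_(e_ i) w) <= gradnorm Omega w.
  have hw := test_H1 oO tw.
  apply: le_trans (gradnorm_gradc oO i hw).
  apply: nrm2_le_ae => //; first exact: sqi_gradc.
  have := gradient_ae oO (test_gradient tw (open_measurable_rV oO)).
  apply: filterS => x hx; rewrite /gradc /patch; case: ifPn => xO.
    by rewrite hx ?mxE//; move: xO; rewrite inE.
  by move: xO; rewrite notin_setE => nO; rewrite (test_deriv_out i tw nO) normr0.
have W2 : nrm2 w ^+ 2 <= 2 * n * nrm2 w * nrm2 ('D_(e_ i) w).
  rewrite nrm2_sqr.
  have -> : \int[mu]_x (w x ^+ 2) = \int[mu]_x (w x * w x).
    by apply: eq_Rintegral => x _; rewrite expr2.
  rewrite E; apply: le_trans (ler_norm _) _; rewrite normrM normrN (ger0_norm (ler0n R 2)).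
  rewrite -!mulrA ler_wpM2l//; apply: le_trans (nrm2_cs sqf sqd) _.
  rewrite mulrA ler_wpM2r ?nrm2_ge0//.
  have <- : nrm2 (fun x => n * w x) = n * nrm2 w by rewrite nrm2Z// ger0_norm.
  apply: nrm2_le_ae => //; first exact: sqi_scale.
  apply: aeW => x; rewrite !normrM (ger0_norm n0).
  have [->|wn0] := eqVneq (w x) 0; first by rewrite normr0 !mulr0.
  rewrite ler_wpM2r//.
  have /On/(_ i) : Omega x by apply: contrapT => nO; move: wn0; rewrite (test_out tw nO) eqxx.
  by rewrite mxE sub0r normrN => /ltW.
rewrite Lw; have [->|wn0] := eqVneq (nrm2 w) 0.
  by rewrite !mulr_ge0// gradnorm_ge0.
have wp : 0 < nrm2 w by rewrite lt_neqAle eq_sym wn0 nrm2_ge0.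
have : nrm2 w * nrm2 w <= nrm2 w * (2 * n * gradnorm Omega w).
  rewrite -expr2; apply: le_trans W2 _.
  have -> : 2 * n * nrm2 w * nrm2 ('D_(e_ i) w) = nrm2 w * (2 * n * nrm2 ('D_(e_ i) w)).
    by move: (nrm2 _) (nrm2 _) => y z; ring.
  by apply: ler_wpM2l; [exact: nrm2_ge0|apply: ler_wpM2l => //; rewrite mulr_ge0].
by rewrite ler_pM2l.
Qed.

Lemma L2norm_H1norm v : L2norm Omega v <= H1norm Omega v.
Proof.
rewrite /H1norm -[leLHS]ger0_norm ?L2norm_ge0// -sqrtr_sqr ler_wsqrtr//.
by rewrite lerDl sqr_ge0.
Qed.

Lemma gradnorm_H1norm v : gradnorm Omega v <= H1norm Omega v.
Proof.
rewrite /H1norm -[leLHS]ger0_norm ?gradnorm_ge0// -sqrtr_sqr ler_wsqrtr//.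
by rewrite lerDr sqr_ge0.
Qed.

Lemma L2norm_triangle (D : set pt) v w : L2 D v -> L2 D w ->
  L2norm D (fun x => v x + w x) <= L2norm D v + L2norm D w.
Proof.
move=> /L2P hv /L2P hw; rewrite !L2normE.
have -> : (fun x => v x + w x) \_ D = fun x => (v \_ D) x + (w \_ D) x.
  by apply/funext => x; rewrite /patch; case: ifP; rewrite ?addr0.
exact: nrm2_triangle.
Qed.

Lemma friedrichs v : H10 Omega v -> L2norm Omega v <= 2 * n * gradnorm Omega v.
Proof.
move=> [hv av]; apply/ler_addgt0Pl => e e0.
pose r := e / (2 * n * 1 + 1).
have p0 : 0 < 2 * n * 1 + 1 by rewrite ltr_wpDl// !mulr_ge0.
have r0 : 0 < r by rewrite divr_gt0.
have [w [tw hw]] := av r r0; have h1w := test_H1 oO tw.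
have h1d : H1 Omega (v \- w).
  have := H1_lin (-1) h1w hv; congr H1; apply/funext => x /=; ring.
have h1m : H1 Omega (fun x => -1 * (v \- w) x) by exact: H1_scale.
have E1 : v = (fun x => (v \- w) x + w x) by apply/funext => x /=; ring.
have E2 : w = (fun x => -1 * (v \- w) x + v x) by apply/funext => x /=; ring.
have a1 : L2norm Omega v <= L2norm Omega (v \- w) + L2norm Omega w.
  by rewrite {1}E1; apply: L2norm_triangle; [case: h1d|case: h1w].
have a2 : gradnorm Omega w <= H1norm Omega (v \- w) + gradnorm Omega v.
  rewrite {1}E2; apply: le_trans (gradnorm_triangle oO h1m hv) _.
  rewrite lerD2r; apply: le_trans (gradnorm_H1norm _) _.
  by rewrite H1norm_scale// normrN normr1 mul1r.
have a3 := test_friedrichs tw; have a4 := L2norm_H1norm (v \- w).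
have er : e = (2 * n * 1 + 1) * r by rewrite /r mulrC divfK// gt_eqF.
move: hw a1 a2 a3 a4; rewrite er.
move: (L2norm Omega v) (L2norm Omega w) (L2norm Omega (v \- w)) (H1norm Omega (v \- w))
  (gradnorm Omega w) (gradnorm Omega v).
move=> x1 x2 x3 x4 x5 x6 h1 h2 h3 h4 h5.
have h6 : 2 * n * x5 <= 2 * n * (x4 + x6) by rewrite ler_wpM2l// mulr_ge0.
have h7 : 2 * n * x4 <= 2 * n * r by rewrite ler_wpM2l ?mulr_ge0// ltW.
rewrite mulr1; lra.
Qed.

Lemma Int_L2 (g v : pt -> R) : L2 Omega g -> L2 Omega v ->
  `|\int[mu]_(x in Omega) (g x * v x)| <= L2norm Omega g * L2norm Omega v.
Proof.
move=> /L2P hg /L2P hv; rewrite Int_restrict_mul !L2normE.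
have -> : \int[mu]_x ((g \_ Omega) x * v x) = \int[mu]_x ((g \_ Omega) x * (v \_ Omega) x).
  by apply: eq_Rintegral => x _; rewrite /patch; case: ifP; rewrite ?mul0r.
exact: nrm2_cs.
Qed.

Lemma Hm1norm_has_ubound (g : pt -> R) : L2 Omega g ->
  ubound [set `|\int[mu]_(x in Omega) (g x * v x)| / gradnorm Omega v |
       v in [set v | H10 Omega v /\ gradnorm Omega v != 0]] (2 * n * L2norm Omega g).
Proof.
move=> hg _ [v [hv vn0] <-].
have vp : 0 < gradnorm Omega v by rewrite lt_neqAle eq_sym vn0 gradnorm_ge0.
rewrite ler_pdivrMr//; have [[Lv _] _] := hv.
apply: le_trans (Int_L2 hg Lv) _; rewrite [leRHS]mulrAC [leRHS]mulrC.
by rewrite ler_wpM2l ?L2norm_ge0//; exact: friedrichs.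
Qed.

Lemma Hm1norm_bound (g v : pt -> R) : L2 Omega g -> H10 Omega v ->
  `|\int[mu]_(x in Omega) (g x * v x)| <= Hm1norm Omega g * gradnorm Omega v.
Proof.
move=> hg hv; have [v0|vn0] := eqVneq (gradnorm Omega v) 0.
  have [[Lv _] _] := hv; apply: le_trans (Int_L2 hg Lv) _.
  have := friedrichs hv; rewrite v0 !mulr0 => h.
  have -> : L2norm Omega v = 0 by apply/eqP; rewrite eq_le h L2norm_ge0.
  by rewrite mulr0.
have vp : 0 < gradnorm Omega v by rewrite lt_neqAle eq_sym vn0 gradnorm_ge0.
rewrite -ler_pdivrMr//; apply: ub_le_sup; last by exists v.
by exists (2 * n * L2norm Omega g); exact: Hm1norm_has_ubound.
Qed.

Lemma Hm1norm_le (g : pt -> R) : L2 Omega g -> Hm1norm Omega g <= 2 * n * L2norm Omega g.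
Proof.
move=> hg; rewrite /Hm1norm; set E := [set _ | _ in _].
have [->|/set0P En0] := eqVneq E set0.
  by rewrite sup0 !mulr_ge0// L2norm_ge0.
by apply: ge_sup => //; exact: Hm1norm_has_ubound.
Qed.

Lemma Hm1norm_ge0 (g : pt -> R) : L2 Omega g -> 0 <= Hm1norm Omega g.
Proof.
move=> hg; rewrite /Hm1norm; set E := [set _ | _ in _].
have [->|/set0P En0] := eqVneq E set0; first by rewrite sup0.
case: (En0) => y [v vv yE].
apply: (@le_trans _ _ (`|\int[mu]_(x in Omega) (g x * v x)| / gradnorm Omega v)).
  by rewrite divr_ge0// gradnorm_ge0.
apply: ub_le_sup; last by exists v.
by exists (2 * n * L2norm Omega g); exact: Hm1norm_has_ubound.
Qed.

End friedrichs.

(** * Simplices and barycentric coordinates *)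

Section euclidean_norm.
Context (R : realType) (d : nat).
Local Notation pt := 'rV[R]_d.

Lemma enorm_tr m n (M : 'M[R]_(m, n)) : enorm M^T = enorm M.
Proof.
rewrite /enorm exchange_big; congr Num.sqrt; apply: eq_bigr => i _.
by apply: eq_bigr => j _; rewrite mxE.
Qed.

Lemma enormZ m n (c : R) (M : 'M[R]_(m, n)) : enorm (c *: M) = `|c| * enorm M.
Proof.
rewrite -[LHS]ger0_norm ?enorm_ge0// -sqrtr_sqr -[RHS]ger0_norm ?mulr_ge0 ?enorm_ge0//.
rewrite -[in RHS]sqrtr_sqr exprMn real_normK ?num_real//; congr Num.sqrt.
rewrite !enorm_sqr mulr_sumr; apply: eq_bigr => i _; rewrite mulr_sumr.
by apply: eq_bigr => j _; rewrite mxE exprMn.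
Qed.

Lemma enorm_eq0 (a : 'cV[R]_d) : enorm a = 0 -> a = 0.
Proof.
move=> a0; have : enorm a ^+ 2 = 0 by rewrite a0 expr0n.
rewrite enorm_dot dotE => /eqP; rewrite psumr_eq0; last by move=> k _; rewrite -expr2 sqr_ge0.
move=> /allP h; apply/colP => i; rewrite mxE.
by have := h i (mem_index_enum _); rewrite /= mulf_eq0 orbb => /eqP.
Qed.

Lemma dotDl (x y z : 'cV[R]_d) : dot (x + y) z = dot x z + dot y z.
Proof. by rewrite !dotE -big_split; apply: eq_bigr => i _; rewrite mxE mulrDl. Qed.

Lemma dotZl (c : R) (x z : 'cV[R]_d) : dot (c *: x) z = c * dot x z.
Proof. by rewrite !dotE mulr_sumr; apply: eq_bigr => i _; rewrite mxE mulrA. Qed.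

Lemma dotDr (x y z : 'cV[R]_d) : dot z (x + y) = dot z x + dot z y.
Proof. by rewrite dotC dotDl !(dotC z). Qed.

Lemma dotZr (c : R) (x z : 'cV[R]_d) : dot z (c *: x) = c * dot z x.
Proof. by rewrite dotC dotZl (dotC z). Qed.

Lemma dot_cs (x y : 'cV[R]_d) : `|dot x y| <= enorm x * enorm y.
Proof.
rewrite -[leRHS]ger0_norm ?mulr_ge0 ?enorm_ge0// -!sqrtr_sqr ler_wsqrtr//.
rewrite exprMn !enorm_dot; apply: discriminant_le; rewrite ?dot_ge0// => t.
have := dot_ge0 (x + t *: y); rewrite !(dotDl, dotDr, dotZl, dotZr) (dotC y x).
by congr (_ <= _); ring.
Qed.

Lemma enorm_triangle (x y : 'cV[R]_d) : enorm (x + y) <= enorm x + enorm y.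
Proof.
rewrite -[leRHS]ger0_norm ?addr_ge0 ?enorm_ge0// -[leLHS]ger0_norm ?enorm_ge0//.
rewrite -!sqrtr_sqr ler_wsqrtr// enorm_dot !(dotDl, dotDr) (dotC y x).
rewrite sqrrD !enorm_dot -!enorm_dot; have := dot_cs x y; have := ler_norm (dot x y).
by move=> h1 h2; rewrite mulr2n; lra.
Qed.

Lemma enorm_sum (I : eqType) (s : seq I) (F : I -> 'cV[R]_d) :
  enorm (\sum_(i <- s) F i) <= \sum_(i <- s) enorm (F i).
Proof.
elim: s => [|i s IH]; last first.
  by rewrite !big_cons; apply: le_trans (enorm_triangle _ _) _; rewrite lerD2l.
rewrite !big_nil -[leLHS]ger0_norm ?enorm_ge0// -sqrtr_sqr enorm_dot.
by rewrite dotE big1 ?sqrtr0// => j _; rewrite mxE mul0r.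
Qed.

Lemma dotrow_dot (x : pt) (a : 'cV[R]_d) : (x *m a) ord0 ord0 = dot x^T a.
Proof. by rewrite /dot trmxK. Qed.

Lemma dotrow_cs (x : pt) (a : 'cV[R]_d) : `|(x *m a) ord0 ord0| <= enorm x * enorm a.
Proof. by rewrite dotrow_dot -(enorm_tr x); exact: dot_cs. Qed.

Lemma coord_enorm (x : pt) i : `|x ord0 i| <= enorm x.
Proof.
rewrite -[leRHS]ger0_norm ?enorm_ge0// -!sqrtr_sqr ler_wsqrtr// enorm_sqr.
rewrite big_ord_recl big_ord0 addr0 (bigD1 i)//= lerDl.
by apply: sumr_ge0 => j _; exact: sqr_ge0.
Qed.

Lemma enorm_coord (x : pt) (m : R) : (forall i, `|x ord0 i| <= m) -> enorm x <= d%:R * m.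
Proof.
move=> h; have -> : x = \sum_i x ord0 i *: delta_mx ord0 i.
  by rewrite [LHS]row_sum_delta.
rewrite -enorm_tr linear_sum; apply: le_trans (enorm_sum _ _) _.
apply: (@le_trans _ _ (\sum_(i < d) m)); last by rewrite sumr_const card_ord mulr_natl.
apply: ler_sum => i _; rewrite linearZ /= enormZ trmx_delta.
have -> : enorm (delta_mx i ord0 : 'cV[R]_d) = 1.
  by rewrite -[LHS]ger0_norm ?enorm_ge0// -sqrtr_sqr enorm_dot dot_delta1 sqrtr1.
by rewrite mulr1.
Qed.

End euclidean_norm.

Section affine_functions.
Context (R : realType) (d : nat).
Local Notation pt := 'rV[R]_d.

Definition aff (a : 'cV[R]_d) (b : R) (x : pt) : R := (x *m a) ord0 ord0 + b.

Lemma aff_sum (a : 'cV[R]_d) b (I : Type) (s : seq I) (w : I -> R) (F : I -> pt) :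
  \sum_(i <- s) w i = 1 -> aff a b (\sum_(i <- s) w i *: F i) = \sum_(i <- s) w i * aff a b (F i).
Proof.
move=> w1; rewrite /aff mulmx_suml summxE -[X in _ + X]mul1r -w1 mulr_suml -big_split.
by apply: eq_bigr => i _; rewrite -scalemxAl mxE mulrDr.
Qed.

Lemma affB a b (x y : pt) : aff a b x - aff a b y = ((x - y) *m a) ord0 ord0.
Proof. by rewrite /aff mulmxBl !mxE; ring. Qed.

Lemma aff_lip a b (x y : pt) : `|aff a b x - aff a b y| <= enorm a * enorm (x - y).
Proof. by rewrite affB mulrC; exact: dotrow_cs. Qed.

Lemma aff_inj (a a' : 'cV[R]_d) (b b' : R) : (forall x, aff a b x = aff a' b' x) -> a = a' /\ b = b'.
Proof.
move=> h; have b0 : b = b' by have := h 0; rewrite /aff !mul0mx !mxE !add0r.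
split=> //; apply/colP => i; have := h (delta_mx ord0 i); rewrite /aff b0 => /addIr.
by rewrite -!rowE !mxE.
Qed.

Lemma continuous_aff a b : continuous (aff a b : pt -> R).
Proof.
apply: continuous_add; last by move=> x; exact: cst_continuous.
have -> : (fun x : pt => (x *m a) ord0 ord0) = fun x => \sum_i x ord0 i * a i ord0.
  by apply/funext => x; rewrite dotrowE.
elim: (index_enum _) => [|i s IH].
  by under [X in continuous X]eq_fun do rewrite big_nil; exact: cst_continuous.
under [X in continuous X]eq_fun do rewrite big_cons.
apply: continuous_add => //; apply: continuous_mul; first exact: coord_continuous'.
by move=> x; exact: cst_continuous.
Qed.

Lemma open_aff_gt a b (c : R) : open [set x : pt | c < aff a b x].
Proof.
have -> : [set x : pt | c < aff a b x] = aff a b @^-1` [set t | c < t] by [].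
by apply: open_comp => [x _|]; [exact: continuous_aff|exact: open_gt].
Qed.

Lemma closed_aff_ge a b (c : R) : closed [set x : pt | c <= aff a b x].
Proof.
have -> : [set x : pt | c <= aff a b x] = aff a b @^-1` [set t | c <= t] by [].
by apply: closed_comp => [x _|]; [exact: continuous_aff|exact: closed_ge].
Qed.

End affine_functions.

Section simplices.
Context (R : realType) (d : nat).
Local Notation pt := 'rV[R]_d.
Implicit Types (S : {fset pt}) (p q : pt).

Lemma barycentric S : simplex S -> exists ab : (pt -> 'cV[R]_d) * (pt -> R),
  [/\ forall p q, p \in S -> q \in S -> aff (ab.1 p) (ab.2 p) q = (p == q)%:R,
      forall x, \sum_(p <- S) aff (ab.1 p) (ab.2 p) x = 1 &
      forall x, \sum_(p <- S) aff (ab.1 p) (ab.2 p) x *: p = x].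
Proof.
move=> [card_S indS].
have sz : size S = (d + 1)%N by rewrite addn1.
pose t (i : 'I_(d + 1)) : pt := nth 0 S i.
have bigS (V : nmodType) (F : pt -> V) : \sum_(p <- S) F p = \sum_i F (t i).
  by rewrite (big_nth 0) sz big_mkord.
pose M : 'M[R]_(d + 1) := \matrix_(i, j) row_mx (t i) (1%:M : 'M[R]_1) ord0 j.
pose k p : 'I_(d + 1) := insubd (rshift d ord0) (index p S).
have kt i : k (t i) = i.
  apply: val_inj; rewrite /k /t index_uniq ?sz//; last exact: fset_uniq.
  by rewrite insubdK// unfold_in /= ltn_ord.
have tk p : p \in S -> t (k p) = p.
  move=> pS; rewrite /t /k insubdK ?nth_index//.
  by rewrite unfold_in /= -sz index_mem.
have uM : M \in unitmx.
  rewrite -row_free_unit; apply: inj_row_free => v vM.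
  have h := indS (fun p => v ord0 (k p)).
  apply/rowP => i; rewrite mxE -(kt i); apply: h.
  - rewrite bigS; have := congr1 (fun N : 'rV_(d + 1) => N ord0 (rshift d ord0)) vM.
    rewrite !mxE => vM0; rewrite -[RHS]vM0; apply: eq_bigr => j _.
    by rewrite kt [M _ _]mxE row_mxEr mxE mulr1.
  - apply/rowP => c; have := congr1 (fun N : 'rV_(d + 1) => N ord0 (lshift 1 c)) vM.
    rewrite !mxE => vM0; rewrite -[RHS]vM0 bigS summxE; apply: eq_bigr => j _.
    by rewrite kt [M _ _]mxE row_mxEl mxE.
  - by rewrite /t mem_nth// sz.
pose N := invmx M.
exists (fun p => \col_j N (lshift 1 j) (k p), fun p => N (rshift d ord0) (k p)) => /=.
have E x p : aff (\col_j N (lshift 1 j) (k p)) (N (rshift d ord0) (k p)) x =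
    (row_mx x 1%:M *m N) ord0 (k p).
  rewrite [RHS]mxE big_split_ord /= big_ord_recl big_ord0 addr0 /aff dotrowE.
  congr (_ + _); last by rewrite row_mxEr mxE mul1r; congr (N _ _); exact: val_inj.
  by apply: eq_bigr => j _; rewrite row_mxEl mxE.
have NM x : row_mx x 1%:M *m N *m M = row_mx x (1%:M : 'M[R]_1).
  by rewrite -mulmxA mulVmx// mulmx1.
split=> [p q pS qS|x|x].
- have -> : aff (\col_j N (lshift 1 j) (k p)) (N (rshift d ord0) (k p)) q =
      (row_mx q 1%:M *m N) ord0 (k p) by exact: E.
  have -> : row_mx q 1%:M = row (k q) M.
    by apply/rowP => j; rewrite !mxE tk.
  rewrite -row_mul mulmxV// [row _ _ _ _]mxE [1%:M _ _]mxE.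
  suff -> : (k q == k p) = (p == q) by [].
  apply/eqP/eqP => [kpq|->//].
  by rewrite -(tk p pS) -(tk q qS) kpq.
- rewrite bigS; have := congr1 (fun z : 'rV_(d + 1) => z ord0 (rshift d ord0)) (NM x).
  rewrite row_mxEr [RHS]mxE => NMx; rewrite -[RHS]NMx mxE; apply: eq_bigr => i _.
  by rewrite E kt [M _ _]mxE row_mxEr [1%:M _ _]mxE eqxx mulr1.
- rewrite bigS; apply/rowP => c.
  have := congr1 (fun z : 'rV_(d + 1) => z ord0 (lshift 1 c)) (NM x).
  rewrite row_mxEl => NMx; rewrite -[RHS]NMx mxE summxE; apply: eq_bigr => i _.
  by rewrite E kt [M _ _]mxE row_mxEl [LHS]mxE.
Qed.

Definition bary_data S : (pt -> 'cV[R]_d) * (pt -> R) :=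
  xget (fun=> 0, fun=> 0) [set ab | [/\ forall p q, p \in S -> q \in S ->
      aff (ab.1 p) (ab.2 p) q = (p == q)%:R,
      forall x, \sum_(p <- S) aff (ab.1 p) (ab.2 p) x = 1 &
      forall x, \sum_(p <- S) aff (ab.1 p) (ab.2 p) x *: p = x]].

Definition bslope S p := (bary_data S).1 p.
Definition bary S p (x : pt) : R := aff (bslope S p) ((bary_data S).2 p) x.

Lemma baryP S : simplex S ->
  [/\ forall p q, p \in S -> q \in S -> bary S p q = (p == q)%:R,
      forall x, \sum_(p <- S) bary S p x = 1 &
      forall x, \sum_(p <- S) bary S p x *: p = x].
Proof.
move=> sS; rewrite /bary /bslope /bary_data; case: xgetP => [ab -> //|H].
by have [ab hab] := barycentric sS; case: (H ab).
Qed.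

Section one_simplex.
Context (S : {fset pt}).
Hypothesis sS : simplex S.

Let baryv p q : p \in S -> q \in S -> bary S p q = (p == q)%:R.
Proof. by have [h _ _] := baryP sS; exact: h. Qed.
Let bary1 x : \sum_(p <- S) bary S p x = 1.
Proof. by have [_ h _] := baryP sS. Qed.
Let baryx x : \sum_(p <- S) bary S p x *: p = x.
Proof. by have [_ _ h] := baryP sS. Qed.

Lemma big_fset_pick (p : pt) (F : pt -> R) : p \in S ->
  \sum_(q <- S) F q * (p == q)%:R = F p.
Proof.
move=> pS; rewrite (big_rem p)//= eqxx mulr1 big_seq big1 ?addr0// => q.
by rewrite mem_rem_uniq ?fset_uniq// inE => /andP[qp _]; rewrite eq_sym (negbTE qp) mulr0.
Qed.

Lemma bary_unique (w : pt -> R) : \sum_(p <- S) w p = 1 ->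
  forall p, p \in S -> bary S p (\sum_(p <- S) w p *: p) = w p.
Proof.
move=> w1 p pS; rewrite /bary aff_sum// -[RHS](big_fset_pick w pS).
rewrite big_seq [RHS]big_seq; apply: eq_bigr => q qS.
by congr (_ * _); exact: baryv.
Qed.

Lemma hullP x : hull S x <-> forall p, p \in S -> 0 <= bary S p x.
Proof.
split=> [[w [w0 w1 ->]] p pS|h]; first by rewrite bary_unique//; exact: w0.
by exists (fun p => bary S p x); split.
Qed.

Lemma vertex_hull p : p \in S -> hull S p.
Proof. by move=> pS; apply/hullP => q qS; rewrite baryv. Qed.

Lemma affE a b x : aff a b x = \sum_(p <- S) bary S p x * aff a b p.
Proof. by rewrite -{1}(baryx x) aff_sum. Qed.

Lemma aff_slope a b : a = \sum_(p <- S) aff a b p *: bslope S p.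
Proof.
have [] // := @aff_inj R d a (\sum_(p <- S) aff a b p *: bslope S p) b
  (\sum_(p <- S) aff a b p * (bary_data S).2 p).
move=> x; rewrite (affE a b x) /aff mulmx_sumr summxE -big_split; apply: eq_bigr => p _.
move: ((p *m a) ord0 ord0 + b) => c.
have -> : (x *m (c *: bslope S p)) ord0 ord0 = c * (x *m bslope S p) ord0 ord0.
  by rewrite -scalemxAr mxE.
by rewrite /bary /aff /= -mulrDr mulrC.
Qed.

Lemma bslope_sum0 : \sum_(p <- S) bslope S p = 0.
Proof.
have := aff_slope 0 1; under eq_bigr do rewrite /aff mulmx0 mxE add0r scale1r.
by move=> <-.
Qed.

Lemma bary_le1 p x : p \in S -> hull S x -> bary S p x <= 1.
Proof.
move=> pS /hullP h; rewrite -(bary1 x) (big_rem p)//= lerDl big_seq.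
by apply: sumr_ge0 => q /mem_rem; exact: h.
Qed.

Lemma hull_dom (v : pt -> R) (m : R) : (forall p, p \in S -> `|v p| <= m) -> forall a b,
  (forall p, p \in S -> v p = aff a b p) -> forall x, hull S x -> `|aff a b x| <= m.
Proof.
move=> vm a b va x /hullP hx; rewrite affE.
apply: le_trans (ler_norm_sum _ _ _) _.
rewrite -[m]mul1r -(bary1 x) mulr_suml big_seq [leRHS]big_seq; apply: ler_sum => p pS.
by rewrite normrM ger0_norm ?hx// ler_wpM2l ?hx// -va//; exact: vm.
Qed.

Definition osimplex : set pt := [set x | forall p, p \in S -> 0 < bary S p x].

Lemma osimplex_hull : osimplex `<=` hull S.
Proof. by move=> x h; apply/hullP => p pS; rewrite ltW//; exact: h. Qed.

Lemma hullE : hull S = \bigcap_(p in [set` S]) [set x | 0 <= bary S p x].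
Proof. by apply/seteqP; split=> x; [move/hullP => h p /=; exact: h|move=> h; apply/hullP => p; exact: h]. Qed.

Lemma closed_hull : closed (hull S).
Proof. by rewrite hullE; apply: closed_bigI => p _; exact: closed_aff_ge. Qed.

Lemma open_osimplex : open osimplex.
Proof.
have -> : osimplex = \big[setI/setT]_(p <- S) [set x | 0 < bary S p x].
  by rewrite -bigcap_seq; apply/seteqP; split=> x h p /= pS; exact: h.
elim/big_ind: _ => [|A B oA oB|p _]; [exact: openT|exact: openI|exact: open_aff_gt].
Qed.

Lemma osimplex_interior : osimplex `<=` (hull S)°.
Proof. by move=> x h; apply: filterS osimplex_hull _; exact: open_nbhs_nbhs (conj open_osimplex h). Qed.

Lemma hull_bounded : exists n : R, hull S `<=` cube 0 n.
Proof.
exists (\sum_(p <- S) enorm p + 1) => x hx i; rewrite mxE sub0r normrN.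
have h : `|aff (delta_mx i ord0) 0 x| <= \sum_(p <- S) enorm p.
  apply: (@hull_dom (fun p => p ord0 i)) => // [p pS|p pS].
    apply: le_trans (coord_enorm _ _) _; rewrite (big_rem p)//= lerDl.
    by apply: sumr_ge0 => q _; exact: enorm_ge0.
  by rewrite /aff addr0 -colE mxE.
by move: h; rewrite /aff addr0 -colE mxE; move=> h; apply: le_lt_trans h _; rewrite ltrDl.
Qed.

Lemma hull_diam_bounded : has_ubound [set enorm (x - y) | x in hull S & y in hull S].
Proof.
have [n hn] := hull_bounded; exists (d%:R * (n + n)) => _ [x hx [y hy <-]].
apply: enorm_coord => i; have := hn _ hx i; have := hn _ hy i.
rewrite !mxE !sub0r !normrN => h1 h2; apply: le_trans (ler_normB _ _) _.
by rewrite lerD// ltW.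
Qed.

Lemma le_diam x y : hull S x -> hull S y -> enorm (x - y) <= diam (hull S).
Proof. by move=> hx hy; apply: ub_le_sup; [exact: hull_diam_bounded|exists x => //; exists y]. Qed.

Lemma simplex_vertices : (0 < d)%N -> exists p q, [/\ p \in S, q \in S & p != q].
Proof.
move=> d0; have [cS _] := sS; have := fset_uniq S; have : (1 < size S)%N by rewrite cS.
case E : (enum_fset S) => [|p [|q s]]// _ /= /andP[].
rewrite inE negb_or => /andP[pq _] _; exists p, q; split=> //.
  by rewrite -[_ \in S]/(p \in enum_fset S) E mem_head.
by rewrite -[_ \in S]/(q \in enum_fset S) E !inE eqxx orbT.
Qed.

Lemma diam_gt0 : (0 < d)%N -> 0 < diam (hull S).
Proof.
move=> /simplex_vertices[p [q [pS qS pq]]].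
apply: lt_le_trans (le_diam (vertex_hull pS) (vertex_hull qS)).
rewrite lt_neqAle enorm_ge0 andbT eq_sym -enorm_tr; apply: contra pq => /eqP/enorm_eq0/eqP.
by rewrite trmx_eq0 subr_eq0.
Qed.

Lemma bslope_neq0 p : (0 < d)%N -> p \in S -> bslope S p != 0.
Proof.
move=> d0 pS; have [p1 [p2 [p1S p2S p12]]] := simplex_vertices d0.
have [q qS pq] : exists2 q, q \in S & p != q.
  by have [pp1|npp1] := eqVneq p p1; [exists p2 => //; rewrite pp1|exists p1].
apply: contraTN isT => /eqP a0; have := baryv pS pS; have := baryv pS qS.
rewrite eqxx (negbTE pq) /bary a0 /aff !mulmx0 !mxE !add0r => -> /eqP.
by rewrite eq_sym oner_eq0.
Qed.

Lemma bslope_ball p (r : R) (c : pt) : 0 <= r -> p \in S ->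
  [set x | enorm (x - c) <= r / 2] `<=` hull S -> r * enorm (bslope S p) <= 1.
Proof.
move=> r0 pS hb; set a := bslope S p.
have [a0|an0] := eqVneq (enorm a) 0; first by rewrite a0 mulr0.
have ap : 0 < enorm a by rewrite lt_neqAle eq_sym an0 enorm_ge0.
pose s := r / 2 / enorm a; have s0 : 0 <= s by rewrite !divr_ge0 ?enorm_ge0.
have hp (e : R) : `|e| = 1 -> hull S (c + (e * s) *: a^T).
  move=> e1; apply: hb => /=; rewrite addrC addKr enormZ enorm_tr normrM e1 mul1r ger0_norm//.
  by rewrite /s divfK.
have h1 := bary_le1 pS (hp 1 (normr1 _)).
have /hullP/(_ _ pS) h2 := hp (-1) (etrans (normrN 1) (normr1 _)).
have : bary S p (c + (1 * s) *: a^T) - bary S p (c + (-1 * s) *: a^T) <= 1 by lra.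
rewrite /bary affB opprD addrACA subrr add0r -scalerBl -/a -scalemxAl mxE dotrow_dot trmxK.
rewrite -enorm_dot; congr (_ <= _); rewrite /s; field.
by [].
Qed.

Lemma bslope_inball p : p \in S -> inball_diam (hull S) * enorm (bslope S p) <= 1.
Proof.
move=> pS; have [a0|an0] := eqVneq (enorm (bslope S p)) 0; first by rewrite a0 mulr0.
have ap : 0 < enorm (bslope S p) by rewrite lt_neqAle eq_sym an0 enorm_ge0.
rewrite -ler_pdivlMr//; apply: ge_sup.
  exists 0, p => // x /=; rewrite mul0r => h.
  suff -> : x = p by exact: vertex_hull.
  have h0 : enorm (x - p)^T = 0 by apply/eqP; rewrite enorm_tr eq_le h enorm_ge0.
  by apply/eqP; rewrite -subr_eq0 -trmx_eq0 (enorm_eq0 h0).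
move=> r [c r0 hb]; rewrite ler_pdivlMr//; exact: bslope_ball hb.
Qed.

Lemma bslope_diam (gamma : R) p : 0 <= gamma -> diam (hull S) <= gamma * inball_diam (hull S) ->
  p \in S -> enorm (bslope S p) * diam (hull S) <= gamma.
Proof.
move=> g0 hS pS; apply: (@le_trans _ _ (enorm (bslope S p) * (gamma * inball_diam (hull S)))).
  by rewrite ler_wpM2l// enorm_ge0.
by rewrite mulrCA ler_piMr// mulrC; exact: bslope_inball.
Qed.

Lemma cube_in_hull (gamma : R) : (0 < d)%N -> 0 < gamma ->
  diam (hull S) <= gamma * inball_diam (hull S) ->
  exists c, cube c (diam (hull S) / (4 * gamma * d%:R)) `<=` hull S.
Proof.
move=> d0 g0 hS; have D0 := diam_gt0 d0.
have i0 : 0 < inball_diam (hull S).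
  by rewrite -(pmulr_rgt0 _ g0); apply: lt_le_trans hS.
have dp : 0 < d%:R :> R by rewrite ltr0n.
set E := [set r | exists2 c, 0 <= r & [set x | enorm (x - c) <= r / 2] `<=` hull S].
have En0 : E !=set0.
  apply: contrapT => /set0P/negP; rewrite negbK => /eqP E0.
  by move: i0; rewrite /inball_diam -/E E0 sup0 ltxx.
have [r [c r0 hb] hr] : exists2 r, E r & inball_diam (hull S) / 2 < r.
  apply: sup_gt => //; rewrite -/(inball_diam _); lra.
exists c => x hx; apply: hb => /=.
apply: (@le_trans _ _ (d%:R * (diam (hull S) / (4 * gamma * d%:R)))).
  by apply: enorm_coord => i; rewrite !mxE distrC ltW//; exact: hx.
have -> : d%:R * (diam (hull S) / (4 * gamma * d%:R)) = diam (hull S) / gamma / 4.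
  by field; rewrite (gt_eqF g0) (gt_eqF dp).
have : diam (hull S) / gamma <= inball_diam (hull S) by rewrite ler_pdivrMr// mulrC.
by lra.
Qed.

End one_simplex.

Lemma le_diam_hull S S' : simplex S -> simplex S' -> hull S `<=` hull S' ->
  diam (hull S) <= diam (hull S').
Proof.
move=> sS sS' h; apply: ge_sup.
  have [cS _] := sS; case E : (enum_fset S) => [|p s]; first by rewrite E in cS.
  have pS : p \in S by rewrite -[_ \in S]/(p \in enum_fset S) E mem_head.
  by exists (enorm (p - p)), p; [exact: vertex_hull|exists p => //; exact: vertex_hull].
by move=> _ [x hx [y hy <-]]; apply: le_diam => //; exact: h.
Qed.

End simplices.

(** * Geometry of shape regular meshes *)

Section mesh_geometry.
Context (R : realType) (d : nat).
Local Notation pt := 'rV[R]_d.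
Local Notation mu := (lebesgue_rV R d).
Implicit Types (S : {fset pt}) (p q : pt).

Lemma ae_seq (I : eqType) (s : seq I) (P : I -> pt -> Prop) :
  (forall i, i \in s -> {ae mu, forall x, P i x}) ->
  {ae mu, forall x, forall i, i \in s -> P i x}.
Proof.
elim: s => [|i s IH] h; first by apply: aeW => x i.
have h1 := h i (mem_head _ _).
have h2 : {ae mu, forall x, forall j, j \in s -> P j x}.
  by apply: IH => j js; apply: h; rewrite inE js orbT.
by apply: filterS2 h1 h2 => x Pi Ps j; rewrite inE => /orP[/eqP ->|/Ps].
Qed.

Lemma ae_null (N : set pt) : measurable N -> mu N = 0%E -> {ae mu, forall x, ~ N x}.
Proof. by move=> mN N0; exists N; split=> // x /= /contrapT. Qed.

Lemma Int_indic (D : set pt) : measurable D -> \int[mu]_x (\1_D x : R) = fine (mu D).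
Proof. by move=> mD; rewrite /Rintegral integral_indic// setIT. Qed.

Lemma seq_argmin (I : eqType) (s : seq I) (f : I -> R) i0 : i0 \in s ->
  exists2 i, i \in s & forall j, j \in s -> f i <= f j.
Proof.
elim: s i0 => // a s IH i0 _; case: s IH => [|b s] IH.
  by exists a; [exact: mem_head|move=> j; rewrite inE => /eqP ->].
have [i si hi] := IH b (mem_head _ _).
have [ai|ia] := leP (f a) (f i).
  exists a; first exact: mem_head.
  by move=> j; rewrite inE => /orP[/eqP ->//|/hi]; exact: le_trans.
exists i; first by rewrite inE si orbT.
by move=> j; rewrite inE => /orP[/eqP ->|/hi//]; exact: ltW.
Qed.

Context (Omega : set pt) (T : {fset {fset pt}}).
Hypotheses (d0 : (0 < d)%N) (pO : polyhedral_domain Omega) (tri : triangulation Omega T).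

Lemma domain_open : open Omega.
Proof. by have [] := pO. Qed.

Lemma mesh_simplex S : S \in T -> simplex S.
Proof. by have [[h _] _] := tri; exact: h. Qed.

Lemma hull_closure S : S \in T -> hull S `<=` closure Omega.
Proof. by have [[_ <-] _] := tri => ST x hx; exists S. Qed.

Lemma mesh_cover x : closure Omega x -> exists2 S, S \in T & hull S x.
Proof. by have [[_ <-] _] := tri => -[S ST hx]; exists S. Qed.

Lemma mesh_coverO x : Omega x -> exists2 S, S \in T & hull S x.
Proof. by move=> Ox; apply: mesh_cover; exact: subset_closure. Qed.

Lemma osimplex_domain S : S \in T -> osimplex S `<=` Omega.
Proof.
move=> ST x /(osimplex_interior (mesh_simplex ST)) h.
by have [_ _ _ _ <-] := pO; apply: filterS h; exact: hull_closure.
Qed.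

Lemma bary_face S S' x p : S \in T -> S' \in T -> hull S x -> hull S' x -> p \in S ->
  bary S p x = if p \in S' then bary S' p x else 0.
Proof.
move=> ST S'T hx hx' pS; have [_ /(_ S S' ST S'T) hI] := tri.
have [w [_ w1 xw]] : hull (S `&` S')%fset x by rewrite -hI.
pose w' q := if q \in (S `&` S')%fset then w q else 0.
have sub (V : nmodType) (F : pt -> V) (A : {fset pt}) : (S `&` S' `<=` A)%fset ->
    (forall q, q \notin (S `&` S')%fset -> F q = 0) ->
    \sum_(q <- (S `&` S')%fset) F q = \sum_(q <- A) F q.
  by move=> sA F0; apply: big_fset_incl => // q _; exact: F0.
have E (V : nmodType) (F G : pt -> V) : (forall q, q \in (S `&` S')%fset -> F q = G q) ->
    \sum_(q <- (S `&` S')%fset) F q = \sum_(q <- (S `&` S')%fset) G q.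
  by move=> FG; rewrite big_seq [RHS]big_seq; exact: eq_bigr.
have w'1 (A : {fset pt}) : (S `&` S' `<=` A)%fset -> \sum_(q <- A) w' q = 1.
  move=> sA; rewrite -(sub _ w')// => [|q /negbTE qF]; last by rewrite /w' qF.
  by rewrite -w1; apply: E => q qF; rewrite /w' qF.
have w'x (A : {fset pt}) : (S `&` S' `<=` A)%fset -> \sum_(q <- A) w' q *: q = x.
  move=> sA; rewrite -(sub _ (fun q => w' q *: q))// => [|q /negbTE qF]; last first.
    by rewrite /w' qF scale0r.
  by rewrite xw; apply: E => q qF; rewrite /w' qF.
rewrite -{1}(w'x S) ?fsubsetIl// (bary_unique (mesh_simplex ST)) ?w'1 ?fsubsetIl//.
case: ifPn => [pS'|npS']; last by rewrite /w' in_fsetI (negbTE npS') andbF.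
by rewrite -(w'x S') ?fsubsetIr// (bary_unique (mesh_simplex S'T)) ?w'1 ?fsubsetIr.
Qed.

Lemma bary_neq0 S x : S \in T -> exists2 p, p \in S & bary S p x != 0.
Proof.
move=> ST; apply: contrapT => H; have [_ /(_ x) h _] := baryP (mesh_simplex ST).
move: h; rewrite big_seq big1 => [/eqP|p pS]; first by rewrite eq_sym oner_eq0.
by apply/eqP/negPn/negP => np; apply: H; exists p.
Qed.

Lemma touch_vertex S S' x : S \in T -> S' \in T -> hull S x -> hull S' x ->
  exists2 p, p \in S & p \in S'.
Proof.
move=> ST S'T hx hx'; have [p pS] := bary_neq0 x ST.
by rewrite (bary_face ST S'T hx hx' pS); case: ifP => [|_ /eqP//]; exists p.
Qed.

Lemma osimplex_disjoint S S' x : S \in T -> S' \in T -> osimplex S x -> hull S' x -> S = S'.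
Proof.
move=> ST S'T ox hx'; have hx := osimplex_hull (mesh_simplex ST) ox.
have SS' : (S `<=` S')%fset.
  apply/fsubsetP => p pS; have := ox p pS.
  by rewrite (bary_face ST S'T hx hx' pS); case: ifP => //; rewrite ltxx.
have [c1 _] := mesh_simplex ST; have [c2 _] := mesh_simplex S'T.
by apply/eqP; rewrite eqEfcard SS' c1 c2 /=.
Qed.

Lemma ae_osimplex : {ae mu, forall x, forall S, S \in T -> hull S x -> osimplex S x}.
Proof.
apply: (@ae_seq _ (enum_fset T)) => S ST; have sS := mesh_simplex ST.
have : {ae mu, forall x, forall p, p \in enum_fset S -> bary S p x <> 0}.
  apply: ae_seq => p pS.
  have := ae_null (measurable_hyperplane (bslope S p) (- (bary_data S).2 p))
    (hyperplane_null _ (bslope_neq0 sS d0 pS)).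
  by apply: filterS => x hx /eqP; rewrite /bary /aff addr_eq0 => /eqP.
apply: filterS => x hx /(hullP sS) hS p pS; rewrite lt_neqAle hS// andbT eq_sym.
by apply/eqP; exact: hx.
Qed.

Lemma ae_closure : {ae mu, forall x, closure Omega x -> Omega x}.
Proof.
apply: filterS ae_osimplex => x hx /mesh_cover[S ST /(hx S ST)].
exact: osimplex_domain.
Qed.

Lemma ae_hull_domain S : S \in T -> {ae mu, forall x, hull S x -> Omega x}.
Proof. by move=> ST; apply: filterS ae_closure => x h /(hull_closure ST). Qed.

Lemma ae_element_sum (F : {fset pt} -> R) : {ae mu, forall x, Omega x -> forall S, S \in T ->
  hull S x -> \sum_(S' <- T) F S' * \1_(hull S') x = F S}.
Proof.
apply: filterS ae_osimplex => x hx Ox S ST /(hx S ST) ox.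
rewrite (big_rem S)//= indicE mem_set; last exact: osimplex_hull (mesh_simplex ST) _ _.
rewrite mulr1 big_seq big1 ?addr0// => S'; rewrite mem_rem_uniq ?fset_uniq// inE => /andP[SS' S'T].
rewrite indicE memNset ?mulr0// => hx'.
by move: SS'; rewrite (osimplex_disjoint ST S'T ox hx') eqxx.
Qed.

Lemma ae_meshsize : {ae mu, forall x, Omega x -> forall S, S \in T ->
  hull S x -> meshsize T x = diam (hull S)}.
Proof.
apply: filterS ae_osimplex => x hx Ox S ST /(hx S ST) ox.
rewrite /meshsize (big_rem S)//= indicE mem_set; last exact: osimplex_interior (mesh_simplex ST) _ _.
rewrite mulr1 big_seq big1 ?addr0// => S'; rewrite mem_rem_uniq ?fset_uniq// inE => /andP[SS' S'T].
rewrite indicE memNset ?mulr0// => /interior_subset hx'.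
by move: SS'; rewrite (osimplex_disjoint ST S'T ox hx') eqxx.
Qed.

Lemma packing (s : seq {fset pt}) (c : {fset pt} -> pt) (z : pt) (r rho : R) :
  uniq s -> {subset s <= enum_fset T} -> 0 <= r -> 0 <= rho ->
  (forall S, S \in s -> cube (c S) r `<=` hull S) ->
  (forall S, S \in s -> cube (c S) r `<=` cube z rho) ->
  (size s)%:R * (2 * r) ^+ d <= (2 * rho) ^+ d.
Proof.
move=> us sT r0 rho0 ch cz.
have ii c' r' := intg_indic (measurable_cube c' r') (cube_bounded_lty c' r').
have Ic c' r' : 0 <= r' -> \int[mu]_x (\1_(cube c' r') x : R) = (2 * r') ^+ d.
  by move=> ?; rewrite Int_indic ?mu_cube//; exact: measurable_cube.
have -> : (size s)%:R * (2 * r) ^+ d = \int[mu]_x (\sum_(S <- s) \1_(cube (c S) r) x).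
  rewrite Int_sum => [|S]; last exact: ii.
  by under eq_bigr do rewrite Ic//; rewrite big_const_seq count_predT iter_addr_0 mulr_natl.
rewrite -(Ic z rho)//; apply: Int_le_ae; [by apply: intg_sum => S; exact: ii|exact: ii|].
apply: filterS ae_osimplex => x hx.
have [[S Ss cS]|H] := pselect (exists2 S, S \in s & cube (c S) r x); last first.
  rewrite big_seq big1; first by rewrite indicE.
  by move=> S Ss; rewrite indicE memNset// => h; apply: H; exists S.
have ox := hx _ (sT _ Ss) (ch _ Ss _ cS).
rewrite [leRHS]indicE mem_set; last exact: cz cS.
rewrite (big_rem S)//= indicE mem_set//= big_seq big1 ?addr0// => S'.
rewrite mem_rem_uniq// inE => /andP[SS' S's]; rewrite indicE memNset// => /(ch _ S's) h'.
by move: SS'; rewrite (osimplex_disjoint (sT _ Ss) (sT _ S's) ox h') eqxx.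
Qed.

Context (gamma : R).
Hypotheses (g1 : 1 <= gamma) (reg : shape_regular gamma T).

Let g0 : 0 < gamma := lt_le_trans ltr01 g1.
Let dR : 0 < d%:R :> R. Proof. by rewrite ltr0n. Qed.

Lemma star_card (z : pt) :
  (size [seq S : {fset pt} <- enum_fset T | z \in S])%:R <= (8 * gamma * d%:R) ^+ d.
Proof.
set s : seq {fset pt} := [seq _ <- _ | _].
case E : s => [|S0 s'].
  by rewrite exprn_ge0// !mulr_ge0// ?ltW.
have S0s : S0 \in s by rewrite E mem_head.
rewrite -E; have [S1 S1s min1] := seq_argmin (fun S => diam (hull S)) S0s.
have sP S : S \in s -> z \in S /\ S \in T by rewrite mem_filter => /andP[].
have [zS1 S1T] := sP _ S1s.
set rho := diam (hull S1); have rho0 : 0 < rho by apply: diam_gt0 (mesh_simplex S1T) d0.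
have /choice[c hc] : forall S, exists c, S \in T -> cube c (diam (hull S) / (4 * gamma * d%:R)) `<=` hull S.
  move=> S; have [ST|nST] := boolP (S \in T); last by exists 0.
  by have [c hc] := cube_in_hull (mesh_simplex ST) d0 g0 (reg ST); exists c.
pose t S := rho / diam (hull S).
pose c' S := z + t S *: (c S - z).
have tp S : S \in s -> 0 < t S.
  by move=> /sP[_ ST]; rewrite divr_gt0//; apply: diam_gt0 (mesh_simplex ST) d0.
have cube' S x : S \in s -> cube (c' S) (rho / (4 * gamma * d%:R)) x ->
    exists2 y, hull S y & x = z + t S *: (y - z).
  move=> Ss h; have [zS ST] := sP _ Ss; have tS := tp _ Ss.
  exists (z + (t S)^-1 *: (x - z)); last first.
    by rewrite [z + _ - z]addrAC subrr add0r scalerA divff ?scale1r ?gt_eqF// addrC subrK.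
  apply: (hc S ST) => i; have := h i; rewrite /c' !mxE => hi.
  have -> : c S ord0 i - (z ord0 i + (t S)^-1 * (x ord0 i - z ord0 i)) =
      (t S)^-1 * (z ord0 i + t S * (c S ord0 i - z ord0 i) - x ord0 i).
    by field; rewrite gt_eqF.
  rewrite normrM gtr0_norm ?invr_gt0// mulrC ltr_pdivrMr//; apply: lt_le_trans hi _.
  rewrite /t; have Dn : diam (hull S) != 0 by rewrite gt_eqF//; apply: diam_gt0 (mesh_simplex ST) d0.
  by rewrite le_eqVlt; apply/orP; left; apply/eqP; field; rewrite Dn (gt_eqF g0) (gt_eqF dR).
have h1 := @packing s c' z (rho / (4 * gamma * d%:R)) (2 * rho).
have {h1} h1 : (size s)%:R * (2 * (rho / (4 * gamma * d%:R))) ^+ d <= (2 * (2 * rho)) ^+ d.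
  apply: h1.
  - by rewrite filter_uniq// fset_uniq.
  - by move=> S /sP[].
  - by rewrite divr_ge0 ?mulr_ge0// ltW.
  - by rewrite mulr_ge0// ltW.
  - move=> S Ss x /(cube' S x Ss)[y hy ->]; have [zS ST] := sP _ Ss.
    have sS := mesh_simplex ST; apply/(hullP sS) => p pS.
    have := proj1 (hullP sS y) hy p pS; have := proj1 (hullP sS z) (vertex_hull sS zS) p pS.
    have t1 : t S <= 1 by rewrite /t ler_pdivrMr ?mul1r ?min1//; apply: diam_gt0 sS d0.
    have -> : bary S p (z + t S *: (y - z)) = (1 - t S) * bary S p z + t S * bary S p y.
      rewrite /bary /aff mulmxDl -scalemxAl mulmxBl !mxE; ring.
    move=> h2 h3; rewrite addr_ge0// mulr_ge0// ?subr_ge0// ltW//; exact: tp.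
  - move=> S Ss x /(cube' S x Ss)[y hy ->] i; have [zS ST] := sP _ Ss.
    have sS := mesh_simplex ST; have tS := tp _ Ss.
    rewrite !mxE opprD addrA subrr sub0r normrN normrM gtr0_norm//.
    have := coord_enorm (y - z) i; have := le_diam sS hy (vertex_hull sS zS).
    rewrite !mxE => h2 h3; apply: (@le_lt_trans _ _ (t S * diam (hull S))).
      by rewrite ler_wpM2l ?(le_trans h3)// ltW.
    rewrite /t divfK ?gt_eqF ?mulr_natl ?mulr2n ?ltrDl//.
    exact: diam_gt0 sS d0.
have E2 : 2 * (2 * rho) = 2 * (rho / (4 * gamma * d%:R)) * (8 * gamma * d%:R).
  by field; rewrite (gt_eqF g0) (gt_eqF dR).
move: h1; rewrite E2 [X in _ <= X -> _]exprMn [X in X <= _ -> _]mulrC ler_pM2l// exprn_gt0// mulr_gt0// divr_gt0//.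
by rewrite !mulr_gt0.
Qed.

Definition touch S S' : Prop := hull S `&` hull S' !=set0.

Lemma touchC S S' : touch S S' <-> touch S' S.
Proof. by rewrite /touch setIC. Qed.

Definition overlap : R := d.+1%:R * (8 * gamma * d%:R) ^+ d.

Lemma touch_card S : S \in T -> (size [seq S' <- enum_fset T | `[< touch S S' >]])%:R <= overlap.
Proof.
move=> ST; have [cS _] := mesh_simplex ST.
apply: (@le_trans _ _ (\sum_(z <- S) (size [seq S' : {fset pt} <- enum_fset T | z \in S'])%:R)); last first.
  apply: (@le_trans _ _ (\sum_(z <- S) (8 * gamma * d%:R) ^+ d)).
    by apply: ler_sum => z _; exact: star_card.
  rewrite big_const_seq count_predT iter_addr_0.
  by rewrite -[leLHS]mulr_natl cS.
rewrite -natr_sum ler_nat size_filter.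
under eq_bigr do rewrite size_filter -sum1_count big_mkcond.
rewrite exchange_big -sum1_count big_mkcond /= big_seq [leqRHS]big_seq.
apply: leq_sum => S' S'T; case: asboolP => // -[x [hx hx']].
have [p pS pS'] := touch_vertex ST S'T hx hx'.
by rewrite (big_rem p)//= pS'.
Qed.

Lemma overlap_ge1 : 1 <= overlap.
Proof.
rewrite /overlap -[leLHS]mulr1 ler_pM// ?ler1n// exprn_ege1//.
have : 1 <= d%:R :> R by rewrite ler1n.
by move: g1; move: (d%:R : R) => e; nra.
Qed.

Lemma overlap_sum (F : {fset pt} -> R) : (forall S, S \in T -> 0 <= F S) ->
  \sum_(S <- T) \sum_(S' <- T | `[< touch S S' >]) F S' <= overlap * \sum_(S <- T) F S.
Proof.
move=> F0; under eq_bigr do rewrite big_mkcond.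
rewrite exchange_big mulr_sumr /= big_seq [leRHS]big_seq; apply: ler_sum => S' S'T.
rewrite -big_mkcond /= big_const_seq iter_addr_0 -mulr_natl ler_wpM2r//; first exact: F0.
rewrite -size_filter; apply: le_trans (touch_card S'T).
rewrite ler_nat !size_filter; apply: sub_count => S /= /asboolP h; apply/asboolP.
exact/touchC.
Qed.

Lemma mesh_card (n : R) : 0 <= n -> closure Omega `<=` cube 0 n ->
  forall r, 0 <= r -> (forall S, S \in T -> r <= diam (hull S)) ->
  (size (enum_fset T))%:R * r ^+ d <= (4 * n * gamma * d%:R) ^+ d.
Proof.
move=> n0 On r r0 hr.
have /choice[c hc] : forall S, exists c, S \in T -> cube c (diam (hull S) / (4 * gamma * d%:R)) `<=` hull S.
  move=> S; have [ST|nST] := boolP (S \in T); last by exists 0.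
  by have [c hc] := cube_in_hull (mesh_simplex ST) d0 g0 (reg ST); exists c.
have q0 : 0 < 4 * gamma * d%:R by rewrite !mulr_gt0.
have sub S : S \in T -> cube (c S) (r / (4 * gamma * d%:R)) `<=` hull S.
  move=> ST x hx; apply: hc => // i; apply: lt_le_trans (hx i) _.
  by rewrite ler_pM2r ?invr_gt0// hr.
have := @packing (enum_fset T) c 0 (r / (4 * gamma * d%:R)) n (fset_uniq _) (fun _ h => h).
have -> : 4 * n * gamma * d%:R = n * (4 * gamma * d%:R) by ring.
move=> /(_ _ n0 sub) h; have : (size (enum_fset T))%:R * (2 * (r / (4 * gamma * d%:R))) ^+ d <= (2 * n) ^+ d.
  apply: h; first by rewrite divr_ge0// ltW.
  by move=> S ST x /(sub S ST)/(hull_closure ST)/On.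
have -> : 2 * (r / (4 * gamma * d%:R)) = 2 / (4 * gamma * d%:R) * r by field; rewrite (gt_eqF g0) (gt_eqF dR).
have -> : 2 * n = 2 / (4 * gamma * d%:R) * (n * (4 * gamma * d%:R)) by field; rewrite (gt_eqF g0) (gt_eqF dR).
by rewrite [(_ * r) ^+ d]exprMn [X in _ <= X -> _]exprMn mulrCA ler_pM2l// exprn_gt0// divr_gt0.
Qed.

End mesh_geometry.

(** * Mollification and truncation *)

Section mollification.
Context (R : realType) (d : nat).
Local Notation pt := 'rV[R]_d.
Local Notation mu := (lebesgue_rV R d).
Local Notation e_ := (@basis_vector R d).
Implicit Types (v w K : pt -> R).

Lemma lip1_lip v (L : R) : (forall i, lip1 (e_ i) v L) ->
  forall x y : pt, `|v x - v y| <= L * \sum_i `|x ord0 i - y ord0 i|.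
Proof.
move=> hl x y; have key (s : seq 'I_d) (z h : pt) :
    `|v (z + \sum_(i <- s) h ord0 i *: e_ i) - v z| <= L * \sum_(i <- s) `|h ord0 i|.
  elim: s z => [|i s IH] z; first by rewrite !big_nil addr0 subrr normr0 mulr0.
  rewrite !big_cons mulrDr addrA [L * _ + _]addrC.
  set z' := z + _ *: _.
  have -> : v (z' + \sum_(j <- s) h ord0 j *: e_ j) - v z =
    (v (z' + \sum_(j <- s) h ord0 j *: e_ j) - v z') + (v z' - v z) by ring.
  by apply: le_trans (ler_normD _ _) _; rewrite lerD//; exact: hl.
have := key (index_enum _) y (x - y); rewrite -row_sum_delta [y + _]addrC subrK.
by congr (_ <= _ * _); apply: eq_bigr => i _; rewrite !mxE.
Qed.

Lemma lip1_continuous v (L : R) : (forall i, lip1 (e_ i) v L) -> continuous v.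
Proof.
move=> hl x; have L0 : 0 <= `|L| by [].
apply/(@cvgrPdist_le _ _ _ (nbhs x) (nbhs_filter x)) => e e0; pose r := e / (`|L| * d%:R + 1).
have p0 : 0 < `|L| * d%:R + 1 by rewrite ltr_wpDl// mulr_ge0.
apply/rV_nbhsP; exists r => [|y hy]; first by rewrite divr_gt0.
apply: le_trans (lip1_lip hl x y) _.
apply: (@le_trans _ _ (`|L| * \sum_i `|x ord0 i - y ord0 i|)).
  by rewrite ler_wpM2r ?ler_norm// sumr_ge0.
apply: (@le_trans _ _ (`|L| * (d%:R * r))).
  rewrite ler_wpM2l// -[d in d%:R](card_ord d) mulr_natl -sumr_const.
  by apply: ler_sum => i _; rewrite ltW.
rewrite mulrA /r mulrA ler_pdivrMr// mulrC ler_wpM2l ?ltW//; lra.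
Qed.

Lemma lip1_derive_le v (L : R) (i : 'I_d) x (l : R) : lip1 (e_ i) v L ->
  is_derive x (e_ i) v l -> `|l| <= L.
Proof.
move=> hl hd; pose h (n : nat) : R := n.+1%:R^-1.
have h0 n : h n != 0 by rewrite invr_eq0 pnatr_eq0.
have hc : h @ \oo --> 0 by exact: cvg_harmonic.
apply: (ler_cvg_to (cvg_norm (is_derive_seq hd h0 hc)) (cvg_cst L)).
near=> n; rewrite normrM normfV ler_pdivrMl ?normr_gt0// mulrC; exact: hl.
Unshelve. all: by end_near.
Qed.

Definition conv w K (x : pt) : R := \int[mu]_y (w y * K (y - x)).

Lemma test_shift_bound K : test_function setT K ->
  exists M : R, forall y, `|K y| <= M.
Proof. by move=> /test_bbs[_ [M [n [h _]]]]; exists M. Qed.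

Lemma bbs_conv w K x : bbs w -> test_function setT K -> bbs (fun y => w y * K (y - x)).
Proof.
move=> bw tK; have [M hM] := test_shift_bound tK.
apply: (bbs_mul (M := M)) => //.
by apply: (measurableT_comp _ (measurable_shift (- x))); case: (test_bbs tK).
Qed.

Lemma conv_shift w K x : bbs w -> test_function setT K ->
  conv w K x = \int[mu]_y (w (y + x) * K y).
Proof.
move=> bw tK; rewrite /conv -(Int_shift x (bbs_intg (bbs_conv x bw tK))).
by apply: eq_Rintegral => y _; rewrite addrK.
Qed.

Lemma conv_is_derive w K i x : bbs w -> test_function setT K ->
  is_derive x (e_ i) (conv w K) (conv w (fun y => -1 * 'D_(e_ i) K y + 0) x).
Proof.
move=> bw tK; apply: is_derive_from_seq => h h0 hc.
have [L hL] := test_lip i tK.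
have iw := bbs_intg bw; have mw := proj1 bw.
have mK := proj1 (test_bbs tK); have mdK := proj1 (test_bbs (test_deriv i tK)).
have msh (f : pt -> R) (z : pt) : measurable_fun setT f -> measurable_fun setT (fun y : pt => f (y - z)).
  by move=> mf; exact: measurableT_comp mf (measurable_shift (- z)).
have -> : (fun n => (h n)^-1 * (conv w K (x + h n *: e_ i) - conv w K x)) =
   (fun n => \int[mu]_y (w y * ((h n)^-1 * (K (y - x + (- h n) *: e_ i) - K (y - x))))).
  apply/funext => n; have i1 := bbs_intg (bbs_conv (x + h n *: e_ i) bw tK).
  have i2 := bbs_intg (bbs_conv x bw tK).
  rewrite /conv -(IntB i1 i2) -(IntZ _ (intg_sub i1 i2)); apply: eq_Rintegral => y _.
  have -> : y - (x + h n *: e_ i) = y - x + (- h n) *: e_ i by rewrite opprD addrA scaleNr.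
  by move: (K _) (K _) => a b; ring.
apply: (proj2 (Int_dct (g := fun y => L * `|w y|) _ _ _ _ _)).
- move=> n; apply: measurable_funM => //; apply: measurable_funM; first exact: measurable_cst.
  apply: measurable_funB; last exact: msh.
  have -> : (fun y : pt => K (y - x + - h n *: e_ i)) = (fun y => K (y - (x + h n *: e_ i))).
    by apply/funext => y; rewrite opprD addrA scaleNr.
  exact: msh.
- apply: measurable_funM => //; apply: measurable_funD; last exact: measurable_cst.
  by apply: measurable_funM; [exact: measurable_cst|exact: (msh ('D_(e_ i) K) x mdK)].
- by apply: intg_scale; exact: intg_norm.
- move=> n y; rewrite normrM mulrC ler_wpM2r// normrM normfV.
  rewrite ler_pdivrMl ?normr_gt0// mulrC; have := hL (y - x) (- h n).
  by rewrite normrN.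
- apply: aeW => y; have hd := @smooth_is_derive R d K i (y - x) (proj1 tK).
  have h0' n : - h n != 0 by rewrite oppr_eq0.
  have hc' : (fun n => - h n) @ \oo --> 0 by rewrite -oppr0; exact: cvgN hc.
  have := is_derive_seq hd h0' hc' => hq.
  apply: cvgM; first exact: cvg_cst.
  have -> : -1 * 'D_(e_ i) K (y - x) + 0 = - 'D_(e_ i) K (y - x) by ring.
  have -> : (fun n => (h n)^-1 * (K (y - x + - h n *: e_ i) - K (y - x))) =
      (fun n => - ((- h n)^-1 * (K (y - x + - h n *: e_ i) - K (y - x)))).
    by apply/funext => n; rewrite invrN mulNr opprK.
  exact: cvgN hq.
Qed.

Lemma conv_bound w K (M : R) x : bbs w -> test_function setT K -> (forall y, `|K y| <= M) ->
  `|conv w K x| <= M * \int[mu]_y `|w y|.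
Proof.
move=> bw tK hM; have ic := bbs_intg (bbs_conv x bw tK); have iw := intg_norm (bbs_intg bw).
apply: le_trans (Int_norm ic) _; rewrite -(IntZ M iw).
apply: Int_le; [exact: intg_norm|exact: intg_scale|move=> y].
by rewrite normrM mulrC ler_wpM2r.
Qed.

Lemma conv_smooth w K : bbs w -> test_function setT K -> smooth (conv w K).
Proof.
move=> bw tK; pose P f := exists2 K', test_function setT K' & f = conv w K'.
have tD i K' : test_function setT K' -> test_function setT (fun y => -1 * 'D_(e_ i) K' y + 0).
  by move=> tK'; apply: test_add (test_deriv i tK') (test0 _).
apply: (@smooth_closed R d P); last by exists K.
- move=> _ [K' tK' ->].
  have /choice[M hM] i := test_shift_bound (tD i _ tK').
  pose L := \sum_i `|M i * \int[mu]_y `|w y| |.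
  apply: (@lip1_continuous _ L) => i.
  apply: (is_derive_lip (f1 := conv w (fun y => -1 * 'D_(e_ i) K' y + 0))) => x.
    exact: conv_is_derive.
  apply: le_trans (conv_bound x bw (tD i _ tK') (hM i)) _.
  apply: le_trans (ler_norm _) _.
  by rewrite /L (bigD1 i)//= lerDl sumr_ge0.
- move=> _ [K' tK' ->] i; exists (conv w (fun y => -1 * 'D_(e_ i) K' y + 0)).
    by exists (fun y => -1 * 'D_(e_ i) K' y + 0) => //; exact: tD.
  by move=> x; exact: conv_is_derive.
Qed.

Lemma mollifier (r : R) : 0 < r -> exists K, [/\ test_function setT K,
  forall y, 0 <= K y, forall y, ~ cube 0 r y -> K y = 0 & \int[mu]_y K y = 1].
Proof.
move=> r0; pose B := bump 0 (\row_i (- r) : pt) (\row_i r).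
have tB : test_function setT B by exact: bump_test.
have B0 y : 0 <= B y := bump_ge0 _ _ _ _.
have cE : cube 0 r = obox (\row_i (- r) : pt) (\row_i r).
  by rewrite cubeE; congr obox; apply/rowP => i; rewrite !mxE ?sub0r ?add0r.
have iB := bbs_intg (test_bbs tB).
pose c := \int[mu]_y B y; have c0 : 0 < c.
  rewrite lt_neqAle Int_ge0// andbT eq_sym; apply/eqP => c0.
  have : mu (cube 0 r) = 0%E.
    have [N [mN N0 hN]] := Int_eq0_ae iB B0 c0.
    apply/eqP; rewrite eq_le measure_ge0 andbT -N0.
    apply: le_measure; rewrite ?inE//; first exact: measurable_cube.
    move=> y; rewrite cE => /(bump_gt0 0) By; apply: hN => /= Bz.
    by move: By; rewrite -/B Bz ltxx.
  rewrite mu_cube ?ltW// => -[] /eqP; rewrite expf_eq0 mulf_eq0 (gt_eqF r0) orbF.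
  by rewrite pnatr_eq0 andbF.
exists (fun y => c^-1 * B y + 0); split.
- by apply: test_add => //; exact: test0.
- by move=> y; rewrite addr0 mulr_ge0// invr_ge0 ltW.
- by move=> y; rewrite cE => h; rewrite /B (bump_eq0 _ h) mulr0 addr0.
- under eq_Rintegral do rewrite addr0.
  by rewrite (IntZ _ iB) mulVf// gt_eqF.
Qed.

Definition trunc (t s : R) : R := if t < s then s - t else if s < - t then s + t else 0.

Lemma trunc_le t s : 0 <= t -> `|trunc t s - s| <= t.
Proof.
move=> t0; rewrite /trunc; case: ltP => h1; first by rewrite ler_norml; lra.
case: ltP => h2; first by rewrite ler_norml; lra.
by rewrite sub0r normrN ler_norml; lra.
Qed.

Lemma trunc_lip t s s' : 0 <= t -> `|trunc t s - trunc t s'| <= `|s - s'|.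
Proof.
move=> t0; rewrite /trunc.
case: (ltP t s) => h1; case: (ltP t s') => h2; try case: (ltP s (- t)) => h3;
  try case: (ltP s' (- t)) => h4; rewrite ler_norml; have := ler_norm (s - s');
  have := ler_norm (- (s - s')); rewrite normrN; lra.
Qed.

Lemma trunc_eq0 t s : `|s| <= t -> trunc t s = 0.
Proof. by rewrite ler_norml => /andP[h1 h2]; rewrite /trunc !ltNge h2 h1. Qed.

End mollification.

Section piecewise_affine_H10.
Context (R : realType) (d : nat).
Local Notation pt := 'rV[R]_d.
Local Notation mu := (lebesgue_rV R d).
Local Notation e_ := (@basis_vector R d).
Implicit Types (v w K : pt -> R).

Lemma is_derive_aff (a : 'cV[R]_d) b x i : is_derive x (e_ i) (aff a b) (a i ord0).
Proof.
apply: is_derive_line.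
rewrite (_ : (fun _ => _) = (fun h : R => a i ord0 * h + aff a b x)); last first.
  apply/funext => h; rewrite /aff mulmxDl mxE -scalemxAl -rowE !mxE.
  by rewrite mulrC addrA.
have := is_deriveD' (is_deriveZ' (a i ord0) (is_derive_id (0 : R) 1))
  (is_derive_cst (aff a b x) (0 : R) (1 : R)).
by rewrite addr0 mulr1.
Qed.

Lemma norm_le_halves (t a b : R) : `|b| <= t / 2 -> `|a - b| <= t / 2 -> `|a| <= t.
Proof. by move=> h1 h2; have := ler_normD (a - b) b; rewrite subrK; lra. Qed.

Lemma add_half_le (t : R) : 0 < t -> t + t / 2 <= 2 * t.
Proof. by lra. Qed.

Definition affine_near v (x : pt) (a : 'cV[R]_d) : Prop :=
  exists2 r : R, 0 < r & forall y, cube x r y -> v y = v x + ((y - x) *m a) ord0 ord0.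

Lemma affine_near_derive v x a i : affine_near v x a -> is_derive x (e_ i) v (a i ord0).
Proof.
move=> [r r0 h]; apply: (is_derive_near _ (is_derive_aff a (v x - (x *m a) ord0 ord0) x i)).
apply/rV_nbhsP; exists r => // y hy; rewrite (h y hy) /aff mulmxBl !mxE; ring.
Qed.

Context (Omega : set pt) (n : R).
Hypotheses (oO : open Omega) (On : Omega `<=` cube 0 n).

Let mO : measurable Omega := open_measurable_rV oO.

Lemma lip1_bbs v (L : R) : (forall i, lip1 (e_ i) v L) -> (forall x, ~ Omega x -> v x = 0) -> bbs v.
Proof.
move=> hl v0; apply: (@continuous_bbs R d v (cbox (\row_i (- n)) (\row_i n))).
- exact: lip1_continuous hl.
- exact: compact_cbox.
- move=> x hx; apply: v0 => /On hc; apply: hx => i; have := hc i.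
  by rewrite !mxE sub0r normrN ltr_norml => /andP[h1 h2]; rewrite !ltW.
Qed.

Lemma H1norm_sqrE v q : H1 Omega v -> is_gradient Omega v q -> H1norm Omega v ^+ 2 =
  \int[mu]_x ((v \_ Omega) x ^+ 2 + \sum_i ((fun x => q x i ord0) \_ Omega) x ^+ 2).
Proof.
move=> hv hq; have [/L2P sv _] := hv.
have sq i : sqi ((fun x => q x i ord0) \_ Omega) by apply/L2P; case: hq.
have iq : intg (fun x => \sum_i ((fun x => q x i ord0) \_ Omega) x ^+ 2).
  by apply: intg_sum => i; case: (sq i).
have i1 := intg_eform (identity_bounds oO) measurableT hv hv.
rewrite (IntD (proj2 sv) iq) /H1norm sqr_sqrtr ?addr_ge0 ?sqr_ge0//.
rewrite L2norm_sqr gradnorm_sqr; congr (_ + _).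
apply: Int_ae; [by apply: intg_measurable; exact: i1|exact: intg_measurable|].
apply: filterS (gradient_ae oO hq) => x hx; rewrite indicT mul1r /edens indicE /patch.
have [Ox|nOx] := pselect (Omega x); last first.
  by rewrite memNset// mul0r big1// => i _; rewrite expr0n.
rewrite mem_set// mul1r mul1mx hx// dotE; apply: eq_bigr => i _; by rewrite expr2.
Qed.

Context (v : pt -> R) (p : pt -> 'cV[R]_d) (L : R).
Hypotheses (L0 : 0 <= L) (hl : forall i, lip1 (e_ i) v L) (v0 : forall x, ~ Omega x -> v x = 0)
  (mp : forall i, measurable_fun setT (fun x => p x i ord0))
  (pL : forall x i, `|p x i ord0| <= L)
  (hp : {ae mu, forall x, affine_near v x (p x) /\ (v x = 0 -> p x = 0)}).

Lemma affine_gradient : is_gradient Omega v p.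
Proof.
have bv := lip1_bbs hl v0; split=> [i|t i tt].
  apply/L2P; apply: (sqi_bounded_support (M := L) (n := n)).
  - apply/(measurable_restrictT _ mO); apply: measurable_funTS; exact: mp.
  - by move=> x; rewrite /patch; case: ifP => _ //; rewrite normr0.
  - move=> x; rewrite /patch; case: ifPn => [|_]; last by rewrite eqxx.
    by rewrite inE => /On.
have [L' l'] := test_lip i tt.
have wk f M M' : M <= M' -> lip1 (e_ i) f M -> lip1 (e_ i) f M'.
  by move=> MM' lf x h; apply: le_trans (lf x h) _; rewrite ler_wpM2r.
have out (f g : pt -> R) : (forall x, ~ Omega x -> g x = 0) ->
    \int[mu]_(x in Omega) (f x * g x) = \int[mu]_x (f x * g x).
  move=> g0; rewrite Rintegral_mkcond; apply: eq_Rintegral => x _.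
  by rewrite /patch; case: ifPn => //; rewrite notin_setE => /g0 ->; rewrite mulr0.
rewrite !out; last 2 first.
- by move=> x; exact: test_out.
- by move=> x; exact: test_deriv_out.
apply: (Int_by_parts (e := e_ i) (L := Num.max L L')) => //.
- exact: test_bbs tt.
- by case: (test_bbs (test_deriv i tt)).
- by apply: wk (hl i); rewrite le_max lexx.
- by apply: wk l'; rewrite le_max lexx orbT.
- by apply: filterS hp => x [h _]; exact: affine_near_derive.
- by apply: aeW => x; apply: smooth_is_derive; case: tt.
Qed.

Lemma affine_H1 : H1 Omega v.
Proof.
split; last by exists p; exact: affine_gradient.
apply/L2P; rewrite (_ : v \_ Omega = v); first exact: bbs_sqi (lip1_bbs hl v0).
by apply/funext => x; rewrite /patch; case: ifPn => //; rewrite notin_setE => /v0 ->.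
Qed.

Section one_mollification.
Context (t r : R) (K : pt -> R).
Hypotheses (t0 : 0 < t) (r0 : 0 < r) (rt : L * (d%:R * r) <= t / 2)
  (tK : test_function setT K) (K0 : forall y, 0 <= K y)
  (Kr : forall y, ~ cube 0 r y -> K y = 0) (K1 : \int[mu]_y K y = 1).

Let w x := trunc t (v x).
Let V := conv w K.

Let t0' : 0 <= t := ltW t0.

Lemma trunc_lip1 i : lip1 (e_ i) w L.
Proof. by move=> x h; apply: le_trans (trunc_lip _ _ t0') _; exact: hl. Qed.

Lemma trunc_out x : ~ Omega x -> w x = 0.
Proof. by move=> /v0 vx; rewrite /w vx trunc_eq0// normr0. Qed.

Let bw : bbs w := lip1_bbs trunc_lip1 trunc_out.
Let VE x : V x = \int[mu]_y (w (y + x) * K y) := conv_shift x bw tK.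
Let iK := bbs_intg (test_bbs tK).
Let ik x : intg (fun y => w (y + x) * K y).
Proof.
have [M hM] := test_shift_bound tK.
by apply: bbs_intg; apply: (bbs_mul (M := M)) => //; [exact: bbs_shift|case: (test_bbs tK)].
Qed.

Lemma near_values x y : cube 0 r y -> `|v (y + x) - v x| <= t / 2.
Proof.
move=> hy; apply: le_trans (lip1_lip hl _ _) _; apply: le_trans rt.
rewrite ler_wpM2l// -[d in d%:R](card_ord d) mulr_natl -sumr_const; apply: ler_sum => i _.
by have := hy i; rewrite !mxE addrK sub0r normrN => /ltW.
Qed.

Lemma mollified_test : test_function Omega V.
Proof.
split; first exact: conv_smooth.
exists [set x | t / 2 <= `|v x|]; split.
- apply: (@subclosed_compact _ _ (cbox (\row_i (- n)) (\row_i n))).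
  + have -> : [set x | t / 2 <= `|v x|] = (fun x => `|v x|) @^-1` [set s | t / 2 <= s] by [].
    apply: closed_comp => [x _|]; last exact: closed_ge.
    apply: (@continuous_comp _ _ _ v); [exact: (lip1_continuous hl)|exact: norm_continuous].
  + exact: compact_cbox.
  + move=> x /= vx; have [Ox|nO] := pselect (Omega x); last first.
      by move: vx; rewrite (v0 nO) normr0 leNgt divr_gt0.
    move=> i; have := On Ox i.
    by rewrite !mxE sub0r normrN ltr_norml => /andP[h1 h2]; rewrite !ltW.
- move=> x /= vx; apply: contrapT => nO; by move: vx; rewrite (v0 nO) normr0 leNgt divr_gt0.
- move=> x /= vx; rewrite VE -[RHS](@Int0 R d); apply: eq_Rintegral => y _.
  have [cy|ncy] := pselect (cube 0 r y); last by rewrite Kr// mulr0.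
  rewrite /w trunc_eq0 ?mul0r//; apply: norm_le_halves (near_values x cy).
  by move/negP: vx; rewrite -ltNge; exact: ltW.
Qed.

Lemma mollified_dist x : `|V x - v x| <= 2 * t.
Proof.
have -> : V x - v x = \int[mu]_y ((w (y + x) - v x) * K y).
  under eq_Rintegral do rewrite mulrBl.
  by rewrite IntB ?IntZ ?K1 ?mulr1 ?VE//; exact: intg_scale.
have i1 : intg (fun y => (w (y + x) - v x) * K y).
  have -> : (fun y => (w (y + x) - v x) * K y) = (fun y => w (y + x) * K y - v x * K y).
    by apply/funext => y; rewrite mulrBl.
  by apply: intg_sub => //; exact: intg_scale.
have -> : 2 * t = \int[mu]_y (2 * t * K y) by rewrite (IntZ _ iK) K1 mulr1.
apply: le_trans (Int_norm i1) _.
apply: Int_le; [exact: intg_norm|exact: intg_scale|move=> y].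
rewrite normrM (ger0_norm (K0 y)).
have [cy|ncy] := pselect (cube 0 r y); last by rewrite Kr// !mulr0.
rewrite ler_wpM2r//; have h1 := near_values x cy; have h2 := trunc_le (v (y + x)) t0'.
have -> : w (y + x) - v x = (trunc t (v (y + x)) - v (y + x)) + (v (y + x) - v x) by rewrite /w addrA subrK.
apply: le_trans (ler_normD _ _) _; apply: le_trans (lerD h2 h1) _.
exact: add_half_le.
Qed.

Lemma mollified_diff x h (a : R) : (forall y, cube 0 r y -> w (y + x + h) - w (y + x) = a) ->
  V (x + h) - V x = a.
Proof.
move=> ha; rewrite !VE -IntB//.
transitivity (\int[mu]_y (a * K y)); last by rewrite (IntZ _ iK) K1 mulr1.
apply: eq_Rintegral => y _; rewrite -mulrBl.
have [cy|ncy] := pselect (cube 0 r y); last by rewrite Kr// !mulr0.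
by rewrite addrA ha.
Qed.

Lemma mollified_lip1 i : lip1 (e_ i) V L.
Proof.
move=> x h; rewrite !VE -IntB//; set f := fun y : pt => _.
have i1 : intg f by exact: intg_sub.
apply: le_trans (Int_norm i1) _; rewrite -[leRHS]mulr1 -K1 -(IntZ _ iK).
apply: Int_le; [exact: intg_norm|exact: intg_scale|move=> y].
rewrite /f -mulrBl normrM (ger0_norm (K0 y)) ler_wpM2r// addrA; exact: trunc_lip1.
Qed.

Lemma mollified_derive x s (a : 'cV[R]_d) (c : R) i : 2 * r <= s ->
  (forall z, cube x s z -> w z = aff a c z) -> is_derive x (e_ i) V (a i ord0).
Proof.
move=> rs hz; apply: is_derive_line.
have E (h : R) : `|h| < r -> V (h *: e_ i + x) = a i ord0 * h + V x.
  move=> hr; rewrite addrC -(subrK (V x) (V (x + h *: e_ i))); congr (_ + _).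
  apply: mollified_diff => y hy; have y' j : `|y ord0 j| < r.
    by have := hy j; rewrite mxE sub0r normrN.
  rewrite !hz.
  - by rewrite affB [y + x + _]addrC addrK -scalemxAl -rowE !mxE mulrC.
  - by move=> j; rewrite !mxE opprD addrCA subrr addr0 normrN; apply: lt_le_trans rs; apply: lt_trans (y' j) _; rewrite mulr_natl mulr2n ltrDl.
  - move=> j; rewrite !mxE.
    have -> : x ord0 j - (y ord0 j + x ord0 j + h * (((ord0 : 'I_1) == ord0) && (j == i))%:R) =
      - (y ord0 j + h * (((ord0 : 'I_1) == ord0) && (j == i))%:R) by ring.
    rewrite normrN; apply: le_lt_trans (ler_normD _ _) _; apply: lt_le_trans rs.
    have : `|h * (((ord0 : 'I_1) == ord0) && (j == i))%:R| <= `|h|.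
      by rewrite normrM; case: (_ && _); rewrite ?normr1 ?mulr1// normr0 mulr0.
    by move=> hh; rewrite mulr_natl mulr2n; apply: ltr_leD => //; exact: le_trans hh (ltW hr).
suff D : is_derive (0 : R) 1 (fun h : R => a i ord0 * h + V x) (a i ord0).
  apply: (is_derive_near _ D); exists r => //= h.
  by rewrite /ball /= sub0r normrN => /E.
have := is_deriveD' (is_deriveZ' (a i ord0) (is_derive_id (0 : R) 1))
  (is_derive_cst (V x) (0 : R) (1 : R)).
by rewrite addr0 mulr1.
Qed.

End one_mollification.

(* Away from the zero set the truncation only changes the constant term; on the
   zero set the slope vanishes almost everywhere. *)
Lemma trunc_affine x : affine_near v x (p x) -> (v x = 0 -> p x = 0) ->
  exists2 s : R, 0 < s & exists2 t1 : R, 0 < t1 & forall t, 0 < t -> t < t1 ->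
  exists c, forall z, cube x s z -> trunc t (v z) = aff (p x) c z.
Proof.
move=> [s s0 hs] h0; have [vx0|vxn0] := eqVneq (v x) 0.
  exists s => //; exists 1 => // t tt _; exists 0 => z hz.
  by rewrite (hs z hz) h0// /aff !mulmx0 mxE vx0 !add0r trunc_eq0// normr0 ltW.
have a0 : 0 < `|v x| by rewrite normr_gt0.
pose s' := Num.min s (`|v x| / 2 / (L * d%:R + 1)).
have q0 : 0 < L * d%:R + 1 by rewrite ltr_wpDl// mulr_ge0.
exists s'; first by rewrite lt_min s0 !divr_gt0.
exists (`|v x| / 2); first by rewrite divr_gt0.
move=> t tt tv.
have close z : cube x s' z -> `|v z - v x| <= `|v x| / 2.
  move=> hz; apply: le_trans (lip1_lip hl _ _) _.
  apply: (@le_trans _ _ (L * (d%:R * (`|v x| / 2 / (L * d%:R + 1))))).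
    rewrite ler_wpM2l// -[d in d%:R](card_ord d) mulr_natl -sumr_const; apply: ler_sum => i _.
    by have := hz i; rewrite lt_min distrC => /andP[_ /ltW]; rewrite card_ord.
  have -> : L * (d%:R * (`|v x| / 2 / (L * d%:R + 1))) = L * d%:R * (`|v x| / 2) / (L * d%:R + 1).
    by ring.
  rewrite ler_pdivrMr// mulrC ler_wpM2l ?divr_ge0//; lra.
have aE z : cube x s' z -> v z = aff (p x) (v x - (x *m p x) ord0 ord0) z.
  move=> hz; rewrite hs; last by move=> i; have := hz i; rewrite lt_min => /andP[].
  by rewrite /aff mulmxBl !mxE; ring.
have [vp|vn] := ltP 0 (v x).
  exists (v x - (x *m p x) ord0 ord0 - t) => z hz.
  have := close z hz; rewrite ler_norml gtr0_norm// => /andP[h1 h2].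
  move: tv; rewrite gtr0_norm// => tv.
  rewrite /trunc ifT; last by lra.
  by rewrite (aE z hz) /aff; ring.
exists (v x - (x *m p x) ord0 ord0 + t) => z hz.
have := close z hz; rewrite ler_norml ler0_norm// => /andP[h1 h2].
move: tv; rewrite ler0_norm// => tv.
rewrite /trunc ifF; last by apply/negbTE; rewrite -leNgt; lra.
rewrite ifT; last by lra.
by rewrite (aE z hz) /aff; ring.
Qed.

Lemma affine_H10 : H10 Omega v.
Proof.
split; first exact: affine_H1.
move=> e e0.
pose t (m : nat) : R := m.+1%:R^-1.
have tp m : 0 < t m by rewrite invr_gt0.
have q0 : 0 < L * d%:R + 1 by rewrite ltr_wpDl// mulr_ge0.
pose r m := t m / (2 * (L * d%:R + 1)).
have rp m : 0 < r m by rewrite divr_gt0// mulr_gt0.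
have rt m : L * (d%:R * r m) <= t m / 2.
  have -> : L * (d%:R * r m) = t m / 2 * (L * d%:R) / (L * d%:R + 1).
    by rewrite /r; field; rewrite gt_eqF.
  rewrite ler_pdivrMr// ler_wpM2l ?divr_ge0 ?ltW//; lra.
have /choice[K hK] m := mollifier d (rp m).
pose V m := conv (fun x => trunc (t m) (v x)) (K m).
have tV m : test_function Omega (V m).
  by have [h1 h2 h3 h4] := hK m; exact: (mollified_test (tp m) (rt m) h1 h3).
have dV m x : `|V m x - v x| <= 2 * t m.
  by have [h1 h2 h3 h4] := hK m; exact: (mollified_dist (tp m) (rt m) h1 h2 h3 h4).
have DV m i x : `|'D_(e_ i) (V m) x| <= L.
  have [h1 h2 h3 h4] := hK m; have := mollified_lip1 (tp m) h1 h2 h4 i => hV.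
  by apply: (lip1_derive_le hV); apply: smooth_is_derive; case: (tV m).
have gV m := is_gradient_lin (-1) (proj1 (test_H1 oO (tV m))) (proj1 affine_H1)
  (test_gradient (tV m) mO) affine_gradient.
pose F m x := ((fun y => -1 * V m y + v y) \_ Omega) x ^+ 2 +
  \sum_i ((fun y => (-1 *: (\col_j 'D_(e_ j) (V m) y) + p y) i ord0) \_ Omega) x ^+ 2.
have FE m : H1norm Omega (v \- V m) ^+ 2 = \int[mu]_x F m x.
  have -> : v \- V m = (fun x => -1 * V m x + v x) by apply/funext => x /=; ring.
  by apply: H1norm_sqrE (gV m); apply: H1_lin; [exact: test_H1|exact: affine_H1].
have bV := lip1_bbs hl v0.
have mF m : measurable_fun setT (F m).
  apply: measurable_funD.
    apply: measurable_funX; apply/(measurable_restrictT _ mO); apply: measurable_funTS.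
    apply: measurable_funD; last by case: bV.
    by apply: measurable_funM; [exact: measurable_cst|case: (test_bbs (tV m))].
  apply: measurable_sum => i; apply: measurable_funX.
  apply/(measurable_restrictT _ mO); apply: measurable_funTS.
  under eq_fun do rewrite !mxE; apply: measurable_funD => //.
  by apply: measurable_funM; [exact: measurable_cst|case: (test_bbs (test_deriv i (tV m)))].
pose g (x : pt) : R := (4 + d%:R * (2 * L) ^+ 2) * \1_(cube 0 n) x.
have ig : intg g.
  by apply: intg_scale; apply: intg_indic; [exact: measurable_cube|exact: cube_bounded_lty].
have c0 : 0 <= 4 + d%:R * (2 * L) ^+ 2 by rewrite addr_ge0// mulr_ge0// sqr_ge0.
have F0 x m : 0 <= F m x.
  by rewrite addr_ge0 ?sqr_ge0//; apply: sumr_ge0 => i _; exact: sqr_ge0.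
have Fg m x : `|F m x| <= g x.
  rewrite ger0_norm// /F /g /patch; case: ifPn => [|_]; last first.
    rewrite expr0n big1 ?addr0 ?mulr_ge0 ?indicE// => i _; by rewrite expr0n.
  rewrite inE => /On cx; rewrite indicE mem_set// mulr1; apply: lerD.
    have := dV m x; have : t m <= 1 by rewrite invf_le1// ler1n.
    move=> h1 h2; have : `|v x - V m x| <= 2 by rewrite distrC; lra.
    rewrite (_ : -1 * V m x + v x = v x - V m x); last by ring.
    by rewrite ler_norml => /andP[]; nra.
  rewrite -[d in d%:R](card_ord d) mulr_natl -sumr_const; apply: ler_sum => i _.
  rewrite !mxE; have := DV m i x; have := pL x i.
  move: (p x i ord0) ('D_(e_ i) (V m) x) => a b h1 h2.
  have h3 : `|-1 * b + a| <= 2 * L.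
    by apply: le_trans (ler_normD _ _) _; rewrite normrM normrN normr1; lra.
  by rewrite -real_normK ?num_real// ler_sqr ?nnegrE// mulr_ge0.
have tc : t @ \oo --> 0 by exact: cvg_harmonic.
have Fc : {ae mu, forall x, F ^~ x @ \oo --> (0 : R)}.
  apply: filterS hp => x [h1 h2].
  have [Ox|nOx] := pselect (Omega x); last first.
    rewrite (_ : F ^~ x = fun=> 0); first exact: cvg_cst.
    apply/funext => m; rewrite /F /patch memNset// expr0n big1 ?addr0// => i _; by rewrite expr0n.
  have [s s0 [t1 t10 hs]] := trunc_affine h1 h2.
  have u0 : (fun m => 4 * (t m * t m)) @ \oo --> (0 : R).
    have := cvgM (cvg_cst (4 : R)) (cvgM tc tc); rewrite mulr0 mulr0; exact.
  apply: (squeeze_cvgr _ (cvg_cst 0) u0).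
  have ht : \forall m \near \oo, t m < t1 by apply: (cvgr_lt 0).
  have hr : \forall m \near \oo, t m < s * (L * d%:R + 1) by apply: (cvgr_lt 0) => //; exact: mulr_gt0.
  near=> m; rewrite F0/=.
  have [c hc] : exists c, forall z, cube x s z -> trunc (t m) (v z) = aff (p x) c z.
    by apply: hs => //; near: m.
  have rs : 2 * r m <= s.
    rewrite /r (_ : 2 * (t m / (2 * (L * d%:R + 1))) = t m / (L * d%:R + 1)); last first.
      by field; rewrite gt_eqF.
    by rewrite ler_pdivrMr// ltW//; near: m.
  have [k1 k2 k3 k4] := hK m.
  have D i : 'D_(e_ i) (V m) x = p x i ord0.
    exact: (derive_val (is_derive := mollified_derive (tp m) (rp m) k1 k3 k4 i rs hc)).
  rewrite /F /patch mem_set// big1 => [|i _]; last first.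
    by rewrite !mxE D mulN1r addNr expr0n.
  rewrite addr0 (_ : -1 * V m x + v x = v x - V m x); last by ring.
  have := dV m x; rewrite distrC ler_norml => /andP[h3 h4].
  by move: h3 h4; move: (v x - V m x) (tp m) => y; nra.
have [_ lim] := Int_dct mF (measurable_cst (0 : R)) ig Fg Fc.
have : \forall m \near \oo, \int[mu]_x F m x < e ^+ 2.
  by apply: (cvgr_lt _ lim); rewrite Int0 exprn_gt0.
move=> [N _ /(_ N (leqnn N))] hN; exists (V N); split=> //.
by rewrite -(ltr_pXn2r (n := 2))// ?nnegrE ?sqrtr_ge0 ?ltW// FE.
Unshelve. all: by end_near.
Qed.

End piecewise_affine_H10.

(** * Finite element functions *)

Section local_lipschitz.
Context (R : realType).

Lemma local_lip (g : R -> R) (L a b : R) : a <= b ->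
  (forall t, a <= t <= b -> exists2 e, 0 < e & forall s, a <= s <= b -> `|s - t| < e ->
    `|g s - g t| <= L * `|s - t|) ->
  `|g b - g a| <= L * (b - a).
Proof.
move=> ab hloc; pose A := [set t | a <= t <= b /\ `|g t - g a| <= L * (t - a)].
have Aa : A a by split; rewrite ?lexx// !subrr mulr0 normr0.
have ubA : has_ubound A by exists b => t [/andP[]].
have sA : has_sup A by split => //; exists a.
pose c := sup A.
have ac : a <= c by exact: ub_le_sup.
have cb : c <= b by apply: ge_sup; [exists a|move=> t [/andP[]]].
have [e e0 he] := hloc c (introT andP (conj ac cb)).
have Ac : A c.
  split; first by rewrite ac cb.
  have [t At ct] := sup_adherent e0 sA.
  have tc : t <= c by exact: ub_le_sup.
  have [tab tA] := At.
  have tc' : `|t - c| = c - t by rewrite distrC ger0_norm ?subr_ge0.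
  have h : `|g t - g c| <= L * (c - t).
    by rewrite -tc'; apply: he => //; rewrite tc'; move: ct; rewrite -/c; lra.
  have -> : g c - g a = (g c - g t) + (g t - g a) by ring.
  by apply: le_trans (ler_normD _ _) _; rewrite distrC; lra.
have [cb'|bc] := ltP c b; last first.
  have [_ h] := Ac; have cE : c = b by apply/le_anti; rewrite cb bc.
  by rewrite -cE.
pose s := Num.min b (c + e / 2).
have cs : c < s by rewrite lt_min cb' ltrDl divr_gt0.
have sb : s <= b by rewrite ge_min lexx.
have se : s <= c + e / 2 by rewrite ge_min lexx orbT.
have sab : a <= s <= b by rewrite sb (le_trans ac (ltW cs)).
have As : A s.
  split=> //; have [_ hc] := Ac.
  have h : `|g s - g c| <= L * (s - c).
    have sc : `|s - c| = s - c by rewrite gtr0_norm ?subr_gt0.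
    by rewrite -sc; apply: he => //; rewrite sc; lra.
  have -> : g s - g a = (g s - g c) + (g c - g a) by ring.
  by apply: le_trans (ler_normD _ _) _; lra.
by have := ub_le_sup ubA As; rewrite -/c leNgt cs.
Qed.

End local_lipschitz.

Section finite_elements.
Context (R : realType) (d : nat).
Local Notation pt := 'rV[R]_d.
Local Notation mu := (lebesgue_rV R d).
Local Notation e_ := (@basis_vector R d).
Implicit Types (S : {fset pt}) (p q : pt).

Lemma near_seq (I : eqType) (s : seq I) (P : I -> pt -> Prop) (x : pt) :
  (forall i, i \in s -> nbhs x (P i)) -> nbhs x (fun y => forall i, i \in s -> P i y).
Proof.
elim: s => [|i s IH] h; first by apply: filterE.
have h1 := h i (mem_head _ _).
have h2 : nbhs x (fun y => forall j, j \in s -> P j y).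
  by apply: IH => j js; apply: h; rewrite inE js orbT.
by apply: filterS2 h1 h2 => y Pi Ps j; rewrite inE => /orP[/eqP ->|/Ps].
Qed.

Lemma near_aff_gt (a : 'cV[R]_d) b c (x : pt) : c < aff a b x -> nbhs x (fun y => c < aff a b y).
Proof. by move=> h; apply: open_nbhs_nbhs; split=> //; exact: open_aff_gt. Qed.

Lemma affN (a : 'cV[R]_d) b (x : pt) : aff (- a) (- b) x = - aff a b x.
Proof. by rewrite /aff mulmxN mxE opprD. Qed.

Lemma enorm_delta (i : 'I_d) : enorm (delta_mx i ord0 : 'cV[R]_d) = 1.
Proof.
by rewrite -[LHS]ger0_norm ?enorm_ge0// -sqrtr_sqr enorm_dot dot_delta1 sqrtr1.
Qed.

Context (Omega : set pt) (T : {fset {fset pt}}).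
Hypotheses (d0 : (0 < d)%N) (pO : polyhedral_domain Omega) (tri : triangulation Omega T).

Let oO : open Omega := domain_open pO.
Let sT S (ST : S \in T) : simplex S := mesh_simplex tri ST.

Lemma near_hull (x : pt) : nbhs x (fun y => forall S, S \in T -> hull S y -> hull S x).
Proof.
apply: (@near_seq _ (enum_fset T) (fun S y => hull S y -> hull S x)) => S ST.
have [hx|nhx] := pselect (hull S x); first by apply: filterE.
have : nbhs x (~` hull S).
  by apply: open_nbhs_nbhs; split=> //; apply: closed_openC; exact: closed_hull (sT ST).
by apply: filterS => y.
Qed.

Lemma star_domain S p x : S \in T -> p \in S -> Omega p -> hull S x -> 0 < bary S p x -> Omega x.
Proof.
move=> ST pS Op hx px.
have homothety S' q (s : R) (y : pt) :
    bary S' q (p + s *: (y - p)) = (1 - s) * bary S' q p + s * bary S' q y.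
  rewrite /bary /aff mulmxDl -scalemxAl mulmxBl !mxE; ring.
have hp := vertex_hull (sT ST) pS.
have bp S' : S' \in T -> p \in S' -> forall q, q \in S' -> bary S' q p = (q == p)%:R.
  by move=> S'T pS'; have [h _ _] := baryP (sT S'T) => q qS'; exact: h.
(* Near x, the cone at p over an element around p lies in that element. *)
have cone S' : S' \in T -> nbhs x (fun y => p \in S' ->
    (forall q, q \in S' -> q != p -> 0 <= bary S' q y) -> hull S' y).
  move=> S'T; have [pS'|npS'] := boolP (p \in S'); last by apply: filterE.
  have [hcone|] := pselect (forall q, q \in S' -> q != p -> 0 <= bary S' q x); last first.
    move=> /existsNP[q /not_implyP[qS' /not_implyP[qp /negP]]]; rewrite -ltNge => qx.
    have : nbhs x (fun y => 0 < aff (- bslope S' q) (- (bary_data S').2 q) y).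
      by apply: near_aff_gt; rewrite affN oppr_gt0.
    apply: filterS => y; rewrite affN oppr_gt0 => qy _ h.
    by have := h q qS' qp; rewrite /bary leNgt qy.
  have b0 : 0 < 1 + `|bary S' p x| by rewrite ltr_pwDl.
  pose s := (1 + `|bary S' p x|)^-1.
  have s0 : 0 < s by rewrite invr_gt0.
  have s1 : s <= 1 by rewrite invf_le1// lerDl.
  pose y := p + s *: (x - p).
  have hy : hull S y.
    apply/(hullP (sT ST)) => q qS; rewrite homothety; apply: addr_ge0.
      by apply: mulr_ge0; [rewrite subr_ge0|exact: (proj1 (hullP (sT ST) p) hp)].
    by apply: mulr_ge0; [exact: ltW|exact: (proj1 (hullP (sT ST) x) hx)].
  have hy' : hull S' y.
    apply/(hullP (sT S'T)) => q qS'; rewrite homothety (bp S')//.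
    have [->|qp] := eqVneq q p; last first.
      by rewrite mulr0 add0r; apply: mulr_ge0; [exact: ltW|exact: hcone].
    have -> : (1 - s) * true%:R + s * bary S' p x = s * (`|bary S' p x| + bary S' p x).
      have sE : s * (1 + `|bary S' p x|) = 1 by rewrite /s mulVf// gt_eqF.
      by rewrite (_ : true%:R = 1 :> R)// mulr1 -{1}sE; move: `|bary S' p x| => c; ring.
    apply: mulr_ge0; first exact: ltW.
    by rewrite -[X in _ + X]opprK subr_ge0 -normrN ler_norm.
  have := bary_face tri ST S'T hy hy' pS; rewrite pS' !homothety !bp// eqxx => /addrI.
  move=> /(mulfI (lt0r_neq0 s0)) E; have : nbhs x (fun y => 0 < bary S' p y).
    by apply: near_aff_gt; rewrite -/(bary S' p x) -E.
  apply: filterS => z pz _ hz; apply/(hullP (sT S'T)) => q qS'.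
  by have [->|qp] := eqVneq q p; [exact: ltW|exact: hz].
have {cone} cones : nbhs x (fun y => forall S', S' \in enum_fset T -> p \in S' ->
    (forall q, q \in S' -> q != p -> 0 <= bary S' q y) -> hull S' y).
  by apply: (@near_seq _ (enum_fset T)) => S' S'T; exact: cone.
have : nbhs p (fun y => Omega y /\ forall S, S \in T -> hull S y -> hull S p).
  by apply: filterI (near_hull p); exact: open_nbhs_nbhs.
move=> /rV_nbhsP[r r0 hr].
pose m := enorm (x - p) + 1; have m0 : 0 < m by rewrite ltr_wpDl// enorm_ge0.
pose s := Num.min 1 (r / m); have s0 : 0 < s by rewrite lt_min ltr01 divr_gt0.
have [_ _ _ _ <-] := pO.
have : nbhs x (cube x 1) by apply: open_nbhs_nbhs; split; [exact: open_cube|move=> i; rewrite subrr normr0].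
apply: filterS2 cones => y hy cy.
have [Oy /= hpy] : Omega (p + s *: (y - p)) /\ forall S, S \in T -> hull S (p + s *: (y - p)) -> hull S p.
  apply: hr => i; rewrite !mxE opprD addrA subrr sub0r normrN normrM gtr0_norm//.
  have h1 : `|y ord0 i - p ord0 i| < m.
    have -> : y ord0 i - p ord0 i = (y ord0 i - x ord0 i) + (x - p) ord0 i by rewrite !mxE; ring.
    apply: le_lt_trans (ler_normD _ _) _; rewrite addrC /m ler_ltD ?coord_enorm//.
    by rewrite distrC; exact: cy.
  apply: (@lt_le_trans _ _ (s * m)); first by rewrite ltr_pM2l.
  by rewrite -ler_pdivlMr// ge_min lexx orbT.
have [S' S'T hy'] := mesh_coverO tri Oy.
have pS' : p \in S'.
  have := bary_face tri ST S'T hp (hpy _ S'T hy') pS; rewrite (bp S)// eqxx.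
  by case: ifP => // _ /eqP; rewrite oner_eq0.
apply: (hull_closure tri S'T); apply: (hy S' S'T pS') => q qS' qp.
have := proj1 (hullP (sT S'T) _) hy' q qS'.
by rewrite homothety (bp S')// (negbTE qp) mulr0 add0r pmulr_rge0.
Qed.

Definition slope (v : pt -> R) S : 'cV[R]_d := \sum_(p <- S) v p *: bslope S p.
Definition offset (v : pt -> R) S : R := \sum_(p <- S) v p * (bary_data S).2 p.

Lemma aff_slopeE v S x : aff (slope v S) (offset v S) x = \sum_(p <- S) bary S p x * v p.
Proof.
rewrite /aff /slope /offset mulmx_sumr summxE -big_split; apply: eq_bigr => p _.
have -> : (x *m (v p *: bslope S p)) ord0 ord0 = v p * (x *m bslope S p) ord0 ord0.
  by rewrite -scalemxAr mxE.
by rewrite /bary /aff /= -mulrDr mulrC.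
Qed.

Definition piecewise_affine (v : pt -> R) : Prop :=
  forall S, S \in T -> forall x, hull S x -> v x = aff (slope v S) (offset v S) x.

Lemma affine_on_slope v S : simplex S -> affine_on (hull S) v ->
  forall x, hull S x -> v x = aff (slope v S) (offset v S) x.
Proof.
move=> sS [a [b h]] x hx; rewrite aff_slopeE h// -/(aff a b x) (affE sS).
rewrite big_seq [RHS]big_seq; apply: eq_bigr => p pS.
by rewrite h//; exact: vertex_hull.
Qed.

Lemma P1_piecewise v : P1 Omega T v -> piecewise_affine v.
Proof. by move=> [_ _ h _] S ST; apply: affine_on_slope (sT ST) (h S ST). Qed.

Section piecewise.
Context (v : pt -> R).
Hypotheses (pv : piecewise_affine v) (v0 : forall x, ~ Omega x -> v x = 0).

Definition slope_bound : R := \sum_(S <- T) enorm (slope v S).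

Lemma slope_bound_ge0 : 0 <= slope_bound.
Proof. by apply: sumr_ge0 => S _; exact: enorm_ge0. Qed.

Lemma slope_le S : S \in T -> enorm (slope v S) <= slope_bound.
Proof.
move=> ST; rewrite /slope_bound (big_rem S)//= lerDl; apply: sumr_ge0 => S' _.
exact: enorm_ge0.
Qed.

Lemma piecewise_lip1 i : lip1 (e_ i) v slope_bound.
Proof.
have loc x : nbhs x (fun y => `|v y - v x| <= slope_bound * enorm (y - x)).
  have [Ox|nOx] := pselect (Omega x).
    have : nbhs x Omega by exact: open_nbhs_nbhs.
    apply: filterS2 (near_hull x) => y hy Oy.
    have [S ST hSy] := mesh_coverO tri Oy.
    rewrite !(pv ST)//; last exact: hy hSy.
    by apply: le_trans (aff_lip _ _ _ _) _; rewrite ler_wpM2r ?enorm_ge0//; exact: slope_le.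
  apply: filterS (near_hull x) => y hy; have [Oy|nOy] := pselect (Omega y); last first.
    by rewrite !v0// subrr normr0 mulr_ge0 ?enorm_ge0// slope_bound_ge0.
  have [S ST hSy] := mesh_coverO tri Oy.
  rewrite !(pv ST)//; last exact: hy hSy.
  by apply: le_trans (aff_lip _ _ _ _) _; rewrite ler_wpM2r ?enorm_ge0//; exact: slope_le.
have e1 (t : R) : enorm (t *: e_ i) = `|t|.
  by rewrite enormZ -enorm_tr trmx_delta enorm_delta mulr1.
have pos x (h : R) : 0 <= h -> `|v (x + h *: e_ i) - v x| <= slope_bound * h.
  move=> h0; have := @local_lip R (fun t => v (x + t *: e_ i)) slope_bound 0 h h0.
  rewrite scale0r addr0 subr0; apply=> t _.
  have /rV_nbhsP[r r0 hr] := loc (x + t *: e_ i).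
  exists r => // s _ st; have -> : `|s - t| = enorm (x + s *: e_ i - (x + t *: e_ i)).
    by rewrite opprD addrACA subrr add0r -scalerBl e1.
  apply: hr => j; rewrite !mxE opprD addrACA subrr add0r -mulrBl normrM.
  apply: le_lt_trans st; rewrite distrC; case: (_ && _); rewrite ?normr1 ?mulr1// normr0 mulr0.
  exact: normr_ge0.
move=> x h; have [h0|h0] := leP 0 h; first by rewrite (ger0_norm h0); exact: pos.
rewrite (ltr0_norm h0) distrC.
have := pos (x + h *: e_ i) (- h); rewrite scaleNr addrK; apply.
by rewrite oppr_ge0 ltW.
Qed.

Definition pgrad (x : pt) : 'cV[R]_d := \sum_(S <- T) (\1_(hull S) x : R) *: slope v S.

Lemma ae_pgrad : {ae mu, forall x, forall S, S \in T -> hull S x -> pgrad x = slope v S}.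
Proof.
apply: filterS (ae_osimplex d0 tri) => x hx S ST /(hx S ST) ox.
rewrite /pgrad (big_rem S)//= indicE mem_set; last exact: osimplex_hull (sT ST) _ _.
rewrite scale1r big_seq big1 ?addr0// => S'; rewrite mem_rem_uniq ?fset_uniq// inE => /andP[SS' S'T].
rewrite indicE memNset ?scale0r// => hx'.
by move: SS'; rewrite (osimplex_disjoint tri ST S'T ox hx') eqxx.
Qed.

Lemma pgradE x i : pgrad x i ord0 = \sum_(S <- T) \1_(hull S) x * slope v S i ord0.
Proof. by rewrite /pgrad summxE; apply: eq_bigr => S _; rewrite mxE. Qed.

Lemma measurable_hull S : S \in T -> measurable (hull S).
Proof. by move=> ST; apply: closed_measurable_rV; exact: closed_hull (sT ST). Qed.

Lemma measurable_pgrad i : measurable_fun setT (fun x => pgrad x i ord0).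
Proof.
pose F S (x : pt) : R := if S \in T then \1_(hull S) x * slope v S i ord0 else 0.
have -> : (fun x => pgrad x i ord0) = fun x => \sum_(S <- T) F S x.
  apply/funext => x; rewrite pgradE big_seq [RHS]big_seq.
  by apply: eq_bigr => S ST; rewrite /F ST.
suff mF S : measurable_fun setT (F S) by exact: measurable_sum.
rewrite /F; case: (boolP (S \in T)) => ST; last exact: measurable_cst.
apply: measurable_funM; last exact: measurable_cst.
by apply: measurable_indic; exact: measurable_hull.
Qed.

Lemma pgrad_le x i : `|pgrad x i ord0| <= slope_bound.
Proof.
rewrite pgradE; apply: le_trans (ler_norm_sum _ _ _) _; apply: ler_sum => S _.
have h : `|slope v S i ord0| <= enorm (slope v S).
  by have := coord_enorm (slope v S)^T i; rewrite mxE enorm_tr.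
rewrite normrM indicE; case: (_ \in _); rewrite ?normr1 ?mul1r// normr0 mul0r.
exact: enorm_ge0.
Qed.

Lemma ae_affine_near : {ae mu, forall x, affine_near v x (pgrad x) /\ (v x = 0 -> pgrad x = 0)}.
Proof.
have nul : {ae mu, forall x, forall S, S \in enum_fset T -> slope v S != 0 ->
    aff (slope v S) (offset v S) x <> 0}.
  apply: ae_seq => S ST; have [s0|sn0] := eqVneq (slope v S) 0.
    by apply: aeW => x; rewrite s0.
  have := ae_null (measurable_hyperplane (slope v S) (- offset v S)) (hyperplane_null _ sn0).
  by apply: filterS => x hx _ /eqP; rewrite /aff addr_eq0 => /eqP.
apply: filterS3 nul ae_pgrad (ae_osimplex d0 tri) => x hn hg ho.
have [[S [ST hS]]|nS] := pselect (exists S, S \in T /\ hull S x).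
  have E := hg S ST hS; split.
    have /rV_nbhsP[r r0 hr] : nbhs x (osimplex S).
      by apply: open_nbhs_nbhs; split; [exact: open_osimplex|exact: ho].
    exists r => // y /hr/(osimplex_hull (sT ST)) hy.
    by rewrite E (pv ST hy) (pv ST hS) -(affB (slope v S) (offset v S)) addrC subrK.
  by rewrite E (pv ST hS) => a0; apply/eqP/negPn/negP => /(hn S ST).
have nc : ~ closure Omega x by move=> /(mesh_cover tri)[S ST h]; apply: nS; exists S.
have nO : ~ Omega x by move=> /subset_closure.
have p0 : pgrad x = 0.
  rewrite /pgrad big_seq big1// => S ST; rewrite indicE memNset ?scale0r// => h.
  by apply: nS; exists S.
rewrite p0; split=> //.
have /rV_nbhsP[r r0 hr] : nbhs x (~` closure Omega).
  by apply: open_nbhs_nbhs; split=> //; apply: closed_openC; exact: closed_closure.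
exists r => // y hy; rewrite mulmx0 mxE addr0 !v0// => /subset_closure Oy.
exact: hr hy Oy.
Qed.

Lemma closure_bounded : covers Omega T -> exists2 n : R, 0 <= n & closure Omega `<=` cube 0 n.
Proof.
move=> [sS cov].
have /choice[n hn] : forall S, exists n : R, S \in T -> hull S `<=` cube 0 n.
  move=> S; have [ST|nST] := boolP (S \in T); last by exists 0.
  by have [n hn] := hull_bounded (sS S ST); exists n.
exists (\sum_(S <- T) `|n S|); first exact: sumr_ge0.
move=> x; rewrite -cov => -[S ST hx] i; apply: lt_le_trans (hn S ST x hx i) _.
by apply: le_trans (ler_norm _) _; rewrite (big_rem S)//= lerDl sumr_ge0.
Qed.

Lemma domain_bounded : exists2 n : R, 0 <= n & Omega `<=` cube 0 n.
Proof.
have [n n0 hn] := closure_bounded (proj1 tri); exists n => // x Ox; apply: hn.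
exact: subset_closure.
Qed.

Lemma piecewise_P1 : P1 Omega T v.
Proof.
have [n n0 On] := domain_bounded.
split=> //.
- exact: (affine_H10 oO On slope_bound_ge0 piecewise_lip1 v0 measurable_pgrad pgrad_le ae_affine_near).
- exact: lip1_continuous piecewise_lip1.
- by move=> S ST; exists (slope v S), (offset v S) => x hx; exact: pv.
Qed.

Lemma grad_slope : {ae mu, forall x, Omega x -> forall S, S \in T -> hull S x ->
  grad Omega v x = slope v S}.
Proof.
have [n n0 On] := domain_bounded.
have := gradient_ae oO (affine_gradient oO On slope_bound_ge0 piecewise_lip1 v0 measurable_pgrad
  pgrad_le ae_affine_near).
by apply: filterS2 ae_pgrad => x h1 h2 Ox S ST hx; rewrite h2// (h1 S).
Qed.

End piecewise.

Definition nodal (c : pt -> R) (x : pt) : R :=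
  let S := xget fset0 [set S | S \in T /\ hull S x] in
  if `[< exists S, S \in T /\ hull S x >] then \sum_(p <- S) bary S p x * c p else 0.

Lemma nodalE c S x : S \in T -> hull S x -> nodal c x = \sum_(p <- S) bary S p x * c p.
Proof.
move=> ST hx; rewrite /nodal; case: asboolP => [_|]; last by case; exists S.
case: xgetP => [S' _ [S'T hx']|]; last by move=> /(_ S); case.
have key A B : A \in T -> B \in T -> hull A x -> hull B x ->
    \sum_(p <- (A `&` B)%fset) bary A p x * c p = \sum_(p <- A) bary A p x * c p.
  move=> AT BT hA hB; apply: big_fset_incl; first exact: fsubsetIl.
  move=> p pA; rewrite in_fsetI pA /= => npB.
  by rewrite (bary_face tri AT BT hA hB pA) (negbTE npB) mul0r.
rewrite -(key S' S)// -(key S S')// fsetIC big_seq [RHS]big_seq.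
apply: eq_bigr => p; rewrite in_fsetI => /andP[pS pS'].
by rewrite (bary_face tri ST S'T hx hx' pS) pS'.
Qed.

Lemma nodal_vertex c S p : S \in T -> p \in S -> nodal c p = c p.
Proof.
move=> ST pS; rewrite (nodalE c ST (vertex_hull (sT ST) pS)).
have [h _ _] := baryP (sT ST); rewrite -[RHS](big_fset_pick c pS).
by rewrite big_seq [RHS]big_seq; apply: eq_bigr => q qS; rewrite h// mulrC eq_sym.
Qed.

Lemma nodal_slope c S : S \in T -> slope (nodal c) S = slope c S.
Proof.
move=> ST; rewrite /slope big_seq [RHS]big_seq; apply: eq_bigr => p pS.
by rewrite (nodal_vertex c ST pS).
Qed.

Lemma nodal_piecewise c : piecewise_affine (nodal c).
Proof.
move=> S ST x hx; rewrite aff_slopeE (nodalE c ST hx) big_seq [RHS]big_seq.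
by apply: eq_bigr => p pS; rewrite (nodal_vertex c ST pS).
Qed.

Lemma nodal_out c : (forall p, ~ Omega p -> c p = 0) -> forall x, ~ Omega x -> nodal c x = 0.
Proof.
move=> c0 x nO; have [[S [ST hx]]|nS] := pselect (exists S, S \in T /\ hull S x); last first.
  by rewrite /nodal; case: asboolP.
rewrite (nodalE c ST hx) big_seq big1// => p pS.
have [Op|nOp] := pselect (Omega p); last by rewrite c0// mulr0.
have := proj1 (hullP (sT ST) x) hx p pS; rewrite le_eqVlt => /orP[/eqP <-|px].
  by rewrite mul0r.
by case: nO; exact: star_domain px.
Qed.

Lemma nodal_P1 c : (forall p, ~ Omega p -> c p = 0) -> P1 Omega T (nodal c).
Proof. by move=> c0; apply: piecewise_P1; [exact: nodal_piecewise|exact: nodal_out]. Qed.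

Lemma P1_H10 v : P1 Omega T v -> H10 Omega v.
Proof. by case. Qed.

Lemma P1_H1 v : P1 Omega T v -> H1 Omega v.
Proof. by move=> [[]]. Qed.

Lemma P1_out v x : P1 Omega T v -> ~ Omega x -> v x = 0.
Proof. by move=> [_ _ _ h]; exact: h. Qed.

Lemma P1_grad v : P1 Omega T v -> {ae mu, forall x, Omega x -> forall S, S \in T -> hull S x ->
  grad Omega v x = slope v S}.
Proof.
by move=> hv; apply: grad_slope; [exact: P1_piecewise|move=> x; exact: P1_out].
Qed.

Lemma P1_lin a v w : P1 Omega T v -> P1 Omega T w -> P1 Omega T (fun x => a * v x + w x).
Proof.
move=> hv hw; apply: piecewise_P1 => [S ST x hx|x nO]; last first.
  by rewrite (P1_out hv nO) (P1_out hw nO) mulr0 addr0.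
rewrite (P1_piecewise hv ST hx) (P1_piecewise hw ST hx) !aff_slopeE mulr_sumr -big_split.
by apply: eq_bigr => p _; rewrite /=; ring.
Qed.

Lemma P1_0 : P1 Omega T (fun=> 0).
Proof.
apply: piecewise_P1 => // S ST x hx; rewrite aff_slopeE big1// => p _.
by rewrite mulr0.
Qed.

Lemma P1_scale a v : P1 Omega T v -> P1 Omega T (fun x => a * v x).
Proof.
by move=> hv; have := P1_lin a hv P1_0; congr P1; apply/funext => x; rewrite addr0.
Qed.

Lemma P1_sub v w : P1 Omega T v -> P1 Omega T w -> P1 Omega T (fun x => v x - w x).
Proof.
by move=> hv hw; have := P1_lin (-1) hw hv; congr P1; apply/funext => x; rewrite mulN1r addrC.
Qed.

Lemma P1_sum (I : Type) (s : seq I) (c : I -> R) (F : I -> pt -> R) :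
  (forall i, P1 Omega T (F i)) -> P1 Omega T (fun x => \sum_(i <- s) c i * F i x).
Proof.
move=> hF; elim: s => [|i s IH].
  by rewrite (_ : (fun _ => _) = fun=> 0); [exact: P1_0|apply/funext => x; rewrite big_nil].
have := P1_lin (c i) (hF i) IH; congr P1; apply/funext => x.
by rewrite big_cons.
Qed.

Lemma nodesP z : z \in nodes Omega T <-> (exists2 S, S \in T & z \in S) /\ Omega z.
Proof.
rewrite /nodes !inE /=; split.
  by move=> /andP[/bigfcupP[S /andP[ST _] zS]]; rewrite inE => Oz; split=> //; exists S.
move=> [[S ST zS] Oz]; rewrite mem_set// andbT; apply/bigfcupP; exists S => //.
by rewrite ST.
Qed.

Lemma P1_eq v w : P1 Omega T v -> P1 Omega T w ->
  (forall z, z \in nodes Omega T -> v z = w z) -> v = w.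
Proof.
move=> hv hw vw; apply/funext => x.
have [Ox|nO] := pselect (Omega x); last by rewrite (P1_out hv nO) (P1_out hw nO).
have [S ST hx] := mesh_coverO tri Ox.
rewrite (P1_piecewise hv ST hx) (P1_piecewise hw ST hx) !aff_slopeE big_seq [RHS]big_seq.
apply: eq_bigr => p pS; congr (_ * _); have [Op|nOp] := pselect (Omega p); last first.
  by rewrite (P1_out hv nOp) (P1_out hw nOp).
by apply: vw; apply/nodesP; split=> //; exists S.
Qed.

Lemma P1_hats (lambda : pt -> pt -> R) v :
  (forall z, z \in nodes Omega T -> is_hat Omega T z (lambda z)) -> P1 Omega T v ->
  v = fun x => \sum_(z <- nodes Omega T) v z * lambda z x.
Proof.
move=> hl hv; apply: P1_eq => // [|z zN].
  pose F z := if z \in nodes Omega T then lambda z else fun=> 0.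
  have := @P1_sum _ (enum_fset (nodes Omega T)) v F; rewrite (_ : (fun x => _) =
     fun x => \sum_(z <- nodes Omega T) v z * lambda z x); last first.
    by apply/funext => x; rewrite big_seq [RHS]big_seq; apply: eq_bigr => z zN; rewrite /F zN.
  by apply=> z; rewrite /F; case: ifP => [/hl[]|_] //; exact: P1_0.
rewrite (big_rem z)//= big_seq big1 ?addr0 => [|y].
  by have [_ -> _] := hl z zN; rewrite mulr1.
rewrite mem_rem_uniq ?fset_uniq// inE => /andP[yz yN].
by have [_ _ ->] := hl y yN; rewrite ?mulr0// eq_sym.
Qed.

End finite_elements.

(** * Cutoff and quasi-interpolation *)

Section small_contrast_bounds.
Context (R : realType) (d : nat).
Local Notation pt := 'rV[R]_d.
Local Notation mu := (lebesgue_rV R d).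

Lemma quotient_bounds (M : 'M[R]_d) (lo up : R) :
  (lo%:E <= ereal_inf (quotients M))%E -> (ereal_sup (quotients M) <= up%:E)%E ->
  forall y, lo * dot y y <= dot (M *m y) y <= up * dot y y.
Proof.
move=> hlo hup y; have [->|y0] := eqVneq y 0; first by rewrite mulmx0 /dot !mulmx0 mxE !mulr0 lexx.
have dy : 0 < dot y y.
  rewrite lt_neqAle dot_ge0 andbT eq_sym -enorm_dot sqrf_eq0.
  by apply: contra y0 => /eqP/enorm_eq0 ->.
have qy : quotients M (dot (M *m y) y / dot y y)%:E by exists y.
have := le_trans (ereal_sup_ubound qy) hup; have := le_trans hlo (ereal_inf_lbound qy).
by rewrite !lee_fin ler_pdivlMr// ler_pdivrMr// => -> ->.
Qed.

Lemma contrast_bounds (D : set pt) (A : pt -> 'M[R]_d) (kappa alpha beta : R) :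
  0 < alpha -> 1 <= kappa -> alpha <= beta ->
  {ae mu, forall x, D x -> forall y, alpha * dot y y <= dot (A x *m y) y <= beta * dot y y} ->
  (ess_sup_on D (fun x => ereal_sup (quotients (A x))) <=
    kappa%:E * ess_inf_on D (fun x => ereal_inf (quotients (A x))))%E ->
  exists2 r : R, 0 < r & {ae mu, forall x, D x -> forall y,
    r * dot y y <= dot (A x *m y) y <= 4 * kappa * r * dot y y}.
Proof.
move=> a0 k1 ab hab hc.
set s := ess_sup_on _ _ in hc; set i := ess_inf_on _ _ in hc.
have k0 : 0 < kappa by exact: lt_le_trans ltr01 k1.
have quot x : (forall y, alpha * dot y y <= dot (A x *m y) y <= beta * dot y y) ->
    (alpha%:E <= ereal_inf (quotients (A x)))%E /\ (ereal_sup (quotients (A x)) <= beta%:E)%E.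
  move=> h; split.
    apply: le_ereal_inf_tmp => _ [y /= y0 <-]; rewrite lee_fin; have /andP[h1 _] := h y.
    rewrite ler_pdivlMr// lt_neqAle dot_ge0 andbT eq_sym -enorm_dot sqrf_eq0.
    by apply: contra y0 => /eqP/enorm_eq0 ->.
  apply: ge_ereal_sup => _ [y /= y0 <-]; rewrite lee_fin; have /andP[_ h1] := h y.
  rewrite ler_pdivrMr// lt_neqAle dot_ge0 andbT eq_sym -enorm_dot sqrf_eq0.
  by apply: contra y0 => /eqP/enorm_eq0 ->.
have ia : (alpha%:E <= i)%E.
  by apply: ereal_sup_ubound; apply: filterS hab => x hx Dx; exact: (quot x (hx Dx)).1.
have sb : (s <= beta%:E)%E.
  by apply: ereal_inf_lbound; apply: filterS hab => x hx Dx; exact: (quot x (hx Dx)).2.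
have [r [r0 si ir]] : exists r : R, [/\ 0 < r, (s < (4 * kappa * r)%:E)%E & (r%:E < i)%E].
  case E : i ia hc => [c| |] //.
    rewrite lee_fin => ac; rewrite -EFinM => sc; exists (c / 2); split.
    - by rewrite divr_gt0//; exact: lt_le_trans ac.
    - apply: le_lt_trans sc _; rewrite lte_fin.
      have cp : 0 < kappa * c by rewrite mulr_gt0//; exact: lt_le_trans ac.
      by have -> : 4 * kappa * (c / 2) = 2 * (kappa * c) by [field]; lra.
    - by rewrite lte_fin ltr_pdivrMr//; lra.
  move=> _ _; exists beta; split; [exact: lt_le_trans ab| |exact: ltry].
  apply: le_lt_trans sb _; rewrite lte_fin; have b0 := lt_le_trans a0 ab; nra.
exists r => //.
have [z1 h1 s1] := ereal_inf_lt si; have [z2 h2 s2] := ereal_sup_gt ir.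
apply: filterS2 h1 h2 => x h1 h2 Dx; apply: quotient_bounds.
  exact: le_trans (ltW s2) (h2 Dx).
exact: le_trans (h1 Dx) (ltW s1).
Qed.

End small_contrast_bounds.

Section vanishing.
Context (R : realType) (d : nat).
Local Notation pt := 'rV[R]_d.
Local Notation mu := (lebesgue_rV R d).

Lemma ae_open_ex (U : set pt) (P : pt -> Prop) x : open U -> U x ->
  {ae mu, forall x, P x} -> exists2 y, U y & P y.
Proof.
move=> oU Ux [N [mN N0 hN]]; apply: contrapT => H.
have /rV_nbhsP[r r0 hr] : nbhs x U by exact: open_nbhs_nbhs.
have : mu (cube x r) = 0%E.
  apply/eqP; rewrite eq_le measure_ge0 andbT -N0.
  apply: le_measure; rewrite ?inE//; first exact: measurable_cube.
  by move=> y /hr Uy; apply: hN => Py; apply: H; exists y.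
rewrite mu_cube ?ltW// => -[] /eqP; rewrite expf_eq0 mulf_eq0 (gt_eqF r0) orbF.
by rewrite pnatr_eq0 andbF.
Qed.

Lemma open_support (v : pt -> R) : continuous v -> open [set x | v x != 0].
Proof.
move=> cv; have -> : [set x | v x != 0] = v @^-1` [set t | t != 0] by [].
by apply: open_comp => [x _|]; [exact: cv|exact: open_neq].
Qed.

Lemma ae_vanish (S : {fset pt}) (v : pt -> R) : simplex S -> continuous v ->
  {ae mu, forall x, osimplex S x -> v x = 0} -> forall x, hull S x -> v x = 0.
Proof.
move=> sS cv hv x hx; apply: contrapT => /eqP vx.
have /rV_nbhsP[r r0 hr] : nbhs x [set x | v x != 0].
  by apply: open_nbhs_nbhs; split=> //; exact: open_support.
have [cS _] := sS.
pose x0 : pt := \sum_(p <- S) d.+1%:R^-1 *: p.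
have b0 p : p \in S -> bary S p x0 = d.+1%:R^-1.
  apply: (bary_unique sS (w := fun=> d.+1%:R^-1)).
  rewrite big_const_seq count_predT iter_addr_0 -[size _]/(#|` S|) cS.
  by rewrite -[LHS]mulr_natl divff// pnatr_eq0.
pose m := enorm (x0 - x) + 1; have m0 : 0 < m by rewrite ltr_wpDl// enorm_ge0.
pose s := Num.min 1 (r / m); have s0 : 0 < s by rewrite lt_min ltr01 divr_gt0.
have s1 : s <= 1 by rewrite ge_min lexx.
pose y := x + s *: (x0 - x).
have oy : osimplex S y.
  move=> p pS; have -> : bary S p y = (1 - s) * bary S p x + s * bary S p x0.
    rewrite /bary /aff mulmxDl -scalemxAl mulmxBl !mxE; ring.
  rewrite (b0 p pS) ltr_wpDl//; last by rewrite mulr_gt0// invr_gt0.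
  by rewrite mulr_ge0 ?subr_ge0//; exact: (proj1 (hullP sS x) hx).
have vy : v y != 0.
  apply: hr => i; rewrite !mxE opprD addrA subrr sub0r normrN normrM gtr0_norm//.
  apply: (@lt_le_trans _ _ (s * m)).
    rewrite ltr_pM2l//; apply: le_lt_trans (_ : enorm (x0 - x) < m); last by rewrite ltrDl.
    by have := coord_enorm (x0 - x) i; rewrite !mxE.
  by rewrite -ler_pdivlMr// ge_min lexx orbT.
have oU : open ([set x | v x != 0] `&` osimplex S).
  by apply: openI; [exact: open_support|exact: open_osimplex].
have [z [vz oz] /(_ oz) hz] := ae_open_ex oU (conj vy oy) hv.
by move: vz; rewrite /= hz eqxx.
Qed.

End vanishing.

Record lod_setting (R : realType) (d : nat) (Omega : set 'rV[R]_d) (gamma kappa Cq Cq' : R)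
    (TH Th : {fset {fset 'rV[R]_d}}) (A : 'rV[R]_d -> 'M[R]_d) (alpha beta : R)
    (I : ('rV[R]_d -> R) -> ('rV[R]_d -> R)) : Prop := LodSetting {
  lod_dim : (0 < d)%N;
  lod_domain : polyhedral_domain Omega;
  lod_coarse : triangulation Omega TH;
  lod_fine : triangulation Omega Th;
  lod_refines : refines Th TH;
  lod_gamma : 1 <= gamma;
  lod_kappa : 1 <= kappa;
  lod_Cq : 1 <= Cq;
  lod_Cq' : 1 <= Cq';
  lod_regular : shape_regular gamma TH;
  lod_fine_regular : shape_regular gamma Th;
  lod_alpha : 0 < alpha;
  lod_alpha_beta : alpha <= beta;
  lod_coef : coef_bounds Omega A alpha beta;
  lod_contrast : small_contrast kappa A Th;
  lod_QI1 : QI1 Omega TH Th I;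
  lod_QI3 : QI3 Omega A TH Th I Cq;
  lod_QI4 : QI4 Omega A TH Th I Cq' }.

Section cutoff.
Context (R : realType) (d : nat) (Omega : set 'rV[R]_d) (gamma kappa Cq Cq' : R)
    (TH Th : {fset {fset 'rV[R]_d}}) (A : 'rV[R]_d -> 'M[R]_d) (alpha beta : R)
    (I : ('rV[R]_d -> R) -> ('rV[R]_d -> R)).
Hypothesis H : lod_setting Omega gamma kappa Cq Cq' TH Th A alpha beta I.
Local Notation pt := 'rV[R]_d.
Local Notation mu := (lebesgue_rV R d).
Local Notation Vh := (P1 Omega Th).
Local Notation VH := (P1 Omega TH).
Implicit Types (K S : {fset pt}) (p : pt).

Let d0 := lod_dim H.
Let pO := lod_domain H.
Let tH := lod_coarse H.
Let th := lod_fine H.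
Let sH K (KT : K \in TH) : simplex K := mesh_simplex tH KT.
Let sh S (ST : S \in Th) : simplex S := mesh_simplex th ST.
Let hA := lod_coef H.
Let a0 := lod_alpha H.
Let g0 : 0 < gamma := lt_le_trans ltr01 (lod_gamma H).
Let k0 : 0 < kappa := lt_le_trans ltr01 (lod_kappa H).

Lemma ae_fine_element : {ae mu, forall x, Omega x -> forall K, K \in TH -> hull K x ->
  osimplex K x /\ exists S, [/\ S \in Th, osimplex S x & hull S `<=` hull K]}.
Proof.
apply: filterS2 (ae_osimplex d0 tH) (ae_osimplex d0 th) => x hx hx' Ox K KT hK.
have oK := hx K KT hK; split=> //.
have [S ST hS] := mesh_coverO th Ox; exists S; split=> //; first exact: hx'.
have [K' K'T SK'] := lod_refines H ST.
by rewrite (osimplex_disjoint tH KT K'T oK (SK' _ hS)).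
Qed.

Lemma fine_contrast S : S \in Th -> exists2 r : R, 0 < r & {ae mu, forall x, hull S x ->
  forall y, r * dot y y <= dot (A x *m y) y <= 4 * kappa * r * dot y y}.
Proof.
move=> ST; apply: (contrast_bounds a0 (lod_kappa H) (lod_alpha_beta H) _ (lod_contrast H ST)).
by apply: filterS2 (coef_rayleigh hA) (ae_hull_domain d0 pO th ST) => x h1 h2 /h2/h1.
Qed.

Lemma P1_vanish_slope v K : Vh v -> K \in TH -> (forall x, hull K x -> v x = 0) ->
  {ae mu, forall x, hull K x -> grad Omega v x = 0}.
Proof.
move=> hv KT v0.
apply: filterS3 (ae_hull_domain d0 pO tH KT) ae_fine_element (P1_grad d0 pO th hv) => x h1 h2 h3 hK.
have Ox := h1 hK; have [_ [S [ST oS SK]]] := h2 Ox K KT hK.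
rewrite (h3 Ox S ST (osimplex_hull (sh ST) oS)) /slope big_seq big1// => p pS.
by rewrite (v0 p (SK _ (vertex_hull (sh ST) pS))) scale0r.
Qed.

Lemma measurable_hullH K : K \in TH -> measurable (hull K).
Proof. exact: (measurable_hull tH). Qed.

Lemma eform_vanish v w K : Vh v -> H1 Omega w -> K \in TH -> (forall x, hull K x -> v x = 0) ->
  eform Omega A (hull K) v w = 0.
Proof.
move=> hv hw KT v0; apply: (eform_ae0 hA) => //; [exact: measurable_hullH|exact: P1_H1 hv|].
by apply: filterS (P1_vanish_slope hv KT v0) => x h _.
Qed.

(* The fine nodal interpolant of eta v, where eta is the coarse finite element
   function with nodal values e. *)
Definition cut (e v : pt -> R) : pt -> R := nodal Th (fun p => nodal TH e p * v p).

Lemma cut_P1 e v : Vh v -> Vh (cut e v).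
Proof. by move=> hv; apply: (nodal_P1 d0 pO th) => p nO; rewrite (P1_out hv nO) mulr0. Qed.

Lemma cut_ae e v K (c : R) : Vh v -> K \in TH -> (forall p, p \in K -> e p = c) ->
  forall x, hull K x -> cut e v x = c * v x.
Proof.
move=> hv KT ec x hx; apply/eqP; rewrite -subr_eq0; apply/eqP; move: x hx.
have hw := cut_P1 e hv.
have hd : Vh (fun x => cut e v x - c * v x).
  by apply: (P1_sub d0 pO th) => //; exact: (P1_scale d0 pO th).
apply: ae_vanish; [exact: sH|by case: hd|].
apply: filterS2 (ae_hull_domain d0 pO tH KT) ae_fine_element => x h1 h2 oK.
have hK := osimplex_hull (sH KT) oK; have Ox := h1 hK.
have [_ [S [ST oS SK]]] := h2 Ox K KT hK; have hS := osimplex_hull (sh ST) oS.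
rewrite /cut (nodalE th _ ST hS) (P1_piecewise th hv ST hS) aff_slopeE mulr_sumr -sumrB.
rewrite big_seq big1// => p pS; have Kp := SK _ (vertex_hull (sh ST) pS).
rewrite (nodalE tH _ KT Kp); have [_ b1 _] := baryP (sH KT).
have -> : \sum_(q <- K) bary K q p * e q = c.
  rewrite -[RHS]mul1r -(b1 p) mulr_suml big_seq [RHS]big_seq.
  by apply: eq_bigr => q qK; rewrite ec.
by rewrite mulrCA subrr.
Qed.

Definition cslope : R := d.+1%:R * gamma.
Definition cstab : R := 8 * kappa * (cslope * (1 + cslope)) ^+ 2.

Lemma cslope_ge1 : 1 <= cslope.
Proof.
rewrite /cslope; have := lod_gamma H; have : 1 <= d.+1%:R :> R by rewrite ler1n.
by move: (d.+1%:R : R) => c h1 h2; nra.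
Qed.

Lemma cstab_ge1 : 1 <= cstab.
Proof.
rewrite /cstab; have c1 := cslope_ge1; have k1 := lod_kappa H.
have : 1 <= cslope * (1 + cslope) by nra.
by move: (_ * _) => t; nra.
Qed.

Lemma slope_cutoff_le e K : K \in TH -> (forall p, p \in K -> `|e p| <= 1) ->
  enorm (slope e K) * diam (hull K) <= cslope.
Proof.
move=> KT e1; have D0 := diam_gt0 (sH KT) d0.
rewrite -ler_pdivlMr//; apply: le_trans (enorm_sum _ _) _.
have [cK _] := sH KT.
apply: (@le_trans _ _ (\sum_(p <- K) gamma / diam (hull K))).
  rewrite big_seq [leRHS]big_seq; apply: ler_sum => p pK; rewrite enormZ.
  rewrite ler_pdivlMr// -mulrA.
  have b0 : 0 <= enorm (bslope K p) * diam (hull K).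
    by apply: mulr_ge0; [exact: enorm_ge0|exact: ltW].
  apply: le_trans (ler_wpM2r b0 (e1 p pK)) _; rewrite mul1r.
  exact: (bslope_diam (sH KT) (ltW g0) (lod_regular H KT) pK).
by rewrite big_const_seq count_predT iter_addr_0 -[leLHS]mulr_natl -[size _]/(#|` K|) cK mulrA.
Qed.

Lemma cutoff_slope e v K S : K \in TH -> S \in Th -> hull S `<=` hull K ->
  (forall p, p \in K -> `|e p| <= 1) -> Vh v -> forall x, hull S x ->
  enorm (slope (cut e v) S) <=
  cslope * (1 + cslope) * (enorm (slope v S) + `|v x| / diam (hull K)).
Proof.
move=> KT ST SK e1 hv x hx.
set a := enorm (slope v S); set h := diam (hull S); set HK := diam (hull K).
have a_ge0 : 0 <= a := enorm_ge0 _.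
have h0 : 0 < h := diam_gt0 (sh ST) d0.
have HK0 : 0 < HK := diam_gt0 (sH KT) d0.
have hH : h <= HK := le_diam_hull (sh ST) (sH KT) SK.
pose eta := nodal TH e.
have etaE y : hull K y -> eta y = aff (slope e K) (offset e K) y.
  by move=> hy; rewrite aff_slopeE /eta (nodalE tH e KT hy).
have eta1 y : hull K y -> `|eta y| <= 1.
  move=> hy; rewrite etaE//; apply: (hull_dom (sH KT) e1) => // p pK.
  by rewrite -(etaE p (vertex_hull (sH KT) pK)) /eta (nodal_vertex tH e KT pK).
have Kv p : p \in S -> hull K p by move=> pS; apply: SK; exact: (vertex_hull (sh ST) pS).
have hp p (pS : p \in S) : hull S p := vertex_hull (sh ST) pS.
have vlip y z : hull S y -> hull S z -> `|v y - v z| <= a * h.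
  move=> hy hz; rewrite (P1_piecewise th hv ST hy) (P1_piecewise th hv ST hz).
  by apply: le_trans (aff_lip _ _ _ _) _; rewrite ler_wpM2l//; exact: (le_diam (sh ST) hy hz).
have [p0 [_ [p0S _ _]]] := simplex_vertices (sh ST) d0.
pose f p := eta p * v p.
have fd p : p \in S -> `|f p - f p0| <= h * (1 + cslope) * (a + `|v x| / HK).
  move=> pS; have -> : f p - f p0 = eta p * (v p - v p0) + (eta p - eta p0) * v p0.
    by rewrite /f; ring.
  apply: le_trans (ler_normD _ _) _; rewrite !normrM.
  have t1 : `|eta p| * `|v p - v p0| <= 1 * (a * h).
    by apply: ler_pM => //; [exact: eta1 (Kv _ pS)|exact: vlip (hp _ pS) (hp _ p0S)].
  have t2 : `|eta p - eta p0| <= cslope / HK * h.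
    rewrite !etaE; [|exact: Kv..]; apply: le_trans (aff_lip _ _ _ _) _.
    apply: ler_pM; rewrite ?enorm_ge0//; last exact: (le_diam (sh ST) (hp _ pS) (hp _ p0S)).
    by rewrite ler_pdivlMr//; exact: slope_cutoff_le.
  have t3 : `|v p0| <= `|v x| + a * HK.
    have -> : v p0 = v x + (v p0 - v x) by ring.
    apply: le_trans (ler_normD _ _) _; rewrite lerD2l.
    by apply: le_trans (vlip _ _ (hp _ p0S) hx) _; rewrite ler_wpM2l.
  have t4 : `|eta p - eta p0| * `|v p0| <= cslope / HK * h * (`|v x| + a * HK) by exact: ler_pM.
  apply: le_trans (lerD t1 t4) _.
  have c0 : 0 <= cslope := le_trans ler01 cslope_ge1.
  have -> : cslope / HK * h * (`|v x| + a * HK) = h * cslope * (a + `|v x| / HK).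
    by field; rewrite gt_eqF.
  rewrite mul1r [h * (1 + _)]mulrDr mulr1 [(h + _) * _]mulrDl lerD2r mulrC; apply: ler_wpM2l; first exact: ltW.
  by rewrite lerDl divr_ge0// ltW.
have E : slope (cut e v) S = \sum_(p <- S) (f p - f p0) *: bslope S p.
  rewrite /cut (nodal_slope th _ ST) /slope.
  under [RHS]eq_bigr do rewrite scalerBl.
  by rewrite sumrB -scaler_sumr (bslope_sum0 (sh ST)) scaler0 subr0.
rewrite E; apply: le_trans (enorm_sum _ _) _.
set B := (1 + cslope) * (a + `|v x| / HK).
have [cS _] := sh ST.
apply: (@le_trans _ _ (\sum_(p <- S) gamma * B)); last first.
  rewrite big_const_seq count_predT iter_addr_0 -[leLHS]mulr_natl -[size _]/(#|` S|) cS.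
  by rewrite /B !mulrA.
rewrite big_seq [leRHS]big_seq; apply: ler_sum => p pS; rewrite enormZ.
have b1 : enorm (bslope S p) * h <= gamma.
  exact: (bslope_diam (sh ST) (ltW g0) (lod_fine_regular H ST) pS).
have B0 : 0 <= B.
  apply: mulr_ge0; first by apply: addr_ge0 => //; exact: le_trans ler01 cslope_ge1.
  by apply: addr_ge0 => //; apply: divr_ge0 => //; exact: ltW.
apply: le_trans (ler_wpM2r (enorm_ge0 _) (fd p pS)) _.
have -> : h * (1 + cslope) * (a + `|v x| / HK) * enorm (bslope S p) =
  enorm (bslope S p) * h * B by rewrite /B; ring.
exact: ler_wpM2r.
Qed.

Lemma cut_density e v K : K \in TH -> (forall p, p \in K -> `|e p| <= 1) -> Vh v ->
  {ae mu, forall x, hull K x -> edens Omega A (cut e v) (cut e v) x <=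
    cstab * (edens Omega A v v x + (diam (hull K))^-1 ^+ 2 * (\tr (A x) * (v \_ Omega) x ^+ 2))}.
Proof.
move=> KT e1 hv.
have /choice[r hr] : forall S, exists r : R, S \in Th -> 0 < r /\ {ae mu, forall x, hull S x ->
    forall y, r * dot y y <= dot (A x *m y) y <= 4 * kappa * r * dot y y}.
  move=> S; have [ST|nST] := boolP (S \in Th); last by exists 0.
  by have [r r0 hr] := fine_contrast ST; exists r.
have hc : {ae mu, forall x, forall S, S \in enum_fset Th -> hull S x ->
    forall y, r S * dot y y <= dot (A x *m y) y <= 4 * kappa * r S * dot y y}.
  by apply: ae_seq => S ST; exact: (hr S ST).2.
have hw := cut_P1 e hv.
have hg : {ae mu, forall x, Omega x -> forall S, S \in Th -> hull S x ->
    grad Omega v x = slope v S /\ grad Omega (cut e v) x = slope (cut e v) S}.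
  apply: filterS2 (P1_grad d0 pO th hv) (P1_grad d0 pO th hw) => x h1 h2 Ox S ST hS.
  by split; [exact: h1|exact: h2].
have hO := ae_hull_domain d0 pO tH KT.
apply: filterS2 (filterI hO ae_fine_element) (filterI hc hg) => x [h1 h2] [h3 h4] hK.
have Ox := h1 hK; have [_ [S [ST oS SK]]] := h2 Ox K KT hK.
have hS := osimplex_hull (sh ST) oS; have [gv gw] := h4 Ox S ST hS.
have [r0 _] := hr S ST; have hq := h3 S ST hS.
rewrite /edens [\1_Omega x]indicE mem_set// !mul1r gv gw /patch mem_set//.
have /andP[_ q1] := hq (slope (cut e v) S).
have /andP[q2 _] := hq (slope v S).
have q3 : r S <= \tr (A x).
  by apply: (trace_ge d0 (ltW r0)) => y; have /andP[] := hq y.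
apply: le_trans q1 _; rewrite -!enorm_dot in q2 *.
have := cutoff_slope KT ST SK e1 hv hS.
set a := enorm (slope v S) in q2 *; set a' := enorm (slope _ S).
set B := cslope * (1 + cslope); set h := (diam (hull K))^-1.
move=> hB.
have a'0 : 0 <= a' := enorm_ge0 _.
have B0 : 0 <= B by have := cslope_ge1; rewrite /B => ?; rewrite mulr_ge0 ?addr_ge0//; lra.
have s1 : a' ^+ 2 <= 2 * B ^+ 2 * (a ^+ 2 + h ^+ 2 * v x ^+ 2).
  apply: (@le_trans _ _ ((B * (a + `|v x| * h)) ^+ 2)).
    by rewrite ler_sqr// nnegrE; exact: le_trans hB.
  have -> : 2 * B ^+ 2 * (a ^+ 2 + h ^+ 2 * v x ^+ 2) = B ^+ 2 * (2 * (a ^+ 2 + h ^+ 2 * v x ^+ 2)) by ring.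
  rewrite exprMn; apply: ler_wpM2l; first exact: sqr_ge0.
  rewrite -[v x ^+ 2]real_normK ?num_real//.
  by move: `|v x| => t; have := sqr_ge0 (a - t * h); rewrite !expr2; lra.
have s2 : r S * v x ^+ 2 <= \tr (A x) * v x ^+ 2 by rewrite ler_wpM2r ?sqr_ge0.
have s3 : h ^+ 2 * (r S * v x ^+ 2) <= h ^+ 2 * (\tr (A x) * v x ^+ 2).
  by rewrite ler_wpM2l ?sqr_ge0.
apply: (@le_trans _ _ (4 * kappa * r S * (2 * B ^+ 2 * (a ^+ 2 + h ^+ 2 * v x ^+ 2)))).
  by rewrite ler_wpM2l// !mulr_ge0// ltW.
have -> : 4 * kappa * r S * (2 * B ^+ 2 * (a ^+ 2 + h ^+ 2 * v x ^+ 2)) =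
  cstab * (r S * a ^+ 2 + h ^+ 2 * (r S * v x ^+ 2)) by rewrite /cstab -/B; ring.
by apply: ler_wpM2l; [exact: le_trans ler01 cstab_ge1|exact: lerD].
Qed.

Lemma cut_energy e v K : K \in TH -> (forall p, p \in K -> `|e p| <= 1) -> Vh v ->
  eform Omega A (hull K) (cut e v) (cut e v) <=
  cstab * (eform Omega A (hull K) v v + (diam (hull K))^-1 ^+ 2 * wform Omega A (hull K) v).
Proof.
move=> KT e1 hv; have hw := cut_P1 e hv; have mK := measurable_hullH KT.
have [Lv _] := P1_H1 hv.
have i1 := intg_eform hA mK (P1_H1 hw) (P1_H1 hw).
have i2 := intg_eform hA mK (P1_H1 hv) (P1_H1 hv).
have i3 := intg_wform hA mK Lv.
have i4 := intg_scale ((diam (hull K))^-1 ^+ 2) i3.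
have -> : cstab * (eform Omega A (hull K) v v + (diam (hull K))^-1 ^+ 2 * wform Omega A (hull K) v) =
    \int[mu]_x (cstab * (\1_(hull K) x * edens Omega A v v x + (diam (hull K))^-1 ^+ 2 *
       (\1_(hull K) x * (\tr (A x) * (v \_ Omega) x ^+ 2)))).
  by rewrite (IntZ _ (intg_add i2 i4)) (IntD i2 i4) (IntZ _ i3).
apply: Int_le_ae => //; first by apply: intg_scale; exact: intg_add.
apply: filterS (cut_density KT e1 hv) => x hx; rewrite indicE.
have [hK|nK] := pselect (hull K x); last by rewrite memNset// !mul0r mulr0 addr0 mulr0.
by rewrite mem_set// !mul1r; exact: hx.
Qed.

Definition patch_energy v K : R :=
  \sum_(K' <- TH | `[< touch K K' >]) eform Omega A (hull K') v v.

Let hullO K (KT : K \in TH) := ae_hull_domain d0 pO tH KT.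

Lemma element_energy_ge0 v K : H1 Omega v -> K \in TH -> 0 <= eform Omega A (hull K) v v.
Proof. by move=> hv KT; apply: (eform_ge0 hA) => //; exact: measurable_hullH. Qed.

Lemma element_patch_le v K : H1 Omega v -> K \in TH ->
  energy Omega A (element_patch TH K) v <= Num.sqrt (patch_energy v K).
Proof.
move=> hv KT; have mP : measurable (element_patch TH K).
  by apply: open_measurable_rV; exact: open_interior.
rewrite (energy_eform hA a0 mP) //; last first.
  apply: aeW => x; rewrite /element_patch => hx.
  have [_ _ _ _ <-] := pO; apply: filterS hx => y [K' [K'T _]].
  exact: (hull_closure tH K'T).
rewrite ler_wsqrtr// /patch_energy -big_filter.
pose D K' : set pt := if K' \in TH then hull K' else set0.
have -> : \sum_(K' <- [seq K' <- enum_fset TH | `[< touch K K' >]]) eform Omega A (hull K') v v =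
    \sum_(K' <- [seq K' <- enum_fset TH | `[< touch K K' >]]) eform Omega A (D K') v v.
  rewrite big_seq [RHS]big_seq; apply: eq_bigr => K'; rewrite mem_filter /D => /andP[_ K'T].
  by rewrite ifT.
apply: (eform_le_sum hA a0) => //.
  by move=> K'; rewrite /D; case: ifP => // K'T; exact: measurable_hullH.
apply: aeW => x _ /interior_subset[K' [K'T tK'] hx].
have K'in : K' \in [seq K' <- enum_fset TH | `[< touch K K' >]].
  by rewrite mem_filter K'T andbT; apply/asboolP/touchC.
rewrite (big_rem K')//= /D ifT// indicE mem_set//= lerDl.
by apply: sumr_ge0 => S _; rewrite indicE.
Qed.

Lemma patch_energy_ge0 v K : H1 Omega v -> 0 <= patch_energy v K.
Proof.
move=> hv; rewrite /patch_energy big_seq_cond; apply: sumr_ge0 => K' /andP[K'T _].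
exact: element_energy_ge0.
Qed.

Lemma I_VH v : Vh v -> VH (I v).
Proof. by have [h _ _] := lod_QI1 H; exact: h. Qed.

Lemma I_lin a v w : Vh v -> Vh w -> I (fun x => a * v x + w x) = (fun x => a * I v x + I w x).
Proof. by have [_ h _] := lod_QI1 H; exact: h. Qed.

Lemma I_err_H1 v : Vh v -> H1 Omega (v \- I v).
Proof.
move=> hv; have := H1_lin (-1) (P1_H1 (I_VH hv)) (P1_H1 hv); congr H1.
by apply/funext => x /=; rewrite mulN1r addrC.
Qed.

Lemma QI3_forms v K : Vh v -> K \in TH ->
  (diam (hull K))^-1 ^+ 2 * wform Omega A (hull K) (v \- I v) <= Cq ^+ 2 * patch_energy v K /\
  eform Omega A (hull K) (v \- I v) (v \- I v) <= Cq ^+ 2 * patch_energy v K.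
Proof.
move=> hv KT; have hd := I_err_H1 hv; have [Ld _] := hd; have mK := measurable_hullH KT.
have p0 := patch_energy_ge0 K (P1_H1 hv).
have q := lod_QI3 H hv KT.
have q0 : 0 <= Cq := le_trans ler01 (lod_Cq H).
have D0 := diam_gt0 (sH KT) d0.
have {}q := le_trans q (ler_wpM2l q0 (element_patch_le (P1_H1 hv) KT)).
have w0 : 0 <= (diam (hull K))^-1 * weighted_L2norm A (hull K) (v \- I v).
  by apply: mulr_ge0; [rewrite invr_ge0 ltW|exact: L2norm_ge0].
have e0 : 0 <= energy Omega A (hull K) (v \- I v) := L2norm_ge0 _ _.
have s0 := sqrtr_ge0 (patch_energy v K).
rewrite -(energy_sqr hA a0 mK (hullO KT) hd) -(weighted_sqr hA a0 mK (hullO KT) Ld).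
have <- : Num.sqrt (patch_energy v K) ^+ 2 = patch_energy v K by exact: sqr_sqrtr.
have c0 : 0 <= Cq * Num.sqrt (patch_energy v K) by exact: mulr_ge0.
rewrite -!exprMn; split; rewrite ler_sqr ?nnegrE//; apply: le_trans q.
  by rewrite lerDl.
by rewrite lerDr.
Qed.

Lemma I_local v K : Vh v -> K \in TH -> patch_energy v K = 0 -> forall x, hull K x -> I v x = v x.
Proof.
move=> hv KT pe x hx; apply/esym/eqP; rewrite -subr_eq0; apply/eqP.
have hd := I_err_H1 hv; have [Ld _] := hd; have mK := measurable_hullH KT.
have D0 := diam_gt0 (sH KT) d0.
have w0 : wform Omega A (hull K) (v \- I v) = 0.
  apply/eqP; rewrite eq_le (wform_ge0 hA a0 mK (hullO KT) Ld) andbT.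
  have [q _] := QI3_forms hv KT; move: q; rewrite pe mulr0 pmulr_rle0//.
  by rewrite exprn_gt0// invr_gt0.
have iw := intg_wform hA mK Ld.
pose f x := `|\1_(hull K) x * (\tr (A x) * ((v \- I v) \_ Omega) x ^+ 2)|.
have f0 : \int[mu]_x f x = 0.
  rewrite -w0; apply: Int_ae; [by apply: intg_measurable; exact: intg_norm|exact: intg_measurable|].
  apply: filterS (trace_ge0 hA a0) => y hy; rewrite /f ger0_norm//; apply: mulr_ge0 => //.
  rewrite /patch; case: ifPn => [|_]; last by rewrite expr0n mulr0.
  by rewrite inE => /hy ?; rewrite mulr_ge0// sqr_ge0.
move: x hx; apply: (ae_vanish (v := v \- I v) (sH KT)).
  have [_ cv _ _] := hv; have [_ cI _ _] := I_VH hv.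
  by move=> y; apply: (@continuousB _ _ _ v (I v)); [exact: cv|exact: cI].
have := Int_eq0_ae (intg_norm iw) (fun x => normr_ge0 _) f0.
apply: filterS3 (hullO KT) (coef_rayleigh hA) => y h1 h2 h3 oK.
have hK := osimplex_hull (sH KT) oK; have Oy := h1 hK.
move: h3 => /eqP; rewrite normr_eq0 indicE mem_set// mul1r /patch mem_set// mulf_eq0.
have tr0 : 0 < \tr (A y).
  apply: (lt_le_trans a0); apply: (trace_ge d0 (ltW a0)) => z.
  by have /andP[] := h2 Oy z.
by rewrite (gt_eqF tr0) sqrf_eq0 => /eqP.
Qed.

End cutoff.

(** * Exponential decay of the correctors *)

Lemma norm_half_ge0 (R : realType) (x y t : R) : 2 * `|t| <= x + y -> 0 <= t + (x + y).
Proof. by have := ler_norm (- t); have := normr_ge0 t; rewrite normrN; lra. Qed.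

Lemma contraction (R : realType) (C x1 x2 x3 x4 x5 : R) : 0 <= C -> x1 <= x4 + x5 -> x2 <= x1 ->
  x4 <= x3 - x2 -> x5 <= C * (x3 - x2) -> x2 <= (1 + C) / (2 + C) * x3.
Proof.
move=> c0 h1 h2 h3 h4; have q0 : 0 < 2 + C by lra.
by rewrite mulrAC ler_pdivlMr//; nra.
Qed.

Lemma cut_total (R : realType) (C x1 x2 x3 x4 x5 : R) : 0 <= C -> x1 <= x2 + x3 ->
  x2 <= C * (x4 - x5) -> x3 <= x4 -> 0 <= x5 -> x1 <= (1 + C) * x4.
Proof. by move=> c0 h1 h2 h3 h4; nra. Qed.

Section patch_levels.
Context (R : realType) (d : nat) (T : {fset {fset 'rV[R]_d}}) (z : 'rV[R]_d).
Implicit Types (K : {fset 'rV[R]_d}).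

(* K belongs to the k-th patch around z; no element belongs to the patch 0. *)
Definition near_patch (k : nat) K : Prop :=
  if k is k'.+1 then hull K `&` vertex_patch T z k' !=set0 else False.

Lemma near_hull_sub k K : K \in T -> near_patch k K -> hull K `<=` vertex_patch T z k.
Proof. by case: k => // k KT h x hx; exists K. Qed.

Lemma near_patchS k K : K \in T -> near_patch k K -> near_patch k.+1 K.
Proof.
case: k => // k KT h; have [x [hx _]] := h; exists x; split=> //.
exact: (near_hull_sub (k := k.+1) KT h).
Qed.

Lemma near_patch_le k l K : (k <= l)%N -> K \in T -> near_patch k K -> near_patch l K.
Proof.
move=> /subnKC <- KT h; elim: (l - k)%N => [|m IH]; first by rewrite addn0.
by rewrite addnS; exact: near_patchS.
Qed.

Lemma near_patch_touch k K K' : K \in T -> near_patch k K -> touch K K' -> near_patch k.+1 K'.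
Proof.
move=> KT h [x [hx hx']]; exists x; split=> //.
exact: near_hull_sub h _ hx.
Qed.

End patch_levels.

Section decay.
Context (R : realType) (d : nat) (Omega : set 'rV[R]_d) (gamma kappa Cq Cq' : R)
    (TH Th : {fset {fset 'rV[R]_d}}) (A : 'rV[R]_d -> 'M[R]_d) (alpha beta : R)
    (I : ('rV[R]_d -> R) -> ('rV[R]_d -> R)).
Hypothesis H : lod_setting Omega gamma kappa Cq Cq' TH Th A alpha beta I.
Local Notation pt := 'rV[R]_d.
Local Notation mu := (lebesgue_rV R d).
Local Notation Vh := (P1 Omega Th).
Local Notation VH := (P1 Omega TH).
Local Notation b K := (eform Omega A (hull K)).
Local Notation B := (eform Omega A setT).
Implicit Types (K S : {fset pt}) (p : pt).

Let d0 := lod_dim H.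
Let pO := lod_domain H.
Let tH := lod_coarse H.
Let th := lod_fine H.
Let oO : open Omega := domain_open pO.
Let sH K (KT : K \in TH) : simplex K := mesh_simplex tH KT.
Let hA := lod_coef H.
Let a0 := lod_alpha H.
Let mK K (KT : K \in TH) : measurable (hull K) := measurable_hull tH KT.

Lemma eform_elements u v : H1 Omega u -> H1 Omega v -> B u v = \sum_(K <- TH) b K u v.
Proof.
move=> hu hv; pose D K : set pt := if K \in TH then hull K else set0.
rewrite (@eform_sum _ _ _ _ _ _ hA _ (enum_fset TH) D)//.
- by rewrite big_seq [RHS]big_seq; apply: eq_bigr => K KT; rewrite /D ifT.
- by move=> K; rewrite /D; case: ifP => // KT; exact: mK.
- apply: filterS (ae_element_sum d0 tH (fun=> 1)) => x hx Ox.
  have [K KT hK] := mesh_coverO tH Ox; rewrite indicT -[LHS](hx Ox K KT hK) big_seq [RHS]big_seq.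
  by apply: eq_bigr => K' K'T; rewrite /D ifT// mul1r.
Qed.

Lemma eform_convex (D : set pt) (s : R) u v : measurable D -> s ^+ 2 = 1 -> H1 Omega u -> H1 Omega v ->
  eform Omega A D (fun x => s * v x + u x) (fun x => s * v x + u x) <=
  2 * (eform Omega A D u u + eform Omega A D v v) /\
  2 * `|eform Omega A D u v| <= eform Omega A D u u + eform Omega A D v v.
Proof.
move=> mD s1 hu hv.
pose Hl (c : R) (f g h : pt -> R) pf pg ph := @eform_lin R d Omega oO A alpha beta hA D c f g h mD pf pg ph.
pose Hs (f g : pt -> R) pf pg := @eform_sym R d Omega A alpha beta hA D f g mD pf pg.
pose Hp (c : R) (f g : pt -> R) pf pg := @H1_lin R d Omega c f g pf pg.
have q t := @psd_quadratic R pt (H1 Omega) (eform Omega A D) Hp Hl Hs t u v hu hv.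
have p t : 0 <= eform Omega A D (fun x => t * v x + u x) (fun x => t * v x + u x).
  by apply: (eform_ge0 hA) => //; exact: H1_lin.
move: (p (- s)) (p 1) (p (-1)); rewrite !q s1 sqrrN s1.
move: (eform _ _ _ u u) (eform _ _ _ u v) (eform _ _ _ v v) => x y t h1 h2 h3; split; first by lra.
by rewrite -normrM_half || (case: (lerP 0 y) => hy; [rewrite ger0_norm//|rewrite ltr0_norm//]; lra).
Qed.

Definition zero_on (f : pt -> R) K : Prop := forall x, hull K x -> f x = 0.

Let ge0 v K : H1 Omega v -> K \in TH -> 0 <= b K v v.
Proof. by move=> hv KT; exact: (element_energy_ge0 H). Qed.

Lemma support_zero_on (e r : pt -> R) K : continuous r -> K \in TH ->
  Defs.support r `<=` Defs.support e -> zero_on e K -> zero_on r K.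
Proof.
move=> cr KT re ez; apply: ae_vanish => //; first exact: sH.
apply: aeW => x oK; apply/eqP/negPn/negP => rx.
have cx : Defs.support e x by apply: re; exact: subset_closure.
have nx : nbhs x (osimplex K) by apply: open_nbhs_nbhs; split=> //; exact: open_osimplex.
have [y [/= ey oy]] := cx _ nx.
by move: ey; rewrite ez ?eqxx//; exact: (osimplex_hull (sH KT)).
Qed.

Lemma patch_zero v K : Vh v -> K \in TH ->
  (forall K', K' \in TH -> touch K K' -> zero_on v K') -> patch_energy Omega TH A v K = 0.
Proof.
move=> hv KT h; rewrite /patch_energy big_seq_cond big1// => K' /andP[K'T /asboolP tK].
apply: (eform_vanish H hv (P1_H1 hv) K'T); exact: h.
Qed.

Lemma I_0 : I (fun=> 0) = fun=> 0.
Proof.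
have h0 : Vh (fun=> 0) := P1_0 d0 pO th.
have := I_lin H (-1) h0 h0; rewrite (_ : (fun x => -1 * 0 + 0) = fun=> 0); last first.
  by apply/funext => x; rewrite mulr0 addr0.
by move=> E; apply/funext => x; rewrite E mulN1r addNr.
Qed.

Lemma I_sub v w : Vh v -> Vh w -> I (fun x => v x - w x) = fun x => I v x - I w x.
Proof.
move=> hv hw; rewrite (_ : (fun x => v x - w x) = fun x => -1 * w x + v x).
  by rewrite (I_lin H)//; apply/funext => x; rewrite mulN1r addrC.
by apply/funext => x; rewrite mulN1r addrC.
Qed.

Context (z : pt).
Local Notation near k K := (near_patch TH z k K).
Local Notation nb k K := `[< near k K >].

Definition outer_energy (v : pt -> R) k : R := \sum_(K <- TH | ~~ nb k K) b K v v.
Definition ring_energy (v : pt -> R) i j : R := \sum_(K <- TH | nb j K && ~~ nb i K) b K v v.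

Lemma ring_outer v i j : (i <= j)%N ->
  outer_energy v i = ring_energy v i j + outer_energy v j.
Proof.
move=> ij; rewrite /outer_energy (bigID (fun K => nb j K)) /=; congr (_ + _).
  by apply: eq_bigl => K; rewrite andbC.
rewrite big_seq_cond [RHS]big_seq_cond; apply: eq_bigl => K.
case KT : (K \in enum_fset TH) => //=; have [hj|hj] := boolP (nb j K); rewrite /= ?andbF ?andbT//.
by apply/negP => /asboolP hi; move/asboolP: hj; apply; exact: near_patch_le hi.
Qed.

Lemma ring_energy_ge0 v i j : H1 Omega v -> 0 <= ring_energy v i j.
Proof.
move=> hv; rewrite /ring_energy big_seq_cond; apply: sumr_ge0 => K /andP[KT _].
exact: ge0.
Qed.

Lemma outer_energy_ge0 v i : H1 Omega v -> 0 <= outer_energy v i.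
Proof.
move=> hv; rewrite /outer_energy big_seq_cond; apply: sumr_ge0 => K /andP[KT _].
exact: ge0.
Qed.

Lemma ring_patch v i j : H1 Omega v ->
  \sum_(K <- TH | nb j K && ~~ nb i.+1 K) patch_energy Omega TH A v K <=
  overlap d gamma * ring_energy v i j.+1.
Proof.
move=> hv; pose F K := if nb j.+1 K && ~~ nb i K then b K v v else 0.
have F0 K : K \in TH -> 0 <= F K by move=> KT; rewrite /F; case: ifP => // _; exact: ge0.
have -> : ring_energy v i j.+1 = \sum_(K <- TH) F K by rewrite /ring_energy big_mkcond.
apply: le_trans _ (overlap_sum d0 tH (lod_gamma H) (lod_regular H) F0).
rewrite big_mkcond big_seq [leRHS]big_seq; apply: ler_sum => K KT.
have s0 : 0 <= \sum_(K' <- TH | `[< touch K K' >]) F K'.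
  by rewrite big_seq_cond; apply: sumr_ge0 => K' /andP[K'T _]; exact: F0.
case: ifP => // /andP[/asboolP hj /asboolP hi].
rewrite /patch_energy big_seq_cond [leRHS]big_seq_cond; apply: ler_sum => K' /andP[K'T /asboolP t].
rewrite /F ifT//; apply/andP; split; apply/asboolP.
  exact: near_patch_touch t.
by move=> hi'; apply: hi; apply: near_patch_touch hi' _ => //; exact/touchC.
Qed.

Lemma ring_sub v i : H1 Omega v -> ring_energy v i.+1 i.+4 <= ring_energy v i i.+4.+1.
Proof.
move=> hv; rewrite /ring_energy big_mkcond [leRHS]big_mkcond big_seq [leRHS]big_seq.
apply: ler_sum => K KT; have := ge0 hv KT.
case: (boolP (nb i.+4 K && ~~ nb i.+1 K)) => [/andP[/asboolP h4 /asboolP h1]|_] b0.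
  rewrite ifT//; apply/andP; split; apply/asboolP; first exact: near_patchS h4.
  by move=> h; apply: h1; exact: near_patchS.
by case: ifP.
Qed.

Definition Ccut : R := cstab d gamma kappa * (1 + Cq ^+ 2 * overlap d gamma).
Definition Cring : R :=
  2 * (Ccut + Cq' ^+ 2 * (2 * (Ccut + Cq ^+ 2 * (overlap d gamma * Ccut)))).

Lemma Cring_ge0 : 0 <= gamma -> 0 <= kappa -> 0 <= Cring.
Proof.
move=> g0 k0; have o0 : 0 <= overlap d gamma by rewrite mulr_ge0// exprn_ge0// !mulr_ge0.
have c0 : 0 <= Ccut.
  apply: mulr_ge0; first by apply: mulr_ge0; [rewrite mulr_ge0|exact: sqr_ge0].
  by apply: addr_ge0 => //; apply: mulr_ge0 => //; exact: sqr_ge0.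
rewrite /Cring; apply: mulr_ge0 => //; apply: addr_ge0 => //; apply: mulr_ge0; first exact: sqr_ge0.
apply: mulr_ge0 => //; apply: addr_ge0 => //; apply: mulr_ge0; first exact: sqr_ge0.
exact: mulr_ge0.
Qed.

Let g_ge0 : 0 <= gamma := le_trans ler01 (lod_gamma H).
Let k_ge0 : 0 <= kappa := le_trans ler01 (lod_kappa H).

Section one_cut.
Context (phi : pt -> R) (i : nat).
Hypotheses (hphi : Vh phi) (Iphi : I phi = fun=> 0).

Let e p : R := if `[< vertex_patch TH z i.+2 p >] then 0 else 1.
Let w0 := cut TH Th e phi.

Let e_in K : K \in TH -> near i.+2 K -> forall p, p \in K -> e p = 0.
Proof.
move=> KT hK p pK; rewrite /e asboolT//; apply: (near_hull_sub KT hK).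
exact: (vertex_hull (sH KT)).
Qed.

Let e_out K : K \in TH -> ~ near i.+3 K -> forall p, p \in K -> e p = 1.
Proof.
move=> KT hK p pK; rewrite /e asboolF// => hp; apply: hK; exists p; split=> //.
exact: (vertex_hull (sH KT)).
Qed.

Let e1 p : `|e p| <= 1.
Proof. by rewrite /e; case: ifP; rewrite ?normr0// normr1. Qed.

Let hw0 : Vh w0 := cut_P1 H e hphi.

Let w0_in K : K \in TH -> near i.+2 K -> zero_on w0 K.
Proof.
move=> KT hK x hx; rewrite /w0 (cut_ae H hphi KT (e_in KT hK) hx) mul0r//.
Qed.

Let w0_out K : K \in TH -> ~ near i.+3 K -> forall x, hull K x -> w0 x = phi x.
Proof. by move=> KT hK x hx; rewrite /w0 (cut_ae H hphi KT (e_out KT hK) hx) mul1r. Qed.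

Let w0_energy_out K : K \in TH -> ~ near i.+3 K -> b K w0 w0 = b K phi phi.
Proof.
move=> KT hK; have hd := P1_sub d0 pO th hw0 hphi.
have hz : zero_on (fun x => w0 x - phi x) K.
  by move=> x hx; rewrite (w0_out KT hK hx) subrr.
have E u : H1 Omega u -> b K w0 u = b K phi u.
  move=> hu; have := eform_lin oO hA 1 (mK KT) (P1_H1 hd) (P1_H1 hphi) hu.
  have -> : (fun x => 1 * (w0 x - phi x) + phi x) = w0.
    by apply/funext => x; rewrite mul1r subrK.
  by rewrite (eform_vanish H hd hu KT hz) mulr0 add0r.
have hw1 := P1_H1 hw0; have hp1 := P1_H1 hphi.
rewrite (E _ hw1) (eform_sym hA (mK KT) hp1 hw1); exact: E _ hp1.
Qed.

Let w0_ring : ring_energy w0 i i.+4.+1 <= Ccut * ring_energy phi i i.+4.+1.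
Proof.
have c1 := cstab_ge1 H; have c0 := le_trans ler01 c1.
have hw1 := P1_H1 hw0; have hp1 := P1_H1 hphi.
pose t K : R := if nb i.+3 K && ~~ nb i.+2 K then patch_energy Omega TH A phi K else 0.
have t0 K : 0 <= t K by rewrite /t; case: ifP => // _; exact: (patch_energy_ge0 H).
have step K : K \in TH -> b K w0 w0 <= cstab d gamma kappa * (b K phi phi + Cq ^+ 2 * t K).
  move=> KT; have b0 := ge0 hp1 KT.
  have s0 : 0 <= Cq ^+ 2 * t K by rewrite mulr_ge0// sqr_ge0.
  have [h2|h2] := pselect (near i.+2 K).
    rewrite (eform_vanish H hw0 hw1 KT (w0_in KT h2)).
    by rewrite mulr_ge0// addr_ge0.
  have [h3|h3] := pselect (near i.+3 K); last first.
    rewrite (w0_energy_out KT h3) -[leLHS]mul1r.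
    by rewrite ler_pM// lerDl.
  apply: le_trans (cut_energy H KT (fun p _ => e1 p) hphi) _.
  rewrite ler_wpM2l// lerD2l /t ifT; last by apply/andP; split; apply/asboolP.
  have [q _] := QI3_forms H hphi KT; move: q.
  by rewrite Iphi (_ : phi \- (fun=> 0) = phi)//; apply/funext => x /=; rewrite subr0.
have trans : \sum_(K <- TH | nb i.+4.+1 K && ~~ nb i K) t K <= overlap d gamma * ring_energy phi i i.+4.+1.
  apply: (@le_trans _ _ (\sum_(K <- TH | nb i.+4 K && ~~ nb i.+1 K) patch_energy Omega TH A phi K)).
    rewrite big_mkcond [leRHS]big_mkcond big_seq [leRHS]big_seq; apply: ler_sum => K KT.
    have p0 := patch_energy_ge0 H K hp1.
    rewrite /t; case: (boolP (nb i.+3 K && ~~ nb i.+2 K)) => [/andP[/asboolP h3 /asboolP h2]|_]; last first.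
      by case: ifP => _; case: ifP.
    rewrite [X in _ <= X]ifT; first by case: ifP.
    apply/andP; split; apply/asboolP; first exact: near_patchS h3.
    by move=> h1; apply: h2; exact: near_patchS.
  exact: ring_patch.
rewrite {1}/ring_energy /Ccut -mulrA mulrDl mul1r -mulrA.
apply: (@le_trans _ _ (\sum_(K <- TH | nb i.+4.+1 K && ~~ nb i K)
   cstab d gamma kappa * (b K phi phi + Cq ^+ 2 * t K))).
  by rewrite big_seq_cond [leRHS]big_seq_cond; apply: ler_sum => K /andP[KT _]; exact: step.
rewrite -mulr_sumr ler_wpM2l// big_split /= lerD2l -mulr_sumr ler_wpM2l//.
exact: sqr_ge0.
Qed.

Lemma cut_corrector : exists w, [/\ Vh w /\ I w = (fun=> 0),
  forall K, K \in TH -> near i.+1 K -> zero_on w K,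
  forall K, K \in TH -> ~ near i.+4 K -> forall x, hull K x -> w x = phi x &
  ring_energy w i.+1 i.+4 <= Cring * ring_energy phi i i.+4.+1].
Proof.
have hw1 := P1_H1 hw0; have hp1 := P1_H1 hphi.
have sq1 : (-1 : R) ^+ 2 = 1 by rewrite sqrrN expr1n.
pose eI := I w0; have heI : VH eI := I_VH H hw0.
have eI_in K : K \in TH -> near i.+1 K -> zero_on eI K.
  move=> KT hK x hx; have pz : patch_energy Omega TH A w0 K = 0.
    apply: patch_zero => // K' K'T t; apply: w0_in => //.
    exact: near_patch_touch hK t.
  by rewrite /eI (I_local H hw0 KT pz hx); apply: (w0_in KT) => //; exact: near_patchS.
have hd := P1_sub d0 pO th hw0 hphi.
have eI_out K : K \in TH -> ~ near i.+4 K -> zero_on eI K.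
  move=> KT hK x hx.
  have out K' : K' \in TH -> touch K K' -> ~ near i.+3 K'.
    by move=> K'T t h; apply: hK; apply: near_patch_touch h _ => //; exact/touchC.
  have pz : patch_energy Omega TH A (fun x => w0 x - phi x) K = 0.
    apply: patch_zero => // K' K'T t y hy.
    by rewrite (w0_out K'T (out K' K'T t) hy) subrr.
  have tKK : touch K K by exists x.
  have := I_local H hd KT pz hx; rewrite (I_sub hw0 hphi) Iphi subr0 /eI => ->.
  by rewrite (w0_out KT (out K KT tKK) hx) subrr.
have [r [hr Ir sr er]] := lod_QI4 H heI.
have cr : continuous r by case: hr.
have hr1 := P1_H1 hr; have heI1 := P1_H1 heI.
have r_zero K : K \in TH -> zero_on eI K -> zero_on r K.
  by move=> KT; apply: support_zero_on.
have hw : Vh (fun x => w0 x - r x) := P1_sub d0 pO th hw0 hr.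
exists (fun x => w0 x - r x); split.
- split=> //; rewrite (I_sub hw0 hr) Ir; apply/funext => x; exact: subrr.
- move=> K KT hK x hx; rewrite (r_zero K KT (eI_in K KT hK) x hx) subr0.
  by apply: (w0_in KT) hx; exact: near_patchS.
- move=> K KT hK x hx; rewrite (r_zero K KT (eI_out K KT hK) x hx) subr0.
  apply: (w0_out KT) hx => h3; apply: hK; exact: near_patchS.
set rho := ring_energy phi i i.+4.+1; have rho0 : 0 <= rho by exact: ring_energy_ge0.
have w0r : ring_energy w0 i i.+4.+1 <= Ccut * rho by exact: w0_ring.
have eIr : B eI eI <= 2 * (Ccut + Cq ^+ 2 * (overlap d gamma * Ccut)) * rho.
  have -> : B eI eI = ring_energy eI i.+1 i.+4.
    rewrite (eform_elements heI1 heI1) /ring_energy [RHS]big_mkcond big_seq [RHS]big_seq.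
    apply: eq_bigr => K KT; case: ifPn => //; rewrite negb_and negbK => h.
    have z0 : zero_on eI K by case/orP: h => /asboolP h; [exact: eI_out|exact: eI_in].
    apply: (eform_ae0 hA) => //; first exact: mK.
    apply: filterS (P1_grad d0 pO tH heI) => x hx Ox hK.
    rewrite (hx Ox K KT hK) /slope big_seq big1// => p pK.
    by rewrite (z0 p (vertex_hull (sH KT) pK)) scale0r.
  have stepI K : K \in TH -> b K eI eI <= 2 * (b K w0 w0 + Cq ^+ 2 * patch_energy Omega TH A w0 K).
    move=> KT; have [_ q] := QI3_forms H hw0 KT; have hd1 := I_err_H1 H hw0.
    have [c _] := eform_convex (mK KT) sq1 hw1 hd1.
    have E : (fun x => -1 * (w0 \- I w0) x + w0 x) = eI by apply/funext => x /=; rewrite /eI; ring.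
    rewrite E in c; apply: le_trans c _.
    by rewrite ler_wpM2l// lerD2l.
  apply: (@le_trans _ _ (\sum_(K <- TH | nb i.+4 K && ~~ nb i.+1 K)
     2 * (b K w0 w0 + Cq ^+ 2 * patch_energy Omega TH A w0 K))).
    by rewrite /ring_energy big_seq_cond [leRHS]big_seq_cond; apply: ler_sum => K /andP[KT _]; exact: stepI.
  rewrite -mulr_sumr big_split /= -mulr_sumr -mulrA ler_wpM2l// mulrDl; apply: lerD.
    exact: le_trans (ring_sub i hw1) w0r.
  rewrite -mulrA ler_wpM2l ?sqr_ge0//; apply: le_trans (ring_patch i i.+4 hw1) _.
  by rewrite -mulrA ler_wpM2l//; exact: le_trans ler01 (overlap_ge1 d0 (lod_gamma H)).
have ErB : B r r <= Cq' ^+ 2 * (2 * (Ccut + Cq ^+ 2 * (overlap d gamma * Ccut)) * rho).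
  have aeO : {ae mu, forall x, Omega x -> Omega x} by apply: aeW.
  have EO v : H1 Omega v -> energy Omega A Omega v ^+ 2 = B v v.
    move=> hv; rewrite (energy_sqr hA a0 (open_measurable_rV oO) aeO hv).
    apply: eq_Rintegral => x _; rewrite indicT /edens !indicE mul1r.
    by move: (dot _ _) => t; case: (x \in Omega); rewrite ?mul1r ?mul0r.
  apply: le_trans (_ : Cq' ^+ 2 * B eI eI <= _); last by rewrite ler_wpM2l// sqr_ge0.
  rewrite -!EO// -exprMn ler_sqr// nnegrE ?L2norm_ge0//.
  by rewrite mulr_ge0 ?L2norm_ge0//; exact: le_trans ler01 (lod_Cq' H).
have stepw K : K \in TH -> b K (fun x => w0 x - r x) (fun x => w0 x - r x) <= 2 * (b K w0 w0 + b K r r).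
  move=> KT; have [c _] := eform_convex (mK KT) sq1 hw1 hr1.
  have E : (fun x => -1 * r x + w0 x) = (fun x => w0 x - r x) by apply/funext => x; ring.
  by rewrite E in c.
apply: (@le_trans _ _ (\sum_(K <- TH | nb i.+4 K && ~~ nb i.+1 K) 2 * (b K w0 w0 + b K r r))).
  by rewrite /ring_energy big_seq_cond [leRHS]big_seq_cond; apply: ler_sum => K /andP[KT _]; exact: stepw.
rewrite -mulr_sumr /Cring -mulrA; apply: ler_wpM2l; first exact: ler0n.
rewrite big_split /= mulrDl; apply: lerD.
  exact: le_trans (ring_sub i hw1) w0r.
rewrite -mulrA; apply: le_trans ErB; rewrite (eform_elements hr1 hr1) big_mkcond big_seq [leRHS]big_seq.
by apply: ler_sum => K KT; case: ifP => _; [exact: lexx|exact: ge0].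
Qed.

End one_cut.

Lemma eform_eq_on u v w K : Vh u -> Vh v -> H1 Omega w -> K \in TH ->
  (forall x, hull K x -> u x = v x) -> b K u w = b K v w.
Proof.
move=> hu hv hw KT uv; have hd := P1_sub d0 pO th hu hv.
have hz : zero_on (fun x => u x - v x) K by move=> x hx; rewrite uv// subrr.
have := eform_lin oO hA 1 (mK KT) (P1_H1 hd) (P1_H1 hv) hw.
have -> : (fun x => 1 * (u x - v x) + v x) = u.
  by apply/funext => x; rewrite mul1r subrK.
by rewrite (eform_vanish H hd hw KT hz) mulr0 add0r.
Qed.

Definition theta : R := (1 + Cring) / (2 + Cring).

Lemma theta_bounds : 0 <= gamma -> 0 <= kappa -> 0 < theta < 1.
Proof.
move=> g0 k0; have c0 := Cring_ge0 g0 k0; rewrite /theta divr_gt0 ?ltr_pdivrMr ?mul1r//=; lra.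
Qed.

Section corrector.
Context (lambda phi : pt -> R).
Hypotheses (hlam : VH lambda) (lz : forall K, K \in TH -> ~ near 1 K -> zero_on lambda K)
  (hphi : Vh phi) (Iphi : I phi = fun=> 0)
  (gal : forall w, Vh w -> I w = (fun=> 0) -> B phi w = B lambda w).

Let hp1 : H1 Omega phi := P1_H1 hphi.
Let hl1 : H1 Omega lambda := P1_H1 hlam.

Let B_lambda w i : Vh w -> (forall K, K \in TH -> near i.+1 K -> zero_on w K) -> B lambda w = 0.
Proof.
move=> hw wz; rewrite (eform_elements hl1 (P1_H1 hw)) big_seq big1// => K KT.
have [h|h] := pselect (near i.+1 K).
  rewrite (eform_sym hA (mK KT) hl1 (P1_H1 hw)); exact: (eform_vanish H hw hl1 KT (wz K KT h)).
have z0 : zero_on lambda K.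
  by apply: lz => // h1; apply: h; exact: near_patch_le h1.
apply: (eform_ae0 hA) (mK KT) hl1 (P1_H1 hw) _.
apply: filterS (P1_grad d0 pO tH hlam) => x hx Ox hK.
rewrite (hx Ox K KT hK) /slope big_seq big1// => p pK.
by rewrite (z0 p (vertex_hull (sH KT) pK)) scale0r.
Qed.

Lemma outer_step i : outer_energy phi i.+4.+1 <= theta * outer_energy phi i.
Proof.
have [w [[hw Iw] w_in w_out wr]] := cut_corrector i hphi Iphi.
have hw1 := P1_H1 hw.
have Bpw : B phi w = 0 by rewrite (gal hw Iw); exact: (B_lambda hw w_in).
have sq1 : (-1 : R) ^+ 2 = 1 by rewrite sqrrN expr1n.
have step K : K \in TH -> (if ~~ nb i.+4 K then b K phi phi else 0) <=
    b K phi w + (if nb i.+4 K && ~~ nb i.+1 K then b K phi phi + b K w w else 0).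
  move=> KT; have [_ c] := eform_convex (mK KT) sq1 hp1 hw1.
  case: (boolP (nb i.+4 K)) => [/asboolP h4|/asboolP h4] /=; last first.
    rewrite addr0 (eform_sym hA (mK KT) hp1 hw1).
    rewrite (eform_eq_on hw hphi hp1 KT (w_out K KT h4)); exact: lexx.
  case: (boolP (nb i.+1 K)) => [/asboolP h1|_] /=.
    rewrite addr0 (eform_sym hA (mK KT) hp1 hw1).
    by rewrite (eform_vanish H hw hp1 KT (w_in K KT h1)).
  exact: norm_half_ge0 c.
have S4 : outer_energy phi i.+4 <= ring_energy phi i.+1 i.+4 + ring_energy w i.+1 i.+4.
  have -> : ring_energy phi i.+1 i.+4 + ring_energy w i.+1 i.+4 =
      \sum_(K <- TH) (if nb i.+4 K && ~~ nb i.+1 K then b K phi phi + b K w w else 0).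
    by rewrite -big_mkcond big_split.
  rewrite [outer_energy _ _]big_mkcond -[leRHS]add0r -[X in _ <= X + _]Bpw (eform_elements hp1 hw1).
  by rewrite -big_split big_seq [leRHS]big_seq; apply: ler_sum => K KT; exact: step.
have o45 : outer_energy phi i.+4.+1 <= outer_energy phi i.+4.
  by rewrite (ring_outer phi (leqnSn i.+4)) lerDr; exact: ring_energy_ge0.
have rs := ring_sub i hp1.
have ro : ring_energy phi i i.+4.+1 = outer_energy phi i - outer_energy phi i.+4.+1.
  by rewrite (@ring_outer phi i i.+4.+1) ?addrK//; do 5 apply: leqW.
by apply: contraction (Cring_ge0 g_ge0 k_ge0) S4 o45 _ _; rewrite -ro.
Qed.

Lemma outer0 : outer_energy phi 0 = B phi phi.
Proof.
rewrite (eform_elements hp1 hp1) /outer_energy; apply: eq_bigl => K.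
by apply/negP => /asboolP.
Qed.

Lemma outer_decay m : outer_energy phi (5 * m) <= theta ^+ m * B phi phi.
Proof.
have /andP[t0 _] := theta_bounds g_ge0 k_ge0.
elim: m => [|m IH]; first by rewrite muln0 outer0 expr0 mul1r.
have -> : (5 * m.+1)%N = (5 * m).+4.+1 by rewrite mulnS addnC !addnS addn0.
apply: le_trans (outer_step _) _.
by rewrite exprS -mulrA ler_wpM2l// ltW.
Qed.

Lemma outer_le i j : (i <= j)%N -> outer_energy phi j <= outer_energy phi i.
Proof. by move=> ij; rewrite (ring_outer phi ij) lerDr; exact: ring_energy_ge0. Qed.

Lemma corrector_energy : B phi phi <= B lambda lambda.
Proof.
have sq1 : (-1 : R) ^+ 2 = 1 by rewrite sqrrN expr1n.
have [_ c] := eform_convex measurableT sq1 hl1 hp1.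
have E := gal hphi Iphi; have n := ler_norm (B lambda phi).
by move: c n; rewrite -E {E}; move: (B phi phi) (B lambda lambda) => x y; lra.
Qed.

Lemma best_approximation k phik w : is_corrector Omega A TH Th I z k lambda phik ->
  Vfs_on Omega Th I (vertex_patch TH z k) w ->
  B (fun x => phi x - phik x) (fun x => phi x - phik x) <= B (fun x => phi x - w x) (fun x => phi x - w x).
Proof.
move=> [[[hk Ik] kz] galk] [[hw Iw] wz].
have hd := P1_sub d0 pO th hphi hk; have he := P1_sub d0 pO th hk hw.
have Ie : I (fun x => phik x - w x) = fun=> 0.
  by rewrite (I_sub hk hw) Ik Iw; apply/funext => x; exact: subrr.
have ez : Vfs_on Omega Th I (vertex_patch TH z k) (fun x => phik x - w x).
  by split=> // x hx; rewrite kz// wz// subrr.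
have orth : B (fun x => phi x - phik x) (fun x => phik x - w x) = 0.
  have E : (fun x => phi x - phik x) = (fun x => -1 * phik x + phi x).
    by apply/funext => x; rewrite mulN1r addrC.
  rewrite E (eform_lin oO hA (-1) measurableT (P1_H1 hk) hp1 (P1_H1 he)).
  rewrite (gal he Ie) -(bform_eform _ _ phik) (galk _ ez) bform_eform.
  by rewrite mulN1r addNr.
pose Hl (c : R) (f g h : pt -> R) pf pg ph := @eform_lin R d Omega oO A alpha beta hA setT c f g h measurableT pf pg ph.
pose Hs (f g : pt -> R) pf pg := @eform_sym R d Omega A alpha beta hA setT f g measurableT pf pg.
pose Hp (c : R) (f g : pt -> R) pf pg := @H1_lin R d Omega c f g pf pg.
have := @psd_quadratic R pt (H1 Omega) B Hp Hl Hs 1 _ _ (P1_H1 hd) (P1_H1 he).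
have -> : (fun x => 1 * (phik x - w x) + (phi x - phik x)) = (fun x => phi x - w x).
  by apply/funext => x; ring.
move=> ->; rewrite orth mulr0 addr0 expr1n mul1r lerDl.
exact: (eform_ge0 hA a0 measurableT (P1_H1 he)).
Qed.

Lemma localization k phik : is_corrector Omega A TH Th I z k lambda phik ->
  B (fun x => phi x - phik x) (fun x => phi x - phik x) <=
  (1 + Cring) * (theta ^+ ((k - 4) %/ 5) * B lambda lambda).
Proof.
move=> hk; have c0 := Cring_ge0 g_ge0 k_ge0; have /andP[t0 _] := theta_bounds g_ge0 k_ge0.
suff key : B (fun x => phi x - phik x) (fun x => phi x - phik x) <=
    (1 + Cring) * outer_energy phi (k - 4).
  apply: le_trans key _; apply: ler_wpM2l; first by rewrite addr_ge0.
  apply: le_trans (ler_wpM2l (exprn_ge0 _ (ltW t0)) corrector_energy).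
  apply: le_trans (outer_decay _); apply: outer_le.
  by rewrite mulnC leq_trunc_div.
have [k4|k4] := leqP k 3.
  have -> : (k - 4 = 0)%N by apply/eqP; rewrite subn_eq0 ltnW.
  have zz : Vfs_on Omega Th I (vertex_patch TH z k) (fun=> 0).
    by split; [split; [exact: (P1_0 d0 pO th)|exact: I_0]|].
  apply: le_trans (best_approximation hk zz) _; rewrite outer0.
  have -> : (fun x => phi x - 0) = phi by apply/funext => x; rewrite subr0.
  rewrite -[leLHS]mul1r; apply: ler_wpM2r; last by rewrite lerDl.
  exact: (eform_ge0 hA a0 measurableT).
move: k4 hk => /subnKC; rewrite addnC addn4; move: (k - 4)%N => i <- hk.
have [w [[hw Iw] w_in w_out wr]] := cut_corrector i hphi Iphi.
have hw1 := P1_H1 hw.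
have dz : Vfs_on Omega Th I (vertex_patch TH z i.+4) (fun x => phi x - w x).
  split; first split; first exact: (P1_sub d0 pO th).
    by rewrite (I_sub hphi hw) Iphi Iw; apply/funext => x; exact: subrr.
  move=> x [Ox nx]; have [K KT hK] := mesh_coverO tH Ox.
  rewrite (w_out K KT _ x hK) ?subrr// => h4; apply: nx.
  exact: near_hull_sub h4 _ hK.
apply: le_trans (best_approximation hk dz) _.
have -> : (fun x => phi x - (phi x - w x)) = w by apply/funext => x; ring.
have step K : K \in TH -> b K w w <= (if nb i.+4 K && ~~ nb i.+1 K then b K w w else 0) +
    (if ~~ nb i.+4 K then b K phi phi else 0).
  move=> KT; case: (boolP (nb i.+4 K)) => [/asboolP h4|/asboolP h4] /=; last first.
    rewrite add0r (eform_eq_on hw hphi hw1 KT (w_out K KT h4)).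
    by rewrite (eform_sym hA (mK KT) hp1 hw1) (eform_eq_on hw hphi hp1 KT (w_out K KT h4)).
  case: (boolP (nb i.+1 K)) => [/asboolP h1|_] /=; rewrite addr0//.
  by rewrite (eform_vanish H hw hw1 KT (w_in K KT h1)).
have S4 : B w w <= ring_energy w i.+1 i.+4 + outer_energy phi i.+4.
  rewrite (eform_elements hw1 hw1) [ring_energy _ _ _]big_mkcond [outer_energy _ _]big_mkcond.
  rewrite -big_split big_seq [leRHS]big_seq; apply: ler_sum => K KT; exact: step.
have ro : ring_energy phi i i.+4.+1 = outer_energy phi i - outer_energy phi i.+4.+1.
  by rewrite (@ring_outer phi i i.+4.+1) ?addrK//; do 5 apply: leqW.
have o4 : outer_energy phi i.+4 <= outer_energy phi i by apply: outer_le; rewrite -addn4 leq_addr.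
have o5 := outer_energy_ge0 i.+4.+1 hp1.
by apply: cut_total c0 S4 _ o4 o5; rewrite -ro.
Qed.

End corrector.

End decay.

(** * Riesz representation and inverse estimates *)

Lemma riesz (R : realType) (T : eqType) (Q : set (T -> R)) (b : (T -> R) -> (T -> R) -> R)
  (Qlin : forall a v w, Q v -> Q w -> Q (fun x => a * v x + w x))
  (bl : forall a u v w, Q u -> Q v -> Q w -> b (fun x => a * u x + v x) w = a * b u w + b v w)
  (bsym : forall u v, Q u -> Q v -> b u v = b v u)
  (bge0 : forall v, Q v -> 0 <= b v v) (N : seq T) (P : set (T -> R)) (l : (T -> R) -> R) :
  P `<=` Q -> (forall a v w, P v -> P w -> P (fun x => a * v x + w x)) -> P (fun=> 0) ->
  (forall a v w, P v -> P w -> l (fun x => a * v x + w x) = a * l v + l w) ->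
  (forall v, P v -> b v v = 0 -> l v = 0) ->
  (forall v, P v -> (forall z, z \in N -> v z = 0) -> v = fun=> 0) ->
  exists phi, P phi /\ forall w, P w -> b phi w = l w.
Proof.
elim: N P l => [|z N IH] P l PQ Plin P0 ll lnull Pdet.
  exists (fun=> 0); split=> // w Pw; rewrite (Pdet w Pw)//.
  have Q0 := PQ _ P0; have b0 : b (fun=> 0) (fun=> 0) = 0.
    have E : (fun x : T => -1 * 0 + 0) = (fun=> 0 : R) by apply/funext => x; rewrite mulr0 addr0.
    by have := bl (-1) _ _ _ Q0 Q0 Q0; rewrite E mulN1r addNr.
  by rewrite b0; apply/esym; exact: lnull.
have [allz|] := pselect (forall v, P v -> v z = 0).
  apply: IH => // v Pv vN; apply: Pdet => // y; rewrite inE => /orP[/eqP ->|/vN//].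
  exact: allz.
move=> /existsNP[v /not_implyP[Pv /eqP vz]].
pose P' : set (T -> R) := [set w | P w /\ w z = 0].
have scale a w : P w -> P (fun x => a * w x).
  by move=> Pw; have := Plin a _ _ Pw P0; congr P; apply/funext => x; rewrite addr0.
pose v1 x := (v z)^-1 * v x.
have Pv1 : P v1 by exact: scale.
have v1z : v1 z = 1 by rewrite /v1 mulVf.
have P'Q : P' `<=` Q by move=> w [/PQ].
have P'lin a w w' : P' w -> P' w' -> P' (fun x => a * w x + w' x).
  by move=> [Pw wz] [Pw' w'z]; split; [exact: Plin|rewrite wz w'z mulr0 addr0].
have P'0 : P' (fun=> 0) by [].
have det' w : P' w -> (forall y, y \in N -> w y = 0) -> w = fun=> 0.
  by move=> [Pw wz] wN; apply: Pdet => // y; rewrite inE => /orP[/eqP ->//|/wN].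
have Qv1 := PQ _ Pv1.
have [psi [[Ppsi psiz] hpsi]] := IH P' l P'Q P'lin P'0
  (fun a u w Pu Pw => ll a u w Pu.1 Pw.1) (fun w Pw => lnull w Pw.1) det'.
have bv1l a u w : P' u -> P' w -> b v1 (fun x => a * u x + w x) = a * b v1 u + b v1 w.
  by move=> /P'Q Qu /P'Q Qw; exact: (psd_addr Qlin bl bsym).
have bv1n w : P' w -> b w w = 0 -> b v1 w = 0.
  move=> /P'Q Qw w0; rewrite bsym//; exact: (psd_null Qlin bl bsym bge0).
have [q [[Pq qz] hq]] := IH P' (b v1) P'Q P'lin P'0 bv1l bv1n det'.
pose v2 x := -1 * q x + v1 x.
have Pv2 : P v2 by exact: Plin.
have Qv2 := PQ _ Pv2; have Qq := PQ _ Pq; have Qpsi := PQ _ Ppsi.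
have v2orth w : P' w -> b v2 w = 0.
  by move=> P'w; rewrite bl ?hq ?mulN1r ?addNr//; exact: P'Q.
pose t := l v2 / b v2 v2.
have tE : t * b v2 v2 = l v2.
  have [b0|bn0] := eqVneq (b v2 v2) 0; last by rewrite /t divfK.
  by rewrite b0 mulr0; apply/esym; exact: lnull.
exists (fun x => t * v2 x + psi x); split; first exact: Plin.
move=> w Pw; have Qw := PQ _ Pw.
pose w' x := - w z * v2 x + w x.
have Pw' : P w' by exact: Plin.
have P'w' : P' w' by split=> //; rewrite /w' /v2 qz v1z; ring.
have wE : w = fun x => w z * v2 x + w' x by apply/funext => x; rewrite /w'; ring.
have Qw' := PQ _ Pw'.
pose u x := t * v2 x + psi x; have Qu : Q u by exact: Qlin.
have e1 : b u w = w z * b u v2 + b u w' by rewrite [in LHS]wE (psd_addr Qlin bl bsym).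
have e2 : b u v2 = t * b v2 v2 + b psi v2 by rewrite /u bl.
have e3 : b u w' = t * b v2 w' + b psi w' by rewrite /u bl.
have e4 : b psi v2 = 0 by rewrite bsym// v2orth.
rewrite e1 e2 e3 e4 (v2orth w')// (hpsi w')// tE.
rewrite [in RHS]wE ll//; ring.
Qed.

Lemma sign_shift (R : realType) (p q y s : R) : p * p * (q * q) = 1 ->
  p * q * y = 3 * s / 4 + p * q * (y - 3 * s / 4 * (p * q)).
Proof. by move=> pq; rewrite -[X in X + _]mulr1 -pq; ring. Qed.

Section mesh_bounds.
Context (R : realType) (d : nat) (Omega : set 'rV[R]_d) (T : {fset {fset 'rV[R]_d}}) (gamma : R).
Local Notation pt := 'rV[R]_d.
Local Notation mu := (lebesgue_rV R d).
Local Notation delta := (meshsize_min T).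
Hypotheses (d0 : (0 < d)%N) (pO : polyhedral_domain Omega) (tri : triangulation Omega T)
  (g1 : 1 <= gamma) (reg : shape_regular gamma T).
Implicit Types (S : {fset pt}).

Let g0 : 0 < gamma := lt_le_trans ltr01 g1.
Let dR : 0 < d%:R :> R. Proof. by rewrite ltr0n. Qed.
Let sT S (ST : S \in T) : simplex S := mesh_simplex tri ST.

Lemma mesh_nonempty : exists S, S \in T.
Proof.
by have [[x Ox] _ _ _ _] := pO; have [S ST _] := mesh_coverO tri Ox; exists S.
Qed.

Lemma meshsize_minP : 0 < delta /\ forall S, S \in T -> delta <= diam (hull S).
Proof.
have [S0 S0T] := mesh_nonempty.
have lb : lbound [set diam (hull S) | S in [set` T]] 0.
  by move=> _ [S ST <-]; apply: ltW; exact: diam_gt0 (sT ST) d0.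
have [S1 S1T h1] := @seq_argmin R _ (enum_fset T) (fun S => diam (hull S)) S0 S0T.
split; last by move=> S ST; apply: ge_inf; [exists 0|exists S].
apply: lt_le_trans (diam_gt0 (sT S1T) d0) _; apply: lb_le_inf; first by exists (diam (hull S0)), S0.
by move=> _ [S ST <-]; exact: h1.
Qed.

Lemma meshsize_max_ge S : S \in T -> diam (hull S) <= meshsize_max T.
Proof.
move=> ST; apply: ub_le_sup; last by exists S.
exists (\sum_(S <- T) diam (hull S)) => _ [S' S'T <-].
rewrite (big_rem S')//= lerDl big_seq; apply: sumr_ge0 => S'' /mem_rem S''T.
by apply: ltW; exact: diam_gt0 (sT S''T) d0.
Qed.

Lemma meshsize_min_max : delta <= meshsize_max T.
Proof.
have [S ST] := mesh_nonempty; have [_ h] := meshsize_minP.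
exact: le_trans (h S ST) (meshsize_max_ge ST).
Qed.

Lemma nodes_card (n : R) : 0 <= n -> closure Omega `<=` cube 0 n ->
  (size (enum_fset (nodes Omega T)))%:R * delta ^+ d <= d.+1%:R * (4 * n * gamma * d%:R) ^+ d.
Proof.
move=> n0 On; have [de0 dle] := meshsize_minP.
have h := mesh_card d0 tri g1 reg n0 On (ltW de0) dle.
apply: (@le_trans _ _ (d.+1%:R * ((size (enum_fset T))%:R * delta ^+ d))); last by rewrite ler_wpM2l.
rewrite mulrA; apply: ler_wpM2r; first by apply: exprn_ge0; exact: ltW.
rewrite -natrM ler_nat.
apply: (@leq_trans (size (flatten [seq enum_fset (K : {fset pt}) | K <- enum_fset T]))).
  apply: uniq_leq_size; first exact: fset_uniq.
  move=> z zN; have [[S ST zS] _] := proj1 (nodesP Omega T z) zN.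
  by apply/flattenP; exists (enum_fset S) => //; apply/mapP; exists S.
rewrite size_flatten /shape -map_comp sumnE big_map big_seq.
apply: (@leq_trans (\sum_(S <- T | S \in T) d.+1)).
  by apply: leq_sum => S ST; have [cS _] := sT ST; rewrite /= -cS.
by rewrite -big_seq big_const_seq count_predT iter_addn_0.
Qed.

Lemma coord_diam S (x y : pt) i : S \in T -> hull S x -> hull S y ->
  `|x ord0 i - y ord0 i| <= diam (hull S).
Proof.
move=> ST hx hy; have := coord_enorm (x - y) i; rewrite !mxE => h.
exact: le_trans h (le_diam (sT ST) hx hy).
Qed.

(* The corner is chosen by the signs of the coefficients, so that all the
   increments have the sign of the value at the centre. *)
Lemma aff_corner (a : 'cV[R]_d) (b : R) (c : pt) (s : R) : 0 < s ->
  exists c', cube c' (s / 4) `<=` cube c s /\ forall x, cube c' (s / 4) x ->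
    `|aff a b c| + s / 2 * \sum_i `|a i ord0| <= `|aff a b x|.
Proof.
move=> s0; pose sg (t : R) : R := if 0 <= t then 1 else -1.
have sgE t : sg t * t = `|t|.
  by rewrite /sg; case: ifPn => [h|]; [rewrite mul1r ger0_norm|rewrite -ltNge => h; rewrite mulN1r ltr0_norm].
have sg2 t : sg t * sg t = 1 by rewrite /sg; case: ifP => _; rewrite ?mulr1// mulrNN mulr1.
have sg1 t : `|sg t| = 1 by rewrite /sg; case: ifP => _; rewrite ?normr1// normrN normr1.
pose o := sg (aff a b c).
pose c' : pt := c + (3 * s / 4) *: \row_i (o * sg (a i ord0)).
have close x i : cube c' (s / 4) x ->
    `|x ord0 i - c ord0 i - 3 * s / 4 * (o * sg (a i ord0))| < s / 4.
  by move=> /(_ i); rewrite /c' !mxE => h; rewrite -normrN; congr (`|_| < _): h; ring.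
exists c'; split.
  move=> x hx i; have h := close x i hx.
  have n1 : `|3 * s / 4 * (o * sg (a i ord0))| = 3 * s / 4.
    by rewrite !normrM !sg1 !mulr1 ger0_norm ?normfV ?ger0_norm// ltW.
  rewrite distrC; have := ler_normD (x ord0 i - c ord0 i - 3 * s / 4 * (o * sg (a i ord0)))
    (3 * s / 4 * (o * sg (a i ord0))); rewrite subrK n1; lra.
move=> x hx.
have oa : aff a b x - aff a b c = \sum_i (x ord0 i - c ord0 i) * a i ord0.
  by rewrite affB dotrowE; apply: eq_bigr => i _; rewrite !mxE.
have key : `|aff a b c| + s / 2 * \sum_i `|a i ord0| <= o * aff a b x.
  have -> : o * aff a b x = o * aff a b c + o * (aff a b x - aff a b c) by ring.
  rewrite sgE lerD2l oa !mulr_sumr; apply: ler_sum => i _.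
  have h := close x i hx; rewrite -(sgE (a i ord0)).
  set t := a i ord0 in h *; set y := x ord0 i - c ord0 i in h *.
  have -> : o * (y * t) = (o * sg t * y) * (sg t * t).
    by rewrite -[y * t]mul1r -(sg2 t); ring.
  rewrite sgE ler_wpM2r//.
  have E : o * sg t * y = 3 * s / 4 + o * sg t * (y - 3 * s / 4 * (o * sg t)).
    have : (o * o) * (sg t * sg t) = 1 by rewrite !sg2 mulr1.
    exact: sign_shift.
  have n1 : `|o * sg t * (y - 3 * s / 4 * (o * sg t))| <= s / 4.
    by rewrite !normrM !sg1 !mul1r ltW.
  by move: n1; rewrite E ler_norml => /andP[]; lra.
apply: le_trans key _; apply: le_trans (ler_norm _) _.
by rewrite normrM sg1 mul1r.
Qed.

Lemma inverse_estimate v S p : P1 Omega T v -> S \in T -> p \in S ->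
  v p ^+ 2 * diam (hull S) ^+ d <= (8 * gamma * d%:R) ^+ d.+2 * L2norm Omega v ^+ 2.
Proof.
move=> hv ST pS; set D := diam (hull S); have D0 : 0 < D := diam_gt0 (sT ST) d0.
have q0 : 0 < 4 * gamma * d%:R by rewrite !mulr_gt0.
have [c hc] := cube_in_hull (sT ST) d0 g0 (reg ST).
set s := diam (hull S) / (4 * gamma * d%:R) in hc; have s0 : 0 < s by rewrite divr_gt0.
have sD : s <= D.
  rewrite ler_pdivrMr// ler_peMr ?ltW//.
  have : 1 <= d%:R :> R by rewrite ler1n.
  by move: g1; move: (d%:R : R) => y; nra.
have pv := P1_piecewise tri hv ST.
set a := slope v S in pv; set b := offset v S in pv.
have [c' [c'c big]] := aff_corner a b c s0.
have hcc : hull S c by apply: hc => i; rewrite subrr normr0.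
pose t := `|aff a b c| + s / 2 * \sum_i `|a i ord0|.
have sum0 : 0 <= \sum_i `|a i ord0| by apply: sumr_ge0.
have t0 : 0 <= t by rewrite addr_ge0// mulr_ge0// divr_ge0// ltW.
have vp : `|v p| <= 8 * gamma * d%:R * t.
  have hp := vertex_hull (sT ST) pS.
  rewrite (pv p hp) (_ : aff a b p = aff a b c + (aff a b p - aff a b c)); last by ring.
  apply: le_trans (ler_normD _ _) _.
  have h1 : `|aff a b p - aff a b c| <= D * \sum_i `|a i ord0|.
    rewrite affB dotrowE mulr_sumr; apply: le_trans (ler_norm_sum _ _ _) _.
    apply: ler_sum => i _; rewrite !mxE normrM ler_wpM2r//; exact: coord_diam.
  have -> : 8 * gamma * d%:R * t = 2 * (D / s) * t.
    have Ds : s * (4 * gamma * d%:R) = D by rewrite /s divfK// gt_eqF.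
    by rewrite -Ds; field; rewrite gt_eqF.
  have E : 2 * (D / s) * t = 2 * (D / s) * `|aff a b c| + D * \sum_i `|a i ord0|.
    by rewrite /t; field; rewrite gt_eqF.
  rewrite E lerD// ler_peMl//; have : 1 <= D / s by rewrite ler_pdivlMr// mul1r.
  lra.
have [[Lv _] _ ] := P1_H10 hv; have sv := Lv; move/L2P: sv => sv.
have cO x : cube c' (s / 4) x -> hull S x by move=> /c'c/hc.
have int : t ^+ 2 * (2 * (s / 4)) ^+ d <= L2norm Omega v ^+ 2.
  have i1 := intg_indic (measurable_cube c' (s / 4)) (cube_bounded_lty c' (s / 4)).
  have -> : t ^+ 2 * (2 * (s / 4)) ^+ d = \int[mu]_x (t ^+ 2 * \1_(cube c' (s / 4)) x).
    by rewrite (IntZ _ i1) Int_indic ?mu_cube ?divr_ge0 ?ltW//; exact: measurable_cube.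
  rewrite L2norm_sqr; apply: Int_le_ae; [exact: intg_scale|by case: sv|].
  apply: filterS (ae_hull_domain d0 pO tri ST) => x hO.
  rewrite indicE; have [cx|ncx] := pselect (cube c' (s / 4) x); last first.
    by rewrite memNset// mulr0 sqr_ge0.
  have hx := cO x cx; rewrite mem_set// mulr1 /patch mem_set; last exact: hO.
  by rewrite (pv x hx) -[leRHS]real_normK ?num_real// ler_sqr ?nnegrE//; exact: big.
have DE : D = 8 * gamma * d%:R * (2 * (s / 4)).
  have Ds : s * (4 * gamma * d%:R) = D by rewrite /s divfK// gt_eqF.
  by rewrite -[LHS]Ds; field.
have G0 : 0 <= 8 * gamma * d%:R by rewrite !mulr_ge0// ltW.
apply: (@le_trans _ _ ((8 * gamma * d%:R * t) ^+ 2 * D ^+ d)).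
  apply: ler_wpM2r; first by apply: exprn_ge0; exact: ltW.
  rewrite -[v p ^+ 2]real_normK ?num_real//; rewrite ler_sqr ?nnegrE//.
  exact: mulr_ge0.
rewrite {1}DE [X in _ * X]exprMn exprMn.
have -> : (8 * gamma * d%:R) ^+ 2 * t ^+ 2 * ((8 * gamma * d%:R) ^+ d * (2 * (s / 4)) ^+ d) =
   (8 * gamma * d%:R) ^+ d.+2 * (t ^+ 2 * (2 * (s / 4)) ^+ d).
  by rewrite -[d.+2]addn2 exprD mulrACA [_ ^+ 2 * _ ^+ d]mulrC.
by rewrite ler_wpM2l// exprn_ge0.
Qed.

Lemma hat_gradnorm (n : R) z lam : 0 <= n -> Omega `<=` cube 0 n ->
  is_hat Omega T z lam -> z \in nodes Omega T ->
  gradnorm Omega lam ^+ 2 * delta ^+ 2 <= gamma ^+ 2 * (2 * n) ^+ d.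
Proof.
move=> n0 On [hl lz lo] zN; have [de0 dle] := meshsize_minP.
have oO := domain_open pO; have hl1 := P1_H1 hl.
have i1 := intg_eform (identity_bounds oO) measurableT hl1 hl1.
have i2 := intg_indic (measurable_cube (0 : pt) n) (cube_bounded_lty 0 n).
rewrite gradnorm_sqr -mulrC -(IntZ _ i1).
have -> : gamma ^+ 2 * (2 * n) ^+ d = \int[mu]_x (gamma ^+ 2 * \1_(cube 0 n) x).
  by rewrite (IntZ _ i2) Int_indic ?mu_cube//; exact: measurable_cube.
apply: Int_le_ae; [exact: intg_scale|exact: intg_scale|].
apply: filterS (P1_grad d0 pO tri hl) => x hx; rewrite indicT mul1r /edens mul1mx indicE.
have [Ox|nOx] := pselect (Omega x); last first.
  by rewrite memNset// mul0r mulr0 mulr_ge0 ?sqr_ge0// indicE.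
rewrite mem_set// mul1r indicE mem_set; last exact: On.
rewrite mulr1; have [S ST hS] := mesh_coverO tri Ox; rewrite (hx Ox S ST hS) -enorm_dot -exprMn.
rewrite ler_sqr ?nnegrE; [|by apply: mulr_ge0; [exact: ltW|exact: enorm_ge0]|exact: ltW].
have vz p : p \in S -> lam p = (z == p)%:R.
  move=> pS; have [<-|zp] := eqVneq z p; first by rewrite lz.
  have [Op|nOp] := pselect (Omega p); last exact: P1_out hl nOp.
  by apply: lo; [apply/nodesP; split=> //; exists S|rewrite eq_sym].
have [zS|nzS] := boolP (z \in S); last first.
  have -> : slope lam S = 0.
    rewrite /slope big_seq big1// => p pS; rewrite vz//; case: eqP => [zp|_]; last by rewrite scale0r.
    by rewrite zp pS in nzS.
  have -> : enorm (0 : 'cV[R]_d) = 0.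
    by rewrite -[LHS]ger0_norm ?enorm_ge0// -sqrtr_sqr enorm_dot /dot mulmx0 mxE sqrtr0.
  by rewrite mulr0 ltW.
have -> : slope lam S = bslope S z.
  rewrite /slope (big_rem z)//= vz// eqxx scale1r big_seq big1 ?addr0// => p.
  rewrite mem_rem_uniq ?fset_uniq// inE => /andP[pz pS].
  by rewrite vz// eq_sym (negbTE pz) scale0r.
apply: le_trans (bslope_diam (sT ST) (ltW g0) (reg ST) zS).
by rewrite mulrC ler_wpM2l ?enorm_ge0//; exact: dle.
Qed.

End mesh_bounds.

Section refinement.
Context (R : realType) (d : nat) (Omega : set 'rV[R]_d) (TH Th : {fset {fset 'rV[R]_d}}).
Local Notation pt := 'rV[R]_d.

Lemma P1_refines v : refines Th TH -> P1 Omega TH v -> P1 Omega Th v.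
Proof.
move=> ref [h1 h2 h3 h4]; split=> // S ST; have [K KT SK] := ref S ST.
by have [a [b hab]] := h3 K KT; exists a, b => x /SK/hab.
Qed.

End refinement.

(** * Galerkin approximation *)

Section galerkin_forms.
Context (R : realType) (T : Type).

Definition linear_space (W : set (T -> R)) : Prop :=
  W (fun=> 0) /\ forall a v w, W v -> W w -> W (fun x => a * v x + w x).

Lemma space_scale (W : set (T -> R)) a v : linear_space W -> W v -> W (fun x => a * v x).
Proof.
move=> [W0 Wl] Wv; have := Wl a _ _ Wv W0.
by congr W; apply/funext => x; rewrite addr0.
Qed.

Lemma space_sub (W : set (T -> R)) v w : linear_space W -> W v -> W w -> W (fun x => v x - w x).
Proof.
move=> [W0 Wl] Wv Ww; have := Wl (-1) _ _ Ww Wv.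
by congr W; apply/funext => x; rewrite mulN1r addrC.
Qed.

Lemma space_sum (W : set (T -> R)) (J : eqType) (s : seq J) (c : J -> R) (F : J -> T -> R) :
  linear_space W -> (forall i, i \in s -> W (F i)) -> W (fun x => \sum_(i <- s) c i * F i x).
Proof.
move=> [W0 Wl]; elim: s => [|i s IH] hF.
  by move: W0; congr W; apply/funext => x; rewrite big_nil.
have hs : W (fun x => \sum_(i <- s) c i * F i x).
  by apply: IH => j js; apply: hF; rewrite inE js orbT.
have := Wl (c i) _ _ (hF i (mem_head _ _)) hs.
by congr W; apply/funext => x; rewrite big_cons.
Qed.

Lemma le_of_sqr_le (x y : R) : 0 <= x -> x * x <= y * x -> 0 <= y -> x <= y.
Proof.
move=> x0 h y0; move: x0; rewrite le_eqVlt => /orP[/eqP <-//|x0].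
by rewrite -(ler_pM2r x0).
Qed.

Context (P : set (T -> R)) (b : (T -> R) -> (T -> R) -> R).
Hypothesis Pl : linear_space P.
Hypothesis bl : forall a u v w, P u -> P v -> P w ->
  b (fun x => a * u x + v x) w = a * b u w + b v w.
Hypothesis bsym : forall u v, P u -> P v -> b u v = b v u.
Hypothesis bge0 : forall v, P v -> 0 <= b v v.
Local Notation nu v := (Num.sqrt (b v v)).

Lemma form0 w : P w -> b (fun=> 0) w = 0.
Proof.
move=> Pw; have E : (fun x : T => -1 * 0 + 0) = (fun=> 0 : R) by apply/funext => x; rewrite mulr0 addr0.
by have := bl (-1) Pl.1 Pl.1 Pw; rewrite E mulN1r addNr.
Qed.

Lemma form_norm_scale a v : P v -> nu (fun x => a * v x) = `|a| * nu v.
Proof.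
move=> Pv; have Pav := space_scale a Pl Pv.
have s w : P w -> b (fun x => a * v x) w = a * b v w.
  move=> Pw; have := bl a Pv Pl.1 Pw; rewrite form0// addr0 => <-.
  by congr b; apply/funext => x; rewrite addr0.
by rewrite s// bsym// s// mulrA -expr2 sqrtrM ?sqr_ge0// sqrtr_sqr.
Qed.

Lemma form_norm_sub v w : P v -> P w -> nu (fun x => v x - w x) <= nu v + nu w.
Proof.
move=> Pv Pw; have h := psd_triangle Pl.2 bl bsym bge0 Pv (space_scale (-1) Pl Pw).
have := h; rewrite (form_norm_scale (-1) Pw) normrN1 mul1r; congr (_ <= _).
by congr (nu _); apply/funext => x; rewrite mulN1r.
Qed.

Lemma form_norm_sum (J : eqType) (s : seq J) (c : J -> R) (F : J -> T -> R) :
  (forall i, i \in s -> P (F i)) ->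
  nu (fun x => \sum_(i <- s) c i * F i x) <= \sum_(i <- s) `|c i| * nu (F i).
Proof.
elim: s => [|i s IH] hF.
  rewrite big_nil (_ : (fun _ => _) = fun=> 0) ?form0 ?sqrtr0//; first exact: Pl.1.
  by apply/funext => x; rewrite big_nil.
have hs j : j \in s -> P (F j) by move=> js; apply: hF; rewrite inE js orbT.
have hi := hF i (mem_head _ _).
rewrite big_cons -form_norm_scale//.
apply: le_trans (lerD (lexx _) (IH hs)).
have := psd_triangle Pl.2 bl bsym bge0 (space_scale (c i) Pl hi) (space_sum c Pl hs).
by congr (nu _ <= _); apply/funext => x; rewrite big_cons.
Qed.

Lemma galerkin_quasi_best (W : set (T -> R)) u uc v : W `<=` P -> linear_space W ->
  P u -> W uc -> W v -> (forall w, W w -> b u w = b uc w) ->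
  nu (fun x => u x - uc x) <= nu (fun x => u x - v x).
Proof.
move=> WP Wl Pu Wuc Wv orth.
set e := fun x => u x - uc x; have Pe : P e by apply: space_sub Pl Pu (WP _ Wuc).
have Pv := WP _ Wv; have Puc := WP _ Wuc.
pose w x := v x - uc x; have Ww : W w by exact: space_sub.
have Pw := WP _ Ww; have Puv := space_sub Pl Pu Pv.
have ew : b e w = 0.
  have := bl (-1) Puc Pu Pw; rewrite (orth w Ww) mulN1r addNr => <-.
  by congr b; apply/funext => x; rewrite mulN1r addrC.
have ee : b e e = b e (fun x => u x - v x).
  have := psd_addr Pl.2 bl bsym 1 Puv Pw Pe; rewrite ew addr0 mul1r => <-.
  by congr b; apply/funext => x; rewrite /e /w; ring.
apply: le_of_sqr_le; rewrite ?sqrtr_ge0//.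
rewrite -expr2 sqr_sqrtr ?bge0// {1}ee; apply: le_trans (ler_norm _) _.
rewrite [leRHS]mulrC; exact: (psd_cs Pl.2 bl bsym bge0).
Qed.

Lemma form_stability u (M : R) : P u -> 0 <= M -> b u u <= M * nu u -> nu u <= M.
Proof.
by move=> Pu M0 h; apply: le_of_sqr_le; rewrite ?sqrtr_ge0// -expr2 sqr_sqrtr ?bge0.
Qed.

End galerkin_forms.

Lemma sum_mul_sqr_le (R : realType) (J : eqType) (s : seq J) (x y : J -> R) (X Y : R) :
  0 <= X -> 0 <= Y -> (forall i, i \in s -> x i ^+ 2 <= X) -> (forall i, i \in s -> 0 <= y i) ->
  (forall i, i \in s -> y i ^+ 2 <= Y) ->
  (\sum_(i <- s) `|x i| * y i) ^+ 2 <= (size s)%:R ^+ 2 * (X * Y).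
Proof.
move=> X0 Y0 hx y0 hy.
have s0 : 0 <= \sum_(i <- s) `|x i| * y i.
  by rewrite big_seq; apply: sumr_ge0 => i si; rewrite mulr_ge0// y0.
have -> : (size s)%:R ^+ 2 * (X * Y) = ((size s)%:R * Num.sqrt (X * Y)) ^+ 2.
  by rewrite exprMn sqr_sqrtr// mulr_ge0.
rewrite ler_sqr ?nnegrE ?mulr_ge0 ?sqrtr_ge0//.
apply: (@le_trans _ _ (\sum_(i <- s) Num.sqrt (X * Y))).
  rewrite big_seq [leRHS]big_seq; apply: ler_sum => i si.
  rewrite -[leLHS]ger0_norm; last by rewrite mulr_ge0// y0.
  rewrite -sqrtr_sqr ler_wsqrtr// exprMn real_normK ?num_real//.
  by apply: ler_pM; rewrite ?sqr_ge0 ?hx ?hy.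
by rewrite big_const_seq count_predT iter_addr_0 mulr_natl.
Qed.

(** * The error of the localized method *)

Lemma truncation_algebra (R : realType) (N t k x y S2 : R) (m : nat) : 0 < t -> 0 <= N ->
  0 <= x -> 0 <= y -> N * t ^+ m <= k -> S2 <= N ^+ 2 * (x / t ^+ m * (y / t ^+ 2)) ->
  S2 * t ^+ (3 * m + 2) <= k ^+ 2 * (x * y).
Proof.
move=> t0 N0 x0 y0 hk hS; have tm : 0 < t ^+ m by rewrite exprn_gt0.
have E : t ^+ (3 * m + 2) = (t ^+ m) ^+ 3 * t ^+ 2 by rewrite exprD -exprM mulnC.
rewrite E; apply: le_trans (ler_wpM2r _ hS) _.
  by rewrite mulr_ge0// exprn_ge0// ltW.
have -> : N ^+ 2 * (x / t ^+ m * (y / t ^+ 2)) * ((t ^+ m) ^+ 3 * t ^+ 2) = (N * t ^+ m) ^+ 2 * (x * y).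
  by move: (t ^+ m) tm => w w0; field; rewrite !gt_eqF.
apply: ler_wpM2r; first exact: mulr_ge0.
have a0 : 0 <= N * t ^+ m by rewrite mulr_ge0// ltW.
by rewrite ler_sqr// nnegrE// (le_trans a0 hk).
Qed.

Lemma collect_constants (R : realType) (K Ci n s c L C r be al G : R) : s ^+ 2 = al^-1 ->
  K * (Ci ^+ 2 * (2 * n * s * ((1 + c) * L)) ^+ 2) * (C * (r * (be * G))) =
  K * (Ci * (2 * n * (1 + c))) ^+ 2 * (C * G) * (be / al * L ^+ 2 * r).
Proof. by move=> <-; ring. Qed.

Section lod_error.
Context (R : realType) (d : nat) (Omega : set 'rV[R]_d) (gamma kappa Cq Cq' : R)
  (TH Th : {fset {fset 'rV[R]_d}}) (A : 'rV[R]_d -> 'M[R]_d) (alpha beta : R)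
  (I : ('rV[R]_d -> R) -> ('rV[R]_d -> R)).
Hypothesis H : lod_setting Omega gamma kappa Cq Cq' TH Th A alpha beta I.
Local Notation pt := 'rV[R]_d.
Local Notation mu := (lebesgue_rV R d).
Local Notation Vh := (P1 Omega Th).
Local Notation VH := (P1 Omega TH).
Local Notation b K := (eform Omega A (hull K)).
Local Notation B := (eform Omega A setT).
Local Notation nu v := (Num.sqrt (B v v)).
Local Notation delta := (meshsize_min TH).

Let d0 : (0 < d)%N := lod_dim H.
Let pO : polyhedral_domain Omega := lod_domain H.
Let oO : open Omega := domain_open pO.
Let tH : triangulation Omega TH := lod_coarse H.
Let th : triangulation Omega Th := lod_fine H.
Let hA : coef_bounds Omega A alpha beta := lod_coef H.
Let a0 : 0 < alpha := lod_alpha H.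
Let g_ge0 : 0 <= gamma := le_trans ler01 (lod_gamma H).
Let k_ge0 : 0 <= kappa := le_trans ler01 (lod_kappa H).
Let sH K (KT : K \in TH) : simplex K := mesh_simplex tH KT.
Let mK K (KT : K \in TH) : measurable (hull K) := measurable_hullH H KT.

Lemma H1_linear : linear_space (H1 Omega).
Proof. split; [exact: (H1_0 oO)|move=> a v w; exact: H1_lin]. Qed.

Lemma Vh_linear : linear_space Vh.
Proof. split; [exact: (P1_0 d0 pO th)|move=> a v w; exact: (P1_lin d0 pO th)]. Qed.

Lemma Vfs_linear : linear_space (Vfs Omega Th I).
Proof.
split; first by split; [exact: Vh_linear.1|exact: (I_0 H)].
move=> a v w [hv Iv] [hw Iw]; split; first exact: Vh_linear.2.
by rewrite (I_lin H)// Iv Iw; apply/funext => x; rewrite mulr0 addr0.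
Qed.

Let Bl a u v w : H1 Omega u -> H1 Omega v -> H1 Omega w ->
  B (fun x => a * u x + v x) w = a * B u w + B v w.
Proof. exact: (eform_lin oO hA a measurableT). Qed.

Let Bsym u v : H1 Omega u -> H1 Omega v -> B u v = B v u.
Proof. exact: (eform_sym hA measurableT). Qed.

Let Bge0 v : H1 Omega v -> 0 <= B v v.
Proof. exact: (eform_ge0 hA a0 measurableT). Qed.

Lemma energy_form v : H1 Omega v -> energy Omega A Omega v = nu v.
Proof.
move=> hv; have aeO : {ae mu, forall x, Omega x -> Omega x} by apply: aeW.
rewrite (energy_eform hA a0 (open_measurable_rV oO) aeO hv); congr (Num.sqrt _).
apply: eq_Rintegral => x _; rewrite indicT /edens !indicE mul1r.
by move: (dot _ _) => t; case: (x \in Omega); rewrite ?mul1r ?mul0r.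
Qed.

Lemma patch_energy_sum v : H1 Omega v ->
  \sum_(K <- TH) patch_energy Omega TH A v K <= overlap d gamma * B v v.
Proof.
move=> hv; rewrite (eform_elements H hv hv).
apply: (overlap_sum d0 tH (lod_gamma H) (lod_regular H)) => K KT.
exact: (element_energy_ge0 H hv KT).
Qed.

Definition Cstab : R := Cq * Num.sqrt (overlap d gamma).

Lemma Cstab_ge0 : 0 <= Cstab.
Proof. by rewrite mulr_ge0 ?sqrtr_ge0//; exact: le_trans ler01 (lod_Cq H). Qed.

Lemma Cstab_sqr : Cstab ^+ 2 = Cq ^+ 2 * overlap d gamma.
Proof.
by rewrite exprMn sqr_sqrtr//; exact: le_trans ler01 (overlap_ge1 d0 (lod_gamma H)).
Qed.

Lemma I_err_norm v : Vh v -> nu (v \- I v) <= Cstab * nu v.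
Proof.
move=> hv; have hv1 := P1_H1 hv; have he := I_err_H1 H hv.
rewrite -[leRHS]ger0_norm; last by rewrite mulr_ge0 ?Cstab_ge0 ?sqrtr_ge0.
rewrite -sqrtr_sqr ler_wsqrtr// exprMn Cstab_sqr sqr_sqrtr ?Bge0//.
rewrite (eform_elements H he he) -mulrA.
apply: le_trans (_ : Cq ^+ 2 * \sum_(K <- TH) patch_energy Omega TH A v K <= _).
  rewrite mulr_sumr big_seq [leRHS]big_seq; apply: ler_sum => K KT.
  by case: (QI3_forms H hv KT).
by apply: ler_wpM2l; [exact: sqr_ge0|exact: patch_energy_sum].
Qed.

Lemma coercive v : H1 Omega v -> gradnorm Omega v <= (Num.sqrt alpha)^-1 * nu v.
Proof.
move=> hv; have /andP[h _] := eform_gradnorm oO hA hv.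
have s0 : 0 < Num.sqrt alpha by rewrite sqrtr_gt0.
rewrite mulrC ler_pdivlMr// mulrC -[leLHS]ger0_norm; last first.
  by rewrite mulr_ge0 ?sqrtr_ge0 ?gradnorm_ge0.
by rewrite -sqrtr_sqr ler_wsqrtr// exprMn sqr_sqrtr// ltW.
Qed.

Lemma bounded_form v : H1 Omega v -> B v v <= beta * gradnorm Omega v ^+ 2.
Proof. by move=> hv; have /andP[] := eform_gradnorm oO hA hv. Qed.

Context (n : R) (g : pt -> R).
Hypotheses (n0 : 0 <= n) (On : closure Omega `<=` cube 0 n) (hg : L2 Omega g).
Local Notation G v := (\int[mu]_(x in Omega) (g x * v x)).
Local Notation load := ((Num.sqrt alpha)^-1 * Hm1norm Omega g).

Let On' : Omega `<=` cube 0 n.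
Proof. by move=> x Ox; apply: On; exact: subset_closure. Qed.

Lemma load_ge0 : 0 <= load.
Proof. by rewrite mulr_ge0 ?invr_ge0 ?sqrtr_ge0//; exact: (Hm1norm_ge0 oO d0 n0 On' hg). Qed.

Lemma load_bound v : H10 Omega v -> `|G v| <= load * nu v.
Proof.
move=> hv; apply: le_trans (Hm1norm_bound oO d0 n0 On' hg hv) _.
rewrite [_ * Hm1norm _ _]mulrC -mulrA ler_wpM2l ?(Hm1norm_ge0 oO d0 n0 On' hg)//.
by apply: coercive; case: hv.
Qed.

Lemma galerkin_stability (W : set (pt -> R)) u : W `<=` H10 Omega ->
  galerkin Omega A g W u -> nu u <= load.
Proof.
move=> WH [Wu hu]; have hu1 := WH _ Wu.
apply: (form_stability Bge0) => //; [by case: hu1|exact: load_ge0|].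
have e : B u u = G u by rewrite -bform_eform hu.
rewrite [leLHS]e; apply: le_trans (ler_norm _) _; exact: load_bound (WH _ Wu).
Qed.

Lemma L2norm_le v : H10 Omega v -> L2norm Omega v <= 2 * n * (Num.sqrt alpha)^-1 * nu v.
Proof.
move=> hv; apply: le_trans (friedrichs oO d0 n0 On' hv) _.
rewrite -[leRHS]mulrA; apply: ler_wpM2l; first by rewrite mulr_ge0.
by apply: coercive; case: hv.
Qed.

Lemma meshsize_load : L2 Omega (meshsize TH \* g) /\
  L2norm Omega (meshsize TH \* g) <= meshsize_max TH * L2norm Omega g.
Proof.
have mm : measurable_fun setT (meshsize TH).
  apply: measurable_sum => K; apply: measurable_funM => //.
  apply: measurable_indic; apply: open_measurable_rV; exact: open_interior.
have [K0 K0T] := mesh_nonempty pO tH.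
have M0 : 0 <= meshsize_max TH.
  exact: le_trans (ltW (diam_gt0 (sH K0T) d0)) (meshsize_max_ge d0 tH K0T).
have sg : sqi (g \_ Omega) by apply/L2P.
have dom : {ae mu, forall x, `|((meshsize TH \* g) \_ Omega) x| <=
    `|meshsize_max TH * (g \_ Omega) x|}.
  apply: filterS (ae_meshsize d0 tH) => x hx.
  rewrite /patch; case: ifPn => [|_]; last by rewrite mulr0.
  rewrite inE => Ox; have [K KT hK] := mesh_coverO tH Ox.
  rewrite /= (hx Ox K KT hK) !normrM; apply: ler_wpM2r => //.
  have D0 := diam_gt0 (sH KT) d0; have Dm := meshsize_max_ge d0 tH KT.
  by rewrite !ger0_norm// ltW.
have smg : sqi ((meshsize TH \* g) \_ Omega).
  apply: (sqi_dom _ (sqi_scale (meshsize_max TH) sg) dom).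
  have -> : (meshsize TH \* g) \_ Omega = fun x => meshsize TH x * (g \_ Omega) x.
    by apply/funext => x; rewrite /patch; case: ifP => //; rewrite mulr0.
  by apply: measurable_funM => //; case: sg.
split; first by apply/L2P.
rewrite !L2normE; apply: le_trans (nrm2_le_ae smg (sqi_scale (meshsize_max TH) sg) dom) _.
by rewrite (nrm2Z _ sg) ger0_norm.
Qed.

(* The load is split as [(H g) (f / H)]; the interpolation estimate controls
   [f / H] because [I f = 0]. *)
Lemma fine_scale_load f : Vh f -> I f = (fun=> 0) ->
  `|G f| <= Cstab * ((Num.sqrt alpha)^-1 * L2norm Omega (meshsize TH \* g)) * nu f.
Proof.
move=> hf If; have hf1 := P1_H1 hf; have [[Lf _] _] := P1_H10 hf.
have sf := Lf; move/L2P : sf => sf.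
have mO := open_measurable_rV oO.
have [Lmg _] := meshsize_load.
pose D (K : {fset pt}) : set pt := if K \in TH then hull K else set0.
have mD K : measurable (D K) by rewrite /D; case: ifP => // KT; exact: mK.
pose r (K : {fset pt}) : R := (diam (hull K))^-1 ^+ 2.
pose W (x : pt) : R := \sum_(K <- TH) r K * (\1_(D K) x * (\tr (A x) * (f \_ Omega) x ^+ 2)).
have iWK K : intg (fun x => \1_(D K) x * (\tr (A x) * (f \_ Omega) x ^+ 2)).
  exact: (intg_wform hA (mD K) Lf).
have iW : intg W by apply: intg_sum => K; exact: intg_scale.
pose s (x : pt) : R := \sum_(K <- TH) (diam (hull K))^-1 * \1_(D K) x.
pose q x := s x * f x.
have ms : measurable_fun setT s.
  by apply: measurable_sum => K; apply: measurable_funM => //; exact: measurable_indic.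
have mf : measurable_fun setT f by apply: continuous_measurable_rV; case: hf.
have sE : {ae mu, forall x, Omega x -> forall K, K \in TH -> hull K x -> s x = (diam (hull K))^-1}.
  apply: filterS (ae_element_sum d0 tH (fun K => (diam (hull K))^-1)) => x hx Ox K KT hK.
  rewrite -(hx Ox K KT hK) /s big_seq [RHS]big_seq.
  by apply: eq_bigr => K' K'T; rewrite /D ifT.
have qE : q \_ Omega = fun x => s x * (f \_ Omega) x.
  by apply/funext => x; rewrite /q /patch; case: ifP => //; rewrite mulr0.
have Wle : {ae mu, forall x, (q \_ Omega) x ^+ 2 <= alpha^-1 * W x}.
  have ae2 := ae_element_sum d0 tH r.
  apply: filterS3 (filterI sE ae2) (coef_rayleigh hA) (trace_ge0 hA a0) => x [h1 h2] hr ht.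
  have [Ox|nOx] := pselect (Omega x); last first.
    have f0 : (f \_ Omega) x = 0 by rewrite /patch memNset.
    by rewrite qE /W big1 => [|K _]; rewrite f0 ?expr0n !mulr0 ?expr0n.
  have [K KT hK] := mesh_coverO tH Ox.
  have -> : W x = r K * (\tr (A x) * (f \_ Omega) x ^+ 2).
    rewrite -(h2 Ox K KT hK) mulr_suml /W big_seq [RHS]big_seq.
    apply: eq_bigr => K1 K1T.
    by rewrite /D ifT// [LHS]mulrA.
  rewrite qE exprMn (h1 Ox K KT hK) [leRHS]mulrCA; apply: ler_wpM2l; first exact: sqr_ge0.
  rewrite mulrA; apply: ler_peMl; first exact: sqr_ge0.
  rewrite mulrC ler_pdivlMr// mul1r; apply: trace_ge => //; first exact: ltW.
  by move=> y; have /andP[] := hr Ox y.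
have mq : measurable_fun setT (q \_ Omega).
  by rewrite qE; apply: measurable_funM => //; case: sf.
have sq : sqi (q \_ Omega).
  split=> //; apply: (intg_dom _ (intg_scale alpha^-1 iW)); first exact: measurable_funX.
  by apply: filterS Wle => x; rewrite ger0_norm ?sqr_ge0.
have Lq : L2 Omega q by apply/L2P.
have nq : L2norm Omega q <= (Num.sqrt alpha)^-1 * (Cstab * nu f).
  rewrite -[leRHS]ger0_norm; last first.
    apply: mulr_ge0; first by rewrite invr_ge0 sqrtr_ge0.
    by apply: mulr_ge0; [exact: Cstab_ge0|exact: sqrtr_ge0].
  rewrite -[leLHS]ger0_norm ?L2norm_ge0// -ler_sqr ?nnegrE// !real_normK ?num_real//.
  rewrite exprMn [(Cstab * _) ^+ 2]exprMn Cstab_sqr exprVn sqr_sqrtr ?(ltW a0)// sqr_sqrtr ?Bge0//.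
  rewrite L2norm_sqr; apply: (@le_trans _ _ (\int[mu]_x (alpha^-1 * W x))).
    by apply: Int_le_ae => //; [case: sq|exact: intg_scale].
  rewrite (IntZ _ iW); apply: ler_wpM2l; first by rewrite invr_ge0 ltW.
  rewrite (Int_sum (enum_fset TH) (fun K => intg_scale (r K) (iWK K))) -mulrA.
  apply: le_trans (_ : Cq ^+ 2 * \sum_(K <- TH) patch_energy Omega TH A f K <= _).
    rewrite mulr_sumr big_seq [leRHS]big_seq; apply: ler_sum => K KT.
    rewrite (IntZ _ (iWK K)) /D ifT//; have [h _] := QI3_forms H hf KT.
    by move: h; rewrite (_ : f \- I f = f)//; apply/funext => x /=; rewrite If subr0.
  by apply: ler_wpM2l; [exact: sqr_ge0|exact: patch_energy_sum].
have -> : G f = \int[mu]_(x in Omega) ((meshsize TH \* g) x * q x).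
  rewrite (Int_restrict_mul Omega g f) (Int_restrict_mul Omega (meshsize TH \* g) q).
  apply: (@Int_ae _ _ (fun x => (g \_ Omega) x * f x) (fun x => ((meshsize TH \* g) \_ Omega) x * q x)).
  - by apply: measurable_funM => //; move/L2P : hg => [].
  - by apply: measurable_funM; [move/L2P : Lmg => []|exact: measurable_funM].
  - apply: filterS2 (ae_meshsize d0 tH) sE => x hm hs.
    rewrite /patch; case: ifPn => [|_]; last by rewrite !mul0r.
    rewrite inE => Ox; have [K KT hK] := mesh_coverO tH Ox; have D0 := diam_gt0 (sH KT) d0.
    by rewrite /q /= (hm Ox K KT hK) (hs Ox K KT hK); field; rewrite gt_eqF.
apply: le_trans (Int_L2 Lmg Lq) _; rewrite mulrC.
apply: le_trans (ler_wpM2r (L2norm_ge0 _ _) nq) _.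
by rewrite le_eqVlt; apply/orP; left; apply/eqP; ring.
Qed.

Lemma global_corrector l : H1 Omega l -> exists phi, [/\ Vh phi, I phi = (fun=> 0) &
  forall w, Vh w -> I w = (fun=> 0) -> B phi w = B l w].
Proof.
move=> hl; have [V0 Vl] := Vfs_linear.
have VP : Vfs Omega Th I `<=` H1 Omega by move=> v [hv _]; exact: P1_H1 hv.
have [phi [[hphi Iphi] hB]] := @riesz R pt (H1 Omega) B H1_linear.2 Bl Bsym Bge0
  (enum_fset (nodes Omega Th)) (Vfs Omega Th I) (B l) VP Vl V0
  (fun a v w hv hw => psd_addr H1_linear.2 Bl Bsym a (VP _ hv) (VP _ hw) hl)
  (fun v hv v0 => etrans (Bsym hl (VP _ hv))
     (psd_null H1_linear.2 Bl Bsym Bge0 (VP _ hv) hl v0))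
  (fun v hv hN => P1_eq th hv.1 Vh_linear.1 hN).
exists phi; split; [exact: hphi|exact: Iphi|].
by move=> w hw Iw; apply: hB; split.
Qed.

Lemma hat_zero_on z l K : is_hat Omega TH z l -> K \in TH -> ~ near_patch TH z 1 K -> zero_on l K.
Proof.
move=> [hl _ lo] KT nK x hx.
have vz p : p \in K -> l p = 0.
  move=> pK; have [Op|nOp] := pselect (Omega p); last exact: P1_out hl nOp.
  apply: lo; first by apply/nodesP; split=> //; exists K.
  apply/eqP => pz; apply: nK; exists z; split=> //.
  by rewrite -pz; exact: vertex_hull (sH KT) _ pK.
rewrite (P1_piecewise tH hl KT hx) /aff /slope /offset.
rewrite big_seq big1 => [|p pK]; last by rewrite vz// scale0r.
by rewrite mulmx0 mxE add0r big_seq big1// => p pK; rewrite vz// mul0r.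
Qed.

Let de0 : 0 < delta := (meshsize_minP d0 pO tH).1.

Lemma nodal_value_bound v z : VH v -> z \in nodes Omega TH ->
  v z ^+ 2 * delta ^+ d <= (8 * gamma * d%:R) ^+ d.+2 * L2norm Omega v ^+ 2.
Proof.
move=> hv /nodesP[[K KT zK] _].
apply: le_trans (inverse_estimate d0 pO tH (lod_gamma H) (lod_regular H) hv KT zK).
apply: ler_wpM2l; first exact: sqr_ge0.
rewrite lerXn2r ?nnegrE//; [exact: ltW|exact: ltW (diam_gt0 (sH KT) d0)|].
exact: (meshsize_minP d0 pO tH).2.
Qed.

Local Notation rate k := (theta d gamma kappa Cq Cq' ^+ ((k - 4) %/ 5)).

Lemma corrector_error z l phi phik k : is_hat Omega TH z l -> z \in nodes Omega TH ->
  Vh phi -> I phi = (fun=> 0) ->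
  (forall w, Vh w -> I w = (fun=> 0) -> B phi w = B l w) ->
  is_corrector Omega A TH Th I z k l phik ->
  nu (fun x => phi x - phik x) ^+ 2 * delta ^+ 2 <=
  (1 + Cring d gamma kappa Cq Cq') * (rate k * (beta * (gamma ^+ 2 * (2 * n) ^+ d))).
Proof.
move=> hl zN hphi Iphi gal ck; have [hlH _ _] := hl.
have [[[hk _] _] _] := ck.
have h1 : H1 Omega (fun x => phi x - phik x) by apply: P1_H1 (P1_sub d0 pO th hphi hk).
rewrite sqr_sqrtr ?Bge0//.
have lo := localization H hlH (fun K KT => hat_zero_on hl KT) hphi Iphi gal ck.
have th0 : 0 <= rate k.
  by apply: exprn_ge0; have /andP[/ltW] := theta_bounds d Cq Cq' g_ge0 k_ge0.
have C0 : 0 <= 1 + Cring d gamma kappa Cq Cq'.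
  by apply: addr_ge0 => //; exact: (Cring_ge0 d Cq Cq' g_ge0 k_ge0).
apply: le_trans (ler_wpM2r (sqr_ge0 _) lo) _.
rewrite -[leLHS]mulrA; apply: ler_wpM2l => //.
rewrite -[leLHS]mulrA; apply: ler_wpM2l => //.
apply: le_trans (ler_wpM2r (sqr_ge0 _) (bounded_form (P1_H1 hlH))) _.
rewrite -[leLHS]mulrA; apply: ler_wpM2l.
  exact: le_trans (ltW a0) (lod_alpha_beta H).
exact: (hat_gradnorm d0 pO tH (lod_gamma H) (lod_regular H) n0 On' hl zN).
Qed.

Lemma I_norm_le uh : Vh uh -> nu uh <= load ->
  L2norm Omega (I uh) <= 2 * n * (Num.sqrt alpha)^-1 * ((1 + Cstab) * load).
Proof.
move=> hu nl; have hI := P1_refines (lod_refines H) (I_VH H hu).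
apply: le_trans (L2norm_le (P1_H10 hI)) _; apply: ler_wpM2l.
  by apply: mulr_ge0; [rewrite mulr_ge0|rewrite invr_ge0 sqrtr_ge0].
have he := I_err_H1 H hu.
have := form_norm_sub H1_linear Bl Bsym Bge0 (P1_H1 hu) he.
rewrite (_ : (fun x => uh x - (uh \- I uh) x) = I uh); last first.
  by apply/funext => x /=; ring.
move=> h; apply: le_trans h _; rewrite mulrDl mul1r; apply: lerD => //.
by apply: le_trans (I_err_norm hu) _; apply: ler_wpM2l => //; exact: Cstab_ge0.
Qed.

Context (lambda : pt -> pt -> R) (Ciso : R) (u uh : pt -> R).
Hypotheses (hat : forall z, z \in nodes Omega TH -> is_hat Omega TH z (lambda z))
  (qi2 : QI2 Omega TH I Ciso)
  (hu : galerkin Omega A g (H10 Omega) u) (huh : galerkin Omega A g Vh uh).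

Definition Cnodes : R := d.+1%:R * (4 * n * gamma * d%:R) ^+ d.

Definition Cvalues : R :=
  (8 * gamma * d%:R) ^+ d.+2 * (Ciso * (2 * n * (1 + Cstab))) ^+ 2.

Definition Cdecay : R := (1 + Cring d gamma kappa Cq Cq') * (gamma ^+ 2 * (2 * n) ^+ d).

Let nuh : nu uh <= load.
Proof. by apply: galerkin_stability huh => v; exact: P1_H10. Qed.

Lemma lod_estimate k phi ucs :
  (forall z, z \in nodes Omega TH -> is_corrector Omega A TH Th I z k (lambda z) (phi z)) ->
  galerkin Omega A g (Vcs Omega TH lambda phi) ucs ->
  energy Omega A Omega (u \- ucs) <= load /\
  exists2 S, energy Omega A Omega (u \- ucs) <= energy Omega A Omega (u \- uh) +
      Cstab * ((Num.sqrt alpha)^-1 * L2norm Omega (meshsize TH \* g)) + S &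
    0 <= S /\ S ^+ 2 * delta ^+ (3 * d + 2) <=
      Cnodes ^+ 2 * (Cvalues * Cdecay) * (beta / alpha * load ^+ 2 * rate k).
Proof.
move=> cor [[cs ucsE] hucs].
set N := enum_fset (nodes Omega TH).
have hk z : z \in N -> Vh (phi z) by move=> zN; have [[[]]] := cor z zN.
have hlh z : z \in N -> Vh (lambda z).
  by move=> zN; have [h _ _] := hat zN; exact: P1_refines (lod_refines H) h.
have hd1 z : z \in N -> Vh (fun x => lambda z x - phi z x).
  by move=> zN; exact: (P1_sub d0 pO th (hlh z zN) (hk z zN)).
pose W := Vcs Omega TH lambda phi.
have WVh : W `<=` Vh.
  move=> _ [c ->]; exact: (space_sum c Vh_linear hd1).
have WP : W `<=` H1 Omega by move=> v /WVh; exact: P1_H1.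
have Wl : linear_space W.
  split; first by exists (fun=> 0); apply/funext => x; rewrite big1// => z _; rewrite mul0r.
  move=> a _ _ [c1 ->] [c2 ->]; exists (fun z => a * c1 z + c2 z); apply/funext => x.
  by rewrite mulr_sumr -big_split; apply: eq_bigr => z _ /=; ring.
have [hu10 hub] := hu; have hu1 : H1 Omega u by case: hu10.
have Wucs : W ucs by exists cs.
have orth w : W w -> B u w = B ucs w.
  move=> Ww; have hw := P1_H10 (WVh _ Ww).
  by rewrite -(bform_eform Omega A u w) -(bform_eform Omega A ucs w) hub// hucs.
have best v : W v -> nu (fun x => u x - ucs x) <= nu (fun x => u x - v x).
  move=> Wv; exact: (galerkin_quasi_best H1_linear Bl Bsym Bge0 WP Wl hu1 Wucs Wv orth).
have hd : H1 Omega (fun x => u x - uh x) by exact: (space_sub H1_linear hu1 (P1_H1 huh.1)).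
have e1 : energy Omega A Omega (u \- ucs) = nu (fun x => u x - ucs x).
  exact: (energy_form (space_sub H1_linear hu1 (WP _ Wucs))).
have e2 : energy Omega A Omega (u \- uh) = nu (fun x => u x - uh x) by exact: energy_form hd.
rewrite e1 e2; split.
  apply: le_trans (best _ Wl.1) _.
  rewrite (_ : (fun x => u x - 0) = u); last by apply/funext => x; rewrite subr0.
  exact: galerkin_stability hu.
have [vH hvH IvH] : exists2 v, VH v & I v = I uh.
  have [[_ _ sur] _] := qi2; have [v hv <-] := sur _ (I_VH H huh.1).
  by exists v.
have vHE := P1_hats d0 pO tH hat hvH.
have glob z : exists p, z \in N -> [/\ Vh p, I p = (fun=> 0) &
    forall w, Vh w -> I w = (fun=> 0) -> B p w = B (lambda z) w].
  have [zN|_] := boolP (z \in N); last by exists (fun=> 0).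
  by have [p hp] := global_corrector (P1_H1 (hlh z zN)); exists p.
have [p hp] := choice glob.
have hpV z : z \in N -> Vh (p z) by move=> /hp[].
pose r x := \sum_(z <- N) vH z * (lambda z x - p z x).
pose Z : set (pt -> R) := [set v | Vh v /\ forall w, Vh w -> I w = (fun=> 0) -> B v w = 0].
have Zl : linear_space Z.
  split; first split; first exact: Vh_linear.1.
    by move=> w hw _; exact: (form0 H1_linear Bl (P1_H1 hw)).
  move=> a v w [hv v0] [hw w0]; split; first exact: Vh_linear.2.
  move=> y hy Iy; have E := Bl a (P1_H1 hv) (P1_H1 hw) (P1_H1 hy).
  by rewrite (v0 y hy Iy) (w0 y hy Iy) mulr0 addr0 in E.
have [hr r0] : Z r.
  apply: space_sum Zl _ => z zN; have [h1 h2 h3] := hp z zN.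
  split; first exact: (P1_sub d0 pO th (hlh z zN) h1).
  move=> w hw Iw; have hw1 := P1_H1 hw.
  have := Bl (-1) (P1_H1 h1) (P1_H1 (hlh z zN)) hw1; rewrite (h3 w hw Iw) mulN1r addNr.
  by have -> : (fun x => -1 * p z x + lambda z x) = fun x => lambda z x - p z x
    by apply/funext => x; rewrite mulN1r addrC.
pose f x := uh x - r x.
have hvHh := P1_refines (lod_refines H) hvH.
have fVfs : Vfs Omega Th I f.
  have h1 : Vfs Omega Th I (fun x => uh x - vH x).
    split; first exact: (P1_sub d0 pO th huh.1 hvHh).
    by rewrite (I_sub H huh.1 hvHh) IvH; apply/funext => x; rewrite subrr.
  have h2 : Vfs Omega Th I (fun x => \sum_(z <- N) vH z * p z x).
    by apply: space_sum Vfs_linear _ => z /hp[].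
  have := Vfs_linear.2 1 _ _ h1 h2; congr (Vfs _ _ _ _); apply/funext => x.
  have vx : vH x = \sum_(z <- N) vH z * lambda z x by rewrite {1}vHE.
  rewrite mul1r /f /r vx -addrA; congr (_ + _).
  have -> : \sum_(z <- N) vH z * (lambda z x - p z x) =
    \sum_(z <- N) vH z * lambda z x - \sum_(z <- N) vH z * p z x.
    by rewrite -sumrB; apply: eq_bigr => z _; rewrite mulrBr.
  by rewrite opprB addrC.
have [hf If] := fVfs; have hf1 := P1_H1 hf.
have Bf : B f f = G f.
  have <- : B uh f = G f by rewrite -bform_eform; exact: huh.2.
  have := Bl (-1) (P1_H1 hr) (P1_H1 huh.1) hf1; rewrite (r0 f hf If) mulr0 add0r.
  by have -> : (fun x => -1 * r x + uh x) = f by apply/funext => x; rewrite mulN1r addrC.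
have nf : nu f <= Cstab * ((Num.sqrt alpha)^-1 * L2norm Omega (meshsize TH \* g)).
  apply: (form_stability Bge0) => //.
    apply: mulr_ge0; first exact: Cstab_ge0.
    by apply: mulr_ge0; [rewrite invr_ge0 sqrtr_ge0|exact: L2norm_ge0].
  by rewrite [leLHS]Bf; apply: le_trans (ler_norm _) _; exact: fine_scale_load.
pose e z x := p z x - phi z x.
have he z : z \in N -> H1 Omega (e z).
  by move=> zN; exact: (P1_H1 (P1_sub d0 pO th (hpV z zN) (hk z zN))).
exists (\sum_(z <- N) `|vH z| * nu (e z)).
  have Wv : W (fun x => \sum_(z <- N) vH z * (lambda z x - phi z x)) by exists vH.
  apply: le_trans (best _ Wv) _.
  pose tail x := \sum_(z <- N) vH z * e z x.
  have htail : H1 Omega tail by exact: (space_sum _ H1_linear he).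
  have h1 := form_norm_sub H1_linear Bl Bsym Bge0 hf1 htail.
  have h2 := psd_triangle H1_linear.2 Bl Bsym Bge0 hd (space_sub H1_linear hf1 htail).
  have h3 := form_norm_sum H1_linear Bl Bsym Bge0 vH he.
  rewrite (_ : (fun x => u x - \sum_(z <- N) vH z * (lambda z x - phi z x)) =
     fun x => (u x - uh x) + (f x - tail x)).
    apply: le_trans h2 _; rewrite -addrA; apply: lerD => //.
    by apply: le_trans h1 _; exact: lerD.
  apply/funext => x; rewrite /f /r /tail.
  have -> : \sum_(z <- N) vH z * (lambda z x - phi z x) =
    \sum_(z <- N) vH z * (lambda z x - p z x) + \sum_(z <- N) vH z * e z x.
    by rewrite -big_split; apply: eq_bigr => z _ /=; rewrite -mulrDr /e addrA subrK.
  by move: (\sum_(z <- N) _) (\sum_(z <- N) _) => s1 s2; ring.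
have K0 : 0 <= (8 * gamma * d%:R) ^+ d.+2.
  by apply: exprn_ge0; rewrite !mulr_ge0//; exact: le_trans ler01 (lod_gamma H).
have R0 : 0 <= rate k by apply: exprn_ge0; have /andP[/ltW] := theta_bounds d Cq Cq' g_ge0 k_ge0.
have dd : 0 < delta ^+ d by exact: exprn_gt0.
set x := (8 * gamma * d%:R) ^+ d.+2 * L2norm Omega vH ^+ 2.
set y := (1 + Cring d gamma kappa Cq Cq') * (rate k * (beta * (gamma ^+ 2 * (2 * n) ^+ d))).
have x0 : 0 <= x by apply: mulr_ge0; [exact: K0|exact: sqr_ge0].
have C0 : 0 <= 1 + Cring d gamma kappa Cq Cq' by apply: addr_ge0 => //; exact: (Cring_ge0 d Cq Cq' g_ge0 k_ge0).
have y0 : 0 <= y.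
  apply: mulr_ge0; [exact: C0|apply: mulr_ge0; first exact: R0].
  apply: mulr_ge0; first exact: le_trans (ltW a0) (lod_alpha_beta H).
  by apply: mulr_ge0; [exact: sqr_ge0|apply: exprn_ge0; rewrite mulr_ge0].
split.
  by apply: sumr_ge0 => z _; apply: mulr_ge0; [exact: normr_ge0|exact: sqrtr_ge0].
have Nc : (size N)%:R * delta ^+ d <= Cnodes.
  exact: (nodes_card d0 pO tH (lod_gamma H) (lod_regular H) n0 On).
have sumle : (\sum_(z <- N) `|vH z| * nu (e z)) ^+ 2 <=
    (size N)%:R ^+ 2 * (x / delta ^+ d * (y / delta ^+ 2)).
  apply: sum_mul_sqr_le.
  - exact: divr_ge0 x0 (ltW dd).
  - by apply: divr_ge0 y0 (sqr_ge0 _).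
  - by move=> z zN; rewrite ler_pdivlMr//; exact: nodal_value_bound.
  - by move=> z _; exact: sqrtr_ge0.
  - move=> z zN; rewrite ler_pdivlMr; last exact: exprn_gt0.
    have [h1 h2 h3] := hp z zN.
    exact: (corrector_error (hat zN) zN h1 h2 h3 (cor z zN)).
apply: le_trans (truncation_algebra de0 (ler0n _ _) x0 y0 Nc sumle) _.
rewrite -mulrA; apply: ler_wpM2l; first exact: sqr_ge0.
have vn : L2norm Omega vH ^+ 2 <= Ciso ^+ 2 * (2 * n * (Num.sqrt alpha)^-1 * ((1 + Cstab) * load)) ^+ 2.
  have h1 : L2norm Omega vH <= Ciso * L2norm Omega (I uh) by rewrite -IvH; exact: qi2.2.
  have h2 := I_norm_le huh.1 nuh.
  have p1 := L2norm_ge0 Omega vH; have p2 := L2norm_ge0 Omega (I uh).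
  apply: le_trans (_ : (Ciso * L2norm Omega (I uh)) ^+ 2 <= _).
    by rewrite ler_sqr ?nnegrE//; exact: le_trans p1 h1.
  rewrite exprMn; apply: ler_wpM2l; first exact: sqr_ge0.
  by rewrite ler_sqr ?nnegrE//; exact: le_trans p2 h2.
apply: le_trans (ler_wpM2r y0 (ler_wpM2l K0 vn)) _.
have sa : (Num.sqrt alpha)^-1 ^+ 2 = alpha^-1 by rewrite exprVn sqr_sqrtr// ltW.
rewrite /y /Cvalues /Cdecay le_eqVlt; apply/orP; left; apply/eqP.
exact: collect_constants.
Qed.

End lod_error.

Lemma absorb_mesh_power (R : realType) (d : nat) (x E F S a X del t K D r : R) :
  0 < del -> 0 < t -> 1 <= X -> 0 <= a -> 0 <= E -> 0 <= F -> 0 <= S -> 0 <= K -> 0 <= D ->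
  x <= a -> x <= E + F + S -> S ^+ 2 * del ^+ (3 * d + 2) <= K * (X ^+ 2 * a ^+ 2 * r) ->
  r <= D * t ^+ (3 * d + 2) ->
  x <= E + F + (1 + Num.sqrt (K * D)) * (X * a * del^-1 * t).
Proof.
move=> del0 t0 X1 a0 E0 F0 S0 K0 D0 xa xS hS hr.
have X0 : 0 <= X := le_trans ler01 X1.
have Y0 : 0 <= X * a * del^-1 * t by rewrite !mulr_ge0// ltW// invr_gt0.
have s0 := sqrtr_ge0 (K * D).
have [big|small] := leP del (X * t).
  apply: le_trans xa _; apply: (@le_trans _ _ (X * a * del^-1 * t)).
    have -> : X * a * del^-1 * t = a * ((X * t) / del) by ring.
    by apply: ler_peMr => //; rewrite ler_pdivlMr// mul1r.
  by rewrite mulrDl mul1r addrCA lerDl !addr_ge0// mulr_ge0.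
apply: le_trans xS _; rewrite lerD2l; apply: (@le_trans _ _ (Num.sqrt (K * D) * (X * a * del^-1 * t))); last first.
  by apply: ler_wpM2r => //; rewrite lerDr.
have td : t <= del.
  by apply: le_trans (ltW small); apply: ler_peMl => //; exact: ltW.
have td3 : t ^+ (3 * d) <= del ^+ (3 * d).
  by apply: lerXn2r => //; rewrite nnegrE ltW.
suff : S ^+ 2 <= (Num.sqrt (K * D) * (X * a * del^-1 * t)) ^+ 2.
  by rewrite ler_sqr// nnegrE// mulr_ge0.
rewrite exprMn sqr_sqrtr ?mulr_ge0//.
have p0 : 0 < del ^+ (3 * d + 2) by exact: exprn_gt0.
rewrite -(ler_pM2r p0); apply: le_trans hS _.
apply: (@le_trans _ _ (K * (X ^+ 2 * a ^+ 2 * (D * (del ^+ (3 * d) * t ^+ 2))))).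
  apply: ler_wpM2l => //; apply: ler_wpM2l; first by rewrite mulr_ge0 ?sqr_ge0.
  apply: le_trans hr _; apply: ler_wpM2l => //; rewrite exprD.
  by apply: ler_wpM2r => //; exact: sqr_ge0.
rewrite exprD le_eqVlt; apply/orP; left; apply/eqP.
by move: (del ^+ (3 * d)) => w; field; rewrite gt_eqF.
Qed.

Lemma decay_rate (R : realType) (th : R) (d k : nat) : 0 < th < 1 ->
  th ^+ ((k - 4) %/ 5) <=
  th ^- 2 * expR (- (- ln th / (5 * (3 * d + 2)%:R) * k%:R)) ^+ (3 * d + 2).
Proof.
move=> /andP[th0 th1]; rewrite mulrC ler_pdivlMr ?exprn_gt0// -exprD -expRM_natr.
have thE : th = expR (ln th) by rewrite lnK// posrE.
rewrite {1}thE -expRM_natl ler_expR.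
have l0 : ln th <= 0 by apply: ltW; apply: ln_lt0; rewrite th0.
have q0 : (3 * d + 2)%:R != 0 :> R by rewrite pnatr_eq0 addn2.
have -> : - (- ln th / (5 * (3 * d + 2)%:R) * k%:R) * (3 * d + 2)%:R = k%:R / 5 * ln th.
  by move: ((3 * d + 2)%:R : R) q0 (ln th) (k%:R : R) => q q0 l kk; field.
apply: ler_wnM2r => //; rewrite ler_pdivrMr// -[X in _ * X]/(5%:R) -natrM ler_nat.
have h : (k - 4 <= (k - 4) %/ 5 * 5 + 4)%N.
  by rewrite {1}(divn_eq (k - 4) 5) leq_add2l -ltnS ltn_pmod.
rewrite leq_subLR in h; apply: leq_trans h _.
by rewrite addnCA mulnDl leq_add2l.
Qed.

Lemma oversampling_bound (R : realType) (c al be del k : R) : 0 < c -> 0 < al -> al <= be ->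
  0 < del -> 1 / (2 * c) * ln (be / al) + 2 / c * ln (1 / del) <= k ->
  Num.sqrt (be / al) * del^-1 * expR (- (c * k)) <= del.
Proof.
move=> c0 a0 ab de0 hk; have b0 := lt_le_trans a0 ab.
have q0 : 0 < be / al by rewrite divr_gt0.
have X0 : 0 < Num.sqrt (be / al) by rewrite sqrtr_gt0.
set X := Num.sqrt _ in X0 *.
have XE : be / al = X ^+ 2 by rewrite sqr_sqrtr// ltW.
have l1 : ln (be / al) = 2 * ln X by rewrite XE lnXn// mulr_natl.
have l2 : ln (1 / del) = - ln del by rewrite div1r lnV// posrE.
have key : - (c * k) <= ln (del ^+ 2 / X).
  rewrite ln_div ?posrE ?exprn_gt0// lnXn//.
  have : c * (1 / (2 * c) * ln (be / al) + 2 / c * ln (1 / del)) <= c * k by rewrite ler_pM2l.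
  rewrite l1 l2 (_ : c * _ = ln X - 2 * ln del); last by field; rewrite gt_eqF.
  by rewrite -[ln del *+ 2]mulr_natl; move: (ln X) (ln del) (c * k) => x y z; lra.
apply: (@le_trans _ _ (X * del^-1 * (del ^+ 2 / X))).
  apply: ler_wpM2l; first by apply: mulr_ge0; [exact: ltW|rewrite invr_ge0 ltW].
  have p0 : 0 < del ^+ 2 / X by rewrite divr_gt0// exprn_gt0.
  by rewrite -[leRHS]lnK ?posrE// ler_expR.
by rewrite le_eqVlt; apply/orP; left; apply/eqP; field; rewrite !gt_eqF.
Qed.

Lemma le_combination (R : realType) (E f w C1 C2 C : R) : 0 <= E -> 0 <= f -> 0 <= w ->
  1 <= C -> C1 <= C -> C2 <= C -> E + C1 * f + C2 * w <= C * (E + f + w).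
Proof.
move=> E0 f0 w0 h h1 h2; rewrite !mulrDr; apply: lerD; first apply: lerD.
- exact: ler_peMl.
- exact: ler_wpM2r.
- exact: ler_wpM2r.
Qed.

Section constants.
Context (R : realType) (d : nat).
Local Notation pt := 'rV[R]_d.
Local Notation mu := (lebesgue_rV R d).

Lemma sup_nonneg_ge0 (E : set R) : (forall x, E x -> 0 <= x) -> 0 <= sup E.
Proof.
move=> E0; have [[[x Ex] ub]|nE] := pselect (has_sup E); last by rewrite sup_out.
exact: le_trans (E0 x Ex) (ub_le_sup ub Ex).
Qed.

Lemma shape_regular_le (T : {fset {fset pt}}) (gamma gamma' : R) : gamma <= gamma' ->
  shape_regular gamma T -> shape_regular gamma' T.
Proof.
move=> gg h S ST; apply: le_trans (h S ST) _; apply: ler_wpM2r => //.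
by apply: sup_nonneg_ge0 => x [].
Qed.

Lemma small_contrast_le (Omega : set pt) (T : {fset {fset pt}}) (A : pt -> 'M[R]_d)
  (alpha beta kappa kappa' : R) :
  (0 < d)%N -> polyhedral_domain Omega -> triangulation Omega T -> 0 < alpha ->
  coef_bounds Omega A alpha beta -> kappa <= kappa' ->
  small_contrast kappa A T -> small_contrast kappa' A T.
Proof.
move=> d0 pO tT a0 hA kk h S ST; apply: le_trans (h S ST) _; apply: lee_wpmul2r; last by rewrite lee_fin.
apply: (@le_trans _ _ alpha%:E); first by rewrite lee_fin ltW.
apply: ereal_sup_ubound.
apply: filterS2 (ae_hull_domain d0 pO tT ST) (coef_rayleigh hA) => x hO hr hx.
apply: le_ereal_inf_tmp => _ [y y0 <-]; rewrite lee_fin.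
have /andP[h1 _] := hr (hO hx) y; rewrite ler_pdivlMr//.
by rewrite -enorm_dot exprn_gt0// lt_neqAle enorm_ge0 andbT eq_sym; apply: contra_neq y0; exact: enorm_eq0.
Qed.

End constants.

(* The constants: gamma bounds the shape regularity of both meshes, kappa is the
   hidden constant of the small contrast assumption, and Cqip, Cqip' are the
   constants of the quasi-interpolation. The rate c and the hidden constant C
   are fixed before the meshes, the coefficient A, alpha, beta, the data g, the
   operator I and k; c does not depend on Ciso either. *)
Theorem theorem3p3 (R : realType) (d : nat) (Omega : set 'rV[R]_d)
    (gamma kappa Cqip Cqip' : R) :
  (0 < d)%N -> polyhedral_domain Omega ->
  exists2 c : R, 0 < c & forall Ciso : R, exists2 C : R, 0 < C &
  forall (TH Th : {fset {fset 'rV[R]_d}}) (A : 'rV[R]_d -> 'M[R]_d)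
    (alpha beta : R) (g : 'rV[R]_d -> R)
    (I : ('rV[R]_d -> R) -> ('rV[R]_d -> R)) (u uh : 'rV[R]_d -> R)
    (lambda : 'rV[R]_d -> 'rV[R]_d -> R),
  triangulation Omega TH -> triangulation Omega Th -> refines Th TH ->
  shape_regular gamma TH -> shape_regular gamma Th ->
  0 < alpha -> alpha <= beta -> coefficient Omega alpha beta A ->
  small_contrast kappa A Th -> L2 Omega g ->
  QI1 Omega TH Th I -> QI2 Omega TH I Ciso -> QI3 Omega A TH Th I Cqip ->
  QI4 Omega A TH Th I Cqip' ->
  galerkin Omega A g (H10 Omega) u ->
  galerkin Omega A g (P1 Omega Th) uh ->
  (forall z, z \in nodes Omega TH -> is_hat Omega TH z (lambda z)) ->
  forall (k : nat) (phi : 'rV[R]_d -> 'rV[R]_d -> R) (ucs : 'rV[R]_d -> R),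
  (0 < k)%N ->
  (forall z, z \in nodes Omega TH ->
    is_corrector Omega A TH Th I z k (lambda z) (phi z)) ->
  galerkin Omega A g (Vcs Omega TH lambda phi) ucs ->
  energy Omega A Omega (u \- ucs) <=
    C * (energy Omega A Omega (u \- uh) +
         (Num.sqrt alpha)^-1 * L2norm Omega (meshsize TH \* g) +
         Num.sqrt (beta / alpha) * (Num.sqrt alpha)^-1 *
         (meshsize_min TH)^-1 * expR (- (c * k%:R)) * Hm1norm Omega g)
  /\
  (1 / (2 * c) * ln (beta / alpha) + 2 / c * ln (1 / meshsize_min TH) <= k%:R ->
   energy Omega A Omega (u \- ucs) <=
     C * (energy Omega A Omega (u \- uh) +
          (Num.sqrt alpha)^-1 * meshsize_max TH * L2norm Omega g)).
Proof.
move=> d0 pO; have [T0 cov] : exists T, covers Omega T by case: pO.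
have [n n0 On] := closure_bounded cov.
pose ga := Num.max gamma 1; pose ka := Num.max kappa 1.
pose q := Num.max Cqip 1; pose q' := Num.max Cqip' 1.
have max1 (r : R) : 1 <= Num.max r 1 by rewrite le_max lexx orbT.
have le_max1 (r : R) : r <= Num.max r 1 by rewrite le_max lexx.
have ga0 : 0 <= ga := le_trans ler01 (max1 _); have ka0 : 0 <= ka := le_trans ler01 (max1 _).
pose th := theta d ga ka q q'.
have th01 : 0 < th < 1 := theta_bounds d q q' ga0 ka0.
have [th0 th1] := andP th01.
have q0 : 0 < (3 * d + 2)%:R :> R by rewrite ltr0n addn2.
pose c := - ln th / (5 * (3 * d + 2)%:R).
have c0 : 0 < c by rewrite divr_gt0 ?mulr_gt0// oppr_gt0 ln_lt0.
exists c => // Ciso.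
pose K := Cnodes d ga n ^+ 2 * (Cvalues d ga q n Ciso * Cdecay d ga ka q q' n).
have K0 : 0 <= K.
  apply: mulr_ge0; first exact: sqr_ge0.
  apply: mulr_ge0; apply: mulr_ge0.
  - by apply: exprn_ge0; rewrite !mulr_ge0.
  - exact: sqr_ge0.
  - by apply: addr_ge0 => //; exact: Cring_ge0.
  - by apply: mulr_ge0; [exact: sqr_ge0|apply: exprn_ge0; rewrite mulr_ge0].
pose Cs := Cstab d ga q; pose Ct := 1 + Num.sqrt (K * th ^- 2).
have Ct1 : 1 <= Ct by rewrite lerDl sqrtr_ge0.
have Cs0 : 0 <= Cs by apply: mulr_ge0; [exact: le_trans ler01 (max1 _)|exact: sqrtr_ge0].
pose C := 1 + Cs + Ct * (1 + 2 * n).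
have [C1 CCs CCt CCn] : [/\ 1 <= C, Cs <= C, Ct <= C & Cs + Ct * (2 * n) <= C].
  by rewrite /C; split; nra.
exists C; first exact: lt_le_trans ltr01 C1.
move=> TH Th A alpha beta g I u uh lambda tH tf ref reg regf a0 ab hA con hg qi1 qi2 qi3 qi4
  hu huh hat k phi ucs k0 cor hucs.
have hc := coefficient_bounds hA.
have qi3' : QI3 Omega A TH Th I q.
  move=> v S hv ST; apply: le_trans (qi3 v S hv ST) _.
  by apply: ler_wpM2r; [exact: L2norm_ge0|exact: le_max1].
have qi4' : QI4 Omega A TH Th I q'.
  move=> w hw; have [v [h1 h2 h3 h4]] := qi4 w hw; exists v; split=> //.
  by apply: le_trans h4 _; apply: ler_wpM2r; [exact: L2norm_ge0|exact: le_max1].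
have H : lod_setting Omega ga ka q q' TH Th A alpha beta I :=
  LodSetting d0 pO tH tf ref (max1 _) (max1 _) (max1 _) (max1 _)
    (shape_regular_le (le_max1 _) reg) (shape_regular_le (le_max1 _) regf) a0 ab hc
    (small_contrast_le d0 pO tf a0 hc (le_max1 _) con) qi1 qi3' qi4'.
have oO := domain_open pO.
have On' : Omega `<=` cube 0 n by move=> x Ox; apply: On; exact: subset_closure.
have [triv [S hS [S0 hS2]]] := lod_estimate H n0 On hg hat qi2 hu huh cor hucs.
have [de0 _] := meshsize_minP d0 pO tH.
have [_ Hg] := meshsize_load H hg.
have s0 : 0 <= (Num.sqrt alpha)^-1 by rewrite invr_ge0 sqrtr_ge0.
have hm0 := Hm1norm_ge0 oO d0 n0 On' hg; have hm := Hm1norm_le oO d0 n0 On' hg.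
have load0 := load_ge0 H n0 On hg.
have X1 : 1 <= Num.sqrt (beta / alpha).
  by rewrite -[leLHS]sqrtr1 ler_wsqrtr// ler_pdivlMr// mul1r.
have XE : beta / alpha = Num.sqrt (beta / alpha) ^+ 2.
  by rewrite sqr_sqrtr// divr_ge0// ltW// (lt_le_trans a0).
rewrite {1}XE in hS2.
have E0 : 0 <= energy Omega A Omega (u \- uh) by exact: L2norm_ge0.
have f0 : 0 <= (Num.sqrt alpha)^-1 * L2norm Omega (meshsize TH \* g).
  by apply: mulr_ge0 => //; exact: L2norm_ge0.
have t0 : 0 < expR (- (c * k%:R)) by exact: expR_gt0.
have i0 : 0 <= th ^- 2 by rewrite invr_ge0 sqr_ge0.
have est := absorb_mesh_power de0 t0 X1 load0 E0 (mulr_ge0 Cs0 f0) S0 K0 i0 triv hS hS2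
  (decay_rate d k th01).
have w0 : 0 <= Num.sqrt (beta / alpha) * ((Num.sqrt alpha)^-1 * Hm1norm Omega g) *
    (meshsize_min TH)^-1 * expR (- (c * k%:R)).
  by apply: mulr_ge0; [apply: mulr_ge0; [apply: mulr_ge0; [exact: le_trans ler01 X1|exact: load0]|rewrite invr_ge0 ltW]|exact: ltW].
split.
  have := le_trans est (le_combination E0 f0 w0 C1 CCs CCt).
  by congr (_ <= _ * (_ + _)); ring.
move=> /(oversampling_bound c0 a0 ab de0) osb.
have g0 := L2norm_ge0 Omega g.
have Mm : meshsize_min TH <= meshsize_max TH := meshsize_min_max d0 pO tH.
have M0 := le_trans (ltW de0) Mm.
have v0 : 0 <= (Num.sqrt alpha)^-1 * meshsize_max TH * L2norm Omega g.
  by rewrite !mulr_ge0.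
have f1 : (Num.sqrt alpha)^-1 * L2norm Omega (meshsize TH \* g) <=
    (Num.sqrt alpha)^-1 * meshsize_max TH * L2norm Omega g.
  by rewrite -mulrA; apply: ler_wpM2l.
have w1 : Num.sqrt (beta / alpha) * ((Num.sqrt alpha)^-1 * Hm1norm Omega g) *
    (meshsize_min TH)^-1 * expR (- (c * k%:R)) <=
    2 * n * ((Num.sqrt alpha)^-1 * meshsize_max TH * L2norm Omega g).
  rewrite (_ : _ * expR _ = (Num.sqrt (beta / alpha) * (meshsize_min TH)^-1 * expR (- (c * k%:R))) *
     ((Num.sqrt alpha)^-1 * Hm1norm Omega g)); last by ring.
  rewrite (_ : 2 * n * _ = meshsize_max TH * ((Num.sqrt alpha)^-1 * (2 * n * L2norm Omega g))); last by ring.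
  apply: ler_pM => //; last by apply: ler_wpM2l.
  - by apply: mulr_ge0; [apply: mulr_ge0; [exact: le_trans ler01 X1|rewrite invr_ge0 ltW]|exact: ltW].
  - exact: le_trans osb Mm.
apply: le_trans est _; rewrite mulrDr -addrA; apply: lerD; first by apply: ler_peMl.
apply: le_trans (lerD (ler_wpM2l Cs0 f1) (ler_wpM2l (le_trans ler01 Ct1) w1)) _.
by rewrite [Ct * _]mulrA -mulrDl; apply: ler_wpM2r.
Qed.
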